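(* Let $X$ be a real separable Hilbert space and let $\{U(t,s)\}_{s\le t}$, $\{B(t)\}_{t\in\mathbb R}$ satisfy assumptions (A1)--(A4) of the context. If $\|U(t,s)\|_{\mathscr L(\mathcal H_s,\mathcal H_t)}<1$ for some $s<t$, then for every $p\ge1$ the operator $P_{s,t}$ maps $L^p(X,\gamma_t)$ into $L^q(X,\gamma_s)$ for every $1\le q\le q_0$ and $$\|P_{s,t}f\|_{L^q(X,\gamma_s)}\le\|f\|_{L^p(X,\gamma_t)},\qquad f\in L^p(X,\gamma_t),$$ where $$q_0=1+(p-1)\|U(t,s)\|^{-2}_{\mathscr L(\mathcal H_s,\mathcal H_t)}.$$ Moreover, if $q>q_0$ then there exists $f\in L^p(X,\gamma_t)$ such that $P_{s,t}f\notin L^q(X,\gamma_s)$.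
   Context: Assumptions. (A1) $\{U(t,s)\}_{s\le t}\subseteq\mathscr L(X)$ is a strongly continuous evolution operator: $(s,t)\mapsto U(t,s)x$ is continuous for every $x\in X$, $U(t,t)=I$ and $U(t,r)U(r,s)=U(t,s)$ for $s\le r\le t$. (A2) $\{B(t)\}_{t\in\mathbb R}\subseteq\mathscr L(X)$, $\sup_{t}\|B(t)\|_{\mathscr L(X)}<\infty$, and $t\mapsto B(t)x$ is bounded and measurable for every $x\in X$. (A3) With $Q(r):=B(r)B(r)^\star$, for every $s<t$ the operator $Q(t,s)=\int_s^tU(t,r)Q(r)U(t,r)^\star\,dr$ has finite trace. (A4) For every $t\in\mathbb R$, $\sup_{s<t}\mathrm{Tr}[Q(t,s)]<\infty$, and $\lim_{s\to-\infty}U(t,s)x=0$ for every $x\in X$. $P_{t,t}=I$ and, for $s<t$ and $\varphi$ bounded Borel, $P_{s,t}\varphi(x)=\int_X\varphi(y)\,\mathcal N_{U(t,s)x,Q(t,s)}(dy)$, where $\mathcal N_{a,Q}$ is the Gaussian measure with mean $a$ and covariance $Q$. Put $Q(t,-\infty)=\int_{-\infty}^tU(t,r)Q(r)U(t,r)^\star\,dr$ and $\gamma_t=\mathcal N_{0,Q(t,-\infty)}$. For every $p\in[1,\infty)$, $P_{s,t}$ extends to a bounded operator $L^p(X,\gamma_t)\to L^p(X,\gamma_s)$ with norm $1$, still denoted $P_{s,t}$. $\mathcal H_t$ is the Cameron–Martin space of $\gamma_t$: $\mathcal H_t=Q(t,-\infty)^{1/2}(X)$ with norm $\|h\|_{\mathcal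 H_t}=\|Q(t,-\infty)^{-1/2}h\|_X$, where $Q(t,-\infty)^{-1/2}h$ is the unique $z\in(\ker Q(t,-\infty)^{1/2})^\perp$ with $Q(t,-\infty)^{1/2}z=h$. Under the assumptions $U(t,s)$ maps $\mathcal H_s$ into $\mathcal H_t$, and $\|U(t,s)\|_{\mathscr L(\mathcal H_s,\mathcal H_t)}\le1$ denotes the norm of its restriction. *)

(* Defs.v *)
From HB Require Import structures.
From mathcomp Require Import all_boot all_order all_algebra.
From mathcomp Require Import all_classical all_reals all_analysis.

Set Implicit Arguments.
Unset Strict Implicit.
Unset Printing Implicit Defensive.

Import Order.TTheory GRing.Theory Num.Theory.
Import numFieldNormedType.Exports.

Local Open Scope classical_set_scope.
Local Open Scope ring_scope.

HB.mixin Record CompleteNormedModule_isHilbert (R : realType) X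
    & CompleteNormedModule R X := {
  inner : X -> X -> R ;
  innerC : forall x y : X, inner x y = inner y x ;
  innerDl : forall x y z : X, inner (x + y) z = inner x z + inner y z ;
  innerZl : forall (a : R) (x y : X), inner (a *: x) y = a * inner x y ;
  inner_norm : forall x : X, inner x x = `|x| ^+ 2
}.

#[short(type="hilbertType")]
HB.structure Definition Hilbert (R : realType) :=
  {X of CompleteNormedModule R X & CompleteNormedModule_isHilbert R X}.

Notation borel X := (g_sigma_algebraType (@open X)).

Definition separable (T : topologicalType) : Prop :=
  exists2 D : set T, countable D & dense D.

Section operators.
Context {R : realType} {X : hilbertType R}.
Implicit Types (A Q S : X -> X).

Definition bounded_op A : Prop := linear A /\ continuous A.

Definition opnorm A : \bar R :=
  ereal_sup [set (`|A x|)%:E | x in [set x : X | `|x| <= 1]].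

(* By the Riesz theorem a bounded operator has exactly one adjoint. *)
Definition adjoint A : X -> X :=
  xget (fun=> 0) [set S | forall x y, inner (A x) y = inner x (S y)].

Definition orthonormal (E : set X) : Prop :=
  forall e e' : X, E e -> E e' -> inner e e' = (e == e')%:R.

(* Orthonormal basis: a maximal orthonormal family. *)
Definition orthonormal_basis (E : set X) : Prop :=
  orthonormal E /\ forall x, (forall e, E e -> inner x e = 0) -> x = 0.

(* Only used for nonnegative operators, for which the sum of the (nonnegative)
   diagonal coefficients does not depend on the basis. *)
Definition trace Q : \bar R :=
  \esum_(e in xget set0 orthonormal_basis) (inner (Q e) e)%:E.

(* The integral over D of an operator-valued function, as a weak (Pettis)
   integral: <(\int_D F(r) dr) x, y> = \int_D <F(r) x, y> dr. *)
Definition op_integral (D : set R) (F : R -> X -> X) : X -> X :=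
  xget (fun=> 0) [set S | bounded_op S /\ forall x y : X,
    (@lebesgue_measure R).-integrable D (fun r => (inner (F r x) y)%:E) /\
    inner (S x) y = Rintegral (@lebesgue_measure R) D (fun r => inner (F r x) y)].

(* The unique nonnegative self-adjoint square root. *)
Definition op_sqrt Q : X -> X :=
  xget (fun=> 0) [set S | [/\ bounded_op S,
    forall x y, inner (S x) y = inner x (S y),
    forall x, 0 <= inner (S x) x &
    forall x, S (S x) = Q x]].

(* The z in the orthogonal of ker S such that S z = h. *)
Definition pseudo_inverse S (h : X) : X :=
  xget 0 [set z | S z = h /\ forall k, S k = 0 -> inner z k = 0].

(* Gaussian law on the line with mean m and variance v. The library's normal
   distribution takes a standard deviation and is not a Dirac mass at 0. *)
Definition gaussian1 (m v : R) : set R -> \bar R :=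
  if v == 0 then \d_m else normal_prob m (Num.sqrt v).

Definition is_gaussian (mu : probability (borel X) R) (a : X) Q : Prop :=
  forall h : X, forall A : set R, measurable A ->
    mu ((fun x : X => inner x h) @^-1` A)
    = gaussian1 (inner a h) (inner (Q h) h) A.

(* N_{a,Q}; it exists and is unique for Q nonnegative, self-adjoint and of
   trace class. *)
Definition gaussian (a : X) Q : probability (borel X) R :=
  xget (\d_(0 : borel X) : probability (borel X) R)
       [set mu | is_gaussian mu a Q].

End operators.

Section evolution.
Context {R : realType} {X : hilbertType R}.
Variables (U : R -> R -> X -> X) (B : R -> X -> X).

(* U t s is only meaningful for s <= t. *)
Definition strongly_continuous_evolution : Prop :=
  [/\ forall s t, s <= t -> bounded_op (U t s),
      forall x, {within [set st : R * R | st.1 <= st.2],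
                  continuous (fun st : R * R => U st.2 st.1 x)},
      forall t x, U t t x = x &
      forall s r t x, s <= r -> r <= t -> U t r (U r s x) = U t s x].

Definition bounded_measurable_family : Prop :=
  [/\ forall t, bounded_op (B t),
      (ereal_sup [set opnorm (B t) | t in [set: R]] < +oo)%E &
      forall x, (exists M, forall t, `|B t x| <= M) /\
        measurable_fun [set: R] (fun t => B t x : borel X)].

Definition noise_cov (r : R) : X -> X := B r \o adjoint (B r).

Definition cov_integrand (t r : R) : X -> X :=
  U t r \o noise_cov r \o adjoint (U t r).

Definition Qcov (t s : R) : X -> X := op_integral `[s, t] (cov_integrand t).

Definition Qinf (t : R) : X -> X := op_integral `]-oo, t] (cov_integrand t).

Definition finite_trace : Prop :=
  forall s t, s < t -> (trace (Qcov t s) < +oo)%E.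

Definition stability : Prop :=
  (forall t, (ereal_sup [set trace (Qcov t s) | s in `]-oo, t[] < +oo)%E) /\
  (forall t x, U t s x @[s --> -oo%R] --> (0 : X)).

Definition invariant_measure (t : R) : probability (borel X) R :=
  gaussian 0 (Qinf t).

Definition transition (s t : R) (phi : X -> R) (x : X) : R :=
  if s == t then phi x
  else Rintegral (gaussian (U t s x) (Qcov t s)) [set: borel X] phi.

(* Operators on L^p are represented by maps on functions compatible with
   almost everywhere equality. *)
Definition is_Lp_extension (s t p : R) (T : (X -> R) -> (X -> R)) : Prop :=
  let gt := invariant_measure t in
  let gs := invariant_measure s in
  [/\ forall f, f \in Lfun gt p%:E -> T f \in Lfun gs p%:E,
      forall f g, f \in Lfun gt p%:E -> g \in Lfun gt p%:E ->
        f = g %[ae gt] -> T f = T g %[ae gs],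
      forall (a : R) f g, f \in Lfun gt p%:E -> g \in Lfun gt p%:E ->
        T (fun x => a * f x + g x) = (fun x => a * T f x + T g x) %[ae gs],
      exists C : R, forall f, f \in Lfun gt p%:E ->
        ('N[gs]_p%:E[EFin \o T f] <= C%:E * 'N[gt]_p%:E[EFin \o f])%E &
      forall phi : borel X -> R, measurable_fun [set: borel X] phi ->
        (exists M, forall x, `|phi x| <= M) ->
        T phi = transition s t phi %[ae gs]].

(* The bounded extension of transition s t to L^p(gamma_t) -> L^p(gamma_s);
   it is unique up to almost everywhere equality, as the bounded Borel
   functions are dense in L^p(gamma_t). *)
Definition Lp_transition (s t p : R) : (X -> R) -> (X -> R) :=
  xget (fun=> 0) [set T | is_Lp_extension s t p T].

Definition CM_space (t : R) : set X := range (op_sqrt (Qinf t)).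

Definition CM_norm (t : R) (h : X) : R :=
  `|pseudo_inverse (op_sqrt (Qinf t)) h|.

Definition CM_opnorm (t s : R) : \bar R :=
  ereal_sup [set (CM_norm t (U t s h))%:E | h in
    [set h | CM_space s h /\ CM_norm s h <= 1]].

(* 1 + (p - 1) / ||U(t,s)||^2, read as +oo when the norm vanishes, also for
   p = 1: the operator then maps f to the constant \int f dgamma_t, hence L^1
   into L^oo. *)
Definition critical_exponent (s t p : R) : \bar R :=
  if CM_opnorm t s == 0%E then +oo%E
  else (1 + (p - 1) * (fine (CM_opnorm t s)) ^- 2)%:E.

End evolution.

(* Main.v *)
(** Write A = U(t,s), and let rho be its norm from H_s to H_t. Since
    Q(t,-oo) = Q(t,s) + A Q(s,-oo) A^*, the measure gamma_t is the law of
    A x + z, where x has law gamma_s and z is an independent variable of law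
    N_{0,Q(t,s)}, and rho is the least constant with
    <Q(s,-oo) A^* k, A^* k> <= rho^2 <Q(t,-oo) k, k> for all k.

    By duality, for p, q > 1 the bound from L^p to L^q follows from
      E [f(A x + z)^a g(x)^b] <= (E f(A x + z))^a (E g(x))^b
    for positive f, g, with a = 1/p, b = 1 - 1/q and rho^2 a b <= (1-a)(1-b).
    If (A x + z, x) is replaced by a small multiple of two signs of correlation
    rho, this holds up to a third-order error. The discrete inequality
    tensorizes; convergence of characteristic functions carries it to the
    Gaussian law for trigonometric polynomials, which are dense. The exponents
    p = 1, q = 1 and q = oo are reached by passing to the limit. The case p = q
    shows that the transition kernel itself defines the extension to L^p.

    For sharpness choose k with <Q(t,-oo) k, k> = 1 and
    tau = <Q(s,-oo) A^* k, A^* k> so close to rho^2 that p - 1 < tau (q - 1).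
    With w = 1 + tau (q - 1) > p, the function f(y) = exp(<y,k>^2 / (2 w)) lies
    in L^p(gamma_t), but bounding f below by exponentials of linear functionals
    gives P f(x) >= exp(<x, A^* k>^2 / (2 tau q)), which is not in
    L^q(gamma_s). *)
From HB Require Import structures.
Require Import Defs.
From mathcomp Require Import all_boot all_order all_algebra.
From mathcomp Require Import all_classical all_reals all_analysis.
From mathcomp Require Import measurable_realfun ess_sup_inf ring lra.

Set Implicit Arguments.
Unset Strict Implicit.
Unset Printing Implicit Defensive.

Import Order.TTheory GRing.Theory Num.Theory.
Import numFieldNormedType.Exports.
Local Open Scope classical_set_scope.
Local Open Scope ring_scope.

(** * Adjoints and square roots *)

(** Adjoints, square roots, weak integrals, Gaussian measures and the L^p extension enter the
    statement as choices by [xget]: nothing is known of them until an object with the defining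
    property exists, hence the constructions from the ground up. Gaussian measures are realized on
    the unit interval: splitting the binary digits of one uniform variable repeatedly gives
    independent normal variables, and a random series in them has the prescribed covariance.

    Laws are compared through integrals of cos (phi + c), phi in a linear class. These functions
    span a real algebra; Bernstein polynomials make its uniform closure a lattice, whose positivity
    sets generate the sigma-algebra. This yields both uniqueness of laws and density.

    The condition rho^2 a b <= (1-a)(1-b) says that the second-order term of the two-point
    inequality is never positive. To realize the correlation rho on every pair of signs, Q(t,-oo) is
    split as rho^(-2) A Q(s,-oo) A^* plus a remainder, nonnegative by the bound that rho satisfies;
    this forces rho > 0, and rho = 0 is reached by enlarging rho. *)

Section inner_product.
Context {R : realType} {X : hilbertType R}.
Implicit Types (x y z : X) (a : R).

Lemma innerDr x y z : inner x (y + z) = inner x y + inner x z.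
Proof. by rewrite innerC innerDl !(innerC _ x). Qed.

Lemma innerZr a x y : inner x (a *: y) = a * inner x y.
Proof. by rewrite innerC innerZl innerC. Qed.

Lemma inner0l x : inner 0 x = 0.
Proof. by rewrite -(scale0r (0 : X)) innerZl mul0r. Qed.

Lemma inner0r x : inner x 0 = 0.
Proof. by rewrite innerC inner0l. Qed.

Lemma innerNl x y : inner (- x) y = - inner x y.
Proof. by rewrite -scaleN1r innerZl mulN1r. Qed.

Lemma innerNr x y : inner x (- y) = - inner x y.
Proof. by rewrite innerC innerNl innerC. Qed.

Lemma innerBl x y z : inner (x - y) z = inner x z - inner y z.
Proof. by rewrite innerDl innerNl. Qed.

Lemma innerBr x y z : inner x (y - z) = inner x y - inner x z.
Proof. by rewrite innerDr innerNr. Qed.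

Lemma inner_suml I (r : seq I) (P : pred I) (F : I -> X) y :
  inner (\sum_(i <- r | P i) F i) y = \sum_(i <- r | P i) inner (F i) y.
Proof.
by elim/big_rec2 : _ => [|i u v _ <-]; rewrite ?inner0l// innerDl.
Qed.

Lemma inner_sumr I (r : seq I) (P : pred I) (F : I -> X) y :
  inner y (\sum_(i <- r | P i) F i) = \sum_(i <- r | P i) inner y (F i).
Proof. by rewrite innerC inner_suml; apply: eq_bigr => i _; rewrite innerC. Qed.

Lemma inner_ge0 x : 0 <= inner x x.
Proof. by rewrite inner_norm exprn_ge0. Qed.

Lemma inner_eq0 x : inner x x = 0 -> x = 0.
Proof.
by rewrite inner_norm => /eqP; rewrite sqrf_eq0 normr_eq0 => /eqP.
Qed.

Lemma inner_ext x y : (forall z, inner x z = inner y z) -> x = y.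
Proof.
by move=> xy; apply/eqP; rewrite -subr_eq0; apply/eqP/inner_eq0; rewrite innerBl xy subrr.
Qed.

Lemma norm2D x y : `|x + y| ^+ 2 = `|x| ^+ 2 + 2 * inner x y + `|y| ^+ 2.
Proof. by rewrite -!inner_norm innerDl !innerDr (innerC y x); ring. Qed.

Lemma norm2B x y : `|x - y| ^+ 2 = `|x| ^+ 2 - 2 * inner x y + `|y| ^+ 2.
Proof. by rewrite norm2D innerNr normrN; ring. Qed.

End inner_product.

Lemma cvgn_unique {R : realType} (V : normedModType R) (u : nat -> V) (a b : V) :
  u n @[n --> \oo] --> a -> u n @[n --> \oo] --> b -> a = b.
Proof.
by move=> ua ub; rewrite -(cvg_lim (@norm_hausdorff _ V) ua) (cvg_lim (@norm_hausdorff _ V) ub).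
Qed.

(** The form may be degenerate. If [b y y = 0], then b (x + t y) (x + t y) is affine in t, and
    unless [b x y = 0] the chosen t gives it the value -1. *)
Lemma form_cauchy_schwarz {R : realType} {V : lmodType R} (b : V -> V -> R) :
  (forall x y, b x y = b y x) ->
  (forall x y z, b (x + y) z = b x z + b y z) ->
  (forall a x y, b (a *: x) y = a * b x y) ->
  (forall x, 0 <= b x x) -> forall x y, b x y ^+ 2 <= b x x * b y y.
Proof.
move=> bC bD bZ b0 x y.
have e t : b (x + t *: y) (x + t *: y) = b x x + 2 * t * b x y + t ^+ 2 * b y y.
  by rewrite bD bZ (bC x) (bC y) !bD !bZ (bC y x); ring.
have [byy|byy] := eqVneq (b y y) 0.
  have [->|bxy] := eqVneq (b x y) 0; first by rewrite expr0n/= mulr_ge0.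
  have := b0 (x + (- (b x x + 1) / (2 * b x y)) *: y).
  rewrite e byy mulr0 addr0.
  rewrite (_ : 2 * (- (b x x + 1) / (2 * b x y)) * b x y = - (b x x + 1)); last by field.
  by lra.
have pyy : 0 < b y y by rewrite lt_neqAle eq_sym byy b0.
have := b0 (x + (- b x y / b y y) *: y); rewrite e.
rewrite (_ : b x x + _ + _ = b x x - b x y ^+ 2 / b y y); last by field.
by rewrite subr_ge0 ler_pdivrMr.
Qed.

(** * Cauchy-Schwarz and Riesz representation *)

Section inner_continuity.
Context {R : realType} {X : hilbertType R}.
Implicit Types (x y z : X) (a : R).

Lemma cauchy_schwarz x y : `|inner x y| <= `|x| * `|y|.
Proof.
rewrite -(@ler_pXn2r _ 2)// ?nnegrE ?mulr_ge0// real_normK ?num_real// exprMn.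
rewrite -!inner_norm; apply: form_cauchy_schwarz => //.
- exact: innerC.
- exact: innerDl.
- exact: innerZl.
- exact: inner_ge0.
Qed.

Lemma norm_le_inner x (c : R) : 0 <= c ->
  (forall y, `|inner x y| <= c * `|y|) -> `|x| <= c.
Proof.
move=> c0 /(_ x); rewrite inner_norm ger0_norm ?exprn_ge0// expr2.
have [->|x0] := eqVneq x 0; first by rewrite normr0.
by rewrite ler_pM2r// normr_gt0.
Qed.

Lemma cvg_innerl (T : Type) (F : set_system T) (FF : Filter F) (f : T -> X) x y :
  f @ F --> x -> (fun t => inner (f t) y) @ F --> inner x y.
Proof.
move=> fx; apply/cvgrPdist_lt => e e0.
have d0 : 0 < e / (`|y| + 1) by rewrite divr_gt0// ltr_wpDl.
have {}fx : \forall t \near F, `|x - f t| < e / (`|y| + 1).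
  by move/cvgrPdist_lt : fx; apply.
apply: filterS fx => t h.
rewrite -innerBl (le_lt_trans (cauchy_schwarz _ _))//.
rewrite (@le_lt_trans _ _ (`|x - f t| * (`|y| + 1)))//.
  by rewrite ler_wpM2l// lerDl.
by rewrite -ltr_pdivlMr// ltr_wpDl.
Qed.

Lemma cvg_innerr (T : Type) (F : set_system T) (FF : Filter F) (f : T -> X) x y :
  f @ F --> x -> (fun t => inner y (f t)) @ F --> inner y x.
Proof.
move=> /cvg_innerl => /(_ y); rewrite innerC.
by under eq_fun do rewrite innerC.
Qed.

Lemma continuous_inner y : continuous (inner ^~ y : X -> R).
Proof. by move=> x; exact: cvg_innerl. Qed.

(* Minimizing [|S k|^2 - 2 l k]: a minimizing sequence has Cauchy images. *)
Lemma riesz_range (S : X -> X) (l : X -> R) (c : R) : linear S ->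
  (forall (a : R) x y, l (a *: x + y) = a * l x + l y) ->
  0 <= c -> (forall k, `|l k| <= c * `|S k|) ->
  exists w, [/\ forall k, inner w (S k) = l k, `|w| <= c &
    forall y, (forall k, inner y (S k) = 0) -> inner w y = 0].
Proof.
move=> lS ll c0 lc.
have SD x y : S (x + y) = S x + S y by have := lS 1 x y; rewrite !scale1r.
have S0 : S 0 = 0 by apply: (addrI (S 0)); rewrite -SD !addr0.
have SZ a x : S (a *: x) = a *: S x by have := lS a x 0; rewrite !addr0 S0 addr0.
have lD x y : l (x + y) = l x + l y by have := ll 1 x y; rewrite scale1r mul1r.
have l0 : l 0 = 0 by apply: (addrI (l 0)); rewrite -lD !addr0.
have lZ a x : l (a *: x) = a * l x by have := ll a x 0; rewrite !addr0 l0 addr0.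
pose J (k : X) : R := `|S k| ^+ 2 - 2 * l k.
have Jlb k : - c ^+ 2 <= J k.
  have := lc k; rewrite ler_norml /J => /andP[_ h].
  have := sqr_ge0 (c - `|S k|); nra.
have hi : has_inf (range J).
  by split; [exists (J 0), 0|exists (- c ^+ 2) => _ [k _ <-]].
pose m := inf (range J).
have mJ k : m <= J k by apply: ge_inf; [exact: hi.2|exists k].
have /choice[k kP] (n : nat) : exists k, J k < m + n.+1%:R^-1.
  have := @inf_adherent _ (range J) n.+1%:R^-1.
  rewrite invr_gt0 ltr0n => /(_ erefl hi)[_ [k _ <-] h].
  by exists k.
(* Parallelogram law: as [J] is at least [m] at the midpoint, the images of two almost minimizing
   points are close, although the points themselves need not be. *)
have par i j : `|S i - S j| ^+ 2 = 2 * J i + 2 * J j - 4 * J (2^-1 *: (i + j)).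
  rewrite /J lZ lD SZ SD normrZ exprMn norm2B norm2D ger0_norm ?invr_ge0//.
  by field.
have cau : cauchy (S (k n) @[n --> \oo]).
  apply/cauchy_ballP => e e0.
  have /= := @near_infty_natSinv_lt R (PosNum (_ : 0 < e ^+ 2 / 4)).
  have e40 : 0 < e ^+ 2 / 4 by rewrite divr_gt0// exprn_gt0.
  move=> /(_ e40) [N _ hN].
  exists (S @` [set k n | n in [set n | (N <= n)%N]], S @` [set k n | n in [set n | (N <= n)%N]]).
    split; by exists N => // n Nn /=; exists (k n) => //; exists n.
  move=> [_ _] [/= [_ [i Ni <-] <-] [_ [j Nj <-] <-]].
  rewrite -ball_normE /ball_/= -(@ltr_pXn2r _ 2) ?nnegrE ?(ltW e0)// par.
  have := hN _ Ni; have := hN _ Nj; rewrite /= => h1 h2.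
  have /lt_trans - /(_ (m + e ^+ 2 / 4)) := kP i; rewrite ltrD2l => /(_ h2) h3.
  have /lt_trans - /(_ (m + e ^+ 2 / 4)) := kP j; rewrite ltrD2l => /(_ h1) h4.
  by have := mJ (2^-1 *: (k i + k j)); lra.
have cS : cvg (S (k n) @[n --> \oo]) by exact: cauchy_cvg.
pose w := lim (S (k n) @[n --> \oo]).
have wE h : inner w (S h) = l h.
  have cvgJ : J (k n) @[n --> \oo] --> m.
    apply/cvgrPdist_lt => e e0; near=> n.
    rewrite distrC ger0_norm ?subr_ge0// ltrBlDl (lt_trans (kP n))// ltrD2l.
    near: n; exact: (near_infty_natSinv_lt (PosNum e0)).
  have main (t : R) : 0 <= 2 * t * (inner w (S h) - l h) + t ^+ 2 * `|S h| ^+ 2.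
    have cv : J (k n) + (2 * t * (inner (S (k n)) (S h) - l h) + t ^+ 2 * `|S h| ^+ 2)
       @[n --> \oo] --> m + (2 * t * (inner w (S h) - l h) + t ^+ 2 * `|S h| ^+ 2).
      apply: cvgD => //; apply: cvgD; last exact: cvg_cst.
      apply: cvgM; first exact: cvg_cst.
      by apply: cvgB; [exact: cvg_innerl|exact: cvg_cst].
    rewrite -(@lerD2l _ m) addr0.
    apply: (ler_cvg_to (cvg_cst m) cv); apply: nearW => n; rewrite (le_trans (mJ (k n + t *: h)))//.
    rewrite /J SD SZ lD lZ norm2D innerZr normrZ exprMn real_normK ?num_real//.
    by lra.
  set d := inner w (S h) - l h in main *; apply/eqP; rewrite -subr_eq0 -/d.
  set s := `|S h| ^+ 2 in main; have s0 : 0 <= s by rewrite exprn_ge0.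
  apply/negPn/negP => d0.
  (* The denominator [s + 1] instead of [s] also covers [S h = 0]. *)
  have := main (- d / (s + 1)).
  have -> : 2 * (- d / (s + 1)) * d + (- d / (s + 1)) ^+ 2 * s =
    - (d ^+ 2 * (s + 2) / (s + 1) ^+ 2) by field; lra.
  rewrite oppr_ge0 leNgt divr_gt0//; last by rewrite exprn_gt0//; lra.
  by rewrite mulr_gt0 ?exprn_even_gt0//; lra.
have wS y : (forall k0, inner y (S k0) = 0) -> inner w y = 0.
  move=> yS; apply: (@cvgn_unique _ R^o (fun n => inner (S (k n)) y)).
    exact: cvg_innerl.
  by apply: cvg_near_cst; apply: nearW => n; rewrite innerC.
exists w; split => //.
have wn2 : `|w| ^+ 2 <= c * `|w|.
  have c1 : inner w (S (k n)) @[n --> \oo] --> `|w| ^+ 2.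
    by rewrite -inner_norm; exact: cvg_innerr.
  have c2 : c * `|S (k n)| @[n --> \oo] --> c * `|w|.
    by apply: cvgM; [exact: cvg_cst|exact: cvg_norm].
  apply: (ler_cvg_to c1 c2); apply: nearW => n.
  by rewrite wE (le_trans (ler_norm _)).
move: wn2; have [->|w0] := eqVneq w 0; first by rewrite normr0.
by rewrite expr2 ler_pM2r// normr_gt0.
Unshelve. all: by end_near. Qed.

End inner_continuity.

(** Linear identities between vectors become ring identities after pairing with an arbitrary
    vector. *)
Ltac vring :=
  apply: inner_ext => ?; rewrite ?(innerDl, innerBl, innerNl, innerZl, inner0l); ring.

(** * Bounded operators and adjoints *)

Section linear_operators.
Context {R : realType} {X : hilbertType R}.
Implicit Types (x y z : X) (a : R) (A S : X -> X).

Lemma lin_0 A : linear A -> A 0 = 0.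
Proof.
move=> lA; apply: (addrI (A 0)).
by have := lA 1 0 0; rewrite !scale1r !addr0 => <-.
Qed.

Lemma lin_D A x y : linear A -> A (x + y) = A x + A y.
Proof. by move=> lA; have := lA 1 x y; rewrite !scale1r. Qed.

Lemma lin_Z A a x : linear A -> A (a *: x) = a *: A x.
Proof. by move=> lA; have := lA a x 0; rewrite !addr0 (lin_0 lA) addr0. Qed.

Lemma lin_N A x : linear A -> A (- x) = - A x.
Proof. by move=> lA; rewrite -scaleN1r (lin_Z _ _ lA) scaleN1r. Qed.

Lemma lin_B A x y : linear A -> A (x - y) = A x - A y.
Proof. by move=> lA; rewrite (lin_D _ _ lA) (lin_N _ lA). Qed.

Lemma lin_sum A I (r : seq I) (P : pred I) (F : I -> X) : linear A ->
  A (\sum_(i <- r | P i) F i) = \sum_(i <- r | P i) A (F i).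
Proof.
move=> lA; elim/big_rec2 : _ => [|i u v _ <-]; first exact: lin_0.
exact: lin_D.
Qed.

Lemma bounded_op_bound A : bounded_op A ->
  exists2 c, 0 <= c & forall x, `|A x| <= c * `|x|.
Proof.
move=> [lA cA].
have /cvgrPdist_lt/(_ 1 ltr01)/nbhs_ballP[d /= d0 hd] := cA 0.
exists (2 / d); first by rewrite divr_ge0// ltW.
move=> x; have [->|x0] := eqVneq x 0; first by rewrite (lin_0 lA) !normr0 mulr0.
have nx : 0 < `|x| by rewrite normr_gt0.
have /hd : ball 0 d ((d / 2 / `|x|) *: x).
  rewrite -ball_normE /ball_/= sub0r normrN normrZ ger0_norm ?divr_ge0// ?ltW//.
  by rewrite mulfVK ?gt_eqF//; lra.
rewrite /= (lin_0 lA) sub0r normrN (lin_Z _ _ lA) normrZ ger0_norm; last first.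
  by rewrite !divr_ge0// ltW.
move/ltW; rewrite -ler_pdivlMl ?divr_gt0//.
by move=> /le_trans; apply; rewrite mulr1 invf_div invf_div mulrC mulrAC.
Qed.

Lemma bounded_opI A c : linear A -> (forall x, `|A x| <= c * `|x|) -> bounded_op A.
Proof.
move=> lA Ac; split => // x; apply/cvgrPdist_lt => e e0.
have c0 : 0 < `|c| + 1 by rewrite ltr_wpDl.
near=> y.
rewrite -(lin_B _ _ lA) (le_lt_trans (Ac _))//.
rewrite (@le_lt_trans _ _ ((`|c| + 1) * `|x - y|))//.
  by rewrite ler_wpM2r// (le_trans (ler_norm c))// lerDl.
rewrite -ltr_pdivlMl//.
near: y; apply: cvgr_dist_lt; last by rewrite mulr_gt0 ?invr_gt0.
exact: cvg_id.
Unshelve. all: by end_near. Qed.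

Lemma riesz (l : X -> R) (c : R) :
  (forall (a : R) x y, l (a *: x + y) = a * l x + l y) ->
  0 <= c -> (forall k, `|l k| <= c * `|k|) ->
  exists2 w, (forall k, inner w k = l k) & `|w| <= c.
Proof.
move=> ll c0 lc; have [w [w1 w2 _]] := @riesz_range R X id l c (fun _ _ _ => erefl) ll c0 lc.
by exists w.
Qed.

Lemma adjointP A : bounded_op A -> forall x y, inner (A x) y = inner x (adjoint A y).
Proof.
move=> bA; rewrite /adjoint.
case: xgetP => [S -> //|noS].
have [c c0 Ac] := bounded_op_bound bA.
have /choice[S SP] y : exists w, forall x, inner w x = inner (A x) y.
  have [|||w w1 _] := @riesz (fun x => inner (A x) y) (c * `|y|).
  - by move=> a u v; rewrite bA.1 innerDl innerZl.
  - by rewrite mulr_ge0.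
  - by move=> k; rewrite (le_trans (cauchy_schwarz _ _))// mulrAC ler_wpM2r.
  by exists w.
by exfalso; apply: (noS S) => x y /=; rewrite [RHS]innerC SP.
Qed.

Lemma adjointPr A : bounded_op A -> forall x y, inner (adjoint A x) y = inner x (A y).
Proof. by move=> bA x y; rewrite innerC -(adjointP bA) innerC. Qed.

Lemma adjoint_linear A : bounded_op A -> linear (adjoint A).
Proof.
move=> bA a x y; apply: inner_ext => z.
by rewrite innerDl innerZl !(adjointPr bA) innerDl innerZl.
Qed.

Lemma adjoint_bound A c : bounded_op A -> 0 <= c -> (forall x, `|A x| <= c * `|x|) ->
  forall x, `|adjoint A x| <= c * `|x|.
Proof.
move=> bA c0 Ac x; apply: norm_le_inner; first by rewrite mulr_ge0.
move=> y; rewrite (adjointPr bA) (le_trans (cauchy_schwarz _ _))//.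
by rewrite mulrC mulrAC ler_wpM2r.
Qed.

Lemma adjoint_bounded A : bounded_op A -> bounded_op (adjoint A).
Proof.
move=> bA; have [c c0 Ac] := bounded_op_bound bA.
by apply: (@bounded_opI _ c); [exact: adjoint_linear|exact: adjoint_bound].
Qed.

Lemma bounded_comp A S : bounded_op A -> bounded_op S -> bounded_op (A \o S).
Proof.
move=> [lA cA] [lS cS]; split => [a x y /=|x]; first by rewrite lS lA.
by apply: continuous_comp; [exact: cS|exact: cA].
Qed.

End linear_operators.

Definition nonneg_op {R : realType} {X : hilbertType R} (Q : X -> X) : Prop :=
  [/\ bounded_op Q, forall x y, inner (Q x) y = inner x (Q y) &
      forall x, 0 <= inner (Q x) x].

(** * Square roots of nonnegative operators *)

Section square_root.
Context {R : realType} {X : hilbertType R}.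
Implicit Types (x y z : X) (a : R) (A S Q : X -> X).

Lemma nonneg_op_cs Q x y : nonneg_op Q ->
  inner (Q x) y ^+ 2 <= inner (Q x) x * inner (Q y) y.
Proof.
move=> [[lQ _] sQ pQ].
apply: (form_cauchy_schwarz (b := fun x y => inner (Q x) y)) => //.
- by move=> u v; rewrite sQ innerC.
- by move=> u v w; rewrite (lin_D _ _ lQ) innerDl.
- by move=> a u v; rewrite (lin_Z _ _ lQ) innerZl.
Qed.

(** Cauchy-Schwarz for the form <A x, y> at x and A x gives |A x|^4 <= <A x, x> <A A x, A x> <=
    |x|^2 |A x|^2. *)
Lemma nonneg_op_contraction A : nonneg_op A ->
  (forall x, inner (A x) x <= inner x x) -> forall x, `|A x| <= `|x|.
Proof.
move=> nA A1 x; have := nonneg_op_cs x (A x) nA.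
rewrite [inner (A x) (A x)]inner_norm => h.
have h2 : inner (A x) x * inner (A (A x)) (A x) <= `|x| ^+ 2 * `|A x| ^+ 2.
  rewrite -!inner_norm; apply: ler_pM => //; case: nA => [_ _ p]; exact: p.
have {}h := le_trans h h2.
have [->|Ax] := eqVneq (A x) 0; first by rewrite normr0.
move: h; rewrite expr2 ler_pM2r; last by rewrite exprn_gt0// normr_gt0.
by rewrite ler_pXn2r// nnegrE.
Qed.

(* The iteration [Y <- (A + Y^2) / 2] for [Y = 1 - sqrt (1 - A)], majorized by
   the scalar iteration [y <- (1 + y^2) / 2] from [0], which increases to [1]. *)
Lemma contraction_sqrt A : nonneg_op A -> (forall x, inner (A x) x <= inner x x) ->
  exists S, nonneg_op S /\ forall x, S (S x) = x - A x.
Proof.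
move=> nA A1; have Ac := nonneg_op_contraction nA A1.
have [[lA cA] sA pA] := nA.
pose Y := fix Y n : X -> X := if n is n'.+1 then
  fun x => 2^-1 *: (A x + Y n' (Y n' x)) else fun=> 0.
pose y := fix y n : R := if n is n'.+1 then 2^-1 * (1 + y n' ^+ 2) else 0.
have y01 n : 0 <= y n <= 1.
  by elim: n => [|n /andP[h0 h1]] /=; rewrite ?lexx ?ler01//; apply/andP; split; nra.
have ynd n : y n <= y n.+1.
  elim: n => [|n ih]; first by have /andP[] := y01 1%N.
  have /andP[h0 h1] := y01 n; have /andP[h2 h3] := y01 n.+1.
  have e k : y k.+1 = 2^-1 * (1 + y k ^+ 2) by [].
  by rewrite !e in ih h2 h3 *; nra.
have lY n : linear (Y n).
  elim: n => [|n ih] a u v /=; first by rewrite scaler0 addr0.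
  by rewrite lA !ih scalerDr !scalerDr !scalerA addrACA (mulrC a) -!scalerA -!scalerDr.
have Yb n x : `|Y n x| <= y n * `|x|.
  elim: n x => [|n ih] x /=; first by rewrite normr0 mul0r.
  rewrite normrZ ger0_norm ?invr_ge0// -mulrA ler_wpM2l ?invr_ge0//.
  rewrite (le_trans (ler_normD _ _))// mulrDl mul1r lerD//.
  rewrite (le_trans (ih _))// expr2 -mulrA ler_wpM2l//.
  by have /andP[] := y01 n.
(* The difference of squares is written Y' (Y' - Y) + (Y' - Y) Y, which respects the order of the
   factors; the scalar increments then dominate the operator increments. *)
have Yd n x : `|Y n.+1 x - Y n x| <= (y n.+1 - y n) * `|x|.
  elim: n x => [|n ih] x.
    rewrite /= subr0 normrZ addr0 expr0n/= addr0 mulr1 subr0.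
    by rewrite ger0_norm ?invr_ge0// ler_wpM2l ?invr_ge0.
  have -> : Y n.+2 x - Y n.+1 x =
      2^-1 *: (Y n.+1 (Y n.+1 x - Y n x) + (Y n.+1 (Y n x) - Y n (Y n x))).
    rewrite (lin_B _ _ (lY n.+1)) addrA subrK.
    by rewrite [Y n.+2 x]/= [X in _ - X]/= -scalerBr opprD addrACA subrr add0r.
  have -> : y n.+2 - y n.+1 = 2^-1 * (y n.+1 * (y n.+1 - y n) + (y n.+1 - y n) * y n).
    have ye k : y k.+1 = 2^-1 * (1 + y k ^+ 2) by [].
    by rewrite (ye n.+1) [X in _ - X](ye n); ring.
  rewrite normrZ ger0_norm ?invr_ge0// -mulrA ler_wpM2l ?invr_ge0//.
  have /andP[n0 _] := y01 n.+1.
  rewrite (le_trans (ler_normD _ _))// mulrDl lerD//.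
    by rewrite (le_trans (Yb _ _))// -mulrA ler_wpM2l.
  by rewrite (le_trans (ih _))// -mulrA ler_wpM2l ?subr_ge0.
have Yd' m n x : `|Y (n + m)%N x - Y n x| <= (y (n + m)%N - y n) * `|x|.
  elim: m => [|m ih]; first by rewrite addn0 !subrr normr0 mul0r.
  rewrite addnS.
  have -> : Y (n + m).+1 x - Y n x = (Y (n + m).+1 x - Y (n + m)%N x) + (Y (n + m)%N x - Y n x).
    by rewrite addrA subrK.
  have -> : y (n + m).+1 - y n = (y (n + m).+1 - y (n + m)%N) + (y (n + m)%N - y n).
    by rewrite addrA subrK.
  by rewrite (le_trans (ler_normD _ _))// mulrDl lerD.
have ycv : cvg (y n @[n --> \oo]).
  apply: nondecreasing_is_cvgn; first exact/nondecreasing_seqP.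
  by exists 1 => _ [n _ <-]; have /andP[] := y01 n.
have ycau : forall e : R, 0 < e -> exists N, forall n, (N <= n)%N -> y n - y N < e.
  move=> e e0; have /cvgrPdist_lt/(_ (e / 2)) := ycv.
  rewrite divr_gt0// => /(_ erefl)[N _ hN]; exists N => n Nn.
  have := hN N (leqnn N); have := hN n Nn => /=.
  by rewrite !ltr_norml; lra.
have Ycv x : cvg (Y n x @[n --> \oo]).
  apply: cauchy_cvg; apply/cauchy_ballP => e e0.
  have e'0 : 0 < e / (2 * (`|x| + 1)) by rewrite divr_gt0// mulr_gt0// ltr_wpDl.
  have [N hN] := ycau _ e'0.
  have near n : (N <= n)%N -> `|Y n x - Y N x| < e / 2.
    move=> Nn; rewrite -(subnKC Nn) (le_lt_trans (Yd' _ _ _))// subnKC//.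
    have x1 : 0 < `|x| + 1 by rewrite ltr_wpDl.
    rewrite (@le_lt_trans _ _ ((y n - y N) * (`|x| + 1)))//.
      rewrite ler_wpM2l ?lerDl// subr_ge0 -(subnKC Nn).
      by elim: (n - N)%N => [|k ih]; rewrite ?addn0// addnS (le_trans ih).
    rewrite -ltr_pdivlMr// (lt_le_trans (hN _ Nn))// invfM mulrA.
    by rewrite -mulrA.
  exists (Y^~ x @` [set n | (N <= n)%N], Y^~ x @` [set n | (N <= n)%N]).
    by split; exists N => // n Nn /=; exists n.
  move=> [_ _] [/= [i Ni <-] [j Nj <-]].
  rewrite -ball_normE /ball_/=.
  rewrite (_ : Y i x - Y j x = (Y i x - Y N x) - (Y j x - Y N x)); last first.
    by rewrite opprB addrA subrK.
  rewrite (le_lt_trans (ler_normB _ _))// (splitr e) ltrD//; exact: near.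
pose Z x : X := lim (Y n x @[n --> \oo]).
have YZ x : Y n x @[n --> \oo] --> Z x by exact: Ycv.
have lZ : linear Z.
  move=> a u v; apply: cvgn_unique (YZ _) _.
  under eq_fun do rewrite lY.
  by apply: cvgD; [apply: cvgZ; [exact: cvg_cst|exact: YZ]|exact: YZ].
have sY n u v : inner (Y n u) v = inner u (Y n v).
  elim: n u v => [|n ih] u v /=; first by rewrite inner0l inner0r.
  by rewrite innerZl innerZr innerDl innerDr sA !ih.
have sZ u v : inner (Z u) v = inner u (Z v).
  apply: (@cvgn_unique _ R^o (fun n => inner (Y n u) v)); first exact: cvg_innerl.
  under eq_fun do rewrite sY.
  exact: cvg_innerr.
have Z1 x : `|Z x| <= `|x|.
  apply: (@cvgr_to_le _ \oo _ _ (fun n => `|Y n x|)); first by apply: cvg_norm; exact: YZ.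
  apply: nearW => n; rewrite (le_trans (Yb _ _))// ler_piMl//.
  by have /andP[] := y01 n.
have ZZ x : Z x = 2^-1 *: (A x + Z (Z x)).
  have c1 : Y n.+1 x @[n --> \oo] --> Z x by rewrite (cvg_shiftS (Y^~ x)).
  apply: (cvgn_unique c1) => /=.
  apply: cvgZ; first exact: cvg_cst.
  apply: cvgD; first exact: cvg_cst.
  have -> : (fun n => Y n (Y n x)) = (fun n => Y n (Y n x - Z x) + Y n (Z x)).
    by apply/funext => n; rewrite (lin_B _ _ (lY n)) subrK.
  rewrite -[X in _ --> X]add0r; apply: cvgD => //.
  apply/cvgr0Pnorm_lt => e e0; near=> n.
  rewrite (le_lt_trans (Yb _ _))//.
  rewrite (@le_lt_trans _ _ `|Y n x - Z x|)//.
    by rewrite ler_piMl//; have /andP[] := y01 n.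
  by near: n; apply: cvgr_distC_lt; [exact: YZ|].
exists (fun x => x - Z x); split; last first.
  move=> x; rewrite (lin_B _ _ lZ).
  have -> : Z (Z x) = 2 *: Z x - A x.
    by rewrite [in RHS]ZZ scalerA divff// scale1r addrAC subrr add0r.
  by vring.
split.
- apply: (@bounded_opI _ _ _ 2).
    by move=> a u v; rewrite lZ scalerBr opprD addrACA.
  move=> x; rewrite (le_trans (ler_normB _ _))// mulrDl !mul1r lerD//.
- by move=> u v; rewrite innerBl innerBr sZ.
- move=> x; rewrite innerBl subr_ge0 inner_norm (le_trans (ler_norm _))//.
  by rewrite (le_trans (cauchy_schwarz _ _))// expr2 ler_wpM2r.
Unshelve. all: by end_near. Qed.

Lemma nonneg_sqrt Q : nonneg_op Q -> exists S, nonneg_op S /\ forall x, S (S x) = Q x.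
Proof.
move=> nQ; have [bQ sQ pQ] := nQ; have [c c0 Qc] := bounded_op_bound bQ.
(* With this [d] the form of Q / d lies between 0 and the identity, and [d] stays positive when
   [c = 0]; the root of 1 - A = Q / d is then scaled back. *)
pose d := c + 1; have d0 : 0 < d by rewrite /d; lra.
pose A x := x - d^-1 *: Q x.
have lA : linear A.
  by move=> a u v; rewrite /A bQ.1; vring.
have [||S [nS SS]] := @contraction_sqrt A.
- split.
  + apply: (@bounded_opI _ _ _ (1 + d^-1 * c)) => // x.
    rewrite (le_trans (ler_normB _ _))// mulrDl mul1r lerD// normrZ.
    by rewrite gtr0_norm ?invr_gt0// -mulrA ler_wpM2l ?invr_ge0// ltW.
  + by move=> u v; rewrite /A innerBl innerBr innerZl innerZr sQ.
  + move=> x; rewrite /A innerBl innerZl subr_ge0 mulrC ler_pdivrMr//.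
    rewrite (le_trans (ler_norm _))// (le_trans (cauchy_schwarz _ _))//.
    rewrite inner_norm expr2 mulrAC ler_wpM2r// mulrC (le_trans (Qc _))//.
    by rewrite ler_wpM2r// /d lerDl.
- move=> x; rewrite /A innerBl innerZl gerBl mulr_ge0 ?invr_ge0// ltW//.
have [bS sS pS] := nS; have [c1 c10 Sc] := bounded_op_bound bS.
exists (fun x => Num.sqrt d *: S x); split; last first.
  move=> x; rewrite (lin_Z _ _ bS.1) scalerA -expr2 sqr_sqrtr ?ltW// SS /A.
  by rewrite opprB addrCA subrr addr0 scalerA divff ?gt_eqF// scale1r.
split.
- apply: (@bounded_opI _ _ _ (Num.sqrt d * c1)).
    by move=> a u v; rewrite bS.1; vring.
  move=> x; rewrite normrZ ger0_norm ?sqrtr_ge0// -mulrA ler_wpM2l ?sqrtr_ge0//.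
- by move=> u v; rewrite innerZl innerZr sS.
- by move=> x; rewrite innerZl mulr_ge0 ?sqrtr_ge0.
Qed.

Lemma op_sqrtP Q : nonneg_op Q -> nonneg_op (op_sqrt Q) /\ forall x, op_sqrt Q (op_sqrt Q x) = Q x.
Proof.
move=> nQ; rewrite /op_sqrt; case: xgetP => [S -> [b s p q] //|noS].
have [S [[b s p] q]] := nonneg_sqrt nQ.
by have := noS S; case.
Qed.

End square_root.

(** * Orthonormal bases and the trace *)

Section orthonormal_sequences.
Context {R : realType} {X : hilbertType R}.
Implicit Types (x y z : X) (a : R) (E : set X).

Lemma orthonormal_basis_exists : exists E : set X, orthonormal_basis E.
Proof.
have [F FP totF|E [oE maxE]] := @Zorn_bigcup X Defs.orthonormal.
  move=> e e' [A FA Ae] [A' FA' Ae'].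
  by have [AA'|AA'] := totF _ _ FA FA'; [apply: (FP A')|apply: (FP A)] => //; exact: AA'.
exists E; split => // x xE; apply/eqP/negPn/negP => x0.
pose x' := `|x|^-1 *: x.
have nx : `|x| != 0 by rewrite normr_eq0.
have x'E e : E e -> inner x' e = 0 by move=> Ee; rewrite innerZl xE// mulr0.
have x'1 : inner x' x' = 1 by rewrite innerZl innerZr inner_norm; field.
apply: (maxE (E `|` [set x'])).
  split; first by move=> e Ee; left.
  move=> /(_ x') h; have := x'E x' (h (or_intror erefl)).
  by rewrite x'1 => /eqP; rewrite oner_eq0.
have nE e : E e -> (e == x') = false.
  by move=> Ee; apply/eqP => ex; have := x'E _ Ee; rewrite ex x'1 => /eqP; rewrite oner_eq0.
move=> e e' [Ee|->] [Ee'|->].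
- exact: oE.
- by rewrite innerC x'E// nE.
- by rewrite x'E// eq_sym nE.
- by rewrite x'1 eqxx.
Qed.

(** Distinct orthonormal vectors are at distance sqrt 2, so points of the dense set chosen within
    1/2 of them are distinct. *)
Lemma orthonormal_countable E : separable X -> Defs.orthonormal E -> countable E.
Proof.
move=> [D cD dD] oE.
have /choice[d dP] e : exists d, D d /\ ball e (2^-1) d.
  have [] := dD (ball e 2^-1) _ (ball_open _ _) => //.
    by exists e; apply: ballxx.
  by move=> d [d1 d2]; exists d.
have /countable_injP[f fi] := cD.
apply/countable_injP; exists (f \o d) => e e' /set_mem Ee /set_mem Ee' /= fe.
have de : d e = d e' by apply: fi => //; rewrite inE; exact: (dP _).1.
apply/eqP/negPn/negP => ee'.
have h2 : `|e - e'| ^+ 2 = 2.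
  by rewrite norm2B -!inner_norm !oE// (negbTE ee') !eqxx /=; lra.
have : `|e - e'| < 1.
  rewrite (_ : e - e' = (e - d e) - (e' - d e')); last by rewrite de opprB addrA subrK.
  rewrite (le_lt_trans (ler_normB _ _))// (splitr 1) ltrD//.
    by have [_] := dP e; rewrite -ball_normE /ball_/= div1r.
  by have [_] := dP e'; rewrite -ball_normE /ball_/= div1r.
rewrite -(@ltr_pXn2r _ 2)// ?nnegrE// h2 expr1n; lra.
Qed.

(* An orthonormal basis listed by the natural numbers, padded with zeros. *)
Definition frame (e : nat -> X) : Prop :=
  [/\ forall j k, j != k -> inner (e j) (e k) = 0,
      forall k, e k = 0 \/ inner (e k) (e k) = 1 &
      forall x, (forall k, inner x (e k) = 0) -> x = 0].

(** Connects [trace], a sum over an unspecified chosen basis, with partial sums along a sequence. A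
    finite trace is only ever used as a bound on these partial sums. *)
Lemma frame_trace : separable X -> exists e : nat -> X, frame e /\
  forall Q : X -> X, linear Q -> (forall x, 0 <= inner (Q x) x) ->
    forall n, ((\sum_(k < n) inner (Q (e k)) (e k))%:E <= trace Q)%E.
Proof.
move=> sX; rewrite /trace.
case: xgetP => [E _ /= [oE cE]|noE]; last first.
  by have [E oE] := orthonormal_basis_exists; case: (noE E).
have /countable_injP[i iinj] := orthonormal_countable sX oE.
pose e k : X := xget 0 [set x | E x /\ i x = k].
have eP k : e k = 0 /\ (forall x, E x -> i x != k) \/ E (e k) /\ i (e k) = k.
  rewrite /e; case: xgetP => [x _ /= [Ex ix]|nx]; first by right.
  left; split => // x Ex; apply/eqP => ix; exact: (nx x).
have ei x : E x -> e (i x) = x.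
  move=> Ex; have [[_ /(_ x Ex)]|[Ee ie]] := eP (i x); first by rewrite eqxx.
  by apply: iinj => //; rewrite inE.
exists e; split.
  split => [j k jk|k|x xe].
  - have [[-> _]|[Ej ij]] := eP j; first by rewrite inner0l.
    have [[-> _]|[Ek ik]] := eP k; first by rewrite inner0r.
    have [ejk|ejk] := eqVneq (e j) (e k); first by move: jk; rewrite -ij -ik ejk eqxx.
    by rewrite oE// (negbTE ejk).
  - have [[-> _]|[Ek _]] := eP k; [by left|right].
    by rewrite oE// eqxx.
  - by apply: cE => y Ey; rewrite -(ei _ Ey).
move=> Q lQ Q0 n.
pose P := [set k | (k < n)%N /\ (E (e k) /\ i (e k) = k)].
apply: esum_ge; exists (e @` P).
  split; first by apply: finite_image; apply: (@sub_finite_set _ _ `I_n) => // k [].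
  by move=> _ [k [_ [Ek _]] <-].
rewrite fsbig_image; last first.
  by move=> j k /set_mem[_ [_ ij]] /set_mem[_ [_ ik]] ejk; rewrite -ij ejk ik.
rewrite (fsbig_widen P `I_n)/=.
- by rewrite -fsbig_ord sumEFin.
- by move=> k [].
- move=> k [/= kn nPk].
  have [[-> _]|Ek] := eP k; first by rewrite (lin_0 lQ) inner0l.
  by case: nPk.
Qed.

Section expansion.
Variable e : nat -> X.
Hypothesis fe : frame e.

Lemma frame_coef x k : inner x (e k) * inner (e k) (e k) = inner x (e k).
Proof.
by have [_ /(_ k)[->|->] _] := fe; rewrite ?mulr1// inner0r mul0r.
Qed.

Let s x n := \sum_(k < n) inner x (e k) *: e k.
Let q x n := \sum_(k < n) inner x (e k) ^+ 2.

Let se x n j : (j < n)%N -> inner (s x n) (e j) = inner x (e j).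
Proof.
move=> jn; rewrite /s inner_suml (bigD1 (Ordinal jn))//= innerZl frame_coef.
rewrite big1 ?addr0// => k kj; rewrite innerZl.
by have [-> //] := fe; rewrite mulr0.
Qed.

Let ss x n m : (n <= m)%N -> inner (s x m) (s x n) = q x n.
Proof.
move=> nm; rewrite /s inner_sumr; apply: eq_bigr => k _.
by rewrite innerZr se// (leq_trans (ltn_ord k)).
Qed.

Let xs x n : inner x (s x n) = q x n.
Proof. by rewrite /s inner_sumr; apply: eq_bigr => k _; rewrite innerZr. Qed.

Lemma frame_bessel x n : \sum_(k < n) inner x (e k) ^+ 2 <= `|x| ^+ 2.
Proof.
have := sqr_ge0 `|x - s x n|; rewrite norm2B xs -[`|s x n| ^+ 2]inner_norm ss//.
by rewrite /q; lra.
Qed.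

Lemma frame_expansion x : \sum_(k < n) inner x (e k) *: e k @[n --> \oo] --> x.
Proof.
have qnd : nondecreasing_seq (q x).
  by apply/nondecreasing_seqP => n; rewrite /q big_ord_recr/= lerDl sqr_ge0.
have qcv : cvgn (q x).
  apply: nondecreasing_is_cvgn => //.
  by exists (`|x| ^+ 2) => _ [n _ <-]; exact: frame_bessel.
have scv : cvgn (s x).
  apply: cauchy_cvg; apply/cauchy_ballP => d d0.
  have d20 : 0 < (d / 2) ^+ 2 / 2 by rewrite divr_gt0// exprn_gt0// divr_gt0.
  have /cvgrPdist_lt/(_ _ d20)[N _ hN] := qcv.
  have near n : (N <= n)%N -> `|s x n - s x N| < d / 2.
    move=> Nn; rewrite -(@ltr_pXn2r _ 2) ?nnegrE ?normr_ge0 ?divr_ge0 ?(ltW d0)//.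
    rewrite norm2B -!inner_norm !ss//.
    have := hN N (leqnn N); have := hN n Nn => /=; rewrite !ltr_norml.
    by move=> /andP[a1 a2] /andP[a3 a4]; lra.
  exists (s x @` [set n | (N <= n)%N], s x @` [set n | (N <= n)%N]).
    by split; exists N => // n Nn /=; exists n.
  move=> [_ _] [/= [i Ni <-] [j Nj <-]].
  rewrite -ball_normE /ball_/=.
  rewrite (_ : s x i - s x j = (s x i - s x N) - (s x j - s x N)); last first.
    by rewrite opprB addrA subrK.
  by rewrite (le_lt_trans (ler_normB _ _))// (splitr d) ltrD//; exact: near.
suff {2}-> : x = limn (s x) by exact: scv.
apply/eqP; rewrite -subr_eq0; apply/eqP; have [_ _] := fe; apply => k.
rewrite innerBl; apply/eqP; rewrite subr_eq0; apply/eqP.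
apply: (@cvgn_unique _ R^o (fun n => inner (s x n) (e k))); last exact: cvg_innerl.
by apply: cvg_near_cst; exists k.+1 => // n kn; rewrite se.
Qed.

Lemma frame_parseval2 x y :
  \sum_(k < n) inner x (e k) * inner y (e k) @[n --> \oo] --> inner x y.
Proof.
rewrite [X in X @ _ --> _](_ : _ = (fun n => inner (\sum_(k < n) inner x (e k) *: e k) y)).
  by apply: cvg_innerl; exact: frame_expansion.
apply/funext => n; rewrite inner_suml; apply: eq_bigr => k _.
by rewrite innerZl (innerC y).
Qed.

Lemma frame_parseval x : \sum_(k < n) inner x (e k) ^+ 2 @[n --> \oo] --> `|x| ^+ 2.
Proof.
rewrite -inner_norm; have := @frame_parseval2 x x.
by under eq_fun do under eq_bigr do rewrite -expr2.
Qed.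

End expansion.

End orthonormal_sequences.

(** * Bounded measurable functions and Bernstein approximation *)

Section bounded_functions.
Context {R : realType} d {T : measurableType d}.
Implicit Types (f g : T -> R).

(** Such functions are integrable for every probability measure, so real integrals are linear and
    monotone on them without further side conditions. *)
Definition bfun f := measurable_fun [set: T] f /\ exists M, forall x, `|f x| <= M.

Lemma bfun_cst (c : R) : bfun (fun=> c).
Proof. by split; [exact: measurable_cst|exists `|c|]. Qed.

Lemma bfunD f g : bfun f -> bfun g -> bfun (fun x => f x + g x).
Proof.
move=> [mf [M fM]] [mg [N gN]]; split; first exact: measurable_funD.
by exists (M + N) => x; rewrite (le_trans (ler_normD _ _))// lerD.
Qed.

Lemma bfunM f g : bfun f -> bfun g -> bfun (fun x => f x * g x).
Proof.
move=> [mf [M fM]] [mg [N gN]]; split; first exact: measurable_funM.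
by exists (M * N) => x; rewrite normrM ler_pM.
Qed.

Lemma bfunZ (a : R) f : bfun f -> bfun (fun x => a * f x).
Proof. by move=> bf; apply: bfunM => //; exact: bfun_cst. Qed.

Lemma bfunN f : bfun f -> bfun (fun x => - f x).
Proof.
move=> [mf [M fM]]; split; first exact: measurableT_comp.
by exists M => x; rewrite normrN.
Qed.

Lemma bfunB f g : bfun f -> bfun g -> bfun (fun x => f x - g x).
Proof. by move=> bf bg; apply: bfunD => //; exact: bfunN. Qed.

Lemma bfun_abs f : bfun f -> bfun (fun x => `|f x|).
Proof.
move=> [mf [M fM]]; split; first exact: measurableT_comp.
by exists M => x; rewrite normr_id.
Qed.

Lemma bfun_indic (E : set T) : measurable E -> bfun (\1_E : T -> R).
Proof.
move=> mE; split; first exact: measurable_indic.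
by exists 1 => x; rewrite indicE ger0_norm// lern1 leq_b1.
Qed.

Lemma bfun_comp d' (T' : measurableType d') (h : T' -> T) f :
  measurable_fun [set: T'] h -> bfun f ->
  measurable_fun [set: T'] (f \o h) /\ exists M, forall x, `|f (h x)| <= M.
Proof.
by move=> mh [mf [M fM]]; split; [exact: measurableT_comp|exists M].
Qed.

Lemma bfun_lip (u : R -> R) (L : R) f : (forall s t, `|u s - u t| <= L * `|s - t|) ->
  bfun f -> bfun (fun x => u (f x)).
Proof.
move=> uL [mf [M fM]]; split.
  apply: measurableT_comp mf; apply: continuous_measurable_fun => x.
  apply/cvgrPdist_lt => e e0; near=> y.
  rewrite (le_lt_trans (uL _ _))// (@le_lt_trans _ _ ((`|L| + 1) * `|x - y|))//.
    by rewrite ler_wpM2r// (le_trans (ler_norm L))// lerDl.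
  rewrite -ltr_pdivlMl; last by rewrite ltr_wpDl.
  near: y; apply: cvgr_dist_lt; first exact: cvg_id.
  by rewrite mulr_gt0// invr_gt0 ltr_wpDl.
exists (`|u 0| + `|L| * M) => x.
rewrite -[u (f x)](subrK (u 0)) addrC (le_trans (ler_normD _ _))// lerD2l.
rewrite (le_trans (uL _ _))// subr0 (le_trans (ler_wpM2r _ (ler_norm L)))//.
by rewrite ler_wpM2l.
Unshelve. all: by end_near. Qed.

Variable P : probability T R.

Lemma bfun_int f : bfun f -> P.-integrable [set: T] (EFin \o f).
Proof.
move=> [mf [M fM]]; apply: measurable_bounded_integrable => //.
  by rewrite (le_lt_trans (probability_le1 _ _))// ltry.
by exists M; split; [exact: num_real|move=> x Mx y _; rewrite /= (le_trans (fM y))// ltW].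
Qed.

Lemma bint_cst (c : R) : (\int[P]_x c)%R = c.
Proof. by rewrite Rintegral_cst//= probability_setT mulr1. Qed.

Lemma bintD f g : bfun f -> bfun g ->
  (\int[P]_x (f x + g x) = \int[P]_x f x + \int[P]_x g x)%R.
Proof. by move=> bf bg; rewrite RintegralD//; exact: bfun_int. Qed.

Lemma bintB f g : bfun f -> bfun g ->
  (\int[P]_x (f x - g x) = \int[P]_x f x - \int[P]_x g x)%R.
Proof. by move=> bf bg; rewrite RintegralB//; exact: bfun_int. Qed.

Lemma bintZ (a : R) f : bfun f -> (\int[P]_x (a * f x) = a * \int[P]_x f x)%R.
Proof. by move=> bf; rewrite RintegralZl//; exact: bfun_int. Qed.

Lemma bint_le f g : bfun f -> bfun g -> (forall x, f x <= g x) ->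
  (\int[P]_x f x <= \int[P]_x g x)%R.
Proof. by move=> bf bg fg; apply: le_Rintegral => //; exact: bfun_int. Qed.

Lemma bint_abs f : bfun f -> `|\int[P]_x f x|%R <= (\int[P]_x `|f x|)%R.
Proof. by move=> bf; apply: le_normr_Rintegral => //; exact: bfun_int. Qed.

Lemma bint_ub f (M : R) : bfun f -> (forall x, `|f x| <= M) -> `|\int[P]_x f x|%R <= M.
Proof.
move=> bf fM; rewrite (le_trans (bint_abs bf))// -[leRHS](bint_cst M).
by apply: bint_le => //; [exact: bfun_abs|exact: bfun_cst].
Qed.

Lemma bint_dist f g (M : R) : bfun f -> bfun g -> (forall x, `|f x - g x| <= M) ->
  `|\int[P]_x f x - \int[P]_x g x|%R <= M.
Proof. by move=> bf bg fg; rewrite -bintB//; apply: bint_ub => //; exact: bfunB. Qed.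

Lemma bint_indic (E : set T) : measurable E -> (\int[P]_x \1_E x)%R = fine (P E).
Proof. by move=> mE; rewrite /Rintegral integral_indic// setIT. Qed.

Lemma bint_cvg (h : nat -> T -> R) f (M : R) : (forall n, bfun (h n)) ->
  (forall n x, `|h n x| <= M) -> (forall x, h n x @[n --> \oo] --> f x) ->
  bfun f /\ (\int[P]_x h n x)%R @[n --> \oo] --> (\int[P]_x f x)%R.
Proof.
move=> bh hM hf.
have mf : measurable_fun [set: T] f.
  by apply: (@measurable_fun_cvg _ _ _ _ h) => [m|x _]; [exact: (bh m).1|exact: hf].
have fM x : `|f x| <= M.
  apply: (@cvgr_to_le _ \oo _ _ (fun n => `|h n x|)); last exact: nearW.
  by apply: cvg_norm; exact: hf.
have bf : bfun f by split => //; exists M.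
split => //; apply: fine_cvg; rewrite fineK; last first.
  by apply: integrable_fin_num => //; exact: bfun_int.
have [//|||||_ _] := @dominated_convergence _ _ _ P setT measurableT
  (fun n x => (h n x)%:E) (fun x => (f x)%:E) (fun=> M%:E).
- by move=> n; apply/measurable_EFinP; exact: (bh n).1.
- exact/measurable_EFinP.
- by apply: aeW => x _; apply: cvg_EFin; [exact: nearW|exact: hf].
- by have := bfun_int (bfun_cst M).
- by apply: aeW => x n _ /=; rewrite lee_fin.
- by [].
Qed.

End bounded_functions.

(** * Bernstein polynomials *)

Section bernstein.
Context {R : realType}.
Implicit Types (x : R) (g h : nat -> R).

(* The mean of [g] under the binomial distribution of parameters [n] and [x]. *)
Fixpoint bern n g x : R := if n is n'.+1 then
  x * bern n' (fun k => g k.+1) x + (1 - x) * bern n' g x else g 0%N.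

Lemma bern_le n g h x : 0 <= x <= 1 -> (forall k, g k <= h k) ->
  bern n g x <= bern n h x.
Proof.
move=> /andP[x0 x1]; elim: n g h => [|n ih] g h gh /=; first exact: gh.
by rewrite lerD// ler_wpM2l ?subr_ge0// ih.
Qed.

Lemma bern_affine n (a b : R) g x : bern n (fun k => a + b * g k) x = a + b * bern n g x.
Proof. by elim: n g => [|n ih] g //=; rewrite !ih; ring. Qed.

(** The variance of the binomial law. The free shift [c] is needed for the induction: the outcome of
    one trial moves the centre by 1 - x or by -x. *)
Lemma bern_sqr n x (c : R) :
  bern n (fun k => (k%:R - n%:R * x + c) ^+ 2) x = c ^+ 2 + n%:R * (x * (1 - x)).
Proof.
elim: n c => [|n ih] c /=; first by ring.
transitivity (x * bern n (fun k => (k%:R - n%:R * x + (c + 1 - x)) ^+ 2) x +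
  (1 - x) * bern n (fun k => (k%:R - n%:R * x + (c - x)) ^+ 2) x); last first.
  by rewrite !ih -natr1; ring.
congr (_ * bern _ _ _ + _ * bern _ _ _); apply/funext => k.
  by rewrite -!natr1; ring.
by rewrite -!natr1; ring.
Qed.

(** From |z| <= e + z^2 / e, the error of a Lipschitz function is bounded by a constant plus a
    multiple of the squared deviation, whose binomial mean is at most that of [bern_sqr] with x (1 -
    x) <= 1. *)
Lemma bern_lip (u : R -> R) (L e : R) n x : 0 <= L -> 0 < e ->
  (forall s t, `|u s - u t| <= L * `|s - t|) -> 0 <= x <= 1 ->
  `|bern n.+1 (fun k => u (k%:R / n.+1%:R)) x - u x| <= L * (e + (n.+1%:R * e)^-1).
Proof.
move=> L0 e0 uL x01; have /andP[x0 x1] := x01.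
have n0 : 0 < n.+1%:R :> R by rewrite ltr0n.
set N : R := n.+1%:R in n0 *.
have key k : `|u (k%:R / N) - u x| <= L * e + (L / (e * N ^+ 2)) * (k%:R - N * x + 0) ^+ 2.
  rewrite (le_trans (uL _ _))//.
  have -> : L * e + L / (e * N ^+ 2) * (k%:R - N * x + 0) ^+ 2 =
      L * (e + (k%:R / N - x) ^+ 2 / e) by field; rewrite ?gt_eqF.
  rewrite ler_wpM2l//; set z := _ - x.
  rewrite -(@ler_pM2r _ e)// mulrDl mulfVK ?gt_eqF//.
  rewrite -(real_normK (num_real z)); have := sqr_ge0 (`|z| - e); have := normr_ge0 z.
  by nra.
have V0 : N * (x * (1 - x)) = 0 ^+ 2 + N * (x * (1 - x)) by rewrite expr0n add0r.
have b1 : bern n.+1 (fun k => u (k%:R / N)) x <=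
    (u x + L * e) + (L / (e * N ^+ 2)) * (N * (x * (1 - x))).
  rewrite V0 -[X in _ <= _ + _ * X]bern_sqr -bern_affine.
  by apply: bern_le => // k; have := key k; rewrite ler_norml => /andP[_ hk]; rewrite -/N -addrA -lerBlDl.
have b2 : (u x - L * e) + (- (L / (e * N ^+ 2))) * (N * (x * (1 - x))) <=
    bern n.+1 (fun k => u (k%:R / N)) x.
  rewrite V0 -[X in _ + _ * X <= _]bern_sqr -bern_affine.
  by apply: bern_le => // k; have := key k; rewrite ler_norml => /andP[hk _]; rewrite -/N mulNr -addrA -opprD -lerBrDl.
have b3 : L / (e * N ^+ 2) * (N * (x * (1 - x))) <= L * (N * e)^-1.
  have -> : L / (e * N ^+ 2) * (N * (x * (1 - x))) = L * (N * e)^-1 * (x * (1 - x)).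
    by field; rewrite ?gt_eqF.
  rewrite ler_piMr//; last by nra.
  by rewrite mulr_ge0// invr_ge0 mulr_ge0 ?ltW.
rewrite mulNr in b2.
set W := _ * (N * (x * _)) in b1 b2 b3; rewrite ler_norml mulrDr.
set D := L / (N * e) in b3 *; set b := bern _ _ _ in b1 b2 *; clearbody W D b.
by apply/andP; split; lra.
Qed.

End bernstein.

(** * Uniform closures of function algebras *)

Section function_algebra.
Context {R : realType} {T : Type}.
Implicit Types (f g : T -> R) (A : (T -> R) -> Prop).

Definition falgebra A := [/\ forall c : R, A (fun=> c),
  forall f g, A f -> A g -> A (fun x => f x + g x),
  forall f g, A f -> A g -> A (fun x => f x * g x) &
  forall f, A f -> exists M, forall x, `|f x| <= M].

Definition uclosure A f := forall e : R, 0 < e ->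
  exists2 g, A g & forall x, `|f x - g x| <= e.

Variable A : (T -> R) -> Prop.
Hypothesis hA : falgebra A.

Lemma uclosure_sub f : A f -> uclosure A f.
Proof. by move=> Af e e0; exists f => // x; rewrite subrr normr0 ltW. Qed.

Lemma uclosure_bounded f : uclosure A f -> exists M, forall x, `|f x| <= M.
Proof.
move=> /(_ 1 ltr01)[g Ag fg]; have [_ _ _ /(_ _ Ag)[M gM]] := hA.
exists (1 + M) => x; rewrite -[f x](subrK (g x)).
by rewrite (le_trans (ler_normD _ _))// lerD.
Qed.

Lemma uclosureD f g : uclosure A f -> uclosure A g -> uclosure A (fun x => f x + g x).
Proof.
move=> uf ug e e0; have e20 : 0 < e / 2 by rewrite divr_gt0.
have [f' Af' ff'] := uf _ e20; have [g' Ag' gg'] := ug _ e20.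
have [_ AD _ _] := hA; exists (fun x => f' x + g' x); first exact: AD.
by move=> x; rewrite opprD addrACA (le_trans (ler_normD _ _))// (splitr e) lerD.
Qed.

Lemma falgebraZ (a : R) f : A f -> A (fun x => a * f x).
Proof. by have [Ac _ AM _] := hA => Af; apply: AM. Qed.

Lemma uclosureZ (a : R) f : uclosure A f -> uclosure A (fun x => a * f x).
Proof.
move=> uf e e0; have a0 : 0 < `|a| + 1 by rewrite ltr_wpDl.
have [g Ag fg] := uf (e / (`|a| + 1)) (divr_gt0 e0 a0).
exists (fun x => a * g x); first exact: falgebraZ.
move=> x; rewrite -mulrBr normrM (@le_trans _ _ ((`|a| + 1) * `|f x - g x|))//.
  by rewrite ler_wpM2r// lerDl.
by rewrite mulrC -ler_pdivlMr.
Qed.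

Lemma uclosureB f g : uclosure A f -> uclosure A g -> uclosure A (fun x => f x - g x).
Proof.
move=> uf ug; rewrite (_ : (fun x => _) = (fun x => f x + (-1) * g x)).
  by apply: uclosureD => //; exact: uclosureZ.
by apply/funext => x; rewrite mulN1r.
Qed.

Lemma falgebra_bern n (u : nat -> R) f : A f -> A (fun x => bern n u (f x)).
Proof.
have [Ac AD AM _] := hA.
move=> Af; elim: n u => [|n ih] u /=; first exact: Ac.
apply: (AD (fun x => f x * bern n (fun k => u k.+1) (f x))
           (fun x => (1 - f x) * bern n u (f x))); first exact: AM.
apply: (AM (fun x => 1 - f x)) => //.
apply: (AD (fun=> 1) (fun x => - f x)) => //.
rewrite (_ : (fun x => - f x) = (fun x => (-1) * f x)); first exact: falgebraZ.
by apply/funext => x; rewrite mulN1r.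
Qed.

(** A bounded [f] is moved affinely into [0, 1], where a Bernstein polynomial of the rescaled [u]
    approximates uniformly and stays in the algebra. This gives absolute values and minima, as in
    the Stone-Weierstrass theorem but without compactness. *)
Lemma uclosure_lip_sub (u : R -> R) (L : R) f : 0 <= L ->
  (forall s t, `|u s - u t| <= L * `|s - t|) -> A f -> uclosure A (fun x => u (f x)).
Proof.
move=> L0 uL Af e e0; have [Ac AD AM /(_ _ Af)[M' fM']] := hA.
pose M := `|M'| + 1.
have M0 : 0 < M by rewrite /M ltr_wpDl.
have fM x : `|f x| <= M by rewrite (le_trans (fM' x))// (le_trans (ler_norm _))// lerDl.
pose v t := u (M * (2 * t - 1)).
pose K := L * M * 2.
have K0 : 0 <= K by rewrite /K !mulr_ge0// ltW.
have vK s t : `|v s - v t| <= K * `|s - t|.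
  rewrite /v (le_trans (uL _ _))// /K -!mulrA ler_wpM2l//.
  have -> : M * (2 * s - 1) - M * (2 * t - 1) = M * 2 * (s - t) by ring.
  by rewrite normrM gtr0_norm ?mulr_gt0// mulrA.
pose eta := e / (2 * (K + 1)).
have eta0 : 0 < eta by rewrite divr_gt0// mulr_gt0// ltr_wpDl.
have [n hn] : exists n : nat, (n.+1%:R * eta)^-1 <= eta.
  have h2 : 0 < eta ^+ 2 by rewrite exprn_gt0.
  have [n _ hn] := near_infty_natSinv_lt (PosNum h2); exists n.
  rewrite invfM ler_pdivrMr// -expr2.
  by have := hn n (leqnn n) => /= /ltW.
exists (fun x => bern n.+1 (fun k => v (k%:R / n.+1%:R)) ((2 * M)^-1 * f x + 2^-1)).
  apply: (falgebra_bern _ _ (f := fun x => (2 * M)^-1 * f x + 2^-1)).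
  by apply: AD => //; exact: falgebraZ.
move=> x; set t := _ * f x + _.
have -> : u (f x) = v t by rewrite /v /t; congr u; field; rewrite gt_eqF.
rewrite distrC (le_trans (@bern_lip _ v K eta n t _ _ _ _))//.
  have := fM x; rewrite ler_norml => /andP[h1 h2].
  have -> : t = (f x + M) / (2 * M) by rewrite /t; field; rewrite gt_eqF.
  apply/andP; split; first by rewrite divr_ge0//; lra.
  by rewrite ler_pdivrMr; lra.
rewrite (@le_trans _ _ (K * (eta + eta)))//; first by rewrite ler_wpM2l// lerD2l.
have -> : K * (eta + eta) = e * (K / (K + 1)) by rewrite /eta; field; lra.
by rewrite ler_piMr ?ltW// ltr_pdivrMr; lra.
Qed.

Lemma uclosure_lip (u : R -> R) (L : R) f : 0 <= L ->
  (forall s t, `|u s - u t| <= L * `|s - t|) -> uclosure A f -> uclosure A (fun x => u (f x)).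
Proof.
move=> L0 uL uf e e0; have L1 : 0 < 2 * (L + 1) by lra.
have [g Ag fg] := uf (e / (2 * (L + 1))) (divr_gt0 e0 L1).
have [h Ah gh] := uclosure_lip_sub L0 uL Ag (divr_gt0 e0 (ltr0n _ 2) : 0 < e / 2%:R).
exists h => // x; rewrite -[u (f x)](subrK (u (g x))) -addrA.
rewrite (le_trans (ler_normD _ _))// (splitr e) lerD//.
rewrite (le_trans (uL _ _))// (@le_trans _ _ (L * (e / (2 * (L + 1)))))// ?ler_wpM2l//.
have -> : L * (e / (2 * (L + 1))) = e / 2 * (L / (L + 1)) by field; lra.
by rewrite ler_piMr ?ltW ?divr_gt0// ltr_pdivrMr; lra.
Qed.

Lemma uclosure_abs f : uclosure A f -> uclosure A (fun x => `|f x|).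
Proof.
by apply: (@uclosure_lip (fun s => `|s|) 1) => // s t; rewrite mul1r ler_dist_dist.
Qed.

Lemma uclosure_min f g : uclosure A f -> uclosure A g ->
  uclosure A (fun x => Num.min (f x) (g x)).
Proof.
move=> uf ug.
rewrite (_ : (fun x => _) = (fun x => 2^-1 * ((f x + g x) - `|f x - g x|))).
  apply: uclosureZ; apply: uclosureB; first exact: uclosureD.
  by apply: uclosure_abs; exact: uclosureB.
apply/funext => x; have [h|h] := leP (f x) (g x).
  by rewrite ler0_norm ?subr_le0//; field.
by rewrite gtr0_norm ?subr_gt0//; field.
Qed.

End function_algebra.

(** * Density of trigonometric polynomials *)

Section trigonometric_functions.
Context {R : realType} {T : Type}.
Implicit Types (f g phi : T -> R) (Phi : set (T -> R)).

Definition linear_class Phi := [/\ Phi (fun=> 0),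
  forall (a : R) phi, Phi phi -> Phi (fun x => a * phi x) &
  forall phi psi, Phi phi -> Phi psi -> Phi (fun x => phi x + psi x)].

(** The phase [c] makes sines available as well, so that the product formula turns this linear span
    into a real algebra. *)
Inductive trig Phi : (T -> R) -> Prop :=
| trig_cos phi (c : R) : Phi phi -> trig Phi (fun x => cos (phi x + c))
| trig_add f g : trig Phi f -> trig Phi g -> trig Phi (fun x => f x + g x)
| trig_scale (a : R) f : trig Phi f -> trig Phi (fun x => a * f x).

Variable Phi : set (T -> R).
Hypothesis lPhi : linear_class Phi.

Lemma trig_ext f g : f =1 g -> trig Phi f -> trig Phi g.
Proof. by move=> /funext ->. Qed.

Lemma trig_cst (c : R) : trig Phi (fun=> c).
Proof.
have [P0 _ _] := lPhi; apply: trig_ext (trig_scale c (trig_cos 0 P0)) => x.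
by rewrite /= addr0 cos0 mulr1.
Qed.

Lemma trig_mul f g : trig Phi f -> trig Phi g -> trig Phi (fun x => f x * g x).
Proof.
have [_ PZ PD] := lPhi.
move=> tf tg; elim: tf => {f} [phi c Pphi|f1 f2 _ ih1 _ ih2|a f _ ih].
- elim: tg => {g} [psi e Ppsi|g1 g2 _ ih1 _ ih2|a g _ ih].
  + have Pm : Phi (fun x => phi x + (-1) * psi x) by apply: PD => //; exact: PZ.
    have Pp := PD _ _ Pphi Ppsi.
    apply: trig_ext (trig_scale 2^-1 (trig_add (trig_cos (c - e) Pm) (trig_cos (c + e) Pp))) => x.
    have -> : phi x + -1 * psi x + (c - e) = (phi x + c) - (psi x + e) by ring.
    have -> : phi x + psi x + (c + e) = (phi x + c) + (psi x + e) by ring.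
    by rewrite (cosB (phi x + c)) (cosD (phi x + c)); field.
  + by apply: trig_ext (trig_add ih1 ih2) => x /=; rewrite mulrDr.
  + by apply: trig_ext (trig_scale a ih) => x /=; rewrite mulrCA.
- by apply: trig_ext (trig_add ih1 ih2) => x /=; rewrite mulrDl.
- by apply: trig_ext (trig_scale a ih) => x /=; rewrite mulrA.
Qed.

Lemma trig_bounded f : trig Phi f -> exists M, forall x, `|f x| <= M.
Proof.
elim=> {f} [phi c _|f1 f2 _ [M1 h1] _ [M2 h2]|a f _ [M h]].
- by exists 1 => x; exact: cos_max.
- by exists (M1 + M2) => x; rewrite (le_trans (ler_normD _ _))// lerD.
- by exists (`|a| * M) => x; rewrite normrM ler_wpM2l.
Qed.

Lemma trig_algebra : falgebra (trig Phi).
Proof.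
by split; [exact: trig_cst|exact: trig_add|exact: trig_mul|exact: trig_bounded].
Qed.

End trigonometric_functions.

Lemma clamp_lip {R : realType} (a b s t : R) : a <= b ->
  `|Num.max a (Num.min b s) - Num.max a (Num.min b t)| <= 1 * `|s - t|.
Proof.
move=> ab; rewrite mul1r.
have h u v : u <= v -> `|Num.max a (Num.min b u) - Num.max a (Num.min b v)| <= v - u.
  move=> uv.
  rewrite !maxEle !minEle; do ![case: ifPn]; rewrite -?ltNge ler_norml => *;
  by apply/andP; split; lra.
have [st|st] := leP s t; first by rewrite distrC [leRHS]ler0_norm ?subr_le0// opprB distrC h.
by rewrite [leRHS]gtr0_norm ?subr_gt0// distrC h// ltW.
Qed.

Lemma clampP {R : realType} (a b s : R) : a <= b -> a <= Num.max a (Num.min b s) <= b.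
Proof. by move=> ab; rewrite le_max lexx/= ge_max ab ge_min lexx. Qed.

Lemma clamp_id {R : realType} (a b s : R) : a <= s <= b -> Num.max a (Num.min b s) = s.
Proof. by move=> /andP[h1 h2]; rewrite (min_idPr h2) (max_idPr h1). Qed.

(** The sum counts the integers from 1 to n below t: it is the minimum of n and the integer part of
    t. *)
Lemma count_floor {R : realType} n (t : R) : 0 <= t ->
  (n%:R <= t -> \sum_(k < n) (k.+1%:R <= t)%R%:R = n%:R :> R) /\
  (t <= n%:R -> `|t - \sum_(k < n) (k.+1%:R <= t)%R%:R| <= 1).
Proof.
move=> t0; elim: n => [|n [ih1 ih2]].
  rewrite big_ord0; split => // t0'.
  by rewrite subr0 ger0_norm// (le_trans t0').
rewrite big_ord_recr/=; have [h|h] := leP n.+1%:R t.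
  rewrite ih1; last by rewrite (le_trans _ h)// ler_nat.
  by rewrite natr1; split => // h'; rewrite (_ : t = n.+1%:R) ?subrr ?normr0//; apply/eqP; rewrite eq_le h h'.
split=> [//|_].
rewrite addr0; have [tn|nt] := leP t n%:R; first exact: ih2.
rewrite ih1 ?(ltW nt)// ger0_norm ?subr_ge0 ?(ltW nt)//.
by rewrite -natr1 in h; rewrite lerBlDl ltW.
Qed.

Section density.
Context {R : realType} d {T : measurableType d}.
Variable Phi : set (T -> R).
Hypothesis lPhi : linear_class Phi.
Hypothesis mPhi : forall phi, Phi phi -> measurable_fun [set: T] phi.
Hypothesis genPhi : forall E : set T, measurable E ->
  <<s [set B | exists phi (c : R), Phi phi /\ B = [set x | c < phi x]] >> E.

Let A := uclosure (trig Phi).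
Let tA := trig_algebra lPhi.

Lemma trig_measurable f : trig Phi f -> measurable_fun [set: T] f.
Proof.
elim=> {f} [phi c Pphi|f1 f2 _ h1 _ h2|a f _ h].
- apply: measurableT_comp; first exact: continuous_measurable_fun (@continuous_cos R).
  by apply: measurable_funD; [exact: mPhi|exact: measurable_cst].
- exact: measurable_funD.
- by apply: measurable_funM => //; exact: measurable_cst.
Qed.

Lemma trig_bfun f : trig Phi f -> bfun f.
Proof. by move=> tf; split; [exact: trig_measurable|exact: trig_bounded tf]. Qed.

Lemma utrig_bfun f : A f -> bfun f.
Proof.
move=> Af; split; last exact: (uclosure_bounded tA).
have /choice[g gP] (n : nat) : exists g, trig Phi g /\ forall x, `|f x - g x| <= n.+1%:R^-1.
  have [g tg fg] := Af n.+1%:R^-1 ltac:(by rewrite invr_gt0 ltr0n).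
  by exists g.
apply: (@measurable_fun_cvg _ _ _ _ g) => [m|x _]; first exact: trig_measurable (gP m).1.
apply/cvgrPdist_le => e e0; near=> n.
rewrite (le_trans ((gP n).2 x))// ltW//; near: n.
exact: (near_infty_natSinv_lt (PosNum e0)).
Unshelve. all: by end_near. Qed.

(* Approximating with respect to several measures at once yields density as
   well as linear relations between measures, in particular uniqueness. *)
Variables (I : finType) (P : I -> probability T R).

Let DF f := bfun f /\ forall e : R, 0 < e -> exists2 g, A g &
  forall i, (\int[P i]_x `|f x - g x| <= e)%R.

Let DF_A f : A f -> DF f.
Proof.
move=> Af; split; first exact: utrig_bfun.
move=> e e0; exists f => // i.
have E : (fun x => `|f x - f x|) = (fun=> 0) by apply/funext => x; rewrite subrr normr0.
by rewrite E !bint_cst ltW.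
Qed.

Let tri (Q : probability T R) f g h (a b : R) : bfun f -> bfun g -> bfun h ->
  (\int[Q]_x `|f x - g x| <= a)%R -> (\int[Q]_x `|g x - h x| <= b)%R ->
  (\int[Q]_x `|f x - h x| <= a + b)%R.
Proof.
move=> bf bg bh ab bc.
have b1 := bfun_abs (bfunB bf bg); have b2 := bfun_abs (bfunB bg bh).
rewrite (le_trans _ (lerD ab bc))// -bintD//; apply: bint_le.
- exact/bfun_abs/bfunB.
- exact: bfunD.
- by move=> x; exact: ler_distD.
Qed.

Let DF_D f g : DF f -> DF g -> DF (fun x => f x + g x).
Proof.
move=> [bf af] [bg ag]; split; first exact: bfunD.
move=> e e0; have e20 : 0 < e / 2 by rewrite divr_gt0.
have [f' Af f1] := af _ e20; have [g' Ag g1] := ag _ e20.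
exists (fun x => f' x + g' x); first exact: (uclosureD tA).
have bf' := utrig_bfun Af; have bg' := utrig_bfun Ag.
have b1 := bfun_abs (bfunB bf bf'); have b2 := bfun_abs (bfunB bg bg').
have b3 := bfun_abs (bfunB (bfunD bf bg) (bfunD bf' bg')).
have le x : `|f x + g x - (f' x + g' x)| <= `|f x - f' x| + `|g x - g' x|.
  by rewrite opprD addrACA ler_normD.
move=> i; rewrite (splitr e) (le_trans _ (lerD (f1 i) (g1 i)))// -bintD//.
by apply: bint_le => //; exact: bfunD.
Qed.

Let DF_Z (a : R) f : DF f -> DF (fun x => a * f x).
Proof.
move=> [bf af]; split; first exact: bfunZ.
move=> e e0; have a0 : 0 < `|a| + 1 by rewrite ltr_wpDl.
have [g Ag g1] := af _ (divr_gt0 e0 a0).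
exists (fun x => a * g x); first exact: (uclosureZ tA).
have bg := utrig_bfun Ag; have b1 := bfun_abs (bfunB bf bg).
have E : (fun x => `|a * f x - a * g x|) = (fun x => `|a| * `|f x - g x|).
  by apply/funext => x; rewrite -mulrBr normrM.
have h (u : R) : 0 <= u -> u <= e / (`|a| + 1) -> `|a| * u <= e.
  move=> u0; rewrite ler_pdivlMr// => h; rewrite (le_trans _ h)// mulrC ler_wpM2l// lerDl//.
by move=> i; rewrite E bintZ//; apply: h => //; apply: Rintegral_ge0.
Qed.

Let DF_lim (h : nat -> T -> R) f (M : R) : (forall n, DF (h n)) ->
  (forall n x, `|h n x| <= M) -> (forall x, h n x @[n --> \oo] --> f x) -> DF f.
Proof.
move=> Dh hM hf.
have bh n : bfun (h n) by exact: (Dh n).1.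
have mf : measurable_fun [set: T] f.
  by apply: (@measurable_fun_cvg _ _ _ _ h) => [m|x _]; [exact: (bh m).1|exact: hf].
have fM x : `|f x| <= M.
  apply: (@cvgr_to_le _ \oo _ _ (fun n => `|h n x|)); last exact: nearW.
  by apply: cvg_norm; exact: hf.
have bf : bfun f by split => //; exists M.
split => // e e0; have e20 : 0 < e / 2 by rewrite divr_gt0.
have cv i : \forall n \near \oo, (\int[P i]_x `|f x - h n x| <= e / 2)%R.
  have [||| _] := @bint_cvg _ _ _ (P i) (fun n x => `|f x - h n x|) (fun=> 0) (M + M).
  - by move=> n; exact/bfun_abs/bfunB.
  - by move=> n x; rewrite normr_id (le_trans (ler_normB _ _))// lerD.
  - move=> x; rewrite -(normr0 R) -(subrr (f x)); apply: cvg_norm.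
    by apply: cvgB; [exact: cvg_cst|exact: hf].
  rewrite bint_cst => /cvgrPdist_le/(_ _ e20); apply: filterS => n.
  by rewrite sub0r normrN; apply: le_trans; exact: ler_norm.
have [n n1] := filter_ex (filter_forall _ cv).
have [g Ag g1] := (Dh n).2 _ e20.
have bg := utrig_bfun Ag.
by exists g => // i; rewrite (splitr e); apply: tri (bh n) _ _ _.
Qed.

(** A pi-system, because the uniform closure is stable under minima; the indicator of such a set is
    the limit of the clamped multiples of [f]. *)
Let G := [set B : set T | exists2 f, A f & B = [set x | 0 < f x]].

Let DF_G B : G B -> DF (\1_B).
Proof.
move=> [f Af ->].
apply: (@DF_lim (fun n x => Num.max 0 (Num.min 1 (n%:R * f x))) _ 1).
- move=> n; apply: DF_A; apply: (@uclosure_lip _ _ _ tA (fun s => Num.max 0 (Num.min 1 s)) 1) => //.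
    by move=> s t; exact: clamp_lip.
  exact: (uclosureZ tA).
- move=> n x; have /andP[h1 h2] := clampP (n%:R * f x) (@ler01 R).
  by rewrite ger0_norm.
- move=> x; rewrite indicE; apply: cvg_near_cst.
  have [h|h] := ltP 0 (f x).
    have [N _ hN] := near_infty_natSinv_lt (PosNum h).
    exists N.+1 => // -[//|n] Nn; rewrite mem_set//= (min_idPl _) ?(max_idPr _)//.
    rewrite -ler_pdivrMl ?ltr0n// mulr1 ltW//; exact: (hN n).
  apply: nearW => n; rewrite memNset/=; last by rewrite ltNge h.
  have h0 : n%:R * f x <= 0 by rewrite mulr_ge0_le0.
  by rewrite (min_idPr _) ?(max_idPl _)// (le_trans h0).
Qed.

Let G_setI : setI_closed G.
Proof.
move=> B C [f Af ->] [g Ag ->]; exists (fun x => Num.min (f x) (g x)).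
  exact: (uclosure_min tA).
by apply/seteqP; split => x /=; rewrite lt_min => /andP.
Qed.

Let G_gen : @measurable _ T = <<s G >>.
Proof.
apply/seteqP; split; last first.
  apply: smallest_sub; first exact: sigma_algebra_measurable.
  move=> _ [f Af ->]; rewrite -[X in measurable X]setTI.
  have [mf _] := utrig_bfun Af.
  rewrite (_ : [set x | _] = f @^-1` `]0, +oo[%classic); first exact: mf.
  by apply/seteqP; split => x /=; rewrite in_itv/= andbT.
move=> E /genPhi; apply: smallest_sub; first exact: smallest_sigma_algebra.
move=> _ [phi [c [Pphi ->]]].
(* Once |phi x - c| / (n + 1) is below pi, the sign of this sine is that of phi x - c. Hence c < phi
   x exactly when x lies in [B n] for all large n. *)
pose B n := [set x | 0 < sin (n.+1%:R^-1 * (phi x - c))].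
have GB n : <<s G >> (B n).
  apply: sub_gen_smallest; exists (fun x => sin (n.+1%:R^-1 * (phi x - c))) => //.
  apply: uclosure_sub; have [_ PZ _] := lPhi.
  apply: trig_ext (trig_cos (- (n.+1%:R^-1 * c) - pi / 2) (PZ n.+1%:R^-1 _ Pphi)) => x.
  by rewrite addrA cosBpihalf mulrBr.
rewrite (_ : [set x | _] = \bigcup_N ~` \bigcup_n ~` B (N + n)%N).
  have sG := @smallest_sigma_algebra _ setT G.
  apply: sigma_algebra_bigcup => N; apply: sigma_algebraC.
  by apply: sigma_algebra_bigcup => n; exact: sigma_algebraC.
apply/seteqP; split => x /=.
  rewrite -subr_gt0 => h.
  have h' : 0 < (phi x - c)^-1 * pi by rewrite mulr_gt0 ?invr_gt0 ?pi_gt0.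
  have [N _ hN] := near_infty_natSinv_lt (PosNum h').
  exists N => // -[n _]; apply; rewrite /B/=; apply: sin_gt0_pi.
  rewrite mulr_gt0 ?invr_gt0 ?ltr0n//= -ltr_pdivlMr// mulrC.
  by apply: (hN (N + n)%N) => /=; exact: leq_addr.
move=> [N _ h]; rewrite ltNge; apply/negP => le0.
have {}h n : B (N + n)%N x by apply: contrapT => h'; apply: h; exists n.
have [eq0|ne0] := eqVneq (phi x - c) 0.
  by have := h 0%N; rewrite /B/= eq0 mulr0 sin0 ltxx.
have h0 : 0 < c - phi x by rewrite lt_neqAle eq_sym -opprB oppr_eq0 ne0 oppr_ge0 subr_le0.
have h' : 0 < (c - phi x)^-1 * pi by rewrite mulr_gt0 ?invr_gt0 ?pi_gt0.
have [M _ hM] := near_infty_natSinv_lt (PosNum h').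
have := h M; rewrite /B/= -opprB mulrN sinN oppr_gt0 ltNge ltW// sin_gt0_pi//.
rewrite mulr_gt0 ?invr_gt0 ?ltr0n//= -ltr_pdivlMr// mulrC.
by apply: (hM (N + M)%N) => /=; exact: leq_addl.
Qed.

Let DF_indic E : measurable E -> DF (\1_E).
Proof.
move=> mE; apply: (@dynkin_induction _ T G (fun E => DF (\1_E)) G_gen G_setI); last by rewrite -G_gen.
- by apply: DF_A; rewrite indicT; exact/uclosure_sub/trig_cst.
- move=> B GB; exact: DF_G.
- move=> S mS DS; rewrite (_ : \1_(~` S) = (fun x => 1 + (-1) * \1_S x)).
    apply: DF_D; first exact/DF_A/uclosure_sub/trig_cst.
    exact: DF_Z.
  by apply/funext => x; rewrite !indicE in_setC; case: (x \in S) => /=; ring.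
move=> F mF tF DF_F.
apply: (@DF_lim (fun n x => \sum_(k < n) \1_(F k) x) _ 1).
- elim=> [|n ih]; first by apply: DF_A; under eq_fun do rewrite big_ord0; exact/uclosure_sub/trig_cst.
  by under eq_fun do rewrite big_ord_recr/=; exact: DF_D.
- move=> n x; rewrite ger0_norm; last by apply: sumr_ge0 => i _; rewrite indicE.
  have [[k Fk]|nF] := pselect (exists k, F k x); last first.
    by rewrite big1// => k _; rewrite indicE memNset// => Fk; apply: nF; exists k.
  have Z j : j != k -> \1_(F j) x = 0 :> R.
    move=> jk; rewrite indicE memNset// => Fj.
    by have /trivIsetP/(_ j k Logic.I Logic.I jk) := tF; rewrite -subset0 => /(_ x); apply.
  elim: n => [|n ih]; first by rewrite big_ord0.
  rewrite big_ord_recr/=; have [nk|nk] := eqVneq n k; last by rewrite Z// addr0.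
  rewrite big1 ?add0r; first by rewrite indicE lern1 leq_b1.
  by move=> i _; rewrite Z// -nk ltn_eqF.
- move=> x; apply: cvg_near_cst.
  have [[k Fk]|nF] := pselect (exists k, F k x); last first.
    apply: nearW => n; rewrite indicE memNset; last by move=> [k _ Fk]; apply: nF; exists k.
    by rewrite big1// => k _; rewrite indicE memNset// => Fk; apply: nF; exists k.
  exists k.+1 => // n kn; rewrite (bigD1 (Ordinal kn))//= big1 ?addr0.
    by rewrite !indicE mem_set// mem_set//; exists k.
  move=> j jk; rewrite indicE memNset// => Fj.
  have /trivIsetP/(_ j k Logic.I Logic.I jk) := tF.
  by rewrite -subset0 => /(_ x); apply.
Qed.

Let DF_unit (f : T -> R) : measurable_fun [set: T] f -> (forall x, 0 <= f x <= 1) -> DF f.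
Proof.
move=> mf f01.
apply: (@DF_lim (fun n x => n.+1%:R^-1 * \sum_(k < n.+1) (k.+1%:R <= n.+1%:R * f x)%R%:R) _ 1).
- move=> n; apply: DF_Z.
  have mk k : DF (fun x => (k.+1%:R <= n.+1%:R * f x)%R%:R).
    pose E := [set x | k.+1%:R <= n.+1%:R * f x].
    have -> : (fun x => (k.+1%:R <= n.+1%:R * f x)%R%:R) = \1_E :> (T -> R).
      apply/funext => x; rewrite indicE; congr (_%:R).
      have [h|h] := boolP (k.+1%:R <= n.+1%:R * f x); first by rewrite mem_set.
      by rewrite memNset//=; exact/negP.
    apply: DF_indic; rewrite -[X in measurable X]setTI.
    rewrite (_ : E = (fun x => n.+1%:R * f x) @^-1` `[k.+1%:R, +oo[%classic).
      by apply: measurable_funM => //; exact: measurable_cst.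
    by apply/seteqP; split => x /=; rewrite in_itv/= andbT.
  elim: n.+1 (n.+1%:R) mk => [m _|N ih m mk].
    by apply: DF_A; under eq_fun do rewrite big_ord0; exact/uclosure_sub/trig_cst.
  by under eq_fun do rewrite big_ord_recr/=; apply: DF_D => //; exact: ih.
- move=> n x; rewrite ger0_norm; last first.
    by rewrite mulr_ge0 ?invr_ge0//; apply: sumr_ge0.
  rewrite ler_pdivrMl ?ltr0n// mulr1 -[X in _ <= X%:R](card_ord n.+1) -sumr_const.
  by apply: ler_sum => k _; rewrite lern1 leq_b1.
- move=> x; apply/cvgrPdist_le => e e0; near=> n.
  have /andP[f0 f1] := f01 x.
  have n0 : 0 < n.+1%:R :> R by rewrite ltr0n.
  have [_] := count_floor n.+1 (mulr_ge0 (ltW n0) f0).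
  move=> /(_ (ler_piMr (ltW n0) f1)) h.
  have {1}-> : f x = n.+1%:R^-1 * (n.+1%:R * f x) by rewrite mulrA mulVf ?mul1r// gt_eqF.
  rewrite -mulrBr normrM gtr0_norm ?invr_gt0//.
  rewrite (le_trans (ler_wpM2l _ h)) ?mulr1 ?invr_ge0// ltW//; near: n.
  exact: (near_infty_natSinv_lt (PosNum e0)).
Unshelve. all: by end_near. Qed.

Lemma trig_dense_family f (e : R) : bfun f -> 0 < e -> exists2 g, trig Phi g &
  forall i, (\int[P i]_x `|f x - g x| <= e)%R.
Proof.
move=> bf e0; have [mf [M' fM']] := bf.
pose M := `|M'| + 1; have M0 : 0 < M by rewrite ltr_wpDl.
have fM x : `|f x| <= M by rewrite (le_trans (fM' x))// (le_trans (ler_norm _))// lerDl.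
have [bf' /(_ (e / 2))] : DF f.
  rewrite (_ : f = (fun x => - M + (2 * M) * ((2 * M)^-1 * (f x + M)))); last first.
    by apply/funext => x; field; rewrite gt_eqF.
  apply: DF_D; first exact/DF_A/uclosure_sub/trig_cst.
  apply: DF_Z; apply: DF_unit.
    by apply: measurable_funM => //; apply: measurable_funD.
  move=> x; have := fM x; rewrite ler_norml => /andP[h1 h2].
  by rewrite mulr_ge0 ?invr_ge0/= ?ler_pdivrMl; lra.
rewrite divr_gt0// => /(_ erefl)[g Ag g1].
have [h th gh] := Ag _ (divr_gt0 e0 (ltr0n _ 2) : 0 < e / 2%:R).
have bg := utrig_bfun Ag; have bh := trig_bfun th.
have gh' (Q : probability T R) : (\int[Q]_x `|g x - h x| <= e / 2)%R.
  rewrite -[leRHS](bint_cst Q); apply: bint_le => //; last exact: bfun_cst.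
  exact/bfun_abs/bfunB.
by exists h => // i; rewrite (splitr e); apply: tri bg _ _ _.
Qed.

(** A single trigonometric polynomial approximates [f] for all the measures at once, so a linear
    relation between measures passes from cosines to all bounded measurable functions. Coefficients
    1, -1 give uniqueness of laws; 1, -1/2, -1/2 give the self-similarity of the uniform law. *)
Lemma trig_relation (a : I -> R) :
  (forall phi (c : R), Phi phi -> \sum_i a i * (\int[P i]_x cos (phi x + c))%R = 0) ->
  forall f, bfun f -> \sum_i a i * (\int[P i]_x f x)%R = 0.
Proof.
move=> cosE f bf.
have tE g : trig Phi g -> \sum_i a i * (\int[P i]_x g x)%R = 0.
  elim=> {g} [phi c|g h tg hg th hh|b g tg hg]; first exact: cosE.
    transitivity (\sum_i a i * (\int[P i]_x g x)%R + \sum_i a i * (\int[P i]_x h x)%R).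
      2: by rewrite hg hh addr0.
    rewrite -big_split/=; by apply: eq_bigr => i _; rewrite bintD ?mulrDr//; exact: trig_bfun.
  transitivity (b * \sum_i a i * (\int[P i]_x g x)%R); last by rewrite hg mulr0.
  rewrite mulr_sumr; apply: eq_bigr => i _.
  by rewrite bintZ; [exact: mulrCA|exact: trig_bfun].
apply/eqP; rewrite -normr_le0; apply/ler_addgt0Pr => e e0; rewrite add0r.
pose K := \sum_i `|a i| + 1.
have K0 : 0 < K by rewrite ltr_wpDl// sumr_ge0.
have [g tg g1] := trig_dense_family bf (divr_gt0 e0 K0).
have bg := trig_bfun tg.
rewrite -[X in `|X|]subr0 -[X in _ - X](tE g tg) -sumrB (le_trans (ler_norm_sum _ _ _))//.
apply: (@le_trans _ _ (\sum_i `|a i| * (e / K))).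
  apply: ler_sum => i _; rewrite -mulrBr normrM ler_wpM2l// -bintB//.
  by rewrite (le_trans (bint_abs _ _))//; exact: bfunB.
rewrite -mulr_suml mulrA ler_pdivrMr// mulrC ler_wpM2l ?(ltW e0)//.
by rewrite /K lerDl.
Qed.

End density.

Lemma trig_unique {R : realType} d {T : measurableType d} (Phi : set (T -> R)) :
  linear_class Phi -> (forall phi, Phi phi -> measurable_fun [set: T] phi) ->
  (forall E : set T, measurable E ->
    <<s [set B | exists phi (c : R), Phi phi /\ B = [set x | c < phi x]] >> E) ->
  forall P Q : probability T R, (forall phi (c : R), Phi phi ->
    (\int[P]_x cos (phi x + c) = \int[Q]_x cos (phi x + c))%R) ->
  forall E, measurable E -> P E = Q E.
Proof.
move=> lP mP gP P Q cosE E mE; have bE := @bfun_indic R _ _ _ mE.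
suff : fine (P E) = fine (Q E).
  move=> h; rewrite -[LHS]fineK ?fin_num_measure// -[RHS]fineK ?fin_num_measure//.
  by rewrite h.
have := @trig_relation _ _ _ Phi lP mP gP bool (fun b => if b then P else Q)
  (fun b => if b then 1 else -1) _ _ bE.
rewrite big_bool/= !bint_indic// => h; apply/eqP; rewrite -subr_eq0 -h ?mul1r ?mulN1r//.
by move=> phi c Pphi; rewrite big_bool/= cosE// mul1r mulN1r subrr.
Qed.

(** Clamping the approximation restores the bounds of [f] without increasing the error, at the price
    of leaving [trig] for its uniform closure. *)
Lemma trig_dense {R : realType} d {T : measurableType d} (Phi : set (T -> R)) :
  linear_class Phi -> (forall phi, Phi phi -> measurable_fun [set: T] phi) ->
  (forall E : set T, measurable E ->
    <<s [set B | exists phi (c : R), Phi phi /\ B = [set x | c < phi x]] >> E) ->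
  forall (P : probability T R) f (a b e : R), measurable_fun [set: T] f ->
  a <= b -> (forall x, a <= f x <= b) -> 0 < e ->
  exists2 g, uclosure (trig Phi) g /\ (forall x, a <= g x <= b) &
    (\int[P]_x `|f x - g x| <= e)%R.
Proof.
move=> lP mP gP P f a b e mf ab fab e0.
have bf : bfun f.
  split => //; exists (`|a| + `|b|) => x.
  have /andP[h1 h2] := fab x; rewrite ler_norml; apply/andP; split.
    by have := lerNnormlW (lexx `|a|); have := normr_ge0 b; lra.
  by have := ler_norm b; have := normr_ge0 a; lra.
have [g tg /(_ tt) fg] := trig_dense_family lP mP gP (fun _ : unit => P) bf e0.
exists (fun x => Num.max a (Num.min b (g x))).
  split; last by move=> x; exact: clampP.
  apply: (@uclosure_lip _ _ _ (trig_algebra lP) (fun s => Num.max a (Num.min b s)) 1) => //.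
    by move=> s t; exact: clamp_lip.
  by apply: uclosure_sub.
rewrite (le_trans _ fg)//; have bg := trig_bfun mP tg.
apply: bint_le.
- apply/bfun_abs/bfunB => //.
  by apply: (@bfun_lip _ _ _ (fun s => Num.max a (Num.min b s)) 1) => // s t; exact: clamp_lip.
- exact/bfun_abs/bfunB.
- by move=> x; rewrite -{1}(clamp_id (fab x)) -[leRHS]mul1r; exact: clamp_lip.
Qed.

(** * The normal law *)

Section normal_law.
Context {R : realType}.
Notation mu := (@lebesgue_measure R).
Implicit Types (m s x t c : R).

Lemma measurable_cosR : measurable_fun [set: measurableTypeR R] (@cos R).
Proof. exact: continuous_measurable_fun (@continuous_cos R). Qed.

Lemma measurable_sinR : measurable_fun [set: measurableTypeR R] (@sin R).
Proof. exact: continuous_measurable_fun (@continuous_sin R). Qed.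

Lemma normal_pdf_val m s x : s != 0 ->
  normal_pdf m s x = normal_peak s * expR (- (x - m) ^+ 2 / (s ^+ 2 * 2)).
Proof. by move=> s0; rewrite normal_pdfE// /normal_fun mulr_natr. Qed.

(** Completing the square: an exponential tilt moves the mean of the density. *)
Lemma normal_pdf_tilt m s (l : R) x : s != 0 ->
  expR (l * (x - m)) * normal_pdf m s x =
  expR (l ^+ 2 * s ^+ 2 / 2) * normal_pdf (m + l * s ^+ 2) s x.
Proof.
move=> s0; rewrite !normal_pdf_val// mulrCA -expRD [RHS]mulrCA -expRD.
by congr (_ * expR _); field.
Qed.

Lemma is_derive_normal_pdf m s x : s != 0 ->
  is_derive x 1 (normal_pdf m s) (- (x - m) / s ^+ 2 * normal_pdf m s x).
Proof.
move=> s0.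
have -> : normal_pdf m s = (fun x => normal_peak s * expR (- (x - m) ^+ 2 / (s ^+ 2 * 2))).
  by apply/funext => y; rewrite normal_pdf_val.
apply: is_derive_eq; rewrite /GRing.scale/=; by field.
Qed.

(** The explicit density and the Radon-Nikodym derivative have the same integrals over measurable
    sets, hence agree almost everywhere. *)
Lemma ge0_integral_normal m s (f : R -> \bar R) :
  measurable_fun [set: R] f -> (forall x, (0 <= f x)%E) ->
  (\int[normal_prob m s]_x f x = \int[mu]_x (f x * (normal_pdf m s x)%:E))%E.
Proof.
move=> mf f0.
have dom := @normal_prob_dominates R m s.
rewrite -(Radon_Nikodym_SigmaFinite.change_of_variables dom)//.
apply: ae_eq_integral => //.
- apply: emeasurable_funM => //.
  by apply: (measurable_int mu); exact: Radon_Nikodym_SigmaFinite.f_integrable.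
- apply: emeasurable_funM => //=; apply/measurable_EFinP; exact: measurable_normal_pdf.
- apply: ae_eqe_mul2l => /=.
  apply: integral_ae_eq => //=.
  + exact: Radon_Nikodym_SigmaFinite.f_integrable.
  + by apply/measurable_EFinP; exact: measurable_normal_pdf.
  + by move=> E E01 mE; rewrite -Radon_Nikodym_SigmaFinite.f_integral.
Qed.

Lemma integrable_tilt m s (l : R) : s != 0 ->
  mu.-integrable [set: R] (fun x => (expR (l * (x - m)) * normal_pdf m s x)%:E).
Proof.
move=> s0; rewrite (_ : (fun x => _) = (fun x => (expR (l ^+ 2 * s ^+ 2 / 2))%:E *
    (normal_pdf (m + l * s ^+ 2) s x)%:E)%E).
  by apply: integrableZl => //; exact: integrable_normal_pdf.
by apply/funext => x; rewrite -EFinM normal_pdf_tilt.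
Qed.

Lemma normal_mgf m s (l : R) : s != 0 ->
  (\int[normal_prob m s]_x (expR (l * (x - m)))%:E = (expR (l ^+ 2 * s ^+ 2 / 2))%:E)%E.
Proof.
move=> s0; rewrite ge0_integral_normal; last 2 first.
- apply/measurable_EFinP; apply: measurableT_comp => //.
  by apply: measurable_funM => //; apply: measurable_funB.
- by move=> x; rewrite lee_fin expR_ge0.
transitivity (\int[mu]_x ((expR (l ^+ 2 * s ^+ 2 / 2))%:E *
    (normal_pdf (m + l * s ^+ 2) s x)%:E))%E.
  by apply: eq_integral => x _; rewrite -!EFinM normal_pdf_tilt.
by rewrite integralZl//= ?integral_normal_pdf ?mule1//; exact: integrable_normal_pdf.
Qed.

Lemma integrable_abs_pdf m s : s != 0 ->
  mu.-integrable [set: R] (fun x => (`|x - m| * normal_pdf m s x)%:E).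
Proof.
move=> s0.
apply: (@le_integrable _ _ _ mu _ measurableT _ (fun x =>
  (expR (1 * (x - m)) * normal_pdf m s x)%:E + (expR (- 1 * (x - m)) * normal_pdf m s x)%:E)%E).
- apply/measurable_EFinP; apply: measurable_funM; last exact: measurable_normal_pdf.
  by apply: measurableT_comp => //; apply: measurable_funB.
- move=> x _; rewrite -EFinD /= lee_fin ger0_norm; last first.
    by rewrite mulr_ge0// normal_pdf_ge0.
  rewrite [leRHS]ger0_norm; last by rewrite addr_ge0// mulr_ge0 ?expR_ge0 ?normal_pdf_ge0.
  rewrite -mulrDl ler_wpM2r ?normal_pdf_ge0// mul1r mulN1r.
  have := expR_ge1Dx (x - m); have := expR_ge1Dx (- (x - m)).
  have := expR_ge0 (x - m); have := expR_ge0 (- (x - m)).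
  by case: (ger0P (x - m)) => h; lra.
- by apply: integrableD => //; exact: integrable_tilt.
Qed.

(** The fundamental theorem on symmetric intervals, followed by dominated convergence; decay of [F]
    along the integers therefore suffices. *)
Lemma integral_derivative_eq0 (F f : R -> R) :
  (forall x, is_derive x 1 F (f x)) -> continuous f ->
  mu.-integrable [set: R] (fun x => (f x)%:E) ->
  F n%:R @[n --> \oo] --> 0 -> F (- n%:R) @[n --> \oo] --> 0 ->
  (\int[mu]_x f x = 0)%R.
Proof.
move=> dF cf intf F1 F2.
have cF : continuous F.
  by move=> x; apply/differentiable_continuous/derivable1_diffP; have [] := dF x.
pose I n := `[- n.+1%:R, n.+1%:R]%classic : set R.
have e n : (\int[mu]_(x in I n) (f x)%:E = (F n.+1%:R - F (- n.+1%:R))%:E)%E.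
  rewrite /I (continuous_FTC2 (F := F))//.
  - by rewrite lt_neqAle lerNl (le_trans _ (ler0n _ _)) ?oppr_le0//= andbT eq_sym -subr_eq0 opprK -natrD pnatr_eq0.
  - exact: continuous_subspaceT.
  - split; first by move=> x _; have [] := dF x.
      exact/cvg_at_right_filter/cF.
    exact/cvg_at_left_filter/cF.
  - by move=> x _; rewrite derive1E; have [_ ->] := dF x.
have [|||||_ _] := @dominated_convergence _ _ _ mu setT measurableT
   (fun n x => ((fun x => (f x)%:E) \_ (I n)) x) (fun x => (f x)%:E) (fun x => `|(f x)%:E|%E).
- move=> n; apply/(measurable_restrictT _ _).1 => //; first exact: measurable_itv.
  by apply: measurable_funTS; exact: measurable_int intf.
- exact: measurable_int intf.
- apply: aeW => x _; apply: cvg_near_cst.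
  near=> n; rewrite patchE mem_set// /I /= in_itv/= -ler_norml.
  near: n; exists (Num.truncn `|x|) => // n /= h.
  have /andP[_ h2] := truncn_itv (normr_ge0 x).
  by rewrite ltW// (lt_le_trans h2)// ler_nat.
- exact: integrable_abse.
- apply: aeW => x n _; rewrite patchE; case: ifP => // _.
  by rewrite abse0 abse_ge0.
rewrite (_ : [sequence _]_n = (fun n => (F n.+1%:R - F (- n.+1%:R))%:E)); last first.
  by apply/funext => n; rewrite -(e n) [RHS]integral_mkcond.
move=> h; rewrite /Rintegral; suff -> : (\int[mu]_x (f x)%:E = 0)%E by [].
apply/esym; apply: (@cvg_unique _ (@ereal_hausdorff R)) h.
apply: cvg_EFin; first exact: nearW.
rewrite /= -(subrr 0); apply: cvgB.
  by move: F1; rewrite -(cvg_shiftS (fun n => F n%:R)).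
by move: F2; rewrite -(cvg_shiftS (fun n => F (- n%:R))).
Unshelve. all: by end_near. Qed.

Section char_fun.
Variables (m s c : R).
Hypothesis s0 : s != 0.
Let p := normal_pdf m s.
Let g t x := cos (t * (x - m) + c) * p x.
Let C t := (\int[mu]_x g t x)%R.

Let mlin t : measurable_fun [set: R] (fun x => t * (x - m) + c).
Proof. by apply: measurable_funD => //; apply: measurable_funM => //; apply: measurable_funB. Qed.

Let ig t : mu.-integrable [set: R] (EFin \o g t).
Proof.
apply: (@le_integrable _ _ _ mu _ measurableT _ (fun x => (p x)%:E)).
- apply/measurable_EFinP/measurable_funM; last exact: measurable_normal_pdf.
  exact: (measurableT_comp measurable_cosR (mlin t)).
- move=> x _; rewrite /= lee_fin normrM ler_piMl//; exact: cos_max.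
- exact: integrable_normal_pdf.
Qed.

Let dg t x : is_derive t 1 (g ^~ x) (- (x - m) * sin (t * (x - m) + c) * p x).
Proof.
rewrite /g; apply: is_derive_eq; rewrite /GRing.scale/=; ring.
Qed.

Let dgx t x : is_derive x 1 (fun x => sin (t * (x - m) + c) * p x)
  (t * (cos (t * (x - m) + c) * p x) - s ^- 2 * ((x - m) * sin (t * (x - m) + c) * p x)).
Proof.
have dp := is_derive_normal_pdf m x s0.
apply: is_derive_eq; rewrite /GRing.scale/= -/p; field; exact: s0.
Qed.

Let isn t : mu.-integrable [set: R] (fun x => ((x - m) * sin (t * (x - m) + c) * p x)%:E).
Proof.
apply: (@le_integrable _ _ _ mu _ measurableT _ (fun x => (`|x - m| * p x)%:E)).
- apply/measurable_EFinP/measurable_funM; last exact: measurable_normal_pdf.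
  apply: measurable_funM; first exact: measurable_funB.
  exact: (measurableT_comp measurable_sinR (mlin t)).
- move=> x _; rewrite /= lee_fin !normrM normr_id.
  by rewrite ler_wpM2r// ler_piMr//; exact: sin_max.
- exact: integrable_abs_pdf.
Qed.

(** Integrates the derivative of sin (t (x - m) + c) p x, which [dgx] computes, over the line. *)
Let ibp t : (\int[mu]_x ((x - m) * sin (t * (x - m) + c) * p x) = s ^+ 2 * t * C t)%R.
Proof.
have cp : continuous p by exact: continuous_normal_pdf.
have cl x : {for x, continuous (fun x => t * (x - m) + c)}.
  apply: cvgD; last exact: cvg_cst.
  apply: cvgM; first exact: cvg_cst.
  by apply: cvgB; [exact: cvg_id|exact: cvg_cst].
(* Tilting by l = 1 and l = -1 shows that the density decays exponentially at both ends, which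
   removes the boundary terms. *)
have pe (l : R) x : p x = expR (- (l * (x - m))) * (expR (l ^+ 2 * s ^+ 2 / 2) * normal_pdf (m + l * s ^+ 2) s x).
  by rewrite -normal_pdf_tilt// mulrA -expRD addNr expR0 mul1r.
have pb (l : R) x : p x <= expR (- (l * (x - m))) * (expR (l ^+ 2 * s ^+ 2 / 2) * normal_peak s).
  by rewrite (pe l) ler_wpM2l ?expR_ge0// ler_wpM2l ?expR_ge0// normal_pdf_ub.
have lim0 (a K : R) : 0 <= K -> (fun n => expR (a - n%:R) * K) @ \oo --> 0.
  move=> K0; apply: (@squeeze_cvgr _ _ _ _ (fun=> 0) (fun n => expR a * K * n.+1%:R^-1)).
  - near=> n; rewrite mulr_ge0 ?expR_ge0//= expRD mulrAC ler_wpM2l ?mulr_ge0 ?expR_ge0//.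
    rewrite expRN lef_pV2 ?posrE ?expR_gt0// -natr1 addrC; exact: expR_ge1Dx.
  - exact: cvg_cst.
  - rewrite -[X in _ --> X](mulr0 (expR a * K)); apply: cvgM; first exact: cvg_cst.
    exact: cvg_harmonic.
have bnd (l : R) (u : nat -> R) (a : R) : (forall n, - (l * (u n - m)) = a - n%:R) ->
    sin (t * (u n - m) + c) * p (u n) @[n --> \oo] --> 0.
  move=> ue; apply: norm_cvg0; apply: (@squeeze_cvgr _ _ _ _ (fun=> 0)
    (fun n => expR (a - n%:R) * (expR (l ^+ 2 * s ^+ 2 / 2) * normal_peak s))).
  - near=> n; rewrite normr_ge0/= normrM (@le_trans _ _ (p (u n)))//.
      by rewrite [X in _ * X]ger0_norm ?normal_pdf_ge0// ler_piMl ?normal_pdf_ge0//; exact: sin_max.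
    by rewrite -ue.
  - exact: cvg_cst.
  - by apply: lim0; rewrite mulr_ge0 ?expR_ge0 ?normal_peak_ge0.
have /= := @integral_derivative_eq0 _ _ (dgx t).
have i1 := isn t; have i2 := ig t.
rewrite RintegralB//; last 2 first.
- by have := integrableZl measurableT t i2.
- by have := integrableZl measurableT (s ^- 2) i1.
rewrite !RintegralZl// => h.
have : t * C t - s ^- 2 * (\int[mu]_x ((x - m) * sin (t * (x - m) + c) * p x))%R = 0.
  apply: h.
  - move=> x; apply: cvgB; apply: cvgM; try exact: cvg_cst.
      apply: cvgM; last exact: cp.
      by apply: (cvg_comp _ cos); [exact: cl|exact: continuous_cos].
    apply: cvgM; last exact: cp.
    apply: cvgM; first by apply: cvgB; [exact: cvg_id|exact: cvg_cst].
    by apply: (cvg_comp _ sin); [exact: cl|exact: continuous_sin].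
  - have j1 := integrableZl measurableT t i2.
    have j2 := integrableZl measurableT (s ^- 2) i1.
    by have := integrableB measurableT j1 j2.
  - by apply: (bnd 1 (fun n => n%:R) m) => n; ring.
  - by apply: (bnd (-1) (fun n => - n%:R) (- m)) => n; ring.
move=> /eqP; rewrite subr_eq0 => /eqP e; apply: (@mulfI _ (s ^- 2)).
  by rewrite invr_eq0 expf_neq0.
by rewrite -e; field.
Unshelve. all: by end_near. Qed.

Let dC t : is_derive t 1 C (- (s ^+ 2 * t) * C t).
Proof.
have tI : `]t - 1, t + 1[%classic t by rewrite /= in_itv/=; apply/andP; split; lra.
have d1 x0 y : partial1of2 g x0 y = - (y - m) * sin (x0 * (y - m) + c) * p y.
  by rewrite partial1of2E; have [_ ->] := dg x0 y.
have h1 x0 (_ : `]t - 1, t + 1[%classic x0) := ig x0.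
have h2 x0 y (_ : `]t - 1, t + 1[%classic x0) (_ : setT y) : derivable (g ^~ y) x0 1.
  by have [] := dg x0 y.
have h3 y : 0 <= `|y - m| * p y by rewrite mulr_ge0// normal_pdf_ge0.
have h4 := integrable_abs_pdf m s0.
have h5 x0 y (_ : `]t - 1, t + 1[%classic x0) (_ : setT y) : `|partial1of2 g x0 y| <= `|y - m| * p y.
  rewrite d1 !normrM normrN [X in _ * X <= _]ger0_norm ?normal_pdf_ge0// ler_wpM2r ?normal_pdf_ge0//.
  by rewrite ler_piMr//; exact: sin_max.
apply: DeriveDef.
  exact: (@derivable_under_integral _ _ _ mu g setT measurableT t (t - 1) (t + 1) tI h1 h2 _ h3 h4 h5).
rewrite -derive1E.
rewrite (@differentiation_under_integral _ _ _ mu g setT measurableT t (t - 1) (t + 1) tI h1 h2 _ h3 h4 h5).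
transitivity (\int[mu]_x ((-1) * ((x - m) * sin (t * (x - m) + c) * p x)))%R.
  by apply: eq_Rintegral => y _; rewrite d1; ring.
rewrite RintegralZl//; last exact: isn.
by rewrite [X in _ * X]ibp; ring.
Qed.

(** Differentiation under the integral and integration by parts give C' = - s^2 t C, so C t exp (t^2
    s^2 / 2) keeps its value at 0, which is cos c. *)
Lemma normal_pdf_char t : (\int[mu]_x (cos (t * (x - m) + c) * normal_pdf m s x))%R =
  expR (- (t ^+ 2 * s ^+ 2 / 2)) * cos c.
Proof.
pose H t := C t * expR (t ^+ 2 * s ^+ 2 / 2).
have dH (u : R) : is_derive u (1 : R) H 0.
  have dCu := dC u.
  by apply: is_derive_eq; rewrite /GRing.scale/=; field.
have := @is_derive_0_is_cst _ H t 0 dH.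
rewrite /H /C /g expr0n/= !mul0r expR0 mulr1.
have -> : (\int[mu]_x (cos (0 * (x - m) + c) * p x))%R = cos c.
  under eq_Rintegral do rewrite mul0r add0r.
  rewrite RintegralZl//; last exact: integrable_normal_pdf.
  by rewrite /Rintegral integral_normal_pdf mulr1.
rewrite -/p; move=> <-; by rewrite expRN [RHS]mulrC mulfK// gt_eqF ?expR_gt0.
Qed.

End char_fun.

Lemma normal_prob_char m s (t c : R) : s != 0 ->
  (\int[normal_prob m s]_x cos (t * x + c))%R = expR (- (t ^+ 2 * s ^+ 2 / 2)) * cos (t * m + c).
Proof.
move=> s0.
have mc : measurable_fun [set: R] (fun x : R => cos (t * x + c)).
  apply: measurableT_comp; first exact: continuous_measurable_fun (@continuous_cos R).
  by apply: measurable_funD => //; apply: measurable_funM.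
have bc : bfun (fun x : R => cos (t * x + c)).
  by split => //; exists 1 => x; exact: cos_max.
have ip := integrable_normal_pdf m s.
have icp : mu.-integrable [set: R] (fun x => (cos (t * x + c) * normal_pdf m s x)%:E).
  apply: (le_integrable measurableT _ _ ip) => [|x _].
    by apply/measurable_EFinP/measurable_funM => //; exact: measurable_normal_pdf.
  by rewrite /= lee_fin normrM ler_piMl//; exact: cos_max.
(* Adding 1 makes the integrand nonnegative, as [ge0_integral_normal] requires. *)
have e : (\int[normal_prob m s]_x (1 + cos (t * x + c)))%R =
    (\int[mu]_x (normal_pdf m s x + cos (t * x + c) * normal_pdf m s x))%R.
  rewrite /Rintegral ge0_integral_normal.
  - by congr fine; apply: eq_integral => x _; rewrite -EFinM mulrDl mul1r.
  - by apply/measurable_EFinP/measurable_funD.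
  - by move=> x; rewrite lee_fin; have := cos_max (t * x + c); rewrite ler_norml; lra.
move: e; rewrite bintD// ?bint_cst; last exact: bfun_cst.
rewrite RintegralD// [X in _ = X + _]/Rintegral integral_normal_pdf => /addrI ->.
rewrite -[RHS](normal_pdf_char m _ s0); apply: eq_Rintegral => x _.
by congr (cos _ * _); ring.
Qed.

Lemma gaussian1_char (m v : R) (t c : R) (nu : probability (measurableTypeR R) R) : 0 <= v ->
  (forall A, measurable A -> nu A = gaussian1 m v A) ->
  (\int[nu]_x cos (t * x + c))%R = expR (- (t ^+ 2 * v / 2)) * cos (t * m + c).
Proof.
move=> v0 nuE.
have mc : measurable_fun [set: R] (fun x : R => (cos (t * x + c))%:E).
  apply/measurable_EFinP.
  apply: measurableT_comp; first exact: continuous_measurable_fun (@continuous_cos R).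
  by apply: measurable_funD => //; apply: measurable_funM.
move: nuE; rewrite /gaussian1; case: eqP => [->|/eqP v1] nuE.
  rewrite mulr0 mul0r oppr0 expR0 mul1r /Rintegral.
  rewrite (@eq_measure_integral _ _ _ _ (\d_(m : measurableTypeR R)) nu)//; last by move=> A mA _; exact: nuE.
  by rewrite integral_dirac// diracT mul1e.
rewrite /Rintegral (@eq_measure_integral _ _ _ _ (normal_prob m (Num.sqrt v)) nu)//; last first.
  by move=> A mA _; exact: nuE.
rewrite -/(Rintegral _ _ _) normal_prob_char ?sqr_sqrtr//.
by rewrite gt_eqF// sqrtr_gt0 lt_neqAle eq_sym v1.
Qed.

End normal_law.

(** * Generating classes of linear functionals *)

Section generation.
Context {R : realType}.

(** An inclusion of sigma-algebras is the measurability of the identity map, which can then be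
    checked through coordinates. *)
Lemma gen_of_measurable_id d (T : measurableType d) (G : set (set T)) :
  measurable_fun [set: g_sigma_algebraType G] (id : g_sigma_algebraType G -> T) ->
  forall E : set T, measurable E -> <<s G >> E.
Proof. by move=> mid E mE; have := mid measurableT E mE; rewrite setTI. Qed.

Lemma measurable_fun_gtP d (T : measurableType d) (f : T -> measurableTypeR R) :
  (forall c : R, measurable [set x | c < f x]) -> measurable_fun [set: T] f.
Proof.
move=> mf; apply: (measurability _ (RGenOInfty.measurableE R)).
move=> _ [_ [c ->] <-]; rewrite setTI.
rewrite (_ : _ @^-1` _ = [set x | c < f x])//.
by apply/seteqP; split => x /=; rewrite in_itv/= andbT.
Qed.

Definition lines : set (measurableTypeR R -> R) :=
  [set phi | exists a : R, phi = (fun x => a * x)].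

Lemma lines_linear : linear_class lines.
Proof.
split.
- by exists 0; apply/funext => x; rewrite mul0r.
- by move=> a _ [b ->]; exists (a * b); apply/funext => x; rewrite mulrA.
- by move=> _ _ [a ->] [b ->]; exists (a + b); apply/funext => x; rewrite mulrDl.
Qed.

Lemma lines_measurable phi : lines phi -> measurable_fun [set: measurableTypeR R] phi.
Proof. by move=> [a ->]; exact: measurable_funM. Qed.

Lemma lines_gen (E : set (measurableTypeR R)) : measurable E ->
  <<s [set B | exists phi (c : R), lines phi /\ B = [set x | c < phi x]] >> E.
Proof.
apply: gen_of_measurable_id; apply: measurable_fun_gtP => c.
apply: sub_gen_smallest; exists (fun x => 1 * x), c.
split; first by exists 1.
by apply/seteqP; split => x /=; rewrite mul1r.
Qed.

Definition planes : set (measurableTypeR R * measurableTypeR R -> R) :=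
  [set phi | exists a b : R, phi = (fun z => a * z.1 + b * z.2)].

Lemma planes_linear : linear_class planes.
Proof.
split.
- by exists 0, 0; apply/funext => x; rewrite !mul0r addr0.
- by move=> c _ [a [b ->]]; exists (c * a), (c * b); apply/funext => x; rewrite mulrDr !mulrA.
- move=> _ _ [a [b ->]] [a' [b' ->]]; exists (a + a'), (b + b'); apply/funext => x.
  by rewrite !mulrDl addrACA.
Qed.

Lemma planes_measurable phi : planes phi ->
  measurable_fun [set: measurableTypeR R * measurableTypeR R] phi.
Proof.
move=> [a [b ->]]; apply: measurable_funD; apply: measurable_funM => //.
Qed.

Lemma planes_gen (E : set (measurableTypeR R * measurableTypeR R)) : measurable E ->
  <<s [set B | exists phi (c : R), planes phi /\ B = [set x | c < phi x]] >> E.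
Proof.
apply: gen_of_measurable_id; apply/measurable_fun_pairP; split.
  apply: measurable_fun_gtP => c; apply: sub_gen_smallest.
  exists (fun z => 1 * z.1 + 0 * z.2), c; split; first by exists 1, 0.
  by apply/seteqP; split => x /=; rewrite mul1r mul0r addr0.
apply: measurable_fun_gtP => c; apply: sub_gen_smallest.
exists (fun z => 0 * z.1 + 1 * z.2), c; split; first by exists 0, 1.
by apply/seteqP; split => x /=; rewrite mul1r mul0r add0r.
Qed.

End generation.

(** * The Borel sigma-algebra of a separable Hilbert space *)

Section borel_hilbert.
Context {R : realType} {X : hilbertType R}.
Hypothesis sX : separable X.

Definition functionals : set (borel X -> R) := [set phi | exists h : X, phi = (fun x => inner x h)].

Lemma functionals_linear : linear_class functionals.
Proof.
split.
- by exists 0; apply/funext => x; rewrite inner0r.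
- by move=> a _ [h ->]; exists (a *: h); apply/funext => x; rewrite innerZr.
- by move=> _ _ [h ->] [k ->]; exists (h + k); apply/funext => x; rewrite innerDr.
Qed.

Lemma continuous_borel_measurable (f : X -> R) : continuous f ->
  measurable_fun [set: borel X] (f : borel X -> measurableTypeR R).
Proof.
move=> cf; apply: measurable_fun_gtP => c; apply: sub_gen_smallest.
rewrite (_ : [set x | _] = f @^-1` [set y | c < y])//.
by apply: open_comp; [move=> x _; exact: cf|exact: open_gt].
Qed.

Lemma functionals_measurable phi : functionals phi -> measurable_fun [set: borel X] phi.
Proof. by move=> [h ->]; exact: (continuous_borel_measurable (@continuous_inner _ _ h)). Qed.

Lemma dense_sequence : exists d : nat -> X, forall x (e : R), 0 < e -> exists n, `|x - d n| < e.
Proof.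
have [D cD dD] := sX; have /countable_injP[f fi] := cD.
exists (fun n => xget 0 [set x | D x /\ f x = n]) => x e e0.
have [||y [xy Dy]] := dD (ball x e); [by exists x; exact: ballxx|exact: ball_open|].
exists (f y); case: xgetP => [z _ [Dz fz]|/(_ y)]; last by case.
have -> : z = y by apply: fi; rewrite ?inE.
by move: xy; rewrite -ball_normE.
Qed.

(** By Parseval each |f - a|^2 is a countable limit of functions of the coordinates, and by
    separability an open set is a countable union of balls around the points of a dense sequence. *)
Lemma measurable_to_borel d (T : measurableType d) (f : T -> borel X) :
  (forall h : X, measurable_fun [set: T] (fun t => inner (f t) h : R)) ->
  measurable_fun [set: T] f.
Proof.
move=> mf; have [e [fe _]] := frame_trace sX; have [c dc] := dense_sequence.
have mn (a : X) : measurable_fun [set: T] (fun t => `|f t - a| ^+ 2 : R).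
  apply: (@measurable_fun_cvg _ _ _ _
    (fun n t => \sum_(k < n) (inner (f t) (e k) - inner a (e k)) ^+ 2)); last first.
    move=> t _; have := @frame_parseval _ _ _ fe (f t - a).
    by under eq_fun do under eq_bigr do rewrite innerBl.
  elim=> [|n ih].
    by under eq_fun do rewrite big_ord0; exact: measurable_cst.
  under eq_fun do rewrite big_ord_recr/=; apply: measurable_funD => //.
  by apply: measurable_funX; exact: measurable_funB.
apply: (measurability (@open X : set (set (borel X))) erefl).
move=> _ [U oU <-]; rewrite setTI.
have -> : f @^-1` U = \bigcup_n \bigcup_(m in [set m : nat | ball (c n) m.+1%:R^-1 `<=` U])
    [set t | `|f t - c n| ^+ 2 < (m.+1%:R^-1) ^+ 2].
  apply/seteqP; split => t /=.
    move=> Uft; have /nbhs_ballP[r /= r0 rU] : nbhs (f t : X) U by exact: open_nbhs_nbhs.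
    have r2 : 0 < r / 2 by rewrite divr_gt0.
    have [m _ hm] := near_infty_natSinv_lt (PosNum r2).
    have m0 : 0 < m.+1%:R^-1 :> R by rewrite invr_gt0.
    have [n hn] := dc (f t) _ m0.
    exists n => //; exists m => /=; last by rewrite ltr_pXn2r// nnegrE// ltW.
    move=> y yn; apply: rU; move: yn; rewrite -!ball_normE /ball_/= => yn.
    rewrite -(subrK (c n) (f t : X)) -addrA (le_lt_trans (ler_normD _ _))// (splitr r).
    have := hm m (leqnn m) => /= h2.
    by rewrite ltrD// (lt_trans _ h2).
  move=> [n _ [m /= h]]; rewrite ltr_pXn2r ?nnegrE ?invr_ge0// => ht.
  by apply: h; rewrite -ball_normE /ball_/= distrC.
apply: bigcup_measurable => n _; apply: bigcup_measurable => m _.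
rewrite (_ : [set t | _] = (fun t => `|f t - c n| ^+ 2 : R) @^-1` `]-oo, (m.+1%:R^-1) ^+ 2[%classic).
  by have := mn (c n) measurableT _ (measurable_itv `]-oo, (m.+1%:R^-1 : R) ^+ 2[); rewrite setTI.
by apply/seteqP; split => t /=; rewrite in_itv/=.
Qed.

Lemma functionals_gen (E : set (borel X)) : measurable E ->
  <<s [set B | exists phi (c : R), functionals phi /\ B = [set x | c < phi x]] >> E.
Proof.
apply: gen_of_measurable_id; apply: measurable_to_borel => h.
suff mh : measurable_fun [set: g_sigma_algebraType [set B | exists phi (c : R),
    functionals phi /\ B = [set x | c < phi x]]] (fun t => inner t h : measurableTypeR R) by exact: mh.
apply: measurable_fun_gtP => c.
apply: sub_gen_smallest; exists (fun x => inner x h), c.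
by split => //; exists h.
Qed.

End borel_hilbert.

(** * Binary digits of a uniform variable *)

Section pushforward.
Context {R : realType} d d' {T : measurableType d} {T' : measurableType d'}.
Variables (P : probability T R) (f : T -> T') (mf : measurable_fun [set: T] f).

Definition push : probability T' R := distribution P (mfun_Sub (mem_set mf)).

Lemma push_int (g : T' -> R) : bfun g -> (\int[push]_x g x)%R = (\int[P]_x g (f x))%R.
Proof.
move=> bg; rewrite /Rintegral integral_distribution//.
  by apply/measurable_EFinP; exact: bg.1.
by have := bfun_int P (bfun_comp mf bg : bfun (g \o f)).
Qed.

Lemma push_ge0_integral (g : T' -> \bar R) : measurable_fun [set: T'] g ->
  (forall y, (0 <= g y)%E) -> (\int[push]_x g x = \int[P]_x g (f x))%E.
Proof. by move=> mg g0; rewrite ge0_integral_distribution. Qed.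

End pushforward.

Section product_probability.
Context {R : realType} d d' {T : measurableType d} {T' : measurableType d'}.
Variables (P : probability T R) (Q : probability T' R).

(** A name for the product measure to which the structure of probability can be attached. *)
Definition pprod : set (T * T') -> \bar R := (P \x Q)%E.

HB.instance Definition _ := Measure.on pprod.

Let pprod_setT : pprod [set: T * T'] = 1%E.
Proof.
by rewrite -setXTT [LHS]product_measure1E//= !probability_setT mule1.
Qed.

HB.instance Definition _ := @Measure_isProbability.Build _ _ _ pprod pprod_setT.

Lemma bfun_pair1 (F : T * T' -> R) x : bfun F -> bfun (fun y => F (x, y)).
Proof. by move=> bF; exact: (bfun_comp (pair1_measurable x) bF). Qed.

Lemma bfun_pair2 (F : T * T' -> R) y : bfun F -> bfun (fun x => F (x, y)).
Proof. by move=> bF; exact: (bfun_comp (pair2_measurable y) bF). Qed.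

Lemma bint_prod (F : T * T' -> R) : bfun F ->
  [/\ bfun (fun x => \int[Q]_y F (x, y))%R,
      bfun (fun y => \int[P]_x F (x, y))%R,
      (\int[pprod]_z F z)%R = (\int[P]_x \int[Q]_y F (x, y))%R &
      (\int[pprod]_z F z)%R = (\int[Q]_y \int[P]_x F (x, y))%R].
Proof.
move=> bF; have [mF [M FM]] := bF.
have iF : (P \x Q)%E.-integrable [set: T * T'] (EFin \o F).
  exact: (bfun_int (pprod : probability _ _) bF).
have e1 x : (\int[Q]_y (F (x, y))%:E = (\int[Q]_y F (x, y))%R%:E)%E.
  by rewrite /Rintegral fineK//; apply: integrable_fin_num => //; exact/bfun_int/bfun_pair1.
have e2 y : (\int[P]_x (F (x, y))%:E = (\int[P]_x F (x, y))%R%:E)%E.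
  by rewrite /Rintegral fineK//; apply: integrable_fin_num => //; exact/bfun_int/bfun_pair2.
split.
- split; last by exists M => x; apply: bint_ub => //; exact: bfun_pair1.
  apply/measurable_EFinP; have := measurable_fubini_F iF.
  by congr measurable_fun; apply/funext => x; rewrite /= -e1.
- split; last by exists M => x; apply: bint_ub => //; exact: bfun_pair2.
  apply/measurable_EFinP; have := measurable_fubini_G iF.
  by congr measurable_fun; apply/funext => x; rewrite /= -e2.
- rewrite {1 2}/Rintegral; congr fine; rewrite /pprod -integral12_prod_meas1//.
  by apply: eq_integral => x _; rewrite -e1.
- rewrite {1 2}/Rintegral; congr fine; rewrite /pprod -integral21_prod_meas1//.
  by apply: eq_integral => x _; rewrite -e2.
Qed.

End product_probability.

Lemma lip_of_derive {R : realType} (f df : R -> R) (L : R) :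
  (forall x : R, is_derive x (1 : R) f (df x)) -> (forall x, `|df x| <= L) ->
  forall a b, `|f a - f b| <= L * `|a - b|.
Proof.
move=> fdf dfL a b.
have cf : continuous f.
  by move=> x; apply/differentiable_continuous/derivable1_diffP; have [] := fdf x.
have h x y : x < y -> `|f x - f y| <= L * `|x - y|.
  move=> xy; have [c _ e] := MVT xy (fun z _ => fdf z) (continuous_subspaceT cf).
  by rewrite distrC e normrM distrC ler_wpM2r.
have [ab|ba|->] := ltgtP a b.
- exact: h.
- by rewrite distrC (distrC a) h.
- by rewrite !subrr normr0 mulr0.
Qed.

Lemma cos_lip {R : realType} (a b : R) : `|cos a - cos b| <= `|a - b|.
Proof.
rewrite -[leRHS]mul1r; apply: (lip_of_derive (df := fun x => - sin x)) => x.
by rewrite normrN; exact: sin_max.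
Qed.

(** * The uniform law and its binary digits *)

Section uniform.
Context {R : realType}.
Notation U := (uniform_prob (@ltr01 R)).

Lemma bfun_cos d (T : measurableType d) (phi : T -> R) : measurable_fun [set: T] phi ->
  bfun (fun x => cos (phi x)).
Proof.
move=> mphi; split; last by exists 1 => x; exact: cos_max.
exact: (measurableT_comp measurable_cosR).
Qed.

Lemma measurable_affine (s c : R) : measurable_fun [set: measurableTypeR R] (fun x : R => s * x + c).
Proof. by apply: measurable_funD => //; apply: measurable_funM. Qed.

Lemma unif_cos (s c : R) : s * (\int[U]_x cos (s * x + c))%R = sin (s + c) - sin c.
Proof.
have [->|s0] := eqVneq s 0; first by rewrite mul0r add0r subrr.
have bc : bfun (fun x : measurableTypeR R => cos (s * x + c)).
  by apply: bfun_cos; exact: measurable_affine.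
have cc : continuous (fun x : R => 1 + cos (s * x + c)).
  move=> x; apply: cvgD; first exact: cvg_cst.
  apply: (cvg_comp _ cos); last exact: continuous_cos.
  by apply: cvgD; [apply: cvgM; [exact: cvg_cst|exact: cvg_id]|exact: cvg_cst].
have dF (x : R) : is_derive x (1 : R) (fun x => x + s^-1 * sin (s * x + c)) (1 + cos (s * x + c)).
  by apply: is_derive_eq; rewrite /GRing.scale/=; field.
have cF : continuous (fun x : R => x + s^-1 * sin (s * x + c)).
  by move=> x; apply/differentiable_continuous/derivable1_diffP; have [] := dF x.
(* The added 1 keeps the integrand nonnegative, as [integral_uniform] requires. *)
have e : (\int[U]_x (1 + cos (s * x + c)))%R = 1 + s^-1 * (sin (s + c) - sin c).
  rewrite /Rintegral integral_uniform; last 2 first.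
  - by apply/measurable_EFinP; apply: measurable_funD => //; exact: bc.1.
  - by move=> x; rewrite lee_fin; have := cos_max (s * x + c); rewrite ler_norml; lra.
  rewrite subr0 invr1 mul1e (continuous_FTC2 (F := fun x => x + s^-1 * sin (s * x + c))) ?ltr01//.
  - by rewrite -EFinB/= mulr1 mulr0 !add0r; ring.
  - exact: continuous_subspaceT.
  - split; first by move=> x _; have [] := dF x.
      exact/cvg_at_right_filter/cF.
    exact/cvg_at_left_filter/cF.
  - by move=> x _; rewrite derive1E; have [_ ->] := dF x.
move: e; rewrite bintD//; last exact: bfun_cst.
by rewrite bint_cst => /addrI ->; rewrite mulrA divff// mul1r.
Qed.

Let half (i : R) (x : measurableTypeR R) : measurableTypeR R := 2^-1 * x + 2^-1 * i.

Let mhalf i : measurable_fun [set: measurableTypeR R] (half i).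
Proof. exact: measurable_affine. Qed.

(** A linear relation between the uniform law and its images on the two halves of the interval; by
    [trig_relation] it needs checking on cosines only. *)
Lemma unif_halves (f : measurableTypeR R -> R) : bfun f ->
  (\int[U]_x f x)%R = 2^-1 * (\int[U]_x f (2^-1 * x))%R + 2^-1 * (\int[U]_x f (2^-1 * x + 2^-1))%R.
Proof.
move=> bf.
pose P (i : 'I_3) : probability (measurableTypeR R) R :=
  match val i with 0%N => U | 1%N => push U (mhalf 0) | _ => push U (mhalf 1) end.
pose a (i : 'I_3) : R := match val i with 0%N => 1 | _ => - 2^-1 end.
suff : \sum_i a i * (\int[P i]_x f x)%R = 0.
  rewrite !big_ord_recl big_ord0/= /P/a/= !push_int//.
  have -> : (\int[U]_x f (half 0 x))%R = (\int[U]_x f (2^-1 * x))%R.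
    by apply: eq_Rintegral => x _; rewrite /half mulr0 addr0.
  have -> : (\int[U]_x f (half 1 x))%R = (\int[U]_x f (2^-1 * x + 2^-1))%R.
    by apply: eq_Rintegral => x _; rewrite /half mulr1.
  by rewrite mul1r addr0; lra.
apply: (trig_relation (@lines_linear R) (@lines_measurable R) (@lines_gen R)) => // _ c [s ->].
have bc t e : bfun (fun x : measurableTypeR R => cos (t * x + e)).
  by apply: bfun_cos; exact: measurable_affine.
rewrite /P/a/= !big_ord_recl big_ord0/= !push_int//.
have [->|s0] := eqVneq s 0.
  have h0 (g : measurableTypeR R -> R) : (\int[U]_x cos (0 * g x + c))%R = cos c.
    by rewrite -[RHS](bint_cst U); apply: eq_Rintegral => x _; rewrite mul0r add0r.
  by rewrite !h0; field.
have e0 : (\int[U]_x cos (s * half 0 x + c))%R = (\int[U]_x cos ((s / 2) * x + c))%R.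
  by apply: eq_Rintegral => x _; congr cos; rewrite /half; field.
have e1 : (\int[U]_x cos (s * half 1 x + c))%R = (\int[U]_x cos ((s / 2) * x + (s / 2 + c)))%R.
  by apply: eq_Rintegral => x _; congr cos; rewrite /half; field.
rewrite e0 e1; apply: (mulfI s0); rewrite mulr0.
have h0 := unif_cos s c; have h1 := unif_cos (s / 2) c.
have h2 := unif_cos (s / 2) (s / 2 + c).
rewrite addrA -splitr in h2.
move: h0 h1 h2; set I0 := (\int[_]_x _)%R; set I1 := (\int[_]_x _)%R; set I2 := (\int[_]_x _)%R.
by clear; move: I0 I1 I2 (sin _) (sin _) (sin _) => I0 I1 I2 a b e h0 h1 h2; lra.
Qed.

Lemma unif_ae (A : set (measurableTypeR R)) : measurable A ->
  (forall x : R, 0 < x < 1 -> ~ A x) -> U A = 0%E.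
Proof.
move=> mA nA; rewrite /uniform_prob integral_uniform_pdf.
have A01 : A `&` `[0, 1]%classic `<=` [set (0:R); 1].
  move=> x /= [Ax]; rewrite in_itv/= => /andP[x0 x1].
  have [->|x0'] := eqVneq x 0; first by left.
  have [->|x1'] := eqVneq x 1; first by right.
  by exfalso; apply: (nA x) => //; rewrite lt_neqAle eq_sym x0' x0 lt_neqAle x1' x1.
apply: null_set_integral => //.
- by apply: measurableI => //; exact: measurable_itv.
- by apply: measurable_funTS; apply/measurable_EFinP; exact: measurable_uniform_pdf.
- apply: countable_lebesgue_measure0; apply: finite_set_countable.
  by apply: (sub_finite_set A01).
Qed.

Lemma unif_eq (f g : measurableTypeR R -> R) : bfun f -> bfun g ->
  (forall x : R, 0 < x < 1 -> f x = g x) -> (\int[U]_x f x)%R = (\int[U]_x g x)%R.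
Proof.
move=> bf bg fg; rewrite /Rintegral; congr fine; apply: ae_eq_integral => //.
- by apply/measurable_EFinP; exact: bf.1.
- by apply/measurable_EFinP; exact: bg.1.
exists (~` `]0, 1[%classic); split.
- by apply: measurableC; exact: measurable_itv.
- by apply: unif_ae => [|x x01]; [by apply: measurableC; exact: measurable_itv|rewrite /= in_itv/= x01].
- move=> x /= h; rewrite in_itv/= => x01; apply: h => _.
  by rewrite fg.
Qed.

(** On ]0, 1[ this is the first binary digit, and [dbl] shifts the digits by one place. Values
    elsewhere do not affect integrals against the uniform law. *)
Definition bit (u : measurableTypeR R) : R := \1_`[2^-1, +oo[ u.
Definition dbl (u : measurableTypeR R) : measurableTypeR R := 2 * u - bit u.

Lemma measurable_bit : measurable_fun [set: measurableTypeR R] bit.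
Proof. by apply: measurable_indic; exact: measurable_itv. Qed.

Lemma measurable_dbl : measurable_fun [set: measurableTypeR R] dbl.
Proof. by apply: measurable_funB; [exact: measurable_funM|exact: measurable_bit]. Qed.

Lemma unif_bit (F : R -> measurableTypeR R -> R) :
  bfun (fun u : measurableTypeR R => F (bit u) (dbl u)) -> bfun (F 0) -> bfun (F 1) ->
  (\int[U]_u F (bit u) (dbl u))%R = 2^-1 * (\int[U]_u F 0 u)%R + 2^-1 * (\int[U]_u F 1 u)%R.
Proof.
move=> bF bF0 bF1; rewrite unif_halves//; congr (_ * _ + _ * _); apply: unif_eq => //.
- have m0 : measurable_fun [set: measurableTypeR R] (fun x : R => 2^-1 * x) by exact: measurable_funM.
  exact: (bfun_comp m0 bF).
- move=> x /andP[x0 x1].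
  have b0 : bit (2^-1 * x) = 0.
    by rewrite /bit indicE memNset//= in_itv/= andbT; apply/negP; rewrite -ltNge; lra.
  by rewrite b0; congr F; rewrite /dbl b0; field.
- exact: (bfun_comp (measurable_affine 2^-1 2^-1) bF).
- move=> x /andP[x0 x1].
  have b1 : bit (2^-1 * x + 2^-1) = 1.
    by rewrite /bit indicE mem_set//= in_itv/= andbT; lra.
  by rewrite b1; congr F; rewrite /dbl b1; field.
Qed.


(** Exchanging the components at each step sends the digits of even rank, counted from 0, to the
    first one and those of odd rank to the second. *)
Fixpoint split_bits (n : nat) (u : measurableTypeR R) : R * R :=
  match n with
  | 0%N => (0, 0)
  | n'.+1 => let p := split_bits n' (dbl u) in (2^-1 * (bit u + p.2), p.1)
  end.

Lemma bit01 u : 0 <= bit u <= 1.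
Proof. by rewrite /bit indicE ler0n lern1 leq_b1. Qed.

Lemma measurable_split_bits n :
  measurable_fun [set: measurableTypeR R] (fun u => (split_bits n u).1 : measurableTypeR R) /\
  measurable_fun [set: measurableTypeR R] (fun u => (split_bits n u).2 : measurableTypeR R).
Proof.
elim: n => [|n [IH1 IH2]] //=; split; last exact: (measurableT_comp IH1 measurable_dbl).
apply: measurable_funM => //; apply: measurable_funD; first exact: measurable_bit.
exact: (measurableT_comp IH2 measurable_dbl).
Qed.

Lemma split_bits01 n u : 0 <= (split_bits n u).1 <= 1 /\ 0 <= (split_bits n u).2 <= 1.
Proof.
elim: n u => [|n IH] u /=; first by rewrite lexx ler01.
by have [h1 h2] := IH (dbl u); split => //; have := bit01 u; lra.
Qed.

Lemma split_bitsS n u : (split_bits n u).1 <= (split_bits n.+1 u).1 /\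
  (split_bits n u).2 <= (split_bits n.+1 u).2.
Proof.
elim: n u => [|n IH] u.
  by have [/andP[? _] /andP[? _]] := split_bits01 1 u; split.
have [h1 h2] := IH (dbl u); split; last exact: h1.
rewrite -[leLHS]/(2^-1 * (bit u + (split_bits n (dbl u)).2)).
rewrite -[leRHS]/(2^-1 * (bit u + (split_bits n.+1 (dbl u)).2)).
by rewrite ler_pM2l ?invr_gt0// lerD2l.
Qed.

Definition even_bits (u : measurableTypeR R) : measurableTypeR R := limn (fun n => (split_bits n u).1).
Definition odd_bits (u : measurableTypeR R) : measurableTypeR R := limn (fun n => (split_bits n u).2).

Lemma cvg_even_bits u : (split_bits n u).1 @[n --> \oo] --> even_bits u.
Proof.
apply: nondecreasing_is_cvgn; first by apply/nondecreasing_seqP => n; have [] := split_bitsS n u.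
by exists 1 => _ [n _ <-]; have [/andP[]] := split_bits01 n u.
Qed.

Lemma cvg_odd_bits u : (split_bits n u).2 @[n --> \oo] --> odd_bits u.
Proof.
apply: nondecreasing_is_cvgn; first by apply/nondecreasing_seqP => n; have [] := split_bitsS n u.
by exists 1 => _ [n _ <-]; have [_ /andP[]] := split_bits01 n u.
Qed.

Lemma measurable_even_bits : measurable_fun [set: measurableTypeR R] even_bits.
Proof.
apply: (measurable_fun_cvg (h := fun n u => (split_bits n u).1)) => [n|u _].
  exact: (measurable_split_bits n).1.
exact: cvg_even_bits.
Qed.

Lemma measurable_odd_bits : measurable_fun [set: measurableTypeR R] odd_bits.
Proof.
apply: (measurable_fun_cvg (h := fun n u => (split_bits n u).2)) => [n|u _].
  exact: (measurable_split_bits n).2.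
exact: cvg_odd_bits.
Qed.


Lemma unif_dist (f : measurableTypeR R -> R) (a e : R) : bfun f ->
  (forall x : R, 0 < x < 1 -> `|f x - a| <= e) -> `|(\int[U]_x f x)%R - a| <= e.
Proof.
move=> bf fa; pose I : set (measurableTypeR R) := `]0, 1[%classic.
have bI : bfun (\1_I : _ -> R) by apply: bfun_indic; exact: measurable_itv.
have e0 : 0 <= e by apply: le_trans (fa 2^-1 _); [exact: normr_ge0|lra].
have bg : bfun (fun x => \1_I x * (f x - a)) by apply: bfunM => //; apply: bfunB => //; exact: bfun_cst.
have -> : (\int[U]_x f x)%R - a = (\int[U]_x (\1_I x * (f x - a)))%R.
  rewrite -[in LHS](bint_cst U a) -bintB//; last exact: bfun_cst.
  apply: unif_eq => //; first by apply: bfunB => //; exact: bfun_cst.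
  by move=> x x01; rewrite indicE mem_set ?mul1r//= in_itv.
apply: bint_ub => // x; rewrite indicE; have [xI|] := boolP (x \in I); last by rewrite mul0r normr0.
by rewrite mul1r fa//; move: xI; rewrite inE /I/= in_itv.
Qed.

Let bfun_split n s t c : bfun (fun u : measurableTypeR R => cos (s * (split_bits n u).1 + t * (split_bits n u).2 + c)).
Proof.
have [m1 m2] := measurable_split_bits n.
apply: bfun_cos; apply: measurable_funD => //.
by apply: measurable_funD; apply: measurable_funM.
Qed.

Definition split_cos n s t c := (\int[U]_u cos (s * (split_bits n u).1 + t * (split_bits n u).2 + c))%R.

Lemma split_cosS n s t c :
  split_cos n.+1 s t c = 2^-1 * split_cos n t (s / 2) c + 2^-1 * split_cos n t (s / 2) (s / 2 + c).
Proof.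
pose F b (u : measurableTypeR R) := cos (s * (2^-1 * (b + (split_bits n u).2)) + t * (split_bits n u).1 + c).
have FE b : F b = fun u => cos (t * (split_bits n u).1 + (s / 2) * (split_bits n u).2 + (s / 2 * b + c)).
  by apply/funext => u; congr cos; field.
rewrite /split_cos (unif_bit (F := F)).
- by congr (_ * _ + _ * _); apply: eq_Rintegral => u _; rewrite FE ?mulr0 ?mulr1 ?add0r.
- exact: (bfun_split n.+1).
- by rewrite FE; exact: bfun_split.
- by rewrite FE; exact: bfun_split.
Qed.

Definition square_cos s t c := (\int[U]_x \int[U]_y cos (s * x + t * y + c))%R.

Lemma bfun_plane s t c : bfun (fun z : measurableTypeR R * measurableTypeR R => cos (s * z.1 + t * z.2 + c)).
Proof.
apply: bfun_cos; apply: measurable_funD => //.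
by apply: measurable_funD; apply: measurable_funM.
Qed.

Lemma square_cosC s t c : square_cos s t c = square_cos t s c.
Proof.
have [_ _ h1 h2] := bint_prod U U (bfun_plane s t c).
rewrite /square_cos -[LHS]h1 h2; apply: eq_Rintegral => x _; apply: eq_Rintegral => y _.
by rewrite /= (addrC (s * _)).
Qed.

Lemma square_cosS s t c :
  square_cos s t c = 2^-1 * square_cos t (s / 2) c + 2^-1 * square_cos t (s / 2) (s / 2 + c).
Proof.
have [b1 _ _ _] := bint_prod U U (bfun_plane s t c).
rewrite (square_cosC t _ c) (square_cosC t _ (_ + c)).
have h0 : (\int[U]_x \int[U]_y cos (s * (2^-1 * x) + t * y + c))%R = square_cos (s / 2) t c.
  by apply: eq_Rintegral => x _; apply: eq_Rintegral => y _; rewrite mulrA.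
have h1 : (\int[U]_x \int[U]_y cos (s * (2^-1 * x + 2^-1) + t * y + c))%R = square_cos (s / 2) t (s / 2 + c).
  apply: eq_Rintegral => x _; apply: eq_Rintegral => y _.
  by rewrite mulrDr mulrA -!addrA (addrCA _ (t * y)).
by rewrite -h0 -h1; exact: (unif_halves b1).
Qed.

(** [split_cosS] and [square_cosS] are the same recursion: it exchanges the frequencies and halves
    one of them. Two steps halve both, hence [n.*2], and the initial gap |s| + |t| shrinks by 1/2
    for every two digits. *)
Lemma split_square_cos n s t c :
  `|split_cos n.*2 s t c - square_cos s t c| <= 2^-1 ^+ n * (`|s| + `|t|).
Proof.
elim: n s t c => [|n IH] s t c.
  rewrite expr0 mul1r double0.
  have -> : split_cos 0 s t c = cos c.
    by rewrite /split_cos -[RHS](bint_cst U); apply: eq_Rintegral => x _; rewrite /= !mulr0 !add0r.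
  have [b1 _ _ _] := bint_prod U U (bfun_plane s t c).
  rewrite distrC; apply: unif_dist => // x x01.
  apply: unif_dist => [|y y01]; first exact: (bfun_pair1 x (bfun_plane s t c)).
  rewrite (le_trans (cos_lip _ _))// addrK (le_trans (ler_normD _ _))// !normrM.
  move: x01 y01 => /andP[x0 x1] /andP[y0 y1].
  by rewrite (gtr0_norm x0) (gtr0_norm y0) lerD// ler_piMr// ltW.
have e x : `|x / 2| = 2^-1 * `|x| by rewrite normrM (@gtr0_norm _ 2^-1) ?invr_gt0// mulrC.
have h' c' : `|split_cos n.*2 (s / 2) (t / 2) c' - square_cos (s / 2) (t / 2) c'| <= 2^-1 ^+ n.+1 * (`|s| + `|t|).
  by apply: le_trans (IH (s / 2) (t / 2) c') _; rewrite !e -mulrDr mulrA -exprSr.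
rewrite doubleS split_cosS square_cosS !(split_cosS n.*2) !(square_cosS t (s / 2)).
have := h' c; have := h' (t / 2 + c); have := h' (s / 2 + c); have := h' (t / 2 + (s / 2 + c)).
move: (_ * (`|s| + _)) (split_cos _ _ _ _) (split_cos _ _ _ _) (split_cos _ _ _ _) (split_cos _ _ _ _) (square_cos _ _ _) (square_cos _ _ _) (square_cos _ _ _) (square_cos _ _ _).
clear => m a1 a2 a3 a4 b1 b2 b3 b4.
by rewrite !ler_norml => /andP[? ?] /andP[? ?] /andP[? ?] /andP[? ?]; apply/andP; split; lra.
Qed.

Lemma measurable_even_odd : measurable_fun [set: measurableTypeR R] (fun u => (even_bits u, odd_bits u)).
Proof.
by apply: measurable_fun_pair; [exact: measurable_even_bits|exact: measurable_odd_bits].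
Qed.

Lemma even_odd_cos s t c :
  (\int[U]_u cos (s * even_bits u + t * odd_bits u + c))%R = square_cos s t c.
Proof.
have h : split_cos n s t c @[n --> \oo] --> (\int[U]_u cos (s * even_bits u + t * odd_bits u + c))%R.
  apply: (bint_cvg U (M := 1) _ _ _).2 => [n|n x|x]; first exact: bfun_split.
    exact: cos_max.
  apply: (cvg_comp _ cos); last exact: continuous_cos.
  apply: cvgD; last exact: cvg_cst.
  by apply: cvgD; apply: cvgM; (try exact: cvg_cst); [exact: cvg_even_bits|exact: cvg_odd_bits].
have h2 : split_cos n.*2 s t c @[n --> \oo] --> (\int[U]_u cos (s * even_bits u + t * odd_bits u + c))%R.
  move/cvgrPdist_le : h => h; apply/cvgrPdist_le => e e0.
  have [N _ NP] := h e e0; exists N => // n /= Nn; apply: NP => /=.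
  by rewrite (leq_trans Nn)// -addnn leq_addr.
apply: (cvgn_unique h2).
have h3 : 2^-1 ^+ n * (`|s| + `|t|) @[n --> \oo] --> 0.
  rewrite -[X in _ --> X](mul0r (`|s| + `|t|)); apply: cvgM; last exact: cvg_cst.
  by apply: cvg_expr; rewrite ger0_norm ?invr_ge0//; lra.
apply/cvgrPdist_le => e e0; move/cvgrPdist_le : h3 => /(_ e e0)[N _ NP]; exists N => // n /= Nn.
rewrite distrC (le_trans (split_square_cos n s t c))//.
by rewrite (le_trans (ler_norm _))// -normrN -sub0r; exact: NP.
Qed.

(** The two halves of the digits are independent uniform variables: their joint characteristic
    function is that of the unit square. *)
Lemma even_odd_int (F : measurableTypeR R * measurableTypeR R -> R) : bfun F ->
  (\int[U]_u F (even_bits u, odd_bits u))%R = (\int[U]_x \int[U]_y F (x, y))%R.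
Proof.
move=> bF; have [_ _ <- _] := bint_prod U U bF.
rewrite -(push_int U measurable_even_odd bF).
rewrite /Rintegral; congr fine; apply: eq_measure_integral => A mA _.
apply: (trig_unique (@planes_linear R) (@planes_measurable R) (@planes_gen R)) => // phi c [s [t ->]].
rewrite (push_int U measurable_even_odd (bfun_plane s t c)) [LHS]even_odd_cos.
by have [_ _ -> _] := bint_prod U U (bfun_plane s t c).
Qed.

End uniform.

(** * Independent normal variables *)

Section quantile.
Context {R : realType}.
Variable nu : probability (measurableTypeR R) R.
Notation U := (uniform_prob (@ltr01 R)).

Let idR : measurableTypeR R -> R := id.
Let midR : measurable_fun [set: measurableTypeR R] idR.
Proof. exact: measurable_id. Qed.
Let rvid : {RV nu >-> R} := mfun_Sub (mem_set midR).

Let F (x : R) : R := fine (nu `]-oo, x]%classic).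

Let FE x : cdf rvid x = (F x)%:E.
Proof. by rewrite /F fineK ?fin_num_measure//; exact: measurable_itv. Qed.

Let F_nd x y : x <= y -> F x <= F y.
Proof. by move=> xy; rewrite -lee_fin -!FE; exact: cdf_nondecreasing. Qed.

Let F_cofinal (u : R) : u < 1 -> exists x, u < F x.
Proof.
move=> u1; have /fine_cvgP[_ h] := cvg_cdfy1 rvid.
have h' : F x @[x --> +oo] --> (1 : R) by move: h; congr (_ --> _); apply: eq_fmap => // x; rewrite /= FE.
have [A [_ hA]] := cvgr_gt 1 h' u u1.
by exists (A + 1); apply: hA; rewrite ltrDl.
Qed.

Let F_coinitial (u : R) : 0 < u -> exists x, F x < u.
Proof.
move=> u0; have /fine_cvgP[_ h] := cvg_cdfNy0 rvid.
have h' : F x @[x --> -oo] --> (0 : R) by move: h; congr (_ --> _); apply: eq_fmap => // x; rewrite /= FE.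
have [A [_ hA]] := cvgr_lt 0 h' u u0.
by exists (A - 1); apply: hA; rewrite gtrBl.
Qed.

Let F_right (x u : R) : F x < u -> exists2 y, x < y & F y < u.
Proof.
move=> xu; have := @cdf_right_continuous _ _ _ _ rvid x; rewrite FE => /fine_cvgP[_ h].
have h' : F y @[y --> x^'+] --> F x.
  by move: h; congr (_ --> _); apply: eq_fmap => // y; rewrite /= FE.
have h2 := cvgr_lt (F x) h' u xu; rewrite near_withinE in h2.
have [e /= e0 he] := (nbhs_ballP x [set y | x < y -> F y < u]).1 (h2 _).
exists (x + e / 2); first by rewrite ltrDl divr_gt0.
apply: he; last by rewrite ltrDl divr_gt0.
rewrite /ball/= opprD addNKr normrN gtr0_norm ?divr_gt0//.
by rewrite gtr_pMr// invf_lt1// ltr1n.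
Qed.

(** Outside ]0, 1[ the set may be empty or unbounded below, so the value is fixed to 0 there. *)
Definition quantile (u : measurableTypeR R) : measurableTypeR R :=
  if 0 < u < 1 then inf [set x | u <= F x] else 0.

(** Right continuity of the distribution function yields the strict inequality in the direction from
    [F c < u]. This equivalence carries both the measurability and the law of [quantile]. *)
Lemma quantile_gt u c : 0 < u < 1 -> (c < quantile u) = (F c < u).
Proof.
move=> /[dup] u01 /andP[u0 u1]; rewrite /quantile u01.
have h0 : [set x | u <= F x] !=set0 by have [x /ltW] := F_cofinal u1; exists x.
have [y Fy] := F_coinitial u0.
have hlb : lbound [set x | u <= F x] y.
  by move=> x /= ux; rewrite leNgt; apply/negP => /ltW/F_nd; rewrite leNgt (lt_le_trans Fy ux).
apply/idP/idP => [ci|Fcu].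
  rewrite ltNge; apply/negP => h; move: ci; rewrite ltNge => /negP; apply.
  by apply: ge_inf => //; exists y.
have [z cz Fz] := F_right Fcu.
apply: lt_le_trans cz _; apply: lb_le_inf => // x /= ux.
by rewrite leNgt; apply/negP => /ltW/F_nd; rewrite leNgt (lt_le_trans Fz ux).
Qed.

Lemma measurable_quantile : measurable_fun [set: measurableTypeR R] quantile.
Proof.
apply: measurable_fun_gtP => c.
have -> : [set u | c < quantile u] =
   `]F c, +oo[%classic `&` `]0, 1[%classic `|` ~` `]0, 1[%classic `&` [set u | c < 0].
  apply/seteqP; split => u /=; rewrite !in_itv/= andbT.
    have [u01|u01] := boolP (0 < u < 1); first by rewrite quantile_gt//; left.
    by rewrite /quantile (negbTE u01); right; split => //; apply/negP.
  by move=> [[Fu u01]|[/negP u01 c0]]; [rewrite quantile_gt|rewrite /quantile (negbTE u01)].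
apply: measurableU; first by apply: measurableI; exact: measurable_itv.
apply: measurableI; first by apply: measurableC; exact: measurable_itv.
have [c0|c0] := ltP c 0; first by rewrite (_ : [set _ | _] = setT)//; apply/seteqP.
rewrite (_ : [set _ | _] = set0)//.
by apply/seteqP; split.
Qed.

Lemma unif_itv (a : R) : 0 <= a <= 1 -> U `]a, +oo[%classic = (1 - a)%:E.
Proof.
move=> /andP[a0 a1]; rewrite /uniform_prob integral_uniform_pdf.
have -> : (\int[lebesgue_measure]_(x in `]a, +oo[ `&` `[0%R, 1%R]) (uniform_pdf 0%R 1%R x)%:E
   = \int[lebesgue_measure]_(x in `]a, 1%R]) 1%:E)%E.
  have -> : `]a, +oo[ `&` `[0, 1]%classic = `]a, 1]%classic :> set R.
    apply/seteqP; split => x /=; rewrite !in_itv/= andbT; first by move=> [-> /andP[_ ->]].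
    by move=> /andP[ax x1]; split => //; rewrite x1 andbT ltW// (le_lt_trans a0 ax).
  apply: eq_integral => x; rewrite inE/= in_itv/= => /andP[ax x1].
  by rewrite /uniform_pdf (ltW (le_lt_trans a0 ax)) x1 subr0 invr1.
by rewrite integral_cst//= mul1e lebesgue_measure_itv/= lte_fin lt_neqAle a1 andbT; case: eqVneq => //= ->; rewrite subrr.
Qed.

Lemma quantile_law A : measurable A -> push U measurable_quantile A = nu A.
Proof.
move: A; apply: (@measure_unique _ R (measurableTypeR R) (@RGenOInfty.G R) (fun n => `](- n%:R), +oo[%classic)).
- exact: RGenOInfty.measurableE.
- move=> _ _ [x ->] [y ->]; exists (Num.max x y).
  by apply/seteqP; split => z /=; rewrite !in_itv/= !andbT gt_max; [move=> [-> ->]|move=> /andP].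
- by move=> n; exists (- n%:R).
- apply/seteqP; split => // x _; exists (Num.bound `|x|) => //=.
  rewrite in_itv/= andbT ltrNl (le_lt_trans (ler_norm _))// normrN.
  by apply: archi_boundP.
- move=> _ [c ->]; rewrite /push/=.
  have F01 : 0 <= F c <= 1.
    by rewrite -!lee_fin -FE cdf_ge0 cdf_le1.
  transitivity (1 - F c)%:E; last first.
    have mc : measurable (`]-oo, c]%classic : set (measurableTypeR R)) by exact: measurable_itv.
    rewrite EFinB /F fineK ?(fin_num_measure nu _ mc)// -(probability_setC nu mc).
    by rewrite setCitvl.
  rewrite -(unif_itv F01).
  have qE : quantile @^-1` `]c, +oo[%classic = [set u : measurableTypeR R | c < quantile u].
    by apply/seteqP; split => u /=; rewrite in_itv/= andbT.
  have mq : measurable [set u : measurableTypeR R | c < quantile u].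
    rewrite -qE -[X in measurable X]setTI; apply: measurable_quantile => //; exact: measurable_itv.
  have mI : measurable (`]F c, +oo[%classic : set (measurableTypeR R)) by exact: measurable_itv.
  rewrite [X in U X = _]qE -(fineK (fin_num_measure U _ mq)) -(fineK (fin_num_measure U _ mI)).
  rewrite -(bint_indic U mI) -(bint_indic U mq).
  congr EFin; apply: unif_eq; [exact: bfun_indic|exact: bfun_indic|move=> u u01].
  rewrite !indicE; congr ((nat_of_bool _)%:R).
  by apply/idP/idP; rewrite !inE/= in_itv/= andbT quantile_gt.
- by move=> n; rewrite (le_lt_trans (probability_le1 _ _)) ?ltry//; exact: measurable_itv.
Qed.

Lemma quantile_int (f : measurableTypeR R -> R) : bfun f ->
  (\int[U]_u f (quantile u))%R = (\int[nu]_x f x)%R.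
Proof.
move=> bf; rewrite -(push_int U measurable_quantile bf) /Rintegral; congr fine.
by apply: eq_measure_integral => A mA _; exact: quantile_law.
Qed.

(* The even binary digits of a uniform variable drive a variable of law nu,
   and its odd digits an independent uniform variable. *)
Definition sample (u : measurableTypeR R) : measurableTypeR R := quantile (even_bits u).

Lemma measurable_sample : measurable_fun [set: measurableTypeR R] sample.
Proof. exact: (measurableT_comp measurable_quantile measurable_even_bits). Qed.

Lemma sample_int (G : measurableTypeR R * measurableTypeR R -> R) : bfun G ->
  (\int[U]_u G (sample u, odd_bits u))%R = (\int[nu]_x \int[U]_y G (x, y))%R.
Proof.
move=> bG.
have mq : measurable_fun [set: measurableTypeR R * measurableTypeR R] (fun z => (quantile z.1, z.2)).
  by apply: measurable_fun_pair => //; apply: measurableT_comp => //; exact: measurable_quantile.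
rewrite (even_odd_int (bfun_comp mq bG : bfun (fun z => G (quantile z.1, z.2))))/=.
by have [b _ _ _] := bint_prod U U bG; exact: (quantile_int b).
Qed.

End quantile.

(** * Independent normal variables on the unit interval *)

Section gaussian_sequence.
Context {R : realType}.
Notation U := (uniform_prob (@ltr01 R)).
Notation N01 := (normal_prob (0 : R) 1).

(** Each variable uses the even digits of the remaining uniform variable and hands its odd digits to
    the following ones, so the whole sequence is independent and lives on one interval. *)
Fixpoint gauss_seq (k : nat) (u : measurableTypeR R) : measurableTypeR R :=
  match k with
  | 0%N => sample N01 u
  | k'.+1 => gauss_seq k' (odd_bits u)
  end.

Lemma measurable_gauss_seq k : measurable_fun [set: measurableTypeR R] (gauss_seq k).
Proof.
elim: k => [|k IH]; first exact: measurable_sample.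
exact: (measurableT_comp IH measurable_odd_bits).
Qed.

Lemma measurable_gauss_sum n (c : nat -> R) (d : R) :
  measurable_fun [set: measurableTypeR R] (fun u => \sum_(k < n) c k * gauss_seq k u + d : measurableTypeR R).
Proof.
apply: measurable_funD => //; apply: measurable_sum => k.
by apply: measurable_funM => //; exact: measurable_gauss_seq.
Qed.

Lemma gauss_seq_char n (c : nat -> R) (d : R) :
  (\int[U]_u cos (\sum_(k < n) c k * gauss_seq k u + d))%R =
    expR (- (\sum_(k < n) c k ^+ 2 / 2)) * cos d.
Proof.
elim: n c d => [|n IH] c d.
  rewrite big_ord0 oppr0 expR0 mul1r -[RHS](bint_cst U).
  by apply: eq_Rintegral => u _; rewrite big_ord0 add0r.
pose G (z : measurableTypeR R * measurableTypeR R) := cos (c 0%N * z.1 + (\sum_(k < n) c k.+1 * gauss_seq k z.2 + d)).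
have bG : bfun G.
  apply: bfun_cos; apply: measurable_funD; first exact: measurable_funM.
  exact: (measurableT_comp (measurable_gauss_sum n (fun k => c k.+1) d) measurable_snd).
transitivity (\int[U]_u G (sample N01 u, odd_bits u))%R.
  by apply: eq_Rintegral => u _; rewrite big_ord_recl/= -addrA.
rewrite (sample_int N01 bG).
set e := expR (- (\sum_(k < n) c k.+1 ^+ 2 / 2)).
transitivity (\int[N01]_x (e * cos (c 0%N * x + d)))%R.
  apply: eq_Rintegral => x _; rewrite -(IH (fun k => c k.+1)); apply: eq_Rintegral => u _.
  by rewrite /G/= addrCA.
rewrite bintZ; last by apply: bfun_cos; exact: measurable_affine.
rewrite normal_prob_char ?oner_neq0// mulr0 add0r mulrA /e -expRD big_ord_recl/=.
by congr (expR _ * _); rewrite expr1n mulr1; ring.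
Qed.

(** The sum has the law of sqrt s times a standard normal variable. The constant comes from x^2 <= 2
    (exp x + exp (- x)), whose normal mean is 4 exp (1/2); a crude second moment is enough for
    convergence. *)
Lemma gauss_seq_sqr n (c : nat -> R) :
  (\int[U]_u ((\sum_(k < n) c k * gauss_seq k u) ^+ 2)%:E <=
    (4 * expR 2^-1 * \sum_(k < n) c k ^+ 2)%:E)%E.
Proof.
set s := \sum_(k < n) c k ^+ 2.
have s0 : 0 <= s by apply: sumr_ge0 => k _; exact: sqr_ge0.
pose h (u : measurableTypeR R) : measurableTypeR R := \sum_(k < n) c k * gauss_seq k u + 0.
have mh : measurable_fun [set: measurableTypeR R] h := measurable_gauss_sum n c 0.
have mg : measurable_fun [set: measurableTypeR R] (fun x : measurableTypeR R => Num.sqrt s * x : measurableTypeR R).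
  exact: measurable_funM.
have msq : measurable_fun [set: measurableTypeR R] (fun x : R => (x ^+ 2)%:E).
  by apply/measurable_EFinP; exact: measurable_funX.
apply: (@le_trans _ _ (\int[N01]_x ((Num.sqrt s * x) ^+ 2)%:E)%E).
  have -> : (\int[U]_u ((\sum_(k < n) c k * gauss_seq k u) ^+ 2)%:E = \int[push U mh]_x (x ^+ 2)%:E)%E.
    rewrite push_ge0_integral// => [|x]; last by rewrite lee_fin sqr_ge0.
    by apply: eq_integral => u _; rewrite /h addr0.
  have -> : (\int[N01]_x ((Num.sqrt s * x) ^+ 2)%:E = \int[push N01 mg]_x (x ^+ 2)%:E)%E.
    by rewrite push_ge0_integral// => x; rewrite lee_fin sqr_ge0.
  rewrite le_eqVlt; apply/orP; left; apply/eqP; apply: eq_measure_integral => A mA _.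
  apply: (trig_unique (@lines_linear R) (@lines_measurable R) (@lines_gen R)) => // phi d [a ->].
  have ba : bfun (fun x : measurableTypeR R => cos (a * x + d)) by apply: bfun_cos; exact: measurable_affine.
  rewrite (push_int U mh ba) (push_int N01 mg ba).
  transitivity (\int[U]_u cos (\sum_(k < n) (a * c k) * gauss_seq k u + d))%R.
    apply: eq_Rintegral => u _; congr (cos (_ + _)); rewrite /h addr0 mulr_sumr.
    by apply: eq_bigr => k _; rewrite mulrA.
  rewrite (gauss_seq_char n (fun k => a * c k)).
  transitivity (\int[N01]_x cos ((a * Num.sqrt s) * x + d))%R; last first.
    by apply: eq_Rintegral => x _; rewrite mulrA.
  rewrite normal_prob_char ?oner_neq0// mulr0 add0r expr1n mulr1 exprMn sqr_sqrtr//.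
  congr (expR (- _) * _); rewrite -!mulr_suml mulr_sumr.
  by congr (_ / _); apply: eq_bigr => k _; rewrite exprMn.
have mexp (l : R) : measurable_fun [set: measurableTypeR R] (fun x : R => (expR (l * (x - 0)))%:E).
  apply/measurable_EFinP; apply: measurableT_comp => //.
  by apply: measurable_funM => //; apply: measurable_funB.
have h2 : (\int[N01]_x (x ^+ 2)%:E <= (4 * expR 2^-1)%:E)%E.
  apply: (@le_trans _ _ (\int[N01]_x (2%:E * ((expR (1 * (x - 0)))%:E + (expR (-1 * (x - 0)))%:E))))%E.
    apply: ge0_le_integral => //.
    - by move=> x _; rewrite lee_fin sqr_ge0.
    - by apply: measurable_funeM; apply: emeasurable_funD; exact: mexp.
    - move=> x _; rewrite -EFinD -EFinM lee_fin subr0 mul1r mulN1r.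
      have := expR_ge1Dxn 1 (normr_ge0 x); have := expR_ge0 x; have := expR_ge0 (- x).
      rewrite -normrX ger0_norm ?sqr_ge0// -[2`!]/2%N.
      by case: (ger0P x) => _; lra.
  rewrite ge0_integralZl//; first last.
  - by move=> x _; rewrite -EFinD lee_fin addr_ge0 ?expR_ge0.
  - by apply: emeasurable_funD; exact: mexp.
  rewrite ge0_integralD//; try (by move=> x _; rewrite lee_fin expR_ge0); try exact: mexp.
  rewrite !normal_mgf ?oner_neq0// -EFinD sqrrN !expr1n !mulr1 mul1r.
  by rewrite -EFinM lee_fin; lra.
under eq_integral do rewrite exprMn sqr_sqrtr// EFinM.
rewrite ge0_integralZl//.
- rewrite mulrC EFinM; apply: lee_pmul => //; rewrite ?lee_fin//.
  by apply: integral_ge0 => x _; rewrite lee_fin sqr_ge0.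
- by move=> x _; rewrite lee_fin sqr_ge0.
Qed.

End gaussian_sequence.

(** * Gaussian measures *)

Lemma bint_ae {R : realType} d (T : measurableType d) (P : probability T R) (f g : T -> R) (A : set T) :
  bfun f -> bfun g -> measurable A -> P (~` A) = 0%E -> (forall x, A x -> f x = g x) ->
  (\int[P]_x f x)%R = (\int[P]_x g x)%R.
Proof.
move=> bf bg mA PA fg; rewrite /Rintegral; congr fine; apply: ae_eq_integral => //.
- by apply/measurable_EFinP; exact: bf.1.
- by apply/measurable_EFinP; exact: bg.1.
exists (~` A); split => //; first exact: measurableC.
by move=> x /= h Ax; apply: h => _; rewrite fg.
Qed.

Lemma ge0_finite_ae {R : realType} d (T : measurableType d) (P : probability T R) (f : T -> \bar R) :
  measurable_fun [set: T] f -> (forall x, (0 <= f x)%E) -> (\int[P]_x f x < +oo)%E ->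
  measurable [set x | (f x < +oo)%E] /\ P (~` [set x | (f x < +oo)%E]) = 0%E.
Proof.
move=> mf f0 fi; have mA : measurable [set x | (f x < +oo)%E].
  by rewrite -[X in measurable X]setTI; exact: emeasurable_fun_infty_o.
split => //.
have [N [mN N0 AN]] : {ae P, forall x, [set: T] x -> f x \is a fin_num}.
  apply: integrable_ae => //; apply/integrableP; split => //.
  by under eq_integral do rewrite gee0_abs//.
apply: (subset_measure0 (B := N)) => //; first exact: measurableC.
by move=> x /= nx; apply: AN => /= /(_ I); rewrite ge0_fin_numE.
Qed.

Lemma sum_tail (V : zmodType) (F : nat -> V) m n : (m <= n)%N ->
  \sum_(k < n) (if (m <= k)%N then F k else 0) = \sum_(k < n) F k - \sum_(k < m) F k.
Proof.
move=> /subnKC <-; elim: (n - m)%N => [|d ih].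
  by rewrite addn0 subrr big1// => k _; rewrite leqNgt ltn_ord.
by rewrite addnS !big_ord_recr/= ih leq_addr addrAC.
Qed.

Section gaussian_vector.
Context {R : realType} {X : hilbertType R}.
Hypothesis sX : separable X.
Notation U := (uniform_prob (@ltr01 R)).

Let vec n (w : nat -> X) (u : measurableTypeR R) : borel X := \sum_(k < n) gauss_seq k u *: w k.

Let inner_vec n w u h : inner (vec n w u : X) h = \sum_(k < n) inner (w k) h * gauss_seq k u.
Proof. by rewrite /vec inner_suml; apply: eq_bigr => k _; rewrite innerZl mulrC. Qed.

Let measurable_inner_vec n w h :
  measurable_fun [set: measurableTypeR R] (fun u => inner (vec n w u : X) h : R).
Proof.
have := measurable_gauss_sum n (fun k => inner (w k) h) 0.
congr measurable_fun; apply/funext => u.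
by rewrite addr0 inner_vec.
Qed.

Let measurable_vec n w : measurable_fun [set: measurableTypeR R] (vec n w).
Proof. by apply: measurable_to_borel => // h; exact: measurable_inner_vec. Qed.

Lemma measurable_norm2 : measurable_fun [set: borel X] (fun x : borel X => `|x : X| ^+ 2 : R).
Proof. by apply: measurable_funX; apply: continuous_borel_measurable; exact: norm_continuous. Qed.

Let vec_norm2 n (w : nat -> X) :
  (\int[U]_u (`|vec n w u : X| ^+ 2)%:E <= (4 * expR 2^-1 * \sum_(k < n) `|w k| ^+ 2)%:E)%E.
Proof.
have [e [fe _]] := frame_trace sX.
pose g N (u : measurableTypeR R) := (\sum_(i < N) inner (vec n w u : X) (e i) ^+ 2)%:E.
have mg N : measurable_fun [set: measurableTypeR R] (g N).
  apply/measurable_EFinP; apply: measurable_sum => i.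
  by apply: measurable_funX; exact: measurable_inner_vec.
have h : (\int[U]_u g N u)%E @[N --> \oo] --> (\int[U]_u (`|vec n w u : X| ^+ 2)%:E)%E.
  have -> : (\int[U]_u (`|vec n w u : X| ^+ 2)%:E = \int[U]_u limn (g ^~ u))%E.
    apply: eq_integral => u _; apply/esym/cvg_lim => //.
    by apply: cvg_EFin; [exact: nearW|exact: (@frame_parseval _ _ _ fe (vec n w u : X))].
  apply: cvg_monotone_convergence => //.
  - by move=> N u _; rewrite lee_fin; apply: sumr_ge0 => i _; exact: sqr_ge0.
  - move=> u _; apply/nondecreasing_seqP => N.
    by rewrite lee_fin big_ord_recr/= lerDl sqr_ge0.
rewrite -(cvg_lim _ h)//; apply: lime_le; first by apply/cvg_ex; eexists; exact: h.
apply: nearW => N; rewrite /g.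
under eq_integral do rewrite -sumEFin.
rewrite ge0_integral_sum//; last 2 first.
- by move=> i; apply/measurable_EFinP; apply: measurable_funX; exact: measurable_inner_vec.
- by move=> i u _; rewrite lee_fin sqr_ge0.
apply: (@le_trans _ _ (\sum_(i < N) (4 * expR 2^-1 * \sum_(k < n) inner (w k) (e i) ^+ 2)%:E)%E).
  apply: lee_sum => i _; have := gauss_seq_sqr n (fun k => inner (w k) (e i)).
  by apply: le_trans; under eq_integral do rewrite inner_vec.
rewrite sumEFin lee_fin -mulr_sumr ler_wpM2l ?mulr_ge0 ?expR_ge0//.
by rewrite exchange_big/=; apply: ler_sum => k _; exact: (@frame_bessel _ _ _ fe).
Qed.

(** The random series with terms [v k] is cut into blocks beyond whose start the sum of the |v k|^2
    is at most 8^(-j). Then the sum of 4^j |block j|^2 has finite mean, is finite on a set [A] of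
    full measure, and there the blocks are O(2^(-j)), hence summable. *)
Lemma gaussian_series (v : nat -> X) (M : R) :
  (forall n, \sum_(k < n) `|v k| ^+ 2 <= M) ->
  exists (Y : measurableTypeR R -> borel X) (A : set (measurableTypeR R)) (m : nat -> nat),
  [/\ measurable_fun [set: measurableTypeR R] Y, measurable A, U (~` A) = 0%E,
      forall j, (j <= m j)%N &
      forall u, A u -> forall h : X,
        \sum_(k < m j) inner (v k) h * gauss_seq k u @[j --> \oo] --> inner (Y u : X) h].
Proof.
move=> vM.
pose a n := \sum_(k < n) `|v k| ^+ 2.
have and_ : nondecreasing_seq a.
  by apply/nondecreasing_seqP => n; rewrite /a big_ord_recr/= lerDl sqr_ge0.
have ca : cvgn a by apply: nondecreasing_is_cvgn => //; exists M => _ [n _ <-]; exact: vM.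
have ale n : a n <= limn a by exact: nondecreasing_cvgn_le.
have /choice[N NP] j : exists N, limn a - a N <= 8^-1 ^+ j.
  have e0 : 0 < (8^-1 : R) ^+ j by rewrite exprn_gt0// invr_gt0.
  have /cvgrPdist_le/(_ _ e0)[N _ /(_ N (leqnn N))] := ca.
  by exists N; rewrite (le_trans (ler_norm _)).
(* The sum makes [m] nondecreasing and at least [N j]; the successors also make it at least [j]. *)
pose m j := (\sum_(i < j.+1) (N i).+1)%N.
have mS j : (m j <= m j.+1)%N by rewrite /m [leqRHS]big_ord_recr/= leq_addr.
have mN j : (N j <= m j)%N by rewrite /m big_ord_recr/= (leq_trans (leqnSn _))// leq_addl.
have mj j : (j <= m j)%N.
  by elim: j => // j ih; rewrite /m big_ord_recr/= -/(m j) addnS ltnS (leq_trans ih)// leq_addr.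
pose w j k := if (m j <= k)%N then v k else 0.
have wE j : vec (m j.+1) (w j) = fun u => vec (m j.+1) v u - vec (m j) v u.
  apply/funext => u; rewrite /vec -(sum_tail (fun k => gauss_seq k u *: v k) (mS j)).
  by apply: eq_bigr => k _; rewrite /w; case: ifP => // _; rewrite scaler0.
have wn j : \sum_(k < m j.+1) `|w j k| ^+ 2 <= 8^-1 ^+ j.
  apply: le_trans (NP j); apply: (@le_trans _ _ (a (m j.+1) - a (m j))); last first.
    by rewrite lerB//; exact: and_.
  rewrite /a -(sum_tail (fun k => `|v k| ^+ 2) (mS j)); apply: ler_sum => k _.
  by rewrite /w; case: ifP => // _; rewrite normr0 expr0n.
pose D j (u : measurableTypeR R) : \bar R := (4 ^+ j * `|vec (m j.+1) (w j) u : X| ^+ 2)%:E.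
have mD j : measurable_fun [set: measurableTypeR R] (D j).
  apply/measurable_EFinP; apply: measurable_funM => //.
  exact: (measurableT_comp measurable_norm2 (measurable_vec _ _)).
have D0 j u : (0 <= D j u)%E by rewrite lee_fin mulr_ge0// ?sqr_ge0// exprn_ge0.
pose G u := (\sum_(j <oo) D j u)%E.
have mG : measurable_fun [set: measurableTypeR R] G by apply: ge0_emeasurable_sum.
have G0 u : (0 <= G u)%E by apply: nneseries_ge0 => j _ _.
have iG : (\int[U]_u G u < +oo)%E.
  rewrite /G integral_nneseries//.
  apply: (@le_lt_trans _ _ (\sum_(j <oo) (4 * expR 2^-1 * 2^-1 ^+ j)%:E)%E).
    apply: lee_nneseries => [j _ _|j _]; first exact: integral_ge0.
    rewrite /D; under eq_integral do rewrite EFinM.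
    rewrite ge0_integralZl//; last first.
      apply/measurable_EFinP.
      exact: (measurableT_comp measurable_norm2 (measurable_vec _ _)).
    apply: (@le_trans _ _ ((4 ^+ j)%:E * (4 * expR 2^-1 * 8^-1 ^+ j)%:E)%E).
      apply: lee_pmul; rewrite ?lee_fin ?exprn_ge0//.
        by apply: integral_ge0 => u _; rewrite lee_fin sqr_ge0.
      apply: le_trans (vec_norm2 _ _) _; rewrite lee_fin ler_wpM2l ?mulr_ge0 ?expR_ge0//.
    rewrite -EFinM lee_fin mulrCA -exprMn.
    by have -> : 4 * 8^-1 = 2^-1 :> R by lra.
  set c := 4 * expR 2^-1; have c0 : 0 <= c by rewrite mulr_ge0// expR_ge0.
  have c2 j : 0 <= c * 2^-1 ^+ j by rewrite mulr_ge0// exprn_ge0// invr_ge0.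
  apply: (@le_lt_trans _ _ (2 * c)%:E); last exact: ltry.
  apply: lime_le; first by apply: is_cvg_nneseries => j _ _; rewrite lee_fin.
  apply: nearW => n; rewrite sumEFin lee_fin.
  have -> : \sum_(0 <= j < n) c * 2^-1 ^+ j = 2 * c * (1 - 2^-1 ^+ n).
    elim: n => [|n ih]; first by rewrite big_nil expr0 subrr mulr0.
    by rewrite big_nat_recr//= ih exprS; lra.
  by rewrite ler_piMr ?mulr_ge0// gerBl exprn_ge0// invr_ge0.
have [mA PA] := ge0_finite_ae mG G0 iG.
set A := [set u | _] in mA PA.
have cA u : A u -> cvgn (fun j => vec (m j) v u : X).
  move=> Au.
  have K0 : 0 <= fine (G u) by rewrite fine_ge0.
  have le j : `|vec (m j.+1) (w j) u : X| <= Num.sqrt (fine (G u)) * 2^-1 ^+ j.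
    have DG : (D j u <= G u)%E.
      apply: le_trans (nneseries_lim_ge j.+1 _) => //.
      rewrite big_nat_recr//= leeDr//; apply: sume_ge0 => i _; exact: D0.
    rewrite -[leLHS]ger0_norm// -sqrtr_sqr -[X in _ * X]ger0_norm ?exprn_ge0 ?invr_ge0//.
    rewrite -sqrtr_sqr -sqrtrM// ler_sqrt ?mulr_ge0 ?sqr_ge0//.
    have : 4 ^+ j * `|vec (m j.+1) (w j) u : X| ^+ 2 <= fine (G u).
      by rewrite -lee_fin fineK ?ge0_fin_numE.
    rewrite -exprM mulnC exprM.
    rewrite mulrC -ler_pdivlMr ?exprn_gt0// => /le_trans; apply.
    rewrite -exprVn ler_wpM2l// -[4^-1](_ : 2^-1 ^+ 2 = _) ?lexx//.
    by rewrite exprVn; congr (_^-1); ring.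
  have /normed_cvg cs : cvgn [normed series (fun j => vec (m j.+1) (w j) u : X)].
    apply: (@series_le_cvg _ _ (geometric (Num.sqrt (fine (G u))) 2^-1)) => [j|j|j|]; [exact: normr_ge0| |exact: le|].
      by rewrite /= mulr_ge0// exprn_ge0// invr_ge0.
    by apply: is_cvg_geometric_series; rewrite ger0_norm ?invr_ge0// invf_lt1// ltr1n.
  have -> : (fun j => vec (m j) v u : X) = (fun j => (vec (m 0%N) v u : X) + series (fun j => vec (m j.+1) (w j) u : X) j).
    apply/funext => j; rewrite /series/=; elim: j => [|j ih]; first by rewrite big_nil addr0.
    by rewrite big_nat_recr//= addrA -ih wE addrC subrK.
  by apply: is_cvgD => //; exact: is_cvg_cst.
pose Y (u : measurableTypeR R) : borel X := if u \in A then limn (fun j => vec (m j) v u : X) else 0.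
have cY u : A u -> forall h : X, \sum_(k < m j) inner (v k) h * gauss_seq k u @[j --> \oo] --> inner (Y u : X) h.
  move=> Au h; under eq_fun do rewrite -inner_vec.
  by rewrite /Y mem_set//; apply: cvg_innerl; exact: cA.
exists Y, A, m; split => //.
apply: measurable_to_borel => // h.
apply: (@measurable_fun_cvg _ _ _ _ (fun j u => \1_A u * inner (vec (m j) v u : X) h)).
  by move=> j; apply: measurable_funM => //; exact: measurable_indic.
move=> u _; have [Au|Au] := pselect (A u).
  rewrite indicE mem_set//; under eq_fun do rewrite mul1r inner_vec; exact: cY.
rewrite indicE memNset//; under eq_fun do rewrite mul0r.
by rewrite /Y memNset// inner0l; exact: cvg_cst.
Qed.


(** With S the square root of Q, the series of the S e_k with normal coefficients has variance sum
    <S e_k, h>^2 = |S h|^2 = <Q h, h> in direction h. Any frame serves; no eigenvectors enter. *)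
Lemma gaussian0_exists (Q : X -> X) (e : nat -> X) (M : R) : frame e -> nonneg_op Q ->
  (forall n, \sum_(k < n) inner (Q (e k)) (e k) <= M) ->
  exists mu : probability (borel X) R, forall (h : X) (c : R),
    (\int[mu]_x cos (inner (x : X) h + c))%R = expR (- (inner (Q h) h / 2)) * cos c.
Proof.
move=> fe nQ QM; have [[bS sS pS] SQ] := op_sqrtP nQ; set S := op_sqrt Q in bS sS pS SQ.
have vM n : \sum_(k < n) `|S (e k)| ^+ 2 <= M.
  apply: le_trans (QM n); apply: ler_sum => k _.
  by rewrite -inner_norm sS SQ innerC.
have [Y [A [m [mY mA UA mj cY]]]] := @gaussian_series (fun k => S (e k)) M vM.
exists (push U mY) => h c.
have mh : measurable_fun [set: borel X] (fun x : borel X => inner (x : X) h + c : R).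
  by apply: measurable_funD => //; apply: functionals_measurable; exists h.
rewrite (push_int U mY (bfun_cos mh)).
have bfn n : bfun (fun u : measurableTypeR R => cos (\sum_(k < n) inner (S (e k)) h * gauss_seq k u + c)).
  by apply: bfun_cos; exact: (measurable_gauss_sum n (fun k => inner (S (e k)) h) c).
have bI : bfun (\1_A : measurableTypeR R -> R) by exact: bfun_indic.
have bg n : bfun (fun u : measurableTypeR R => \1_A u * cos (\sum_(k < n) inner (S (e k)) h * gauss_seq k u + c)).
  by apply: bfunM.
have bY : bfun (fun u : measurableTypeR R => cos (inner (Y u : X) h + c)).
  exact: (bfun_comp mY (bfun_cos mh)).
have lim1 : (\int[U]_u (\1_A u * cos (\sum_(k < m j) inner (S (e k)) h * gauss_seq k u + c)))%R
    @[j --> \oo] --> (\int[U]_u (\1_A u * cos (inner (Y u : X) h + c)))%R.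
  apply: (bint_cvg U (M := 1) _ _ _).2 => [n|n u|u]; first exact: bg.
    rewrite normrM -[leRHS]mulr1 ler_pM//; last exact: cos_max.
    by rewrite indicE ger0_norm// lern1 leq_b1.
  rewrite indicE; have [uA|uA] := boolP (u \in A).
    under eq_fun do rewrite mul1r; rewrite mul1r.
    apply: (cvg_comp _ cos); last exact: continuous_cos.
    apply: cvgD; last exact: cvg_cst.
    by apply: cY; rewrite inE in uA.
  by under eq_fun do rewrite mul0r; rewrite mul0r; exact: cvg_cst.
have -> : (\int[U]_u cos (inner (Y u : X) h + c))%R = (\int[U]_u (\1_A u * cos (inner (Y u : X) h + c)))%R.
  by apply: (bint_ae bY (bfunM bI bY) mA UA) => u Au; rewrite indicE mem_set ?mul1r.
have e1 j : (\int[U]_u (\1_A u * cos (\sum_(k < m j) inner (S (e k)) h * gauss_seq k u + c)))%R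
    = expR (- (2^-1 * \sum_(k < m j) inner (S h) (e k) ^+ 2)) * cos c.
  transitivity (\int[U]_u cos (\sum_(k < m j) inner (S (e k)) h * gauss_seq k u + c))%R.
    by apply/esym/(bint_ae (bfn _) (bg _) mA UA) => u Au; rewrite indicE mem_set ?mul1r.
  rewrite (gauss_seq_char (m j) (fun k => inner (S (e k)) h)).
  congr (expR (- _) * _); rewrite mulr_sumr; apply: eq_bigr => k _.
  by rewrite sS innerC mulrC.
apply: (cvgn_unique lim1); under eq_fun do rewrite e1.
apply: cvgM; last exact: cvg_cst.
apply: (cvg_comp _ expR); last exact: continuous_expR.
apply: cvgN.
have -> : inner (Q h) h / 2 = 2^-1 * `|S h| ^+ 2 by rewrite -inner_norm sS SQ innerC mulrC.
apply: cvgM; first exact: cvg_cst.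
have := @frame_parseval _ _ _ fe (S h) => /cvgrPdist_le cP.
apply/cvgrPdist_le => eps eps0; have [N _ NP] := cP eps eps0.
exists N => // j /= Nj; apply: NP => /=.
by apply: leq_trans Nj _; exact: mj.
Qed.

Lemma char_unique (mu nu : probability (borel X) R) :
  (forall (h : X) c, (\int[mu]_x cos (inner (x : X) h + c) = \int[nu]_x cos (inner (x : X) h + c))%R) ->
  forall E, measurable E -> mu E = nu E.
Proof.
move=> h; apply: (trig_unique functionals_linear functionals_measurable (functionals_gen sX)).
by move=> _ c [k ->]; exact: h.
Qed.

Lemma measurable_inner (h : X) : measurable_fun [set: borel X] (fun x : borel X => inner (x : X) h : measurableTypeR R).
Proof. by apply: functionals_measurable; exists h. Qed.

Lemma bfun_cos_inner (h : X) c : bfun (fun x : borel X => cos (inner (x : X) h + c)).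
Proof. by apply: bfun_cos; apply: measurable_funD => //; exact: measurable_inner. Qed.

Lemma measurable_translate (a : X) : measurable_fun [set: borel X] (fun x : borel X => (x : X) + a : borel X).
Proof.
apply: measurable_to_borel => // h; under eq_fun do rewrite innerDl.
by apply: measurable_funD => //; exact: measurable_inner.
Qed.

(** Translates between the one-dimensional marginals of the definition and characteristic functions,
    with which all later comparisons of laws are made. *)
Lemma is_gaussian_char (mu : probability (borel X) R) a (Q : X -> X) : nonneg_op Q ->
  is_gaussian mu a Q <-> forall (h : X) (c : R),
    (\int[mu]_x cos (inner (x : X) h + c))%R = expR (- (inner (Q h) h / 2)) * cos (inner a h + c).
Proof.
move=> [[lQ _] _ Q0]; split => [gmu h c|cmu h A mA].
  have := push_int mu (measurable_inner h) (bfun_cos (measurable_affine 1 c)).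
  have := @gaussian1_char R (inner a h) (inner (Q h) h) 1 c (push mu (measurable_inner h)) (Q0 h).
  rewrite expr1n !mul1r => <- // => [->|B mB]; last exact: gmu.
  by apply: eq_Rintegral => x _; rewrite mul1r.
have [nu nuE] : exists nu : probability (measurableTypeR R) R, forall B, measurable B ->
    nu B = gaussian1 (inner a h) (inner (Q h) h) B.
  rewrite /gaussian1; case: eqP => _; last by exists (normal_prob (inner a h) (Num.sqrt (inner (Q h) h))).
  by exists (\d_(inner a h : measurableTypeR R) : probability _ _).
rewrite -nuE// -[LHS]/(push mu (measurable_inner h) A).
apply: (trig_unique (@lines_linear R) (@lines_measurable R) (@lines_gen R)) => // phi c [t ->].
rewrite (gaussian1_char t c (Q0 h) nuE).
rewrite (push_int mu (measurable_inner h) (bfun_cos (measurable_affine t c))).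
transitivity (\int[mu]_x cos (inner (x : X) (t *: h) + c))%R.
  by apply: eq_Rintegral => x _; rewrite innerZr.
rewrite cmu innerZr (lin_Z _ _ lQ) innerZl innerZr mulrA -expr2//.
Qed.

Lemma gaussianP (a : X) (Q : X -> X) (e : nat -> X) (M : R) : frame e -> nonneg_op Q ->
  (forall n, \sum_(k < n) inner (Q (e k)) (e k) <= M) ->
  is_gaussian (gaussian a Q) a Q.
Proof.
move=> fe nQ QM; rewrite /gaussian; case: xgetP => [mu -> //|noG].
have [mu0 mu0E] := gaussian0_exists fe nQ QM.
exfalso; apply: (noG (push mu0 (measurable_translate a))).
apply/is_gaussian_char => // h c.
rewrite (push_int mu0 (measurable_translate a) (bfun_cos_inner h c)) -mu0E.
by apply: eq_Rintegral => x _; rewrite innerDl addrA.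
Qed.

End gaussian_vector.

(** * Covariance operators *)

Section pettis.
Context {R : realType} {X : hilbertType R}.
Notation mu := (@lebesgue_measure R).

(* A factorization F(r) = W(r)^* W(r) makes the weak integral of F exist as
   soon as the quadratic form \int |W(r) x|^2 dr is bounded. *)
Lemma op_integral_square (D : set R) (F W : R -> X -> X) (M : R) :
  measurable D -> (forall r, D r -> linear (W r)) ->
  (forall r, D r -> forall x y, inner (F r x) y = inner (W r x) (W r y)) ->
  (forall x y, measurable_fun D (fun r => inner (W r x) (W r y))) ->
  (forall x, (\int[mu]_(r in D) (`|W r x| ^+ 2)%:E <= (M * `|x| ^+ 2)%:E)%E) ->
  nonneg_op (op_integral D F) /\ forall x y,
    mu.-integrable D (fun r => (inner (F r x) y)%:E) /\
    inner (op_integral D F x) y = Rintegral mu D (fun r => inner (F r x) y).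
Proof.
move=> mD lW FW mW WM.
have FWe x y : {in D, (fun r => (inner (F r x) y)%:E) =1 (fun r => (inner (W r x) (W r y))%:E)}.
  by move=> r /set_mem Dr; rewrite FW.
have mW2 x : measurable_fun D (fun r => `|W r x| ^+ 2).
  by have := mW x x; under eq_fun do rewrite inner_norm.
have iW2 x : mu.-integrable D (fun r => (`|W r x| ^+ 2)%:E).
  apply/integrableP; split; first by apply/measurable_EFinP; exact: mW2.
  under eq_integral do rewrite gee0_abs ?lee_fin ?sqr_ge0//.
  by apply: le_lt_trans (WM x) _; exact: ltry.
have iW x y : mu.-integrable D (EFin \o (fun r => inner (W r x) (W r y))).
  apply: (@le_integrable _ _ _ _ _ (mD : measurable (D : set (measurableTypeR R))) _ (fun r => (`|W r x| ^+ 2)%:E + (`|W r y| ^+ 2)%:E)%E).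
  - by apply/measurable_EFinP; exact: mW.
  - move=> r Dr; rewrite /= lee_fin [leRHS]ger0_norm ?addr_ge0 ?sqr_ge0//.
    apply: (le_trans (cauchy_schwarz _ _)).
    have := sqr_ge0 (`|W r x| - `|W r y|); have := sqr_ge0 (`|W r x|); have := sqr_ge0 (`|W r y|).
    rewrite !expr2; nra.
  - exact: integrableD.
have iF x y : mu.-integrable D (fun r => (inner (F r x) y)%:E).
  apply: (eq_integrable (mD : measurable (D : set (measurableTypeR R))) (EFin \o (fun r => inner (W r x) (W r y)))) => //.
  by move=> r Dr; rewrite FWe.
pose b x y := Rintegral mu D (fun r => inner (W r x) (W r y)).
have bC x y : b x y = b y x by apply: eq_Rintegral => r _; rewrite innerC.
have bD x y z : b (x + y) z = b x z + b y z.
  rewrite /b -RintegralD//; apply: eq_Rintegral => r /set_mem Dr.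
  by rewrite (lin_D _ _ (lW r Dr)) innerDl.
have bZ a x y : b (a *: x) y = a * b x y.
  rewrite /b -RintegralZl//; apply: eq_Rintegral => r /set_mem Dr.
  by rewrite (lin_Z _ _ (lW r Dr)) innerZl.
have b0 x : 0 <= b x x by apply: Rintegral_ge0 => r Dr; exact: inner_ge0.
have M0 x : b x x <= Num.max M 0 * `|x| ^+ 2.
  apply: (@le_trans _ _ (M * `|x| ^+ 2)); last by rewrite ler_wpM2r ?sqr_ge0// le_max lexx.
  rewrite -lee_fin; apply: le_trans (WM x).
  rewrite /b /Rintegral fineK; last exact: (integrable_fin_num (mD : measurable (D : set (measurableTypeR R))) (iW x x)).
  by under eq_integral do rewrite inner_norm.
set K := Num.max M 0 in M0; have K0 : 0 <= K by rewrite le_max lexx orbT.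
have bK x y : `|b x y| <= (K * `|x|) * `|y|.
  rewrite -(@ler_pXn2r _ 2)// ?nnegrE ?mulr_ge0// real_normK ?num_real//.
  apply: (le_trans (form_cauchy_schwarz bC bD bZ b0 x y)).
  have -> : (K * `|x| * `|y|) ^+ 2 = (K * `|x| ^+ 2) * (K * `|y| ^+ 2) by ring.
  by apply: ler_pM.
have /choice[S SP] x : exists S, (forall y, inner S y = b x y) /\ `|S| <= K * `|x|.
  have [|||S h1 h2] := @riesz _ _ (b x) (K * `|x|).
  - by move=> a y z; rewrite bC bD bZ !(bC _ x).
  - by rewrite mulr_ge0.
  - by move=> y; exact: bK.
  by exists S.
have bS : bounded_op S.
  apply: (@bounded_opI _ _ _ K); last by move=> x; have [] := SP x.
  move=> a x y; apply: inner_ext => z.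
  by rewrite innerDl innerZl !(SP _).1 bD bZ.
have bE x y : b x y = Rintegral mu D (fun r => inner (F r x) y).
  by apply: eq_Rintegral => r /set_mem Dr; rewrite FW.
have h : bounded_op (op_integral D F) /\ forall x y,
    mu.-integrable D (fun r => (inner (F r x) y)%:E) /\
    inner (op_integral D F x) y = Rintegral mu D (fun r => inner (F r x) y).
  rewrite /op_integral; case: xgetP => [S' -> //|/(_ S)[]].
  by split => // x y; split => //; rewrite (SP x).1.
split; last exact: h.2.
split; first exact: h.1.
- by move=> x y; rewrite (h.2 x y).2 innerC (h.2 y x).2 -!bE bC.
- by move=> x; rewrite (h.2 x x).2 -bE.
Qed.

End pettis.

(** * The covariance over a bounded interval *)

Section evolution.
Context {R : realType} {X : hilbertType R}.
Variables (U : R -> R -> X -> X) (B : R -> X -> X).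
Hypotheses (sX : separable X) (sU : strongly_continuous_evolution U) (bB : bounded_measurable_family B).
Notation mu := (@lebesgue_measure R).

Let bU s t : s <= t -> bounded_op (U t s).
Proof. by have [h _ _ _] := sU; exact: h. Qed.

Let bBt t : bounded_op (B t).
Proof. by have [h _ _] := bB. Qed.

Lemma evolution_within t x : {within `]-oo, t]%classic, continuous (fun r => U t r x)}.
Proof.
have [_ cU _ _] := sU.
apply/subspace_continuousP => r /=; rewrite in_itv/= => rt.
have /subspace_continuousP := cU x => /(_ (r, t) rt) h.
move=> V /h; rewrite /nbhs/= => -[[P Q] [/= Pr Qt] PQ].
have Qtt : Q t by exact: nbhs_singleton Qt.
rewrite /within/=; near=> r'; rewrite in_itv/= => r't.
by apply: (PQ (r', t)) => //; split => //=; near: r'.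
Unshelve. all: by end_near. Qed.

Lemma measurable_inner_evolution (t : R) x y : measurable_fun (`]-oo, t]%classic : set R) (fun r => inner (U t r x) y).
Proof.
apply: subspace_continuous_measurable_fun => //.
apply/subspace_continuousP => r rt; apply: cvg_innerl.
by have /subspace_continuousP := @evolution_within t x; exact.
Qed.

(** W(t,r) = B(r)^* U(t,r)^*, the factor for which the covariance integrand is W^* W. *)
Definition half_integrand t r x := adjoint (B r) (adjoint (U t r) x).

Let W := half_integrand.

Lemma half_integrand_linear t r : r <= t -> linear (W t r).
Proof.
move=> rt a x y; rewrite /W/half_integrand (adjoint_linear (bU rt)).
by rewrite (adjoint_linear (bBt r)).
Qed.

Lemma cov_integrandE t r x y : r <= t -> inner (cov_integrand U B t r x) y = inner (W t r x) (W t r y).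
Proof.
move=> rt; rewrite /cov_integrand/noise_cov/=.
by rewrite (adjointP (bU rt)) (adjointP (bBt r)).
Qed.

(** The assumptions concern B(r) z and U(t,r) z, not the adjoints. So <W z, z'> is rewritten as
    <U(t,r) B(r) z', z>, and B(r) z' is expanded in a frame to separate the two factors. *)
Lemma measurable_half_integrand (t : R) x y : measurable_fun (`]-oo, t]%classic : set R) (fun r => inner (W t r x) (W t r y)).
Proof.
have [e [fe _]] := frame_trace sX; have [_ _ mB] := bB.
have m1 z z' : measurable_fun (`]-oo, t]%classic : set R) (fun r => inner (W t r z) z').
  apply: (@measurable_fun_cvg _ _ _ _ (fun n r => \sum_(k < n) inner (B r z') (e k) * inner (U t r (e k)) z)).
    move=> n; apply: measurable_sum => k; apply: measurable_funM; last exact: measurable_inner_evolution.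
    have mi : measurable_fun [set: borel X] (fun x : borel X => inner (x : X) (e k) : R).
      by apply: functionals_measurable; exists (e k).
    by apply: measurable_funTS; exact: (measurableT_comp mi (mB z').2).
  move=> r; rewrite /= in_itv/= => rt.
  rewrite /W/half_integrand (adjointPr (bBt r)) (adjointPr (bU rt)) innerC.
  have cUr := (bU rt).2 (B r z').
  have := @frame_expansion _ _ _ fe (B r z') => /(continuous_cvg _ cUr) h.
  have -> : (fun n => \sum_(k < n) inner (B r z') (e k) * inner (U t r (e k)) z) =
      (fun n => inner (U t r (\sum_(k < n) inner (B r z') (e k) *: e k)) z).
    apply/funext => n; rewrite (lin_sum _ _ _ (bU rt).1) inner_suml; apply: eq_bigr => k _.
    by rewrite (lin_Z _ _ (bU rt).1) innerZl.
  exact: (@cvg_innerl _ _ _ _ _ _ _ z h).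
apply: (@measurable_fun_cvg _ _ _ _ (fun n r => \sum_(k < n) inner (W t r x) (e k) * inner (W t r y) (e k))).
  by move=> n; apply: measurable_sum => k; apply: measurable_funM.
by move=> r _; exact: (@frame_parseval2 _ _ _ fe).
Qed.

Lemma measurable_half_norm2 (t : R) x : measurable_fun (`]-oo, t]%classic : set R) (fun r => `|half_integrand t r x| ^+ 2).
Proof.
have := @measurable_half_integrand t x x.
by congr measurable_fun; apply/funext => r; rewrite inner_norm.
Qed.

(** For fixed x, continuity in r bounds U(t,r) x on the compact interval; Banach-Steinhaus makes the
    bound uniform in x. *)
Lemma evolution_bounded s t : exists2 M, 0 <= M & forall r x, s <= r <= t -> `|U t r x| <= M * `|x|.
Proof.
have [st|ts] := leP s t; last first.
  exists 0 => // r x /andP[sr rt]; have := le_lt_trans (le_trans sr rt) ts.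
  by rewrite ltxx.
pose F : set (X -> X) := [set f | exists2 r, s <= r <= t & f = U t r].
have [||M MP] := @Banach_Steinhauss R X X F _ _ 1.
- move=> _ [r /andP[sr rt] ->]; split; last exact: (bU rt).1.
  have [c c0 Uc] := bounded_op_bound (bU rt) => a; exists (c * a) => x xa.
  by rewrite (le_trans (Uc x))// ler_wpM2l.
- move=> x; have [|c _ cP] := @EVT_max R (fun r => `|U t r x|) s t st.
    apply: continuous_subspaceW (_ : `[s, t] `<=` `]-oo, t]) _.
      by move=> r /=; rewrite !in_itv/= => /andP[].
    apply/subspace_continuousP => r rt; apply: cvg_norm.
    by have /subspace_continuousP := @evolution_within t x; exact.
  exists `|U t c x| => _ [r rst ->]; apply: cP.
  by rewrite in_itv.
exists (Num.max M 0) => [|r x /[dup] /andP[sr rt] rst]; first by rewrite le_max lexx orbT.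
have [->|x0] := eqVneq x 0.
  by rewrite (lin_0 (bU rt).1) normr0 mulr0.
have nx : 0 < `|x| by rewrite normr_gt0.
have := MP (U t r) (ex_intro2 _ _ r rst erefl) (`|x|^-1 *: x) _.
rewrite (lin_Z _ _ (bU rt).1) !normrZ normfV normr_id mulVf ?normr_eq0// => /(_ (lexx _)).
rewrite mulrC ler_pdivrMr// => h; apply: le_trans h _.
by rewrite ler_wpM2r// le_max lexx.
Qed.

Lemma noise_bounded : exists2 b, 0 <= b & forall r x, `|B r x| <= b * `|x|.
Proof.
have [_ sB _] := bB.
set S := ereal_sup _ in sB.
have nB r x : `|x| <= 1 -> (`|B r x|%:E <= S)%E.
  move=> x1; apply: (@le_trans _ _ (opnorm (B r))); last by apply: ereal_sup_ubound; exists r.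
  by apply: ereal_sup_ubound; exists x.
have S0 : (0 <= S)%E.
  by apply: le_trans (nB 0 0 _); rewrite ?lee_fin ?normr0.
have fS : S \is a fin_num by rewrite ge0_fin_numE.
exists (fine S) => [|r x]; first exact: fine_ge0.
have [->|x0] := eqVneq x 0; first by rewrite (lin_0 (bBt r).1) normr0 mulr0.
have nx : 0 < `|x| by rewrite normr_gt0.
have := nB r (`|x|^-1 *: x).
rewrite (lin_Z _ _ (bBt r).1) !normrZ normfV normr_id mulVf ?normr_eq0// => /(_ (lexx _)).
by rewrite -[S]fineK// lee_fin mulrC ler_pdivrMr.
Qed.


Let mE (t : R) (D : set R) : D `<=` `]-oo, t]%classic -> measurable D -> forall x y,
  measurable_fun D (fun r => inner (W t r x) (W t r y)).
Proof.
move=> Dt mD x y; apply: (measurable_funS _ Dt); first exact: measurable_itv.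
exact: measurable_half_integrand.
Qed.

Lemma Qcov_spec s t : nonneg_op (Qcov U B t s) /\ forall x y,
  mu.-integrable `[s, t] (fun r => (inner (cov_integrand U B t r x) y)%:E) /\
  inner (Qcov U B t s x) y = Rintegral mu `[s, t] (fun r => inner (cov_integrand U B t r x) y).
Proof.
have [M M0 UM] := evolution_bounded s t; have [b b0 Bb] := noise_bounded.
have st : `[s, t]%classic `<=` `]-oo, t]%classic.
  by move=> r /=; rewrite !in_itv/= => /andP[].
apply: (@op_integral_square _ _ _ _ (W t) ((b * M) ^+ 2 * (Num.max (t - s) 0))) => //.
- by move=> r /st; rewrite /= in_itv/= => /half_integrand_linear.
- by move=> r /st; rewrite /= in_itv/= => rt x y; exact: cov_integrandE.
- exact: mE.
move=> x; apply: (@le_trans _ _ (\int[mu]_(r in `[s, t]) cst ((b * M * `|x|) ^+ 2)%:E r)%E).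
  apply: ge0_le_integral => //=.
  - by apply/measurable_EFinP; apply: (measurable_funS _ st); [exact: measurable_itv|exact: measurable_half_norm2].
  - move=> r; rewrite in_itv/= => /andP[sr rt]; rewrite lee_fin ler_pXn2r ?nnegrE ?mulr_ge0//.
    have bA : bounded_op (U t r) by exact: bU.
    rewrite /W/half_integrand -mulrA (le_trans (adjoint_bound (bBt r) b0 (Bb r) _))// ler_wpM2l//.
    by apply: (adjoint_bound bA M0) => y; apply: UM; rewrite sr.
rewrite integral_cst//= lebesgue_measure_itv/= lte_fin.
have -> : (b * M) ^+ 2 * Num.max (t - s) 0 * `|x| ^+ 2 = (b * M * `|x|) ^+ 2 * Num.max (t - s) 0 by ring.
case: ifP => st'; last by rewrite mule0 lee_fin mulr_ge0 ?sqr_ge0// le_max lexx orbT.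
by rewrite -EFinB -EFinM lee_fin ler_wpM2l ?sqr_ge0// le_max lexx.
Qed.

Lemma Qcov_form s t x :
  (\int[mu]_(r in `[s, t]) (`|W t r x| ^+ 2)%:E)%E = (inner (Qcov U B t s x) x)%:E.
Proof.
have [_ /(_ x x)[i ->]] := Qcov_spec s t.
rewrite /Rintegral fineK; last exact: (integrable_fin_num _ i).
apply: eq_integral => r; rewrite inE/= in_itv/= => /andP[sr rt].
by rewrite cov_integrandE// inner_norm.
Qed.

End evolution.

(** With S the root of Q, <Q x, x> = sum <x, S e_k>^2 <= |x|^2 sum |S e_k|^2. Trace bounds uniform
    in s thus bound the forms uniformly, which lets the integral down to -oo exist. *)
Lemma form_le_trace {R : realType} {X : hilbertType R} (e : nat -> X) (Q : X -> X) (M : R) :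
  frame e -> nonneg_op Q -> (forall n, \sum_(k < n) inner (Q (e k)) (e k) <= M) ->
  forall x, inner (Q x) x <= M * `|x| ^+ 2.
Proof.
move=> fe nQ QM x; have [[_ sS _] SQ] := op_sqrtP nQ; set S := op_sqrt Q in sS SQ.
rewrite -SQ sS inner_norm.
apply: (ler_cvg_to (@frame_parseval _ _ _ fe (S x)) (cvg_cst _)).
apply: nearW => n; apply: (@le_trans _ _ (\sum_(k < n) inner (Q (e k)) (e k) * `|x| ^+ 2)); last first.
  by rewrite -mulr_suml ler_wpM2r ?sqr_ge0.
apply: ler_sum => k _; rewrite sS -[inner x _ ^+ 2](real_normK (num_real _)).
rewrite -SQ sS inner_norm -exprMn ler_pXn2r ?nnegrE ?mulr_ge0//.
by rewrite mulrC cauchy_schwarz.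
Qed.

(** * The covariance of the invariant measures *)

Section stationary.
Context {R : realType} {X : hilbertType R}.
Variables (U : R -> R -> X -> X) (B : R -> X -> X).
Hypotheses (sX : separable X) (sU : strongly_continuous_evolution U) (bB : bounded_measurable_family B).
Hypotheses (tU : finite_trace U B) (stU : stability U B).
Notation mu := (@lebesgue_measure R).
Variable e : nat -> X.
Hypotheses (fe : frame e)
  (trE : forall Q : X -> X, linear Q -> (forall x, 0 <= inner (Q x) x) ->
    forall n, ((\sum_(k < n) inner (Q (e k)) (e k))%:E <= trace Q)%E).

Lemma Qcov_trace t : exists M, forall s, s < t -> forall n,
  \sum_(k < n) inner (Qcov U B t s (e k)) (e k) <= M.
Proof.
have [/(_ t) sup _] := stU; set S := ereal_sup _ in sup.
have bnd s : s < t -> forall n, ((\sum_(k < n) inner (Qcov U B t s (e k)) (e k))%:E <= S)%E.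
  move=> st n; have [[[lQ _] _ pQ] _] := Qcov_spec sX sU bB s t.
  apply: le_trans (trE lQ pQ n) _; apply: ereal_sup_ubound.
  by exists s => //=; rewrite in_itv.
have S0 : (0 <= S)%E by apply: le_trans (bnd (t - 1) _ 0%N); rewrite ?big_ord0// gtrBl.
exists (fine S) => s st n; rewrite -lee_fin fineK ?ge0_fin_numE//.
exact: bnd.
Qed.

Let W t r x := half_integrand U B t r x.

Let itvNy_bigcup (t : R) : `]-oo, t]%classic = \bigcup_n `[t - n.+1%:R, t]%classic :> set R.
Proof.
apply/seteqP; split => r /=; last by move=> [n _ /=]; rewrite !in_itv/= => /andP[].
rewrite in_itv/= => rt; exists (Num.bound (t - r)) => //=; rewrite in_itv/= rt andbT.
rewrite lerBlDr -lerBlDl (le_trans (ltW (archi_boundP _)))//; first by rewrite subr_ge0.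
by rewrite ler_nat.
Qed.

Lemma Qcov_cvg t x : (inner (Qcov U B t (t - n.+1%:R) x) x)%:E @[n --> \oo] -->
  (\int[mu]_(r in `]-oo, t]) (`|W t r x| ^+ 2)%:E)%E.
Proof.
rewrite itvNy_bigcup; under eq_fun do rewrite -(Qcov_form sX sU bB).
apply: ge0_nondecreasing_set_cvg_integral => //.
- move=> n m nm; rewrite subsetEset => r /=; rewrite !in_itv/= => /andP[nr ->].
  by rewrite andbT (le_trans _ nr)// lerB// ler_nat ltnS.
- move=> n; apply: (@measurable_funS _ _ _ _ (`]-oo, t]%classic : set R)) => //.
    by move=> r /=; rewrite !in_itv/= => /andP[].
  by apply/measurable_EFinP; exact: (@measurable_half_norm2 _ _ _ _ sX sU bB t x).
Qed.

(** Bounds for [Qcov] over [t - n - 1, t] are uniform in n and pass to the half-line by monotone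
    convergence, first for the form and then for the partial traces. *)
Lemma Qinf_spec t : [/\ nonneg_op (Qinf U B t),
  (forall x, (\int[mu]_(r in `]-oo, t]) (`|W t r x| ^+ 2)%:E)%E = (inner (Qinf U B t x) x)%:E) &
  exists M, forall n, \sum_(k < n) inner (Qinf U B t (e k)) (e k) <= M].
Proof.
have [M QM] := Qcov_trace t.
have qM n x : inner (Qcov U B t (t - n.+1%:R) x) x <= M * `|x| ^+ 2.
  have [nQ _] := Qcov_spec sX sU bB (t - n.+1%:R) t.
  by apply: (form_le_trace fe nQ); apply: QM; rewrite gtrBl.
have [nQ QE] : nonneg_op (Qinf U B t) /\ forall x y,
    mu.-integrable `]-oo, t] (fun r => (inner (cov_integrand U B t r x) y)%:E) /\
    inner (Qinf U B t x) y = Rintegral mu `]-oo, t] (fun r => inner (cov_integrand U B t r x) y).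
  apply: (@op_integral_square _ _ _ _ (W t) M) => //.
  - by move=> r; rewrite /= in_itv/= => /(half_integrand_linear sU bB).
  - by move=> r; rewrite /= in_itv/= => rt x y; exact: cov_integrandE.
  - exact: measurable_half_integrand.
  - move=> x; rewrite -(cvg_lim _ (@Qcov_cvg t x))//; apply: lime_le.
      by apply/cvg_ex; eexists; exact: (@Qcov_cvg t x).
    by apply: nearW => n; rewrite lee_fin.
have form x : (\int[mu]_(r in `]-oo, t]) (`|W t r x| ^+ 2)%:E)%E = (inner (Qinf U B t x) x)%:E.
  have [i ->] := QE x x.
  rewrite /Rintegral fineK; last exact: (integrable_fin_num _ i).
  apply: eq_integral => r; rewrite inE/= in_itv/= => rt.
  by rewrite cov_integrandE// inner_norm.
split => //; exists M => n.
have h : \sum_(k < n) inner (Qcov U B t (t - j.+1%:R) (e k)) (e k) @[j --> \oo] -->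
    \sum_(k < n) inner (Qinf U B t (e k)) (e k).
  elim: n => [|n ih].
    by under eq_fun do rewrite big_ord0; rewrite big_ord0; exact: cvg_cst.
  under eq_fun do rewrite big_ord_recr/=; rewrite big_ord_recr/=; apply: cvgD => //.
  by have := @Qcov_cvg t (e n); rewrite form => /fine_cvgP[].
apply: (ler_cvg_to h (cvg_cst M)).
by apply: nearW => j; apply: QM; rewrite gtrBl.
Qed.

(** The integral is cut at s; below s the relation U(t,r) = U(t,s) U(s,r) carries the adjoint of
    U(t,s) onto x. *)
Lemma Qinf_split s t x : s <= t -> inner (Qinf U B t x) x =
  inner (Qcov U B t s x) x + inner (Qinf U B s (adjoint (U t s) x)) (adjoint (U t s) x).
Proof.
move=> st; have [_ ft _] := Qinf_spec t; have [_ fs _] := Qinf_spec s.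
apply: EFin_inj; rewrite EFinD -ft -fs -(Qcov_form sX sU bB).
have mW : measurable_fun (`]-oo, t]%classic : set R) (fun r => (`|W t r x| ^+ 2)%:E).
  by apply/measurable_EFinP; exact: (@measurable_half_norm2 _ _ _ _ sX sU bB t x).
have ts : `]-oo, t]%classic = `]-oo, s[%classic `|` `[s, t]%classic :> set R.
  apply/seteqP; split => r /=; rewrite !in_itv/=.
    by move=> rt; have [rs|sr] := ltP r s; [left|right].
  by move=> [rs|/andP[]//]; rewrite (le_trans (ltW rs)).
rewrite [X in (\int[_]_(_ in X) _)%E]ts ge0_integral_setU//; first last.
- apply/disj_setPS => r /=; rewrite !in_itv/= => -[rs /andP[sr _]].
  by move: rs; rewrite ltNge sr.
- by rewrite -ts.
rewrite addrC; congr (_ + _)%E.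
rewrite integral_itv_bndo_bndc; last first.
  by apply: (measurable_funS _ _ mW) => //; rewrite ts; left.
apply: eq_integral => r; rewrite inE/= in_itv/= => rs.
have [bU _ _ mU] := sU.
congr (`|adjoint (B r) _| ^+ 2)%:E; apply: inner_ext => y.
rewrite (adjointPr (bU _ _ (le_trans rs st))) -(mU r s t)//.
by rewrite (adjointPr (bU _ _ rs)) (adjointPr (bU _ _ st)).
Qed.

End stationary.

(** * The Cameron-Martin operator norm *)

Section range_norm.
Context {R : realType} {X : hilbertType R}.
Implicit Types S A : X -> X.

Lemma pseudo_inverseE S (w : X) : linear S -> (forall k, S k = 0 -> inner w k = 0) ->
  pseudo_inverse S (S w) = w.
Proof.
move=> lS wk; have [Sz zk] : S (pseudo_inverse S (S w)) = S w /\ forall k, S k = 0 -> inner (pseudo_inverse S (S w)) k = 0.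
  by rewrite /pseudo_inverse; case: xgetP => [z _ []|/(_ w)[]].
move: (pseudo_inverse _ _) Sz zk => z Sz zk.
have Szw : S (z - w) = 0 by rewrite (lin_B _ _ lS) Sz subrr.
apply/eqP; rewrite -subr_eq0; apply/eqP/inner_eq0.
by rewrite innerBl zk// wk// subrr.
Qed.

Lemma pseudo_inverse0 S : linear S -> pseudo_inverse S 0 = 0.
Proof.
move=> lS; rewrite -[X in pseudo_inverse _ X](lin_0 lS) pseudo_inverseE// => k _.
by rewrite inner0l.
Qed.

Variables (Rs Rt A : X -> X).
Hypotheses (lRs : linear Rs) (sRs : forall x y, inner (Rs x) y = inner x (Rs y)).
Hypotheses (lRt : linear Rt) (sRt : forall x y, inner (Rt x) y = inner x (Rt y)).
Hypothesis bA : bounded_op A.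

(* Douglas' range inclusion. *)
Let preimage_t (c : R) (a : X) : 0 <= c -> (forall k, `|Rs (adjoint A k)| <= c * `|Rt k|) ->
  exists w, [/\ Rt w = A (Rs a), forall k, Rt k = 0 -> inner w k = 0 & `|w| <= c * `|a|].
Proof.
move=> c0 cR; have [|||w [h1 h2 h3]] := @riesz_range R X Rt (fun k => inner (A (Rs a)) k) (c * `|a|) lRt.
- by move=> b x y; rewrite innerDr innerZr.
- by rewrite mulr_ge0.
- move=> k; rewrite (adjointP bA) sRs (le_trans (cauchy_schwarz _ _))//.
  by rewrite mulrAC [leRHS]mulrC ler_wpM2l.
exists w; split => //.
  by apply: inner_ext => k; rewrite sRt h1.
by move=> k Rk; apply: h3 => y; rewrite -sRt Rk inner0l.
Qed.

Let preimage_s (a : X) : exists w, Rs w = Rs a /\ forall k, Rs k = 0 -> inner w k = 0.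
Proof.
have [|||w [h1 h2 h3]] := @riesz_range R X Rs (fun k => inner (Rs a) k) `|a| lRs.
- by move=> b x y; rewrite innerDr innerZr.
- by [].
- by move=> k; rewrite sRs cauchy_schwarz.
exists w; split; first by apply: inner_ext => k; rewrite sRs h1.
by move=> k Rk; apply: h3 => y; rewrite -sRs Rk inner0l.
Qed.

(** [CM_opnorm] stated for arbitrary symmetric operators in place of the two square roots; the two
    are convertible. *)
Definition range_opnorm : \bar R :=
  ereal_sup [set (`|pseudo_inverse Rt (A h)|)%:E | h in
    [set h | range Rs h /\ `|pseudo_inverse Rs h| <= 1]].

Lemma range_opnorm_le c : 0 <= c -> (forall k, `|Rs (adjoint A k)| <= c * `|Rt k|) ->
  (range_opnorm <= c%:E)%E.
Proof.
move=> c0 cR; apply: ge_ereal_sup => _ [h [[a _ <-] hn] <-].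
rewrite lee_fin; have [w0 [wE wk0]] := preimage_s a.
move: hn; rewrite -wE (pseudo_inverseE lRs wk0) => hn.
have [w [Rw wk wn]] := preimage_t w0 c0 cR.
rewrite -Rw (pseudo_inverseE lRt wk) (le_trans wn)//.
by rewrite ler_piMr.
Qed.

Lemma range_opnorm_ge0 : (0 <= range_opnorm)%E.
Proof.
apply: ereal_sup_ubound; exists 0; last first.
  by rewrite (lin_0 bA.1) pseudo_inverse0// normr0.
split; last by rewrite pseudo_inverse0// normr0.
by exists 0 => //; exact: lin_0.
Qed.

Hypothesis Rst : forall k, `|Rs (adjoint A k)| <= `|Rt k|.

Let Rst1 k : `|Rs (adjoint A k)| <= 1 * `|Rt k|.
Proof. by rewrite mul1r. Qed.

Lemma range_opnorm_fin : range_opnorm \is a fin_num.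
Proof.
by rewrite ge0_fin_numE ?range_opnorm_ge0// (le_lt_trans (range_opnorm_le ler01 Rst1))// ltry.
Qed.

(** The supremum is tested on Rs a / |a| with a = Rs A^* k. If w is the preimage of A Rs a under Rt
    orthogonal to ker Rt, then |w| is at most the norm times |a|, while |a|^2 = <w, Rt k>. *)
Lemma range_opnorm_bound k : `|Rs (adjoint A k)| <= fine range_opnorm * `|Rt k|.
Proof.
have n0 : 0 <= fine range_opnorm by rewrite fine_ge0// range_opnorm_ge0.
have [w [Rw wk _]] := preimage_t (Rs (adjoint A k)) ler01 Rst1.
set a := Rs (adjoint A k) in Rw *.
have [a0|a0] := eqVneq a 0; first by rewrite a0 normr0 mulr_ge0.
have na : 0 < `|a| by rewrite normr_gt0.
have h1 : `|w| <= fine range_opnorm * `|a|.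
  rewrite -ler_pdivrMr// -lee_fin fineK ?range_opnorm_fin//; apply: ereal_sup_ubound.
  exists (Rs (`|a|^-1 *: a)); last first.
    rewrite (lin_Z _ _ lRs) (lin_Z _ _ bA.1) -Rw -(lin_Z _ _ lRt) pseudo_inverseE//.
      by rewrite normrZ normfV normr_id mulrC.
    by move=> j Rj; rewrite innerZl wk// mulr0.
  split; first by exists (`|a|^-1 *: a).
  have ak j : Rs j = 0 -> inner (`|a|^-1 *: a) j = 0.
    by move=> Rj; rewrite innerZl /a sRs Rj inner0r mulr0.
  by rewrite (pseudo_inverseE lRs ak) normrZ normfV normr_id mulVf// normr_eq0.
have h2 : `|a| ^+ 2 <= `|w| * `|Rt k|.
  have -> : `|a| ^+ 2 = inner w (Rt k).
    by rewrite -sRt Rw (adjointP bA) sRs inner_norm.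
  exact: le_trans (ler_norm _) (cauchy_schwarz _ _).
rewrite -(ler_pM2r na) -expr2 (le_trans h2)//.
by rewrite mulrAC ler_wpM2r.
Qed.

Lemma range_opnorm_sup c : 0 <= c -> c < fine range_opnorm ->
  exists k, c * `|Rt k| < `|Rs (adjoint A k)|.
Proof.
move=> c0 cn; apply: contrapT => h.
have : (range_opnorm <= c%:E)%E.
  apply: range_opnorm_le => // k; rewrite leNgt; apply/negP => hk.
  by apply: h; exists k.
by rewrite -[X in (X <= _)%E]fineK ?range_opnorm_fin// lee_fin leNgt cn.
Qed.

End range_norm.

Lemma sqrt_norm {R : realType} {X : hilbertType R} (Q : X -> X) : nonneg_op Q ->
  forall x, `|op_sqrt Q x| ^+ 2 = inner (Q x) x.
Proof. by move=> nQ x; have [[_ sR _] RR] := op_sqrtP nQ; rewrite -inner_norm sR RR innerC. Qed.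

Lemma CM_opnorm_spec {R : realType} {X : hilbertType R} (U : R -> R -> X -> X) (B : R -> X -> X) (s t : R) :
  nonneg_op (Qinf U B s) -> nonneg_op (Qinf U B t) -> bounded_op (U t s) ->
  (forall k, inner (Qinf U B s (adjoint (U t s) k)) (adjoint (U t s) k) <= inner (Qinf U B t k) k) ->
  exists rho : R, [/\ CM_opnorm U B t s = rho%:E, 0 <= rho,
    forall k, inner (Qinf U B s (adjoint (U t s) k)) (adjoint (U t s) k) <= rho ^+ 2 * inner (Qinf U B t k) k &
    forall c, 0 <= c -> c < rho -> exists k,
      c ^+ 2 * inner (Qinf U B t k) k < inner (Qinf U B s (adjoint (U t s) k)) (adjoint (U t s) k)].
Proof.
move=> nVs nVt bA VV; have [[bRs sRs _] _] := op_sqrtP nVs; have [[bRt sRt _] _] := op_sqrtP nVt.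
have Rst k : `|op_sqrt (Qinf U B s) (adjoint (U t s) k)| <= `|op_sqrt (Qinf U B t) k|.
  by rewrite -(@ler_pXn2r _ 2)// ?nnegrE// !sqrt_norm.
have r0 : 0 <= fine (CM_opnorm U B t s).
  by apply: fine_ge0; exact: (range_opnorm_ge0 bRs.1 bRt.1 bA).
exists (fine (CM_opnorm U B t s)); split => //.
- by rewrite fineK//; exact: (range_opnorm_fin bRs.1 sRs bRt.1 sRt bA Rst).
- move=> k; rewrite -!sqrt_norm// -exprMn ler_pXn2r ?nnegrE ?mulr_ge0//.
  exact: (range_opnorm_bound bRs.1 sRs bRt.1 sRt bA Rst).
- move=> c c0 cn; have [k hk] := range_opnorm_sup bRs.1 sRs bRt.1 sRt bA Rst c0 cn.
  by exists k; rewrite -!sqrt_norm// -exprMn ltr_pXn2r ?nnegrE ?mulr_ge0.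
Qed.

(** * The two-point inequality *)

Section taylor.
Context {R : realType}.

(** The mean value theorem in place of integration: the constant is kept rather than divided by n +
    1, so iterating it gives crude but sufficient remainders. *)
Lemma taylor_step (f df : R -> R) (K M : R) n :
  (forall x : R, is_derive x (1 : R) f (df x)) -> f 0 = 0 -> 0 <= K ->
  (forall x, `|x| <= M -> `|df x| <= K * `|x| ^+ n) ->
  forall x, `|x| <= M -> `|f x| <= K * `|x| ^+ n.+1.
Proof.
move=> fdf f0 K0 dfK x xM.
have cf : continuous f.
  by move=> y; apply/differentiable_continuous/derivable1_diffP; have [] := fdf y.
have [c cx e] : exists2 c, `|c| <= `|x| & f x = df c * x.
  have [x0|x0|->] := ltgtP x 0; last by exists 0 => //; rewrite f0 mulr0.
  - have [c ci e] := MVT x0 (fun z _ => fdf z) (continuous_subspaceT cf).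
    exists c; first by move: ci; rewrite in_itv/= => /andP[? ?]; rewrite !ltr0_norm//; lra.
    by move: e; rewrite f0 !sub0r mulrN => /oppr_inj.
  - have [c ci e] := MVT x0 (fun z _ => fdf z) (continuous_subspaceT cf).
    exists c; first by move: ci; rewrite in_itv/= => /andP[? ?]; rewrite !gtr0_norm//; lra.
    by move: e; rewrite f0 !subr0.
rewrite e normrM exprSr mulrA ler_wpM2r// (le_trans (dfK c _)) ?(le_trans cx)//.
by rewrite ler_wpM2l// lerXn2r ?nnegrE.
Qed.

Lemma sin_bound (x : R) : `|sin x| <= 1 * `|x| ^+ 1.
Proof.
apply: (taylor_step (df := cos) (M := `|x|)) => // [|y _]; first exact: sin0.
by rewrite expr0 mulr1 cos_max.
Qed.

Lemma cos_bound (x : R) : `|1 - cos x| <= 1 * `|x| ^+ 2.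
Proof.
apply: (taylor_step (f := fun x => 1 - cos x) (df := sin) (M := `|x|)) => // [y||y _]; last exact: sin_bound.
  by apply: is_derive_eq; rewrite /GRing.scale/=; ring.
by rewrite cos0 subrr.
Qed.

Lemma cos_taylor (x : R) : `|cos x - 1 + x ^+ 2 / 2| <= 1 * `|x| ^+ 4.
Proof.
apply: (taylor_step (f := fun x => cos x - 1 + x ^+ 2 / 2) (df := fun x => x - sin x) (M := `|x|)) => // [y||y _].
- by apply: is_derive_eq; rewrite /GRing.scale/=; field.
- by rewrite cos0; ring.
apply: (taylor_step (f := fun x => x - sin x) (df := fun x => 1 - cos x) (M := `|y|)) => // [|z _].
- by rewrite sin0 subrr.
- exact: cos_bound.
Qed.

Lemma expR_taylor (u : R) : 0 <= u -> `|expR (- u) - 1 + u| <= u ^+ 2.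
Proof.
move=> u0; have e1 := expR_ge1Dx (- u); have e2 := expR_ge1Dx u.
have e0 : 0 < expR (- u) by exact: expR_gt0.
have e3 : expR (- u) * (1 + u) <= 1.
  have e : expR (- u) * expR u = 1 by rewrite -expRD addNr expR0.
  by rewrite -[leRHS]e ler_wpM2l// ltW.
have e4 : expR (- u) <= 1 by rewrite -expR0 ler_expR oppr_le0.
rewrite ger0_norm; first nra.
by lra.
Qed.

Lemma expR_taylor3 (x : R) : `|x| <= 1 -> expR x <= 1 + x + x ^+ 2 / 2 + expR 1 * `|x| ^+ 3.
Proof.
have d (z : R) : is_derive z (1 : R) expR (expR z) by exact: is_derive_expR.
have E0 : 0 <= expR (1 : R) by exact: expR_ge0.
move=> x1; suff : `|expR x - 1 - x - x ^+ 2 / 2| <= expR 1 * `|x| ^+ 3.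
  by rewrite ler_norml => /andP[_]; lra.
apply: (taylor_step (f := fun x => expR x - 1 - x - x ^+ 2 / 2) (df := fun x => expR x - 1 - x) (M := 1)) => // [y||y y1].
- by apply: is_derive_eq; rewrite /GRing.scale/=; field.
- by rewrite expR0; ring.
apply: (taylor_step (f := fun x => expR x - 1 - x) (df := fun x => expR x - 1) (M := 1)) => // [z||z z1].
- by apply: is_derive_eq; rewrite /GRing.scale/=; ring.
- by rewrite expR0; ring.
apply: (taylor_step (f := fun x => expR x - 1) (df := expR) (M := 1)) => // [w||w w1].
- by apply: is_derive_eq; rewrite /GRing.scale/=; ring.
- by rewrite expR0 subrr.
by rewrite expr0 mulr1 ger0_norm ?expR_ge0// ler_expR (le_trans (ler_norm _)).
Qed.

(** The gap s - s^2/2 + s^3/3 - ln (1 + s) has derivative s^3 / (1 + s), of the sign of s, so it is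
    minimal at 0. The bound holds up to -1, where a two-sided one would fail. *)
Lemma ln_taylor (s : R) : -1 < s -> ln (1 + s) <= s - s ^+ 2 / 2 + `|s| ^+ 3.
Proof.
move=> s1; pose g (x : R) := x - x ^+ 2 / 2 + x ^+ 3 / 3 - ln (1 + x).
have dg (x : R) : -1 < x -> is_derive x (1 : R) g (x ^+ 3 / (1 + x)).
  move=> x1; have x0 : 0 < 1 + x by lra.
  have dl : is_derive x (1 : R) (fun x => ln (1 + x)) ((1 + x)^-1).
    have dln : is_derive (1 + x) (1 : R) (@ln R) ((1 + x)^-1) by exact: is_derive1_ln.
    have da : is_derive x (1 : R) (fun x : R => 1 + x) 1.
      by apply: is_derive_eq; rewrite /GRing.scale/=; ring.
    have := @is_derive1_comp R (@ln R) (fun x : R => 1 + x) x _ _ dln da.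
    by rewrite mulr1.
  by apply: is_derive_eq; rewrite /GRing.scale/=; field; rewrite gt_eqF.
have cg x : -1 < x -> {for x, continuous g}.
  by move=> x1; apply/differentiable_continuous/derivable1_diffP; have [] := dg x x1.
have g0 : g 0 = 0 by rewrite /g addr0 ln1; ring.
suff : 0 <= g s.
  have s3 : 0 <= `|s| ^+ 3 by rewrite exprn_ge0.
  by rewrite /g; have := ler_norm (s ^+ 3); rewrite normrX; lra.
have cw u v : -1 < u -> {within `[u, v], continuous g}.
  move=> u1; apply/continuous_in_subspaceT => x; rewrite inE/= in_itv/= => /andP[ux _].
  by apply: cg; apply: lt_le_trans ux.
have [s0|s0|->] := ltgtP s 0; last by rewrite g0.
- have di z : z \in `]s, 0[ -> is_derive z (1 : R) g (z ^+ 3 / (1 + z)).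
    by rewrite in_itv/= => /andP[sz _]; apply: dg; exact: lt_trans sz.
  have [c] := MVT s0 di (cw s 0 s1).
  rewrite in_itv/= g0 !sub0r => /andP[sc c0] e.
  have : g s = c ^+ 3 / (1 + c) * s by apply: oppr_inj; rewrite e mulrN.
  have c1 : 0 < 1 + c by lra.
  have h : c ^+ 3 / (1 + c) <= 0.
    by rewrite pmulr_lle0 ?invr_gt0// exprS nmulr_rle0// sqr_ge0.
  by move=> ->; rewrite mulr_le0// ltW.
- have di z : z \in `]0, s[ -> is_derive z (1 : R) g (z ^+ 3 / (1 + z)).
    by rewrite in_itv/= => /andP[z0 _]; apply: dg; exact: lt_trans z0.
  have [c] := MVT s0 di (cw 0 s (@ltrN10 R)).
  rewrite in_itv/= g0 !subr0 => /andP[c0 cs] ->.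
  have c1 : 0 <= 1 + c by lra.
  by rewrite mulr_ge0 ?(ltW s0)// divr_ge0// exprn_ge0// ltW.
Qed.

(** Factors are replaced one at a time, the others being at most 1 in absolute value. *)
Lemma prod_dist (I : Type) (r : seq I) (a b : I -> R) :
  (forall i, `|a i| <= 1) -> (forall i, `|b i| <= 1) ->
  `|\prod_(i <- r) a i - \prod_(i <- r) b i| <= \sum_(i <- r) `|a i - b i|.
Proof.
move=> a1 b1; elim: r => [|i r ih]; first by rewrite !big_nil subrr normr0.
rewrite !big_cons.
set p := \prod_(j <- r) a j in ih *; set q := \prod_(j <- r) b j in ih *.
have -> : a i * p - b i * q = (a i - b i) * p + b i * (p - q) by ring.
have p1 : `|p| <= 1.
  rewrite /p; elim: (r) => [|j r' IH]; first by rewrite big_nil normr1.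
  by rewrite big_cons normrM mulr_ile1.
rewrite (le_trans (ler_normD _ _))// !normrM lerD//; first by rewrite ler_piMr.
by rewrite (le_trans _ ih)// ler_piMl.
Qed.

End taylor.

(** * Sums of correlated signs *)

Section discrete.
Context {R : realType} {X : hilbertType R}.
Variable rho : R.
Hypothesis rho01 : 0 <= rho <= 1.
Implicit Types (F G : X -> X -> R) (l : seq (X * X)).

(* Mean of F(S, T) where (S, T) is the sum of independent (e v, e' w) over the
   pairs (v, w) in l, with e, e' signs of correlation rho. *)
Fixpoint disc l F : R :=
  if l is p :: l' then
    4^-1 * ((1 + rho) * disc l' (fun x y => F (x + p.1) (y + p.2)) +
            (1 - rho) * disc l' (fun x y => F (x + p.1) (y - p.2)) +
            (1 - rho) * disc l' (fun x y => F (x - p.1) (y + p.2)) +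
            (1 + rho) * disc l' (fun x y => F (x - p.1) (y - p.2)))
  else F 0 0.

Lemma disc_cst l (c : R) : disc l (fun _ _ => c) = c.
Proof. by elim: l => [//|p l /= ->]; lra. Qed.

Lemma discD l F G : disc l (fun x y => F x y + G x y) = disc l F + disc l G.
Proof. by elim: l F G => [//|p l ih] F G /=; rewrite !ih; ring. Qed.

Lemma discZ l (a : R) F : disc l (fun x y => a * F x y) = a * disc l F.
Proof. by elim: l F => [//|p l ih] F /=; rewrite !ih; ring. Qed.

Lemma disc_le l F G : (forall x y, F x y <= G x y) -> disc l F <= disc l G.
Proof.
have [r0 r1] := andP rho01.
elim: l F G => [|p l ih] F G FG /=; first exact: FG.
rewrite ler_wpM2l// !lerD// ler_wpM2l ?ih//; lra.
Qed.

Lemma disc_dist l F G (M : R) : (forall x y, `|F x y - G x y| <= M) -> `|disc l F - disc l G| <= M.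
Proof.
move=> FG; rewrite ler_norml; apply/andP; split.
  rewrite lerBrDl -[X in _ + X](disc_cst l (- M)) -discD; apply: disc_le => x y.
  by have := FG x y; rewrite ler_norml; lra.
rewrite lerBlDl -[X in _ + X](disc_cst l M) -discD; apply: disc_le => x y.
by have := FG x y; rewrite ler_norml; lra.
Qed.

(** Characteristic function of one pair (e v, e' w). It is real because (e, e') and (-e, -e') have
    the same law; [cov2] is the corresponding variance. *)
Definition charfac (h k : X) (p : X * X) : R :=
  cos (inner p.1 h) * cos (inner p.2 k) - rho * (sin (inner p.1 h) * sin (inner p.2 k)).

Definition cov2 (h k : X) (p : X * X) : R :=
  inner p.1 h ^+ 2 + inner p.2 k ^+ 2 + 2 * rho * (inner p.1 h * inner p.2 k).

Definition size3 (p : X * X) : R := (`|p.1| + `|p.2|) ^+ 3.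

Lemma disc_cos l h k c :
  disc l (fun x y => cos (inner x h + inner y k + c)) = \prod_(p <- l) charfac h k p * cos c.
Proof.
elim: l c => [|p l ih] c /=; first by rewrite big_nil !inner0l !add0r mul1r.
have e (s t : R) : disc l (fun x y => cos (inner (x + s *: p.1) h + inner (y + t *: p.2) k + c)) =
    \prod_(p <- l) charfac h k p * cos (c + (s * inner p.1 h + t * inner p.2 k)).
  rewrite -ih; congr disc; apply/funext => x; apply/funext => y; congr cos.
  by rewrite !innerDl !innerZl; ring.
have := e 1 1; have := e 1 (-1); have := e (-1) 1; have := e (-1) (-1).
rewrite !scale1r !scaleN1r => -> -> -> ->; rewrite big_cons /charfac !mul1r !mulN1r.
set P := \prod_(_ <- _) _; set al := inner _ h; set be := inner _ k.
by rewrite !cosD !sinD !cosN !sinN; field.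
Qed.

Lemma charfacE h k p : charfac h k p =
  2^-1 * (1 + rho) * cos (inner p.1 h + inner p.2 k) + 2^-1 * (1 - rho) * cos (inner p.1 h - inner p.2 k).
Proof. by rewrite /charfac !cosD cosN sinN; field. Qed.

Lemma charfac_le1 h k p : `|charfac h k p| <= 1.
Proof.
have [r0 r1] := andP rho01.
rewrite charfacE; have := cos_max (inner p.1 h + inner p.2 k); have := cos_max (inner p.1 h - inner p.2 k).
rewrite !ler_norml; move: (cos _) (cos _) => u v /andP[? ?] /andP[? ?]; apply/andP; split; nra.
Qed.

Lemma cov2_ge0 h k p : 0 <= cov2 h k p.
Proof.
have [r0 r1] := andP rho01; rewrite /cov2; move: (inner _ h) (inner _ k) => u v.
have := sqr_ge0 (u + v); have := sqr_ge0 (u - v); rewrite !sqrrD sqrrN; nra.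
Qed.

(** With s = |<v, h>| + |<w, k>|, the errors of the cosines and of the exponential are of order s^4,
    hence of order s^3 when s <= 1; for s >= 1 the trivial bound 2 suffices. *)
Lemma charfac_taylor h k p :
  `|charfac h k p - expR (- (cov2 h k p / 2))| <= 3 * (`|h| + `|k|) ^+ 3 * size3 p.
Proof.
have [r0 r1] := andP rho01.
set H := `|h| + `|k|; have H0 : 0 <= H by rewrite addr_ge0.
set al := inner p.1 h; set be := inner p.2 k.
set s := `|al| + `|be|.
have s0 : 0 <= s by rewrite addr_ge0.
have sH : s ^+ 3 <= H ^+ 3 * size3 p.
  rewrite /size3 -exprMn lerXn2r ?nnegrE ?mulr_ge0 ?addr_ge0//.
  have := cauchy_schwarz p.1 h; have := cauchy_schwarz p.2 k; rewrite -/al -/be => h1 h2.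
  rewrite /s /H; have := normr_ge0 p.1; have := normr_ge0 p.2; have := normr_ge0 h; have := normr_ge0 k.
  move: `|p.1| `|p.2| `|h| `|k| h1 h2 => a b c d h1 h2 ? ? ? ?; nra.
apply: (@le_trans _ _ (3 * s ^+ 3)); last by rewrite -mulrA ler_wpM2l.
have [s1|s1] := leP 1 s.
  apply: (@le_trans _ _ 2).
    apply: (le_trans (ler_normB _ _)); rewrite -(_ : 1 + 1 = 2 :> R); last by lra.
    rewrite lerD ?charfac_le1// ger0_norm ?expR_ge0// -expR0 ler_expR oppr_le0.
    by rewrite divr_ge0 ?cov2_ge0.
  have : 1 <= s ^+ 3 by rewrite exprn_ege1.
  by lra.
have c1 := cos_taylor (al + be); have c2 := cos_taylor (al - be).
have b1 : `|al + be| ^+ 4 <= s ^+ 4 by rewrite lerXn2r ?nnegrE// ler_normD.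
have b2 : `|al - be| ^+ 4 <= s ^+ 4 by rewrite lerXn2r ?nnegrE// ler_normB.
have q0 : 0 <= cov2 h k p / 2 by rewrite divr_ge0 ?cov2_ge0.
have e1 := expR_taylor q0.
have qs : cov2 h k p <= s ^+ 2.
  rewrite /cov2 /s -/al -/be.
  have := ler_norm (al * be); rewrite normrM => h1.
  have h2 : al ^+ 2 = `|al| ^+ 2 by rewrite real_normK ?num_real.
  have h3 : be ^+ 2 = `|be| ^+ 2 by rewrite real_normK ?num_real.
  rewrite h2 h3; have := normr_ge0 al; have := normr_ge0 be; move: h1; clear -r0 r1.
  move: (al * be) `|al| `|be| => w a b h1 b0 a0.
  have ab := mulr_ge0 a0 b0; have : 0 <= rho * (a * b - w) by rewrite mulr_ge0// subr_ge0.
    have : 0 <= (1 - rho) * (a * b) by rewrite mulr_ge0// subr_ge0.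
    by rewrite mulrBr mulrBl sqrrD; lra.
have qs2 : (cov2 h k p / 2) ^+ 2 <= s ^+ 4.
  rewrite -[s ^+ 4]/(s ^+ (2 * 2)) exprM lerXn2r ?nnegrE ?exprn_ge0//.
  by have := cov2_ge0 h k p; lra.
have s43 : s ^+ 4 <= s ^+ 3 by rewrite exprS ler_piMl ?exprn_ge0// ltW.
rewrite charfacE -/al -/be.
have qE : cov2 h k p / 2 = 2^-1 * (1 + rho) * ((al + be) ^+ 2 / 2) + 2^-1 * (1 - rho) * ((al - be) ^+ 2 / 2).
  by rewrite /cov2 -/al -/be; field.
rewrite mul1r in c1; rewrite mul1r in c2.
have {}c1 := le_trans c1 (le_trans b1 s43); have {}c2 := le_trans c2 (le_trans b2 s43).
have {}e1 := le_trans e1 (le_trans qs2 s43).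
move: qE c1 c2 e1; move: (expR (- (cov2 h k p / 2))) => w; move: (cov2 h k p / 2) => q.
move: (cos (al + be)) (cos (al - be)) ((al + be) ^+ 2 / 2) ((al - be) ^+ 2 / 2) (s ^+ 3) => u v x y z; clear -r0 r1; rewrite !ler_norml => qE /andP[? ?] /andP[? ?] /andP[? ?].
by apply/andP; split; nra.
Qed.

Definition err l : R := \sum_(p <- l) size3 p.

(** The signs of different pairs are independent, so the characteristic function is a product,
    compared factor by factor with a product of Gaussian factors. *)
Lemma disc_cos_approx l h k c :
  `|disc l (fun x y => cos (inner x h + inner y k + c)) - expR (- ((\sum_(p <- l) cov2 h k p) / 2)) * cos c|
    <= 3 * (`|h| + `|k|) ^+ 3 * err l.
Proof.
have -> : expR (- ((\sum_(p <- l) cov2 h k p) / 2)) = \prod_(p <- l) expR (- (cov2 h k p / 2)).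
  rewrite mulr_suml -sumrN; elim: l => [|p l ih]; first by rewrite !big_nil expR0.
  by rewrite !big_cons expRD ih.
rewrite disc_cos -mulrBl normrM; apply: (@le_trans _ _ (\sum_(p <- l) `|charfac h k p - expR (- (cov2 h k p / 2))|)).
  rewrite -[leRHS]mulr1 ler_pM//; last exact: cos_max.
  apply: prod_dist => p; first exact: charfac_le1.
  by rewrite ger0_norm ?expR_ge0// -expR0 ler_expR oppr_le0 divr_ge0 ?cov2_ge0.
by rewrite /err mulr_sumr; apply: ler_sum => p _; exact: charfac_taylor.
Qed.

End discrete.

(** * The inequality for one pair of signs *)

Section four_points.
Context {R : realType}.
Variables (rho a b : R).
Hypotheses (rho01 : 0 <= rho <= 1) (a01 : 0 < a < 1) (b01 : 0 < b < 1).
Hypothesis rab : rho ^+ 2 * (a * b) <= (1 - a) * (1 - b).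

(** A convenient upper bound for the two constants of [four_points]: 3 + 8 exp 1 for small
    increments and 4 for large ones. *)
Definition four_const : R := 4 + 16 * expR 1.

(** Second-order expansion of a ln (1 + s al) + b ln (1 + t be) for signs s, t. *)
Let z (al be s t : R) : R := a * (s * al) + b * (t * be) - a * al ^+ 2 / 2 - b * be ^+ 2 / 2.

Lemma expR_quadratic (al be : R) : `|al| + `|be| <= 2^-1 ->
  4^-1 * ((1 + rho) * expR (z al be 1 1) + (1 - rho) * expR (z al be 1 (-1)) +
          (1 - rho) * expR (z al be (-1) 1) + (1 + rho) * expR (z al be (-1) (-1)))
    <= 1 + (2 + 8 * expR 1) * (`|al| + `|be|) ^+ 3.
Proof.
move=> m12; set m := `|al| + `|be| in m12 *.
have [r0 r1] := andP rho01; have [a0 a1] := andP a01; have [b0 b1] := andP b01.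
have m0 : 0 <= m by rewrite addr_ge0.
have E0 : 0 <= expR (1 : R) by exact: expR_ge0.
(* This is where [rab] enters: averaging z + y^2 / 2, with y its linear part, over the correlated
   signs leaves the difference of these two sides. *)
have q0 : rho * (a * b) * (al * be) <= (a * (1 - a) * al ^+ 2 + b * (1 - b) * be ^+ 2) / 2.
  set P := a * (1 - a) * al ^+ 2; set Q := b * (1 - b) * be ^+ 2.
  have P0 : 0 <= P by rewrite mulr_ge0 ?sqr_ge0// mulr_ge0 ?(ltW a0)// subr_ge0 ltW.
  have Q0 : 0 <= Q by rewrite mulr_ge0 ?sqr_ge0// mulr_ge0 ?(ltW b0)// subr_ge0 ltW.
  have PQ : (rho * (a * b) * (al * be)) ^+ 2 <= P * Q.
    have -> : P * Q = (1 - a) * (1 - b) * (a * b * (al * be) ^+ 2) by rewrite /P/Q; ring.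
    have -> : (rho * (a * b) * (al * be)) ^+ 2 = rho ^+ 2 * (a * b) * (a * b * (al * be) ^+ 2) by ring.
    by rewrite ler_wpM2r// mulr_ge0 ?sqr_ge0// mulr_ge0 ?(ltW a0) ?(ltW b0).
  apply: le_trans (ler_norm _) _; rewrite -(@ler_pXn2r _ 2)// ?nnegrE ?divr_ge0 ?addr_ge0//.
  rewrite real_normK ?num_real// (le_trans PQ)//.
  by have := sqr_ge0 (P - Q); rewrite sqrrB => h; rewrite expr_div_n sqrrD; lra.
pose w := - (a * al ^+ 2 / 2) - b * be ^+ 2 / 2.
have al2 : al ^+ 2 = `|al| ^+ 2 by rewrite real_normK ?num_real.
have be2 : be ^+ 2 = `|be| ^+ 2 by rewrite real_normK ?num_real.
have w0 : w <= 0.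
  have : 0 <= a * al ^+ 2 by rewrite mulr_ge0 ?sqr_ge0// ltW.
  have : 0 <= b * be ^+ 2 by rewrite mulr_ge0 ?sqr_ge0// ltW.
  by rewrite /w; lra.
have wm : - (m ^+ 2) <= w.
  rewrite /w /m al2 be2 sqrrD; move: (`|al|) (`|be|) (normr_ge0 al) (normr_ge0 be) => x y x0 y0.
  have : a * x ^+ 2 <= x ^+ 2 by rewrite ler_piMl ?sqr_ge0// ltW.
  have : b * y ^+ 2 <= y ^+ 2 by rewrite ler_piMl ?sqr_ge0// ltW.
  by have := mulr_ge0 x0 y0; have := sqr_ge0 x; have := sqr_ge0 y; lra.
have zb s t : `|s| = 1 -> `|t| = 1 ->
    expR (z al be s t) <= 1 + (z al be s t) + (a * (s * al) + b * (t * be)) ^+ 2 / 2 + (2 + 8 * expR 1) * m ^+ 3.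
  move=> s1 t1; pose y := a * (s * al) + b * (t * be).
  have zE : z al be s t = y + w by rewrite /z /y /w; ring.
  have ym : `|y| <= m.
    rewrite /y (le_trans (ler_normD _ _))// !normrM s1 t1 !mul1r (gtr0_norm a0) (gtr0_norm b0).
    by rewrite lerD// ler_piMl// ltW.
  have m2 : m ^+ 2 <= m by rewrite expr2 ler_piMl//; lra.
  have zm : `|z al be s t| <= 2 * m.
    by rewrite zE (le_trans (ler_normD _ _))// (ler0_norm w0); lra.
  have z1 : `|z al be s t| <= 1 by lra.
  apply: (le_trans (expR_taylor3 z1)).
  have z3 : `|z al be s t| ^+ 3 <= 8 * m ^+ 3.
    by rewrite (_ : 8 = 2 ^+ 3); [rewrite -exprMn lerXn2r ?nnegrE ?mulr_ge0|ring].
  have : expR 1 * `|z al be s t| ^+ 3 <= expR 1 * (8 * m ^+ 3) by rewrite ler_wpM2l.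
  have : z al be s t ^+ 2 <= y ^+ 2 + 4 * m ^+ 3.
    rewrite zE sqrrD.
    have yw : y * w <= m * m ^+ 2.
      apply: (le_trans (ler_norm _)); rewrite normrM ler_pM// (ler0_norm w0); lra.
    have ww : w ^+ 2 <= m ^+ 2 * m.
      rewrite expr2 -mulrNN ler_pM ?oppr_ge0//; lra.
    have -> : m ^+ 3 = m * m ^+ 2 by ring.
    have mm : 0 <= m * m ^+ 2 by rewrite mulr_ge0 ?sqr_ge0.
    by move: ww; rewrite (mulrC (m ^+ 2)) => ww; lra.
  by rewrite -/y; lra.
have n1 : `|1 : R| = 1 by rewrite normr1.
have nN : `|-1 : R| = 1 by rewrite normrN1.
have := zb 1 1 n1 n1; have := zb 1 (-1) n1 nN; have := zb (-1) 1 nN n1; have := zb (-1) (-1) nN nN.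
set E := (2 + 8 * expR 1) * m ^+ 3.
have zz s t : z al be s t = a * (s * al) + b * (t * be) + w by rewrite /z /w; ring.
move: (expR (z al be 1 1)) (expR (z al be 1 (-1))) (expR (z al be (-1) 1)) (expR (z al be (-1) (-1))) => e1 e2 e3 e4.
rewrite !zz !mul1r !mulN1r => h4 h3 h2 h1.
have rp : 0 <= 1 + rho by lra. have rm : 0 <= 1 - rho by lra.
have := ler_wpM2l rp h1; have := ler_wpM2l rm h2; have := ler_wpM2l rm h3; have := ler_wpM2l rp h4.
clear h1 h2 h3 h4; rewrite /w => k4 k3 k2 k1.
have : 4^-1 * ((1 + rho) * e1 + (1 - rho) * e2 + (1 - rho) * e3 + (1 + rho) * e4) <=
  1 - a * al ^+ 2 / 2 - b * be ^+ 2 / 2 + (a ^+ 2 * al ^+ 2 + b ^+ 2 * be ^+ 2 + 2 * rho * (a * b) * (al * be)) / 2 + E.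
  move: k4 k3 k2 k1; lra.
lra.
Qed.


Lemma expR_linear (al be : R) : 2^-1 <= `|al| + `|be| ->
  expR (a * `|al| + b * `|be|) <= expR (4 * (`|al| + `|be|) ^+ 3).
Proof.
have [a0 a1] := andP a01; have [b0 b1] := andP b01.
move=> m12; rewrite ler_expR; set m := _ + _ in m12 *.
apply: (@le_trans _ _ m); first by rewrite /m lerD// ler_piMl// ltW.
have m0 : 0 <= m by rewrite /m addr_ge0.
have : 4^-1 <= m ^+ 2 by have : 2^-1 ^+ 2 <= m ^+ 2 by [rewrite lerXn2r ?nnegrE]; lra.
have -> : m ^+ 3 = m * m ^+ 2 by ring.
by nra.
Qed.

(* With s = (A1 - A2)/(A1 + A2), t = (B1 - B2)/(B1 + B2), the second order
   terms of the left-hand side form a negative semidefinite quadratic form. *)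
Lemma four_points (A1 A2 B1 B2 : R) : 0 < A1 -> 0 < A2 -> 0 < B1 -> 0 < B2 ->
  4^-1 * ((1 + rho) * (A1 `^ a * B1 `^ b) + (1 - rho) * (A1 `^ a * B2 `^ b) +
          (1 - rho) * (A2 `^ a * B1 `^ b) + (1 + rho) * (A2 `^ a * B2 `^ b))
    <= expR (four_const * (`|A1 - A2| / (A1 + A2) + `|B1 - B2| / (B1 + B2)) ^+ 3) *
       (((A1 + A2) / 2) `^ a * ((B1 + B2) / 2) `^ b).
Proof.
have [r0 r1] := andP rho01; have [a0 a1] := andP a01; have [b0 b1] := andP b01.
move=> A10 A20 B10 B20.
have E0 : 0 <= expR (1 : R) by exact: expR_ge0.
have A0 : 0 < (A1 + A2) / 2 by rewrite divr_gt0// addr_gt0.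
have B0 : 0 < (B1 + B2) / 2 by rewrite divr_gt0// addr_gt0.
set Ab := (A1 + A2) / 2 in A0 *; set Bb := (B1 + B2) / 2 in B0 *.
pose al := (A1 - A2) / (A1 + A2); pose be := (B1 - B2) / (B1 + B2).
have AA : 0 < A1 + A2 by rewrite addr_gt0.
have BB : 0 < B1 + B2 by rewrite addr_gt0.
have -> : `|A1 - A2| / (A1 + A2) = `|al| by rewrite normrM normfV (gtr0_norm AA).
have -> : `|B1 - B2| / (B1 + B2) = `|be| by rewrite normrM normfV (gtr0_norm BB).
have al1 : `|al| < 1.
  by rewrite normrM normfV (gtr0_norm AA) ltr_pdivrMr// mul1r ltr_norml; lra.
have be1 : `|be| < 1.
  by rewrite normrM normfV (gtr0_norm BB) ltr_pdivrMr// mul1r ltr_norml; lra.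
have A1E : A1 = Ab * (1 + 1 * al) by rewrite /Ab /al; field; rewrite gt_eqF.
have A2E : A2 = Ab * (1 + -1 * al) by rewrite /Ab /al; field; rewrite gt_eqF.
have B1E : B1 = Bb * (1 + 1 * be) by rewrite /Bb /be; field; rewrite gt_eqF.
have B2E : B2 = Bb * (1 + -1 * be) by rewrite /Bb /be; field; rewrite gt_eqF.
(* The second-order bound serves small increments; the linear one, from ln (1 + x) <= x, serves
   increments with |al| + |be| > 1/2, where m <= 4 m^3. *)
have pw (c d s x : R) : 0 < c < 1 -> `|s| = 1 -> `|x| < 1 -> 0 < d ->
    (d * (1 + s * x)) `^ c <= d `^ c * expR (c * (s * x) - c * x ^+ 2 / 2 + `|x| ^+ 3) /\
    (d * (1 + s * x)) `^ c <= d `^ c * expR (c * `|x|).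
  move=> /andP[c0 c1] s1 x1 d0.
  have sx : `|s * x| = `|x| by rewrite normrM s1 mul1r.
  have sx1 : -1 < s * x by move: x1; rewrite -sx ltr_norml => /andP[].
  have sx0 : 0 < 1 + s * x by lra.
  rewrite powRM ?(ltW d0) ?(ltW sx0)//.
  have -> : (1 + s * x) `^ c = expR (c * ln (1 + s * x)) by rewrite /powR gt_eqF.
  have s2 : (s * x) ^+ 2 = x ^+ 2.
    by rewrite -[LHS](real_normK (num_real _)) sx real_normK ?num_real.
  have l1 := ln_taylor sx1; rewrite s2 sx in l1.
  have x3 : 0 <= `|x| ^+ 3 by rewrite exprn_ge0.
  split; rewrite ler_wpM2l ?powR_ge0// ler_expR.
    have : c * ln (1 + s * x) <= c * (s * x - x ^+ 2 / 2 + `|x| ^+ 3) by rewrite ler_wpM2l// ltW.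
    have : c * `|x| ^+ 3 <= `|x| ^+ 3 by rewrite ler_piMl// ltW.
    by rewrite mulrDr mulrBr; lra.
  rewrite ler_wpM2l ?(ltW c0)//; have := le_ln1Dx sx1 => /le_trans; apply.
  by rewrite -sx ler_norm.
set m := `|al| + `|be|; have m0 : 0 <= m by rewrite addr_ge0.
have n1 : `|1 : R| = 1 by rewrite normr1.
have nN : `|-1 : R| = 1 by rewrite normrN1.
have Pab : 0 <= Ab `^ a * Bb `^ b by rewrite mulr_ge0 ?powR_ge0.
have m3 : 0 <= m ^+ 3 by rewrite exprn_ge0.
have rp : 0 <= 1 + rho by lra. have rm : 0 <= 1 - rho by lra.
have [m12|m12] := leP m 2^-1; last first.
  have q s t : `|s| = 1 -> `|t| = 1 ->
      (Ab * (1 + s * al)) `^ a * (Bb * (1 + t * be)) `^ b <= expR (four_const * m ^+ 3) * (Ab `^ a * Bb `^ b).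
    move=> s1 t1; have [_ h1] := pw a Ab s al a01 s1 al1 A0; have [_ h2] := pw b Bb t be b01 t1 be1 B0.
    apply: le_trans (ler_pM (powR_ge0 _ _) (powR_ge0 _ _) h1 h2) _.
    rewrite mulrACA mulrC -expRD ler_wpM2r// (le_trans (expR_linear (ltW m12)))//.
    by rewrite ler_expR ler_wpM2r// /four_const lerDl mulr_ge0.
  have := q 1 1 n1 n1; have := q 1 (-1) n1 nN; have := q (-1) 1 nN n1; have := q (-1) (-1) nN nN.
  rewrite -A1E -A2E -B1E -B2E.
  move=> h4 h3 h2 h1.
  have := ler_wpM2l rp h1; have := ler_wpM2l rm h2; have := ler_wpM2l rm h3; have := ler_wpM2l rp h4.
  by lra.
have q s t : `|s| = 1 -> `|t| = 1 ->
    (Ab * (1 + s * al)) `^ a * (Bb * (1 + t * be)) `^ b <= (Ab `^ a * Bb `^ b) * expR (m ^+ 3) * expR (z al be s t).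
  move=> s1 t1; have [h1 _] := pw a Ab s al a01 s1 al1 A0; have [h2 _] := pw b Bb t be b01 t1 be1 B0.
  apply: le_trans (ler_pM (powR_ge0 _ _) (powR_ge0 _ _) h1 h2) _.
  rewrite mulrACA -expRD -[leRHS]mulrA -expRD ler_wpM2l// ler_expR /z.
  have : `|al| ^+ 3 + `|be| ^+ 3 <= m ^+ 3.
    have -> : m ^+ 3 = `|al| ^+ 3 + `|be| ^+ 3 + 3 * (`|al| * `|be|) * m by rewrite /m; ring.
    by rewrite lerDl mulr_ge0// mulr_ge0// mulr_ge0.
  by lra.
have := q 1 1 n1 n1; have := q 1 (-1) n1 nN; have := q (-1) 1 nN n1; have := q (-1) (-1) nN nN.
rewrite -A1E -A2E -B1E -B2E => h4 h3 h2 h1.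
have k1 := ler_wpM2l rp h1; have k2 := ler_wpM2l rm h2; have k3 := ler_wpM2l rm h3; have k4 := ler_wpM2l rp h4.
have quad := expR_quadratic m12; rewrite -/m in quad.
have e3 : 1 + (2 + 8 * expR 1) * m ^+ 3 <= expR ((2 + 8 * expR 1) * m ^+ 3) by exact: expR_ge1Dx.
set P := Ab `^ a * Bb `^ b in Pab k1 k2 k3 k4 *.
have PE0 : 0 <= P * expR (m ^+ 3) by rewrite mulr_ge0 ?expR_ge0.
apply: (@le_trans _ _ (P * expR (m ^+ 3) * expR ((2 + 8 * expR 1) * m ^+ 3))).
  have := ler_wpM2l PE0 (le_trans quad e3).
  move: k1 k2 k3 k4; move: (P * expR (m ^+ 3)) (expR (_ * m ^+ 3)) => p ee.
  by lra.
rewrite -mulrA -expRD mulrC ler_wpM2r// ler_expR /four_const.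
have : 0 <= expR 1 * m ^+ 3 by rewrite mulr_ge0.
by lra.
Qed.

End four_points.

(** * Tensorization *)

Section powR_lipschitz.
Context {R : realType}.

(** For d <= y <= x, x^a - y^a <= y^a (x / y - 1) and y^a <= 1 + y, whence the constant 1 + 1/d.
    Staying away from 0 is what makes the power Lipschitz. *)
Lemma powR_lip (a d s t : R) : 0 <= a <= 1 -> 0 < d -> d <= s -> d <= t ->
  `|s `^ a - t `^ a| <= (1 + d^-1) * `|s - t|.
Proof.
move=> /andP[a0 a1] d0.
have h (x y : R) : d <= y -> y <= x -> `|x `^ a - y `^ a| <= (1 + d^-1) * `|x - y|.
  move=> dy yx; have y0 : 0 < y by apply: lt_le_trans dy.
  have x0 : 0 < x by apply: lt_le_trans yx.
  have yxa : y `^ a <= x `^ a by apply: ge0_ler_powR => //; rewrite nnegrE ltW.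
  rewrite !ger0_norm ?subr_ge0//.
  have xE : x = y * (x / y) by field; rewrite gt_eqF.
  have xy1 : 1 <= x / y by rewrite ler_pdivlMr// mul1r.
  have h1 : x `^ a <= y `^ a * (x / y).
    rewrite {1}xE powRM ?(ltW y0) ?divr_ge0 ?(ltW x0) ?(ltW y0)// ler_wpM2l ?powR_ge0//.
    by rewrite -[leRHS]powRr1 ?(le_trans ler01)// ler_powR.
  have h2 : y `^ a <= 1 + y.
    have [y1|y1] := leP y 1.
      apply: (@le_trans _ _ 1); last by rewrite lerDl ltW.
      apply: (@le_trans _ _ (1 `^ a)); last by rewrite powR1.
      by rewrite ge0_ler_powR// nnegrE ltW.
    apply: (@le_trans _ _ (y `^ 1)); first by rewrite ler_powR// ltW.
    by rewrite powRr1 ?(ltW y0)//; lra.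
  apply: (@le_trans _ _ (y `^ a / y * (x - y))).
    have -> : y `^ a / y * (x - y) = y `^ a * (x / y) - y `^ a by field; rewrite gt_eqF.
    by rewrite lerB.
  rewrite ler_wpM2r ?subr_ge0// ler_pdivrMr// (le_trans h2)// mulrDl mul1r addrC lerD2l.
  by rewrite mulrC ler_pdivlMr// mul1r.
move=> ds dt; have [st|ts] := leP s t; last by apply: h => //; exact: ltW.
by rewrite distrC (distrC s); exact: h.
Qed.

Lemma powR_max_lip (a d s t : R) : 0 <= a <= 1 -> 0 < d ->
  `|Num.max d s `^ a - Num.max d t `^ a| <= (1 + d^-1) * `|s - t|.
Proof.
move=> a01 d0; apply: (le_trans (powR_lip a01 d0 _ _)); rewrite ?le_max ?lexx//.
rewrite ler_wpM2l ?addr_ge0 ?invr_ge0 ?(ltW d0)//.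
have := normr_ge0 (s - t); have := ler_norm (s - t); have := ler_norm (t - s); rewrite (distrC t).
rewrite ler_norml /Num.max; case: ltP => ?; case: ltP => ?; lra.
Qed.

Lemma cvg_powR (a d : R) (u : nat -> R) (l : R) : 0 <= a <= 1 -> 0 < d -> (forall n, d <= u n) ->
  u n @[n --> \oo] --> l -> u n `^ a @[n --> \oo] --> l `^ a.
Proof.
move=> a01 d0 du ul.
have dl : d <= l by apply: (ler_cvg_to (cvg_cst d) ul); exact: nearW.
apply/cvgrPdist_le => e e0; have K0 : 0 < 1 + d^-1 by rewrite addr_gt0// invr_gt0.
have /cvgrPdist_le/(_ (e / (1 + d^-1)) (divr_gt0 e0 K0))[N _ NP] := ul.
exists N => // n Nn; apply: (le_trans (powR_lip a01 d0 dl (du n))).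
by rewrite mulrC -ler_pdivlMr//; exact: NP.
Qed.

End powR_lipschitz.

Section discrete_hypercontractivity.
Context {R : realType} {X : hilbertType R}.
Variables (rho a b : R).
Hypotheses (rho01 : 0 <= rho <= 1) (a01 : 0 < a < 1) (b01 : 0 < b < 1).
Hypothesis rab : rho ^+ 2 * (a * b) <= (1 - a) * (1 - b).
Implicit Types (l : seq (X * X)) (f g : X -> R).

Let lip L f := forall x y, `|f x - f y| <= L * `|x - y|.

(** Conditioning on the first pair of signs translates f and g; the induction hypothesis applies to
    the translates and [four_points] to their means. These differ by at most 2 L |v| and are at
    least d, so the pair costs a multiple of ((L / d) (|v| + |w|))^3 in the exponent. *)
Lemma disc_holder l f g (d L : R) : 0 < d -> 0 <= L -> (forall x, d <= f x) -> (forall x, d <= g x) ->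
  lip L f -> lip L g ->
  disc rho l (fun x y => f x `^ a * g y `^ b) <=
    expR (@four_const R * (L / d) ^+ 3 * err l) *
    (disc rho l (fun x _ => f x) `^ a * disc rho l (fun _ y => g y) `^ b).
Proof.
move=> d0 L0; set K := four_const * (L / d) ^+ 3.
elim: l f g => [|p l ih] f g df dg Lf Lg.
  by rewrite /err big_nil mulr0 expR0 mul1r.
have lipS h v : lip L h -> lip L (fun x => h (x + v)).
  by move=> Lh x y; apply: le_trans (Lh _ _) _; rewrite opprD addrACA subrr addr0.
have IH (v w : X) := ih (fun x => f (x + v)) (fun y => g (y + w)) (fun x => df _) (fun y => dg _) (lipS f v Lf) (lipS g w Lg).
set e := expR (K * err l) in IH.
have e0 : 0 <= e by exact: expR_ge0.
pose A v := disc rho l (fun x _ => f (x + v)).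
pose B w := disc rho l (fun _ y => g (y + w)).
have Ad v : d <= A v by rewrite -(disc_cst rho l d); apply: disc_le.
have Bd w : d <= B w by rewrite -(disc_cst rho l d); apply: disc_le.
have dist2 (v : X) x : `|(x + v) - (x - v)| = 2 * `|v|.
  by rewrite opprB addrC addrA subrK -mulr2n -scaler_nat normrZ ger0_norm.
have AL v : `|A v - A (- v)| <= L * (2 * `|v|).
  by apply: disc_dist => // x y; rewrite -(dist2 v x); exact: Lf.
have BL v : `|B v - B (- v)| <= L * (2 * `|v|).
  by apply: disc_dist => // x y; rewrite -(dist2 v y); exact: Lg.
have [r0 r1] := andP rho01.
have rp : 0 <= 1 + rho by lra. have rm : 0 <= 1 - rho by lra.
have Ap v : 0 < A v by apply: lt_le_trans (Ad v).
have Bp v : 0 < B v by apply: lt_le_trans (Bd v).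
have fp := four_points rho01 a01 b01 rab (Ap p.1) (Ap (- p.1)) (Bp p.2) (Bp (- p.2)).
have fE : disc rho (p :: l) (fun x _ => f x) = (A p.1 + A (- p.1)) / 2 by rewrite /= /A; field.
have gE : disc rho (p :: l) (fun _ y => g y) = (B p.2 + B (- p.2)) / 2 by rewrite /= /B; field.
rewrite fE gE.
have k1 := ler_wpM2l rp (IH p.1 p.2); have k2 := ler_wpM2l rm (IH p.1 (- p.2)).
have k3 := ler_wpM2l rm (IH (- p.1) p.2); have k4 := ler_wpM2l rp (IH (- p.1) (- p.2)).
apply: (@le_trans _ _ (e * (4^-1 * ((1 + rho) * (A p.1 `^ a * B p.2 `^ b) + (1 - rho) * (A p.1 `^ a * B (- p.2) `^ b) +
   (1 - rho) * (A (- p.1) `^ a * B p.2 `^ b) + (1 + rho) * (A (- p.1) `^ a * B (- p.2) `^ b))))).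
  rewrite [leLHS]/=; move: k1 k2 k3 k4; rewrite -/(A _) -/(B _) -/(A _) -/(B _).
  by lra.
apply: (le_trans (ler_wpM2l e0 fp)); rewrite [leLHS]mulrA; apply: ler_wpM2r.
  by rewrite mulr_ge0 ?powR_ge0.
rewrite /e -expRD ler_expR /err big_cons mulrDr addrC lerD2r /K -mulrA ler_wpM2l//.
  by rewrite /four_const addr_ge0// mulr_ge0// expR_ge0.
have AA : 0 <= A p.1 + A (- p.1) by rewrite addr_ge0 ?(ltW (Ap _)).
have BB : 0 <= B p.2 + B (- p.2) by rewrite addr_ge0 ?(ltW (Bp _)).
have Ld : 0 <= L / d by rewrite divr_ge0// ltW.
rewrite /size3 -exprMn lerXn2r ?nnegrE ?addr_ge0 ?(mulr_ge0 Ld) ?addr_ge0 ?divr_ge0//.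
have q (u x y : R) : 0 <= u -> d <= x -> d <= y -> `|x - y| <= L * (2 * u) -> `|x - y| / (x + y) <= L / d * u.
  move=> u0 dx dy xy; rewrite ler_pdivrMr; last by rewrite addr_gt0//; [apply: lt_le_trans dx|apply: lt_le_trans dy].
  apply: (le_trans xy); have -> : L * (2 * u) = L / d * u * (d + d) by field; rewrite gt_eqF.
  by apply: ler_wpM2l; [rewrite mulr_ge0// divr_ge0// ltW|rewrite lerD].
by rewrite mulrDr lerD// q.
Qed.

End discrete_hypercontractivity.

(** * Passage to the Gaussian limit *)

Section limit.
Context {R : realType} {X : hilbertType R}.
Hypothesis sX : separable X.
Variable rho : R.
Hypothesis rho01 : 0 <= rho <= 1.

Definition pairings : set (borel X * borel X -> R) :=
  [set phi | exists h k : X, phi = (fun z => inner (z.1 : X) h + inner (z.2 : X) k)].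

Lemma pairings_linear : linear_class pairings.
Proof.
split.
- by exists 0, 0; apply/funext => x; rewrite !inner0r addr0.
- by move=> c _ [h [k ->]]; exists (c *: h), (c *: k); apply/funext => x; rewrite !innerZr mulrDr.
- move=> _ _ [h [k ->]] [h' [k' ->]]; exists (h + h'), (k + k'); apply/funext => x.
  by rewrite !innerDr addrACA.
Qed.

Lemma pairings_measurable phi : pairings phi -> measurable_fun [set: borel X * borel X] phi.
Proof.
move=> [h [k ->]]; apply: measurable_funD.
  have mh : measurable_fun [set: borel X] (fun x : borel X => inner (x : X) h : R).
    by apply: functionals_measurable; exists h.
  exact: (measurableT_comp mh measurable_fst).
have mk : measurable_fun [set: borel X] (fun x : borel X => inner (x : X) k : R).
  by apply: functionals_measurable; exists k.
exact: (measurableT_comp mk measurable_snd).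
Qed.

Lemma trig_fst f : trig (@functionals R X) f -> trig pairings (fun z => f z.1).
Proof.
elim=> {f} [phi c [h ->]|f g _ ihf _ ihg|c f _ ihf]; [|exact: trig_add|exact: trig_scale].
have Pp : pairings (fun z => inner (z.1 : X) h + inner (z.2 : X) 0) by exists h, 0.
by apply: trig_ext (trig_cos c Pp) => z; rewrite inner0r addr0.
Qed.

Lemma trig_snd f : trig (@functionals R X) f -> trig pairings (fun z => f z.2).
Proof.
elim=> {f} [phi c [h ->]|f g _ ihf _ ihg|c f _ ihf]; [|exact: trig_add|exact: trig_scale].
have Pp : pairings (fun z => inner (z.1 : X) 0 + inner (z.2 : X) h) by exists 0, h.
by apply: trig_ext (trig_cos c Pp) => z; rewrite inner0r add0r.
Qed.

Lemma trig_lip f : trig (@functionals R X) f ->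
  exists2 L, 0 <= L & forall x y : X, `|f x - f y| <= L * `|x - y|.
Proof.
elim=> {f} [phi c [h ->]|f g _ [L L0 Lf] _ [M M0 Mg]|c f _ [L L0 Lf]].
- exists `|h| => // x y; rewrite (le_trans (cos_lip _ _))//.
  rewrite opprD addrACA subrr addr0 -innerBl mulrC; exact: cauchy_schwarz.
- exists (L + M) => [|x y]; first exact: addr_ge0.
  by rewrite opprD addrACA mulrDl (le_trans (ler_normD _ _))// lerD.
- exists (`|c| * L) => [|x y]; first exact: mulr_ge0.
  by rewrite -mulrBr normrM -mulrA ler_wpM2l.
Qed.

Variables (P : probability (borel X * borel X)%type R) (q : X -> X -> R) (l : nat -> seq (X * X)).
Hypothesis charP : forall h k c,
  (\int[P]_z cos (inner (z.1 : X) h + inner (z.2 : X) k + c))%R = expR (- (q h k / 2)) * cos c.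
Hypothesis errl : err (l n) @[n --> \oo] --> (0 : R).
Hypothesis covl : forall h k, \sum_(p <- l n) cov2 rho h k p @[n --> \oo] --> q h k.

(** The central limit theorem: [disc_cos_approx] reduces it to convergence of the covariances, its
    error being a multiple of [err]. *)
Lemma disc_cvg_trig F : trig pairings F ->
  disc rho (l n) (fun x y => F (x, y)) @[n --> \oo] --> (\int[P]_z F z)%R.
Proof.
elim=> {F} [phi c [h [k ->]]|f g tf ihf tg ihg|c f tf ihf].
- rewrite /= charP.
  have c1 : expR (- ((\sum_(p <- l n) cov2 rho h k p) / 2)) * cos c @[n --> \oo] --> expR (- (q h k / 2)) * cos c.
    apply: cvgM; last exact: cvg_cst.
    apply: (cvg_comp _ expR); last exact: continuous_expR.
    by apply: cvgN; apply: cvgM => //; exact: cvg_cst.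
  have c2 : 3 * (`|h| + `|k|) ^+ 3 * err (l n) @[n --> \oo] --> (0 : R).
    by rewrite -[X in _ --> X](mulr0 (3 * (`|h| + `|k|) ^+ 3)); apply: cvgM => //; exact: cvg_cst.
  have c3 : (fun n => disc rho (l n) (fun x y => cos (inner x h + inner y k + c)) -
      expR (- ((\sum_(p <- l n) cov2 rho h k p) / 2)) * cos c) @ \oo --> (0 : R).
    apply/cvgrPdist_le => e e0; move/cvgrPdist_le : c2 => /(_ e e0)[N _ NP]; exists N => // n Nn.
    rewrite sub0r normrN (le_trans (disc_cos_approx rho01 _ _ _ _))//.
    by have := NP n Nn; rewrite /= sub0r normrN; apply: le_trans; exact: ler_norm.
  have -> : (fun n => disc rho (l n) (fun x y => cos (inner x h + inner y k + c))) =
      (fun n => (disc rho (l n) (fun x y => cos (inner x h + inner y k + c)) -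
      expR (- ((\sum_(p <- l n) cov2 rho h k p) / 2)) * cos c) +
      expR (- ((\sum_(p <- l n) cov2 rho h k p) / 2)) * cos c).
    by apply/funext => n; rewrite subrK.
  by have := cvgD c3 c1; rewrite add0r; apply.
- rewrite bintD; [|exact: (trig_bfun pairings_measurable)..].
  by under eq_fun do rewrite discD; exact: cvgD.
- rewrite bintZ; last exact: (trig_bfun pairings_measurable).
  by under eq_fun do rewrite discZ; apply: cvgM => //; exact: cvg_cst.
Qed.

Lemma disc_cvg F : uclosure (trig pairings) F ->
  disc rho (l n) (fun x y => F (x, y)) @[n --> \oo] --> (\int[P]_z F z)%R.
Proof.
move=> uF; apply/cvgrPdist_le => e e0; have e3 : 0 < e / 3 by rewrite divr_gt0.
have [G tG FG] := uF _ e3.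
have bF := utrig_bfun pairings_linear pairings_measurable uF.
have bG := trig_bfun pairings_measurable tG.
have /cvgrPdist_le/(_ _ e3)[N _ NP] := disc_cvg_trig tG.
exists N => // n Nn; have h1 := bint_dist P bF bG FG.
have h2 : `|disc rho (l n) (fun x y => F (x, y)) - disc rho (l n) (fun x y => G (x, y))| <= e / 3.
  by apply: disc_dist => // x y; exact: FG.
have := NP n Nn; move: h1 h2; rewrite /= !ler_norml; move: (disc _ _ _) (disc _ _ _) => u v.
by move=> /andP[? ?] /andP[? ?] /andP[? ?]; apply/andP; split; lra.
Qed.

Variables a b : R.
Hypotheses (a01 : 0 < a < 1) (b01 : 0 < b < 1).
Hypothesis rab : rho ^+ 2 * (a * b) <= (1 - a) * (1 - b).

Lemma uclosure_powR (f : borel X * borel X -> R) (d c : R) : 0 < c < 1 -> 0 < d -> (forall x, d <= f x) ->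
  uclosure (trig pairings) f -> uclosure (trig pairings) (fun z => f z `^ c).
Proof.
move=> /andP[c0 c1] d0 df uf.
have -> : (fun z => f z `^ c) = (fun z => Num.max d (f z) `^ c).
  by apply/funext => z; rewrite (max_idPr (df z)).
apply: (uclosure_lip (trig_algebra pairings_linear) (u := fun s => Num.max d s `^ c) (L := 1 + d^-1)) => //.
  by rewrite addr_ge0// invr_ge0 ltW.
by move=> s t; apply: powR_max_lip => //; rewrite (ltW c0) ltW.
Qed.

Lemma uclosure_sqr (f : borel X * borel X -> R) :
  uclosure (trig pairings) f -> uclosure (trig pairings) (fun z => f z ^+ 2).
Proof.
move=> uf; have [M' fM'] := uclosure_bounded (trig_algebra pairings_linear) uf.
pose M := `|M'|; have M0 : 0 <= M := normr_ge0 _.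
have fM x : - M <= f x <= M by rewrite -ler_norml (le_trans (fM' x))// ler_norm.
have MM : - M <= M by lra.
pose u s := Num.max (- M) (Num.min M s) ^+ 2.
have -> : (fun z => f z ^+ 2) = (fun z => u (f z)).
  by apply/funext => z; rewrite /u clamp_id.
apply: (uclosure_lip (trig_algebra pairings_linear) (L := 2 * M)) => // [|s t]; first exact: mulr_ge0.
rewrite /u; have := clamp_lip s t MM; rewrite mul1r; move: (clampP s MM) (clampP t MM).
move: (Num.max (- M) (Num.min M s)) (Num.max (- M) (Num.min M t)) => v w /andP[? ?] /andP[? ?] h.
by rewrite subr_sqr normrM mulrC ler_pM// ler_norml; apply/andP; split; lra.
Qed.

(** By polarization from squares. With [uclosure_powR] it places f^a g^b, no trigonometric
    polynomial, in the class where [disc_cvg] applies. *)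
Lemma uclosureM (f g : borel X * borel X -> R) : uclosure (trig pairings) f ->
  uclosure (trig pairings) g -> uclosure (trig pairings) (fun z => f z * g z).
Proof.
move=> uf ug; have tA := trig_algebra pairings_linear.
have -> : (fun z => f z * g z) = (fun z => 2^-1 * (((f z + g z) ^+ 2 - f z ^+ 2) - g z ^+ 2)).
  by apply/funext => z; field.
apply: uclosureZ => //; apply: uclosureB => //; last exact: uclosure_sqr.
apply: uclosureB => //; last exact: uclosure_sqr.
by apply: uclosure_sqr; exact: uclosureD.
Qed.

(** Trigonometric polynomials are Lipschitz, so [disc_holder] applies with a fixed constant, and its
    exponential factor tends to 1 with [err]. *)
Lemma trig_holder f g (d : R) : 0 < d -> trig (@functionals R X) f -> trig (@functionals R X) g ->
  (forall x, d <= f x) -> (forall x, d <= g x) ->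
  (\int[P]_z (f z.1 `^ a * g z.2 `^ b) <= (\int[P]_z f z.1) `^ a * (\int[P]_z g z.2) `^ b)%R.
Proof.
move=> d0 tf tg df dg; have [Lf Lf0 lf] := trig_lip tf; have [Lg Lg0 lg] := trig_lip tg.
pose L := Num.max Lf Lg.
have Lfl (x y : X) : `|f x - f y| <= L * `|x - y|.
  by rewrite (le_trans (lf x y))// ler_wpM2r// le_max lexx.
have Lgl (x y : X) : `|g x - g y| <= L * `|x - y|.
  by rewrite (le_trans (lg x y))// ler_wpM2r// le_max lexx orbT.
have L0 : 0 <= L by rewrite le_max Lf0.
have tA := trig_algebra pairings_linear.
have uf := uclosure_sub (trig_fst tf); have ug := uclosure_sub (trig_snd tg).
have lhs := disc_cvg (uclosureM (uclosure_powR a01 d0 (fun z => df z.1) uf) (uclosure_powR b01 d0 (fun z => dg z.2) ug)).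
have /andP[a0 a1] := a01; have /andP[b0 b1] := b01.
have rf := cvg_powR (a := a) (d := d) _ d0 _ (disc_cvg uf).
have rg := cvg_powR (a := b) (d := d) _ d0 _ (disc_cvg ug).
have re : expR (@four_const R * (L / d) ^+ 3 * err (l n)) @[n --> \oo] --> (1 : R).
  rewrite -expR0; apply: (cvg_comp _ expR); last exact: continuous_expR.
  have := cvgM (cvg_cst (@four_const R * (L / d) ^+ 3)) errl.
  by rewrite mulr0; apply.
rewrite -[leRHS]mul1r; apply: (ler_cvg_to lhs (cvgM re (cvgM (rf _ _) (rg _ _)))).
- by rewrite (ltW a0) ltW.
- by move=> n; rewrite -(disc_cst rho (l n) d); apply: disc_le => // x y; exact: df.
- by rewrite (ltW b0) ltW.
- by move=> n; rewrite -(disc_cst rho (l n) d); apply: disc_le => // x y; exact: dg.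
- by apply: nearW => n; exact: (disc_holder rho01 a01 b01 rab (l n) d0 L0 df dg Lfl Lgl).
Qed.

End limit.

(** * The Gaussian inequality *)

Lemma powR_le1D {R : realType} (c s : R) : 0 <= c <= 1 -> 0 <= s -> s `^ c <= 1 + s.
Proof.
move=> /andP[c0 c1] s0; have [s1|s1] := leP s 1.
  apply: (@le_trans _ _ (1 `^ c)); last by rewrite powR1 lerDl.
  by rewrite ge0_ler_powR// nnegrE.
apply: (@le_trans _ _ (s `^ 1)); first by rewrite ler_powR// ltW.
by rewrite powRr1//; lra.
Qed.

Lemma bfun_powR {R : realType} d (T : measurableType d) (f : T -> R) (c : R) :
  0 <= c -> (forall x, 0 <= f x) -> bfun f -> bfun (fun x => f x `^ c).
Proof.
move=> c0 f0 [mf [M fM]]; split; first exact: (measurableT_comp (measurable_powR c) mf).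
exists (M `^ c) => x; rewrite ger0_norm ?powR_ge0//.
have fx : f x <= M by rewrite (le_trans (ler_norm _)).
by rewrite ge0_ler_powR// nnegrE// (le_trans _ fx).
Qed.

Lemma bfun_itv {R : realType} d (T : measurableType d) (f : T -> R) (u v : R) :
  measurable_fun [set: T] f -> (forall x, u <= f x <= v) -> bfun f.
Proof.
move=> mf ufv; split => //; exists (`|u| + `|v|) => x; have /andP[uf fv] := ufv x.
have := ler_norm v; have := ler_norm (- u); rewrite normrN => ? ?.
by have := normr_ge0 u; have := normr_ge0 v; rewrite ler_norml => ? ?; apply/andP; split; lra.
Qed.

Section scaled_lists.
Context {R : realType} {X : hilbertType R}.
Implicit Types p : nat -> X * X.

Definition scale_pair (c : R) (p : X * X) : X * X := (c *: p.1, c *: p.2).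

(* Replacing p_k by N^2 copies of p_k / N keeps its covariance and divides its
   third-order error by N. *)
Definition copies p n : seq (X * X) :=
  flatten [seq nseq (n.+1 ^ 2)%N (scale_pair n.+1%:R^-1 (p k)) | k <- iota 0 n].

Lemma sum_copies p n (phi : X * X -> R) :
  \sum_(z <- copies p n) phi z = \sum_(k < n) n.+1%:R ^+ 2 * phi (scale_pair n.+1%:R^-1 (p k)).
Proof.
rewrite /copies big_flatten big_map -{1}(subn0 n) -/(index_iota 0 n) big_mkord.
apply: eq_bigr => k _; rewrite big_nseq iter_addr_0 -[LHS]mulr_natl natrX.
by [].
Qed.

Lemma err_copies p n : err (copies p n) = n.+1%:R^-1 * \sum_(k < n) size3 (p k).
Proof.
rewrite /err sum_copies mulr_sumr; apply: eq_bigr => k _.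
rewrite /size3 /scale_pair/= !normrZ ger0_norm ?invr_ge0// -mulrDr exprMn mulrA; congr (_ * _).
have : n.+1%:R != 0 :> R by rewrite pnatr_eq0.
by move: n.+1%:R => N N0; field.
Qed.

Lemma cov2_copies (rho : R) p n h k : \sum_(z <- copies p n) cov2 rho h k z = \sum_(j < n) cov2 rho h k (p j).
Proof.
rewrite sum_copies; apply: eq_bigr => j _; rewrite /cov2 /scale_pair/= !innerZl.
have : n.+1%:R != 0 :> R by rewrite pnatr_eq0.
by move: n.+1%:R => N N0; field.
Qed.

End scaled_lists.

Lemma cvg_rate {R : realType} (u : nat -> R) (l c : R) :
  (forall n, `|u n - l| <= c * n.+1%:R^-1) -> u n @[n --> \oo] --> l.
Proof.
move=> ul; have c0 : 0 <= c by have := le_trans (normr_ge0 _) (ul 0%N); rewrite invr1 mulr1.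
have h : c * n.+1%:R^-1 @[n --> \oo] --> (0 : R).
  by have := cvgM (cvg_cst c) (@cvg_harmonic R); rewrite mulr0; apply.
apply/cvgrPdist_le => e e0; move/cvgrPdist_le : h => /(_ e e0)[N _ NP]; exists N => // n Nn.
rewrite distrC (le_trans (ul n))//; have := NP n Nn; rewrite /= sub0r normrN.
by apply: le_trans; exact: ler_norm.
Qed.

(** * The Gaussian pair and its approximation by signs *)

Section mehler.
Context {R : realType} {X : hilbertType R}.
Hypothesis sX : separable X.
Variables (e : nat -> X) (A C Vs Vt : X -> X) (Mc Ms Mt : R).
Hypotheses (fe : frame e) (bA : bounded_op A).
Hypotheses (nC : nonneg_op C) (nVs : nonneg_op Vs) (nVt : nonneg_op Vt).
Hypotheses (trC : forall n, \sum_(k < n) inner (C (e k)) (e k) <= Mc)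
  (trs : forall n, \sum_(k < n) inner (Vs (e k)) (e k) <= Ms)
  (trt : forall n, \sum_(k < n) inner (Vt (e k)) (e k) <= Mt).
Hypothesis VtE : forall k, inner (Vt k) k = inner (C k) k + inner (Vs (adjoint A k)) (adjoint A k).

Notation gs := (gaussian 0 Vs).
Notation gt := (gaussian 0 Vt).
Notation nu := (gaussian 0 C).

Lemma gs_char h c : (\int[gs]_x cos (inner (x : X) h + c))%R = expR (- (inner (Vs h) h / 2)) * cos c.
Proof.
by have /(is_gaussian_char _ _ nVs) -> := gaussianP sX 0 fe nVs trs; rewrite inner0l add0r.
Qed.

Lemma gt_char h c : (\int[gt]_x cos (inner (x : X) h + c))%R = expR (- (inner (Vt h) h / 2)) * cos c.
Proof.
by have /(is_gaussian_char _ _ nVt) -> := gaussianP sX 0 fe nVt trt; rewrite inner0l add0r.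
Qed.

Lemma nu_char h c : (\int[nu]_x cos (inner (x : X) h + c))%R = expR (- (inner (C h) h / 2)) * cos c.
Proof.
by have /(is_gaussian_char _ _ nC) -> := gaussianP sX 0 fe nC trC; rewrite inner0l add0r.
Qed.

Definition mehler_shift (z : borel X * borel X) : borel X := A z.1 + (z.2 : X).

Lemma measurable_shift : measurable_fun [set: borel X * borel X] mehler_shift.
Proof.
apply: measurable_to_borel => // h.
have -> : (fun z : borel X * borel X => inner (mehler_shift z : X) h) =
    (fun z => inner (z.1 : X) (adjoint A h) + inner (z.2 : X) h).
  by apply/funext => z; rewrite /mehler_shift innerDl (adjointP bA).
by apply: pairings_measurable; exists (adjoint A h), h.
Qed.

Lemma measurable_shift1 x : measurable_fun [set: borel X] (fun z => mehler_shift (x, z)).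
Proof. exact: (measurableT_comp measurable_shift (pair1_measurable x)). Qed.

Definition swap_shift (z : borel X * borel X) : borel X * borel X := (mehler_shift z, z.1).

Lemma measurable_swap_shift : measurable_fun [set: borel X * borel X] swap_shift.
Proof. by apply: measurable_fun_pair; [exact: measurable_shift|exact: measurable_fst]. Qed.

Definition joint : probability (borel X * borel X)%type R := push (pprod gs nu) measurable_swap_shift.

Lemma joint_int (G : borel X * borel X -> R) : bfun G ->
  (\int[joint]_z G z)%R = (\int[gs]_x \int[nu]_z G (mehler_shift (x, z), x))%R.
Proof.
move=> bG; rewrite (push_int (pprod gs nu) measurable_swap_shift bG).
by have [_ _ -> _] := bint_prod gs nu (bfun_comp measurable_swap_shift bG : bfun (fun z => G (swap_shift z))).
Qed.

(** Variance of <A x + z, h> + <x, k> for independent x of covariance [Vs] and z of covariance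
    [C]. *)
Definition joint_cov h k := inner (C h) h + inner (Vs (adjoint A h + k)) (adjoint A h + k).

Lemma joint_char h k c :
  (\int[joint]_z cos (inner (z.1 : X) h + inner (z.2 : X) k + c))%R = expR (- (joint_cov h k / 2)) * cos c.
Proof.
have bG : bfun (fun z : borel X * borel X => cos (inner (z.1 : X) h + inner (z.2 : X) k + c)).
  apply: bfun_cos; apply: measurable_funD => //.
  by apply: pairings_measurable; exists h, k.
rewrite (joint_int bG).
have bc : bfun (fun x : borel X => cos (inner (x : X) (adjoint A h + k) + c)) by exact: bfun_cos_inner.
transitivity (\int[gs]_x (expR (- (inner (C h) h / 2)) * cos (inner (x : X) (adjoint A h + k) + c)))%R.
  apply: eq_Rintegral => x _; rewrite -nu_char; apply: eq_Rintegral => z _; congr cos.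
  by rewrite /mehler_shift/= !innerDl innerDr (adjointP bA); ring.
rewrite bintZ// gs_char mulrA -expRD; congr (expR _ * _).
by rewrite /joint_cov; field.
Qed.

Lemma joint_fst E : measurable E -> push joint measurable_fst E = gt E.
Proof.
apply: (char_unique sX) => h c.
rewrite (push_int joint measurable_fst (bfun_cos_inner h c)) gt_char.
transitivity (\int[joint]_z cos (inner (z.1 : X) h + inner (z.2 : X) 0 + c))%R.
  by apply: eq_Rintegral => z _; rewrite inner0r addr0.
by rewrite joint_char /joint_cov addr0 VtE.
Qed.

Lemma joint_snd E : measurable E -> push joint measurable_snd E = gs E.
Proof.
apply: (char_unique sX) => h c.
rewrite (push_int joint measurable_snd (bfun_cos_inner h c)) gs_char.
transitivity (\int[joint]_z cos (inner (z.1 : X) 0 + inner (z.2 : X) h + c))%R.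
  by apply: eq_Rintegral => z _; rewrite inner0r add0r.
rewrite joint_char /joint_cov; have [[lC _] _ _] := nC.
by rewrite (lin_0 (adjoint_linear bA)) add0r (lin_0 lC) inner0l add0r.
Qed.

Lemma joint_fst_int f : bfun f -> (\int[joint]_z f z.1)%R = (\int[gt]_x f x)%R.
Proof.
move=> bf; rewrite -(push_int joint measurable_fst bf) /Rintegral; congr fine.
by apply: eq_measure_integral => E mE _; exact: joint_fst.
Qed.

Lemma joint_snd_int f : bfun f -> (\int[joint]_z f z.2)%R = (\int[gs]_x f x)%R.
Proof.
move=> bf; rewrite -(push_int joint measurable_snd bf) /Rintegral; congr fine.
by apply: eq_measure_integral => E mE _; exact: joint_snd.
Qed.

Section holder.
Variables rho a b : R.
Hypotheses (rho0 : 0 < rho) (rho1 : rho <= 1) (a01 : 0 < a < 1) (b01 : 0 < b < 1).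
Hypothesis rab : rho ^+ 2 * (a * b) <= (1 - a) * (1 - b).
Hypothesis Vrho : forall k, inner (Vs (adjoint A k)) (adjoint A k) <= rho ^+ 2 * inner (Vt k) k.

(** Pairs (rho^(-1) A S e_k, S e_k) with signs of correlation rho have covariances rho^(-2) A Vs A^*
    and Vs and cross-covariance A Vs. What is then missing in the first component is [D],
    nonnegative by [Vrho]; the pairs (T e_k, 0) supply it. *)
Let D k := Vt k - rho ^- 2 *: A (Vs (adjoint A k)).

Let Dform h k : inner (D h) k = inner (Vt h) k - rho ^- 2 * inner (Vs (adjoint A h)) (adjoint A k).
Proof. by rewrite /D innerBl innerZl (adjointP bA). Qed.

Let nD : nonneg_op D.
Proof.
have [bVt sVt pVt] := nVt; have [bVs sVs pVs] := nVs.
have bAVA : bounded_op (A \o (Vs \o adjoint A)).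
  by apply: bounded_comp => //; apply: bounded_comp => //; exact: adjoint_bounded.
split.
- have [c1 c10 h1] := bounded_op_bound bVt; have [c2 c20 h2] := bounded_op_bound bAVA.
  apply: (@bounded_opI _ _ _ (c1 + `|rho ^- 2| * c2)).
    move=> s x y; rewrite /D bVt.1 -[A (Vs (adjoint A (s *: x + y)))]/((A \o (Vs \o adjoint A)) (s *: x + y)) bAVA.1.
    by rewrite /= scalerBr scalerDr !scalerA (mulrC s) opprD addrACA.
  move=> x; rewrite /D mulrDl (le_trans (ler_normB _ _))// lerD//.
  by rewrite normrZ -mulrA ler_wpM2l//; exact: h2.
- by move=> x y; rewrite Dform [RHS]innerC Dform sVt [inner x _]innerC sVs [inner (adjoint A x) _]innerC.
- move=> x; rewrite Dform subr_ge0 -ler_pdivlMl ?invr_gt0 ?exprn_gt0// invrK.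
  exact: Vrho.
Qed.

Let S := op_sqrt Vs.
Let T := op_sqrt D.
Let pr k : X * X := (rho^-1 *: A (S (e k)), S (e k)).
Let pz k : X * X := (T (e k), 0).
Let lists n := copies pr n ++ copies pz n.

Let sqrt_coef (Q : X -> X) (nQ : nonneg_op Q) h j : inner (op_sqrt Q (e j)) h = inner (op_sqrt Q h) (e j).
Proof. by have [[_ sQ _] _] := op_sqrtP nQ; rewrite sQ innerC. Qed.

Let sqrt_sum (Q : X -> X) (nQ : nonneg_op Q) h k :
  \sum_(j < n) inner (op_sqrt Q (e j)) h * inner (op_sqrt Q (e j)) k @[n --> \oo] --> inner (Q h) k.
Proof.
have [[_ sQ _] QQ] := op_sqrtP nQ.
have -> : inner (Q h) k = inner (op_sqrt Q h) (op_sqrt Q k) by rewrite -QQ sQ.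
have := @frame_parseval2 _ _ _ fe (op_sqrt Q h) (op_sqrt Q k).
by under eq_fun do under eq_bigr do rewrite -!(sqrt_coef nQ).
Qed.

Let cov_lists h k : \sum_(p <- lists n) cov2 rho h k p @[n --> \oo] --> joint_cov h k.
Proof.
have lim : rho ^- 2 * (\sum_(j < n) inner (S (e j)) (adjoint A h) * inner (S (e j)) (adjoint A h)) +
   \sum_(j < n) inner (S (e j)) k * inner (S (e j)) k +
   2 * (\sum_(j < n) inner (S (e j)) (adjoint A h) * inner (S (e j)) k) +
   \sum_(j < n) inner (T (e j)) h * inner (T (e j)) h @[n --> \oo] --> joint_cov h k.
  have -> : joint_cov h k = rho ^- 2 * inner (Vs (adjoint A h)) (adjoint A h) + inner (Vs k) k +
      2 * inner (Vs (adjoint A h)) k + inner (D h) h.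
    rewrite Dform VtE /joint_cov; have [[lV _] sV _] := nVs.
    rewrite (lin_D _ _ lV) !innerDl !innerDr [inner (Vs k) (adjoint A h)]sV [inner k _]innerC.
    by ring.
  apply: cvgD; last exact: sqrt_sum.
  apply: cvgD; last by apply: cvgM; [exact: cvg_cst|exact: sqrt_sum].
  apply: cvgD; last exact: sqrt_sum.
  by apply: cvgM; [exact: cvg_cst|exact: sqrt_sum].
have E n : \sum_(p <- lists n) cov2 rho h k p =
   rho ^- 2 * (\sum_(j < n) inner (S (e j)) (adjoint A h) * inner (S (e j)) (adjoint A h)) +
   \sum_(j < n) inner (S (e j)) k * inner (S (e j)) k +
   2 * (\sum_(j < n) inner (S (e j)) (adjoint A h) * inner (S (e j)) k) +
   \sum_(j < n) inner (T (e j)) h * inner (T (e j)) h; last by under eq_fun do rewrite E.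
rewrite /lists big_cat/= !cov2_copies !mulr_sumr -!big_split/=; apply: eq_bigr => j _.
rewrite /cov2 /pr /pz/= inner0l innerZl (adjointP bA).
by field; rewrite gt_eqF.
Qed.

(** A bound on the trace bounds the |S e_k|^2 one by one, hence the sum of their cubes by a multiple
    of the trace. [copies] divides this by n + 1. For [T] the trace of [D] is at most that of
    [Vt]. *)
Let err_lists : err (lists n) @[n --> \oo] --> (0 : R).
Proof.
have [c c0 Ac] := bounded_op_bound bA.
pose K := rho^-1 * c + 1; have K0 : 0 <= K by rewrite addr_ge0// mulr_ge0// invr_ge0 ltW.
have cube (x M : R) : 0 <= x -> x ^+ 2 <= M -> x ^+ 3 <= (1 + M) * x ^+ 2.
  move=> x0 xM; have : x <= 1 + M by have := sqr_ge0 (x - 1); rewrite sqrrB; lra.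
  by rewrite exprS => h; rewrite ler_wpM2r ?sqr_ge0.
have bnd (Q : X -> X) (M : R) : nonneg_op Q -> (forall n, \sum_(k < n) inner (Q (e k)) (e k) <= M) ->
    forall n, \sum_(k < n) `|op_sqrt Q (e k)| ^+ 3 <= (1 + M) * M.
  move=> nQ QM n; have M0 : 0 <= M by have := QM 0%N; rewrite big_ord0.
  apply: (@le_trans _ _ ((1 + M) * \sum_(k < n) inner (Q (e k)) (e k))); last by rewrite ler_wpM2l// addr_ge0.
  rewrite mulr_sumr; apply: ler_sum => k _; rewrite -(sqrt_norm nQ); apply: cube => //.
  rewrite (sqrt_norm nQ) (le_trans _ (QM k.+1))// big_ord_recr/= lerDr.
  by apply: sumr_ge0 => i _; have [_ _] := nQ; apply.
have trD n : \sum_(k < n) inner (D (e k)) (e k) <= Mt.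
  apply: le_trans (trt n); apply: ler_sum => k _; rewrite Dform lerBlDr lerDl mulr_ge0//.
    by rewrite invr_ge0 exprn_ge0// ltW.
  by have [_ _] := nVs; apply.
pose B := K ^+ 3 * ((1 + Ms) * Ms) + (1 + Mt) * Mt.
apply: (@cvg_rate _ _ _ B) => n; rewrite subr0 /lists /err big_cat/= -!/(err _) !err_copies -mulrDr.
have s0 (p : nat -> X * X) : 0 <= \sum_(k < n) size3 (p k).
  by apply: sumr_ge0 => k _; rewrite exprn_ge0// addr_ge0.
rewrite ger0_norm; last by rewrite mulr_ge0 ?invr_ge0// addr_ge0.
rewrite mulrC ler_wpM2r ?invr_ge0// lerD//.
  apply: (@le_trans _ _ (\sum_(k < n) K ^+ 3 * `|S (e k)| ^+ 3)).
    apply: ler_sum => k _; rewrite /size3 /pr/= -exprMn lerXn2r ?nnegrE ?addr_ge0 ?(mulr_ge0 K0)//.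
    rewrite /K mulrDl mul1r lerD2r normrZ gtr0_norm ?invr_gt0// -mulrA ler_wpM2l//.
    by rewrite invr_ge0 ltW.
  by rewrite -mulr_sumr ler_wpM2l ?exprn_ge0//; exact: (bnd Vs).
apply: (le_trans _ (bnd D Mt nD trD n)); apply: ler_sum => k _.
by rewrite /size3 /pz/= normr0 addr0.
Qed.

Lemma joint_trig_holder f g (d : R) : 0 < d -> trig (@functionals R X) f -> trig (@functionals R X) g ->
  (forall x, d <= f x) -> (forall x, d <= g x) ->
  (\int[joint]_z (f z.1 `^ a * g z.2 `^ b) <= (\int[joint]_z f z.1) `^ a * (\int[joint]_z g z.2) `^ b)%R.
Proof.
have rho01 : 0 <= rho <= 1 by rewrite ltW.
exact: (trig_holder rho01 joint_char err_lists cov_lists a01 b01 rab).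
Qed.


Let trig_near (mu : probability (borel X) R) f (d M eps : R) : measurable_fun [set: borel X] f ->
  0 < d -> (forall x, d <= f x <= M) -> 0 < eps ->
  exists f', [/\ trig (@functionals R X) f', forall x, d / 2 <= f' x <= M + d &
    (\int[mu]_x `|f x - f' x|)%R <= eps].
Proof.
move=> mf d0 dfM eps0; pose e1 := Num.min (eps / 2) (d / 2).
have e10 : 0 < e1 by rewrite lt_min !divr_gt0.
have dM : d <= M by have /andP[] := dfM 0; exact: le_trans.
have e20 : 0 < eps / 2 by rewrite divr_gt0.
have [g [ug gb gi]] := trig_dense functionals_linear functionals_measurable (functionals_gen sX) mu mf dM dfM e20.
have [f' tf fg] := ug _ e10; exists f'; split => // [x|].
  have := fg x; have /andP[? ?] := gb x; rewrite ler_norml => /andP[? ?].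
  have : e1 <= d / 2 by rewrite /e1 ge_min lexx orbT.
  by move=> ?; apply/andP; split; lra.
have bf : bfun f by exact: bfun_itv dfM.
have bg : bfun g := utrig_bfun functionals_linear functionals_measurable ug.
have bf' : bfun f' := trig_bfun functionals_measurable tf.
apply: (@le_trans _ _ (\int[mu]_x (`|f x - g x| + `|g x - f' x|))%R).
  apply: bint_le; [exact/bfun_abs/bfunB|apply: bfunD; exact/bfun_abs/bfunB|move=> x].
  by rewrite -{1}(subrK (g x) (f x)) -addrA ler_normD.
rewrite bintD; [|exact/bfun_abs/bfunB..].
rewrite (splitr eps) lerD//; apply: (@le_trans _ _ (\int[mu]_x e1)%R).
  by apply: bint_le; [exact/bfun_abs/bfunB|exact: bfun_cst|].
by rewrite bint_cst /e1 ge_min lexx.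
Qed.

(** Approximants at distance 1/(n + 1) in L^1 are kept above d / 2, where powers are Lipschitz, so
    both sides converge. *)
Lemma joint_holder f g (d M : R) : measurable_fun [set: borel X] f -> measurable_fun [set: borel X] g ->
  0 < d -> (forall x, d <= f x <= M) -> (forall x, d <= g x <= M) ->
  (\int[joint]_z (f z.1 `^ a * g z.2 `^ b) <= (\int[gt]_x f x) `^ a * (\int[gs]_x g x) `^ b)%R.
Proof.
move=> mf mg d0 dfM dgM.
have d20 : 0 < d / 2 by rewrite divr_gt0.
have /andP[a0 a1] := a01; have /andP[b0 b1] := b01.
have a01' : 0 <= a <= 1 by rewrite !ltW.
have b01' : 0 <= b <= 1 by rewrite !ltW.
have /choice[f' fP] n := trig_near gt mf d0 dfM (ltac:(by rewrite invr_gt0 ltr0n) : 0 < n.+1%:R^-1 :> R).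
have /choice[g' gP] n := trig_near gs mg d0 dgM (ltac:(by rewrite invr_gt0 ltr0n) : 0 < n.+1%:R^-1 :> R).
have bf : bfun f by exact: bfun_itv dfM.
have bg : bfun g by exact: bfun_itv dgM.
have bf' n : bfun (f' n) by have [tf _ _] := fP n; exact: trig_bfun functionals_measurable _ tf.
have bg' n : bfun (g' n) by have [tg _ _] := gP n; exact: trig_bfun functionals_measurable _ tg.
have dM : d <= M by have /andP[] := dfM 0; exact: le_trans.
have df x : d / 2 <= f x by have /andP[? _] := dfM x; lra.
have dg x : d / 2 <= g x by have /andP[? _] := dgM x; lra.
have df' n x : d / 2 <= f' n x by have [_ /(_ x)/andP[]] := fP n.
have dg' n x : d / 2 <= g' n x by have [_ /(_ x)/andP[]] := gP n.
have pos (x : R) : d / 2 <= x -> 0 <= x by apply: le_trans; exact: ltW.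
pose K := 1 + (d / 2)^-1; have K0 : 0 <= K by rewrite addr_ge0// invr_ge0 ltW.
pose M1 := 1 + (M + d); have M10 : 0 <= M1 by rewrite /M1; lra.
have bF (h k : borel X -> R) : bfun h -> bfun k -> (forall x, d / 2 <= h x) -> (forall x, d / 2 <= k x) ->
    bfun (fun z : borel X * borel X => h z.1 `^ a * k z.2 `^ b).
  move=> bh bk dh dk; apply: bfunM.
    apply: bfun_powR => [|z|]; [exact: ltW|exact: pos|exact: (bfun_comp measurable_fst bh)].
  apply: bfun_powR => [|z|]; [exact: ltW|exact: pos|exact: (bfun_comp measurable_snd bk)].
have bdf n : bfun (fun x => `|f x - f' n x|) by exact/bfun_abs/bfunB.
have bdg n : bfun (fun x => `|g x - g' n x|) by exact/bfun_abs/bfunB.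
have lhs : (\int[joint]_z (f' n z.1 `^ a * g' n z.2 `^ b))%R @[n --> \oo] -->
    (\int[joint]_z (f z.1 `^ a * g z.2 `^ b))%R.
  apply: (@cvg_rate _ _ _ (K * M1 * 2)) => n.
  have b1' : bfun (fun z : borel X * borel X => `|f z.1 - f' n z.1|) by exact: (bfun_comp measurable_fst (bdf n)).
  have b2' : bfun (fun z : borel X * borel X => `|g z.2 - g' n z.2|) by exact: (bfun_comp measurable_snd (bdg n)).
  rewrite -bintB; [|exact: bF..].
  apply: (le_trans (bint_abs _ _)); first by apply: bfunB; exact: bF.
  apply: (@le_trans _ _ (\int[joint]_z (K * M1 * (`|f z.1 - f' n z.1| + `|g z.2 - g' n z.2|)))%R).
    apply: bint_le => [||z].
    - by apply: bfun_abs; apply: bfunB; exact: bF.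
    - by apply: bfunZ; exact: bfunD.
    have -> : f' n z.1 `^ a * g' n z.2 `^ b - f z.1 `^ a * g z.2 `^ b =
       (f' n z.1 `^ a - f z.1 `^ a) * g' n z.2 `^ b + f z.1 `^ a * (g' n z.2 `^ b - g z.2 `^ b) by ring.
    rewrite (le_trans (ler_normD _ _))// !normrM mulrDr lerD//.
      rewrite mulrAC ler_pM//; first by rewrite distrC powR_lip.
      rewrite ger0_norm ?powR_ge0// (le_trans (powR_le1D b01' (pos _ (dg' n z.2))))//.
      by rewrite /M1 lerD2l; have [_ /(_ z.2)/andP[]] := gP n.
    rewrite mulrC -[leRHS]mulrA [leRHS]mulrCA -[leRHS]mulrCA.
    rewrite [leRHS]mulrA mulrAC ler_pM//; first by rewrite distrC powR_lip.
    rewrite ger0_norm ?powR_ge0// (le_trans (powR_le1D a01' (pos _ (df z.1))))//.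
    by rewrite /M1 lerD2l; have /andP[_] := dfM z.1; lra.
  rewrite bintZ; last exact: bfunD.
  rewrite bintD// (joint_fst_int (bdf n)) (joint_snd_int (bdg n)) -[leRHS]mulrA ler_wpM2l ?mulr_ge0//.
  have [_ _ h1] := fP n; have [_ _ h2] := gP n.
  apply: (le_trans (lerD h1 h2)).
  by move: (n.+1%:R^-1 : R) => u; rewrite mulr_natl mulr2n.
have intf : (\int[gt]_x f' n x)%R @[n --> \oo] --> (\int[gt]_x f x)%R.
  apply: (@cvg_rate _ _ _ 1) => n; rewrite mul1r distrC -bintB//.
  by apply: (le_trans (bint_abs _ _)); [exact: bfunB|have [_ _] := fP n].
have intg : (\int[gs]_x g' n x)%R @[n --> \oo] --> (\int[gs]_x g x)%R.
  apply: (@cvg_rate _ _ _ 1) => n; rewrite mul1r distrC -bintB//.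
  by apply: (le_trans (bint_abs _ _)); [exact: bfunB|have [_ _] := gP n].
have low (mu : probability (borel X) R) (h : borel X -> R) : bfun h -> (forall x, d / 2 <= h x) -> d / 2 <= (\int[mu]_x h x)%R.
  by move=> bh dh; rewrite -(bint_cst mu (d / 2)); apply: bint_le => //; exact: bfun_cst.
apply: (ler_cvg_to lhs (cvgM (cvg_powR a01' d20 (fun n => low gt _ (bf' n) (df' n)) intf)
  (cvg_powR b01' d20 (fun n => low gs _ (bg' n) (dg' n)) intg))).
apply: nearW => n /=; have [tf _ _] := fP n; have [tg _ _] := gP n.
have := joint_trig_holder d20 tf tg (df' n) (dg' n).
by rewrite (joint_fst_int (bf' n)) (joint_snd_int (bg' n)).
Qed.

End holder.

Definition mehler_op (f : borel X -> R) (x : borel X) : R := (\int[nu]_z f (mehler_shift (x, z)))%R.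

Lemma bfun_mehler f : bfun f -> bfun (mehler_op f).
Proof.
move=> bf; have bfs : bfun (fun z => f (mehler_shift z)) by exact: (bfun_comp measurable_shift bf).
by have [b1 _ _ _] := bint_prod gs nu bfs; exact: b1.
Qed.

Lemma mehler_bounds f (d M : R) : bfun f -> (forall x, d <= f x <= M) -> forall x, d <= mehler_op f x <= M.
Proof.
move=> bf dfM x; have bfx : bfun (fun z => f (mehler_shift (x, z))).
  exact: (bfun_comp (measurable_shift1 x) bf).
rewrite /mehler_op; apply/andP; split.
  rewrite -(bint_cst nu d); apply: bint_le => // [|z]; first exact: bfun_cst.
  by have /andP[] := dfM (mehler_shift (x, z)).
rewrite -(bint_cst nu M); apply: bint_le => // [|z]; first exact: bfun_cst.
by have /andP[] := dfM (mehler_shift (x, z)).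
Qed.

Lemma powR_absorb (x y c q : R) : 0 < x -> x <= y `^ c * x `^ (1 - q^-1) -> x `^ q^-1 <= y `^ c.
Proof.
move=> x0 h; rewrite -(ler_pM2r (powR_gt0 (1 - q^-1) x0)) -powRD ?(gt_eqF x0) ?implybT//.
by rewrite subrKC powRr1// ltW.
Qed.

(** [joint_holder] for f^p and (P f)^q: integrating out z turns the left side E
    [f (A x + z) (P f x)^(q - 1)] into E [(P f)^q], and the factor (E [(P f)^q])^(1 - 1/q) on the
    right cancels. *)
Lemma mehler_hypercontractive (rho p q : R) f (d M : R) : 0 < rho -> rho <= 1 ->
  (forall k, inner (Vs (adjoint A k)) (adjoint A k) <= rho ^+ 2 * inner (Vt k) k) ->
  1 < p -> 1 < q -> rho ^+ 2 * (q - 1) <= p - 1 ->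
  bfun f -> 0 < d -> (forall x, d <= f x <= M) ->
  ((\int[gs]_x mehler_op f x `^ q) `^ q^-1 <= (\int[gt]_x f x `^ p) `^ p^-1)%R.
Proof.
move=> rho0 rho1 Vrho p1 q1 pq bf d0 dfM.
have p0 : 0 < p by rewrite (lt_trans ltr01). have q0 : 0 < q by rewrite (lt_trans ltr01).
pose a := p^-1; pose b := 1 - q^-1.
have a01 : 0 < a < 1 by rewrite invr_gt0 p0/= invf_lt1.
have q01 : 0 < q^-1 < 1 by rewrite invr_gt0 q0/= invf_lt1.
have b01 : 0 < b < 1 by rewrite /b; move: q01; lra.
(* Multiplied by p q, this is rho^2 (q - 1) <= p - 1. *)
have rab : rho ^+ 2 * (a * b) <= (1 - a) * (1 - b).
  have -> : rho ^+ 2 * (a * b) = rho ^+ 2 * (q - 1) * (p^-1 * q^-1).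
    by rewrite /a /b; field; rewrite !gt_eqF.
  have -> : (1 - a) * (1 - b) = (p - 1) * (p^-1 * q^-1).
    by rewrite /a /b; field; rewrite !gt_eqF.
  by rewrite ler_wpM2r// mulr_ge0 ?invr_ge0 ?ltW.
have bP := bfun_mehler bf; have dPM := mehler_bounds bf dfM.
have f0 x : 0 <= f x by have /andP[h _] := dfM x; rewrite (le_trans (ltW d0)).
have P0 x : 0 < mehler_op f x by have /andP[h _] := dPM x; rewrite (lt_le_trans d0).
have dM : d <= M by have /andP[] := dfM 0; exact: le_trans.
have M0 : 0 < M by exact: lt_le_trans dM.
pose d' := Num.min (d `^ p) (d `^ q); pose M' := Num.max (M `^ p) (M `^ q).
have d'0 : 0 < d' by rewrite lt_min !powR_gt0.
have bnd (c : R) (h : borel X -> R) : c = p \/ c = q -> (forall x, d <= h x <= M) -> forall x, d' <= h x `^ c <= M'.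
  move=> cpq dhM x; have /andP[dh hM] := dhM x.
  have c0 : 0 <= c by case: cpq => ->; exact: ltW.
  have h1 : d `^ c <= h x `^ c by rewrite ge0_ler_powR// nnegrE (ltW d0, le_trans (ltW d0)).
  have h2 : h x `^ c <= M `^ c by rewrite ge0_ler_powR// nnegrE ?(ltW M0)// (le_trans (ltW d0)).
  by rewrite /d' /M' ge_min le_max; case: cpq h1 h2 => <- -> ->; rewrite ?orbT.
have bfp : bfun (fun x => f x `^ p) by apply: bfun_powR => //; exact: ltW.
have bPq : bfun (fun x => mehler_op f x `^ q).
  by apply: bfun_powR => // [|x]; exact: ltW.
have := joint_holder rho0 rho1 a01 b01 rab Vrho bfp.1 bPq.1 d'0 (bnd p f (or_introl erefl) dfM)
   (bnd q _ (or_intror erefl) dPM).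
have -> : (\int[joint]_z ((f z.1 `^ p) `^ a * (mehler_op f z.2 `^ q) `^ b))%R =
    (\int[gs]_x mehler_op f x `^ q)%R.
  transitivity (\int[joint]_z (f z.1 * mehler_op f z.2 `^ (q - 1)))%R.
    apply: eq_Rintegral => z _; rewrite -!powRrM divff ?gt_eqF// powRr1//; congr (_ * _ `^ _).
    by rewrite /b; field; rewrite gt_eqF.
  have bq1 : bfun (fun x => mehler_op f x `^ (q - 1)).
    by apply: bfun_powR => // [|x]; [rewrite subr_ge0 ltW|exact: ltW].
  have bG : bfun (fun z : borel X * borel X => f z.1 * mehler_op f z.2 `^ (q - 1)).
    by apply: bfunM; [exact: (bfun_comp measurable_fst bf)|exact: (bfun_comp measurable_snd bq1)].
  rewrite (joint_int bG); apply: eq_Rintegral => x _ /=.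
  under eq_Rintegral do rewrite mulrC.
  rewrite bintZ; last exact: (bfun_comp (measurable_shift1 x) bf).
  rewrite -/(mehler_op f x) mulrC -[X in X * _]powRr1 ?(ltW (P0 x))// -powRD ?gt_eqF ?implybT ?subrKC//.
have I0 : 0 < (\int[gs]_x mehler_op f x `^ q)%R.
  apply: (lt_le_trans d'0); rewrite -(bint_cst gs d'); apply: bint_le => // [|x]; first exact: bfun_cst.
  by have /andP[] := bnd q _ (or_intror erefl) dPM x.
exact: powR_absorb.
Qed.

End mehler.

(** * Unbounded functions and endpoint exponents *)

Lemma cvg_powR2 {R : realType} (x c : nat -> R) (x0 c0 : R) : (forall n, 0 < x n) -> 0 < x0 ->
  x n @[n --> \oo] --> x0 -> c n @[n --> \oo] --> c0 -> x n `^ c n @[n --> \oo] --> x0 `^ c0.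
Proof.
move=> xp x0p xx cc.
have -> : (fun n => x n `^ c n) = (fun n => expR (c n * ln (x n))).
  by apply/funext => n; rewrite /powR gt_eqF.
rewrite [X in _ --> X](_ : _ = expR (c0 * ln x0)); last by rewrite /powR gt_eqF.
apply: (continuous_cvg _ (@continuous_expR R (c0 * ln x0))).
by apply: cvgM => //; apply: (continuous_cvg _ (continuous_ln x0p)).
Qed.

Lemma cvg_shift_harmonic {R : realType} (p : R) : p + n.+1%:R^-1 @[n --> \oo] --> p.
Proof. by apply: (@cvg_rate _ _ _ 1) => n; rewrite addrAC subrr add0r mul1r ger0_norm// invr_ge0. Qed.

(* Perturbing the exponents reaches the endpoints p = 1 and q = 1. *)
Lemma cvg_norm_exponent {R : realType} d (T : measurableType d) (P : probability T R) (f : T -> R) (a M p : R) :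
  0 < p -> 0 < a -> bfun f -> (forall x, a <= f x <= M) ->
  ((\int[P]_x f x `^ (p + n.+1%:R^-1)) `^ (p + n.+1%:R^-1)^-1)%R @[n --> \oo] -->
  ((\int[P]_x f x `^ p) `^ p^-1)%R.
Proof.
move=> p0 a0 bf fM; pose r n := p + n.+1%:R^-1.
have r0 n : 0 < r n by rewrite addr_gt0// invr_gt0.
have rp1 n : r n <= p + 1 by rewrite lerD2l invf_le1// ler1n.
have f0 x : 0 < f x by have /andP[h _] := fM x; exact: lt_le_trans h.
have bfr (c : R) : 0 < c -> bfun (fun x => f x `^ c) by move=> c0; apply: bfun_powR => // [|x]; exact: ltW.
have pos (c : R) : 0 < c -> 0 < (\int[P]_x f x `^ c)%R.
  move=> c0; apply: (@lt_le_trans _ _ (a `^ c)); first exact: powR_gt0.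
  rewrite -(bint_cst P (a `^ c)); apply: bint_le => // [||x]; [exact: bfun_cst|exact: bfr|].
  by have /andP[h _] := fM x; rewrite ge0_ler_powR// ?nnegrE ltW.
apply: (@cvg_powR2 _ (fun n => (\int[P]_x f x `^ r n)%R) (fun n => (r n)^-1)).
- by move=> n; exact: (pos _ (r0 n)).
- exact: (pos _ p0).
- have [|n x|x|_] := @bint_cvg _ _ _ P (fun n x => f x `^ r n) (fun x => f x `^ p) ((1 + M) `^ (p + 1)).
  + by move=> n; exact: bfr.
  + have /andP[h1 h2] := fM x.
    rewrite ger0_norm ?powR_ge0// (@le_trans _ _ ((1 + M) `^ r n))//.
      rewrite ge0_ler_powR ?nnegrE ?(ltW (r0 n)) ?(ltW (f0 x))//.
        by have := f0 x; lra.
      by lra.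
    by rewrite ler_powR//; have := f0 x; lra.
  + by apply: cvg_powR2 => //; [exact: cvg_cst|exact: cvg_shift_harmonic].
  by [].
- by apply: cvgV; [rewrite gt_eqF|exact: cvg_shift_harmonic].
Qed.

Lemma powR_chain {R : realType} (p q i j k l : R) : 0 < p -> 0 < q -> 0 <= i -> i <= j -> 0 <= k -> k <= l ->
  j `^ q^-1 <= k `^ p^-1 -> i `^ (q^-1 * p) <= l.
Proof.
move=> p0 q0 i0 ij k0 kl jk; have j0 : 0 <= j by exact: le_trans ij.
have le1 : i `^ q^-1 <= k `^ p^-1.
  by apply: le_trans jk; rewrite ge0_ler_powR// invr_ge0 ltW.
rewrite powRrM (le_trans _ kl)// -[leRHS](powRr1 k0) -(mulVf (lt0r_neq0 p0)) (powRrM k).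
by rewrite ge0_ler_powR ?nnegrE ?powR_ge0 ?(ltW p0).
Qed.

Lemma ereal_nondecreasing_le_limn {R : realType} (u : nat -> \bar R) : nondecreasing_seq u ->
  forall n, (u n <= limn u)%E.
Proof.
move=> nd n; apply: lime_ge; first exact: ereal_nondecreasing_is_cvgn.
by exists n => // m /= nm; exact: nd.
Qed.

(** * From bounded positive functions to nonnegative ones *)

Section positive.
Context {R : realType} d (T : measurableType d).
Variables (gs gt nu : probability T R) (sh : T * T -> T).
Hypothesis msh : measurable_fun [set: T * T] sh.
Variable rho : R.
Let P (f : T -> R) x := (\int[nu]_z f (sh (x, z)))%R.
Hypothesis HC : forall p q f (a M : R), 1 < p -> 1 < q -> rho ^+ 2 * (q - 1) <= p - 1 ->
  bfun f -> 0 < a -> (forall x, a <= f x <= M) ->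
  ((\int[gs]_x P f x `^ q) `^ q^-1 <= (\int[gt]_x f x `^ p) `^ p^-1)%R.
Variables p q : R.
Hypotheses (p1 : 1 <= p) (q1 : 1 <= q) (pq : rho ^+ 2 * (q - 1) <= p - 1) (rho2 : rho ^+ 2 <= 1).

Let p0 : 0 < p. Proof. exact: lt_le_trans p1. Qed.
Let q0 : 0 < q. Proof. exact: lt_le_trans q1. Qed.

Let bsh (f : T -> R) : bfun f -> bfun (fun z => f (sh z)).
Proof. by move=> bf; exact: (bfun_comp msh bf). Qed.

Let bP (f : T -> R) : bfun f -> bfun (P f).
Proof. by move=> bf; have [b _ _ _] := bint_prod gs nu (bsh bf); exact: b. Qed.

Let bf1 (f : T -> R) x : bfun f -> bfun (fun z => f (sh (x, z))).
Proof. by move=> bf; exact: (bfun_pair1 x (bsh bf)). Qed.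

Let P_le (f g : T -> R) : bfun f -> bfun g -> (forall x, f x <= g x) -> forall x, P f x <= P g x.
Proof. by move=> bf bg fg x; apply: bint_le; [exact: bf1|exact: bf1|]. Qed.

Let P_bounds (f : T -> R) (a M : R) : bfun f -> (forall x, a <= f x <= M) -> forall x, a <= P f x <= M.
Proof.
move=> bf fM x; apply/andP; split.
  rewrite -(bint_cst nu a); apply: bint_le => [||z]; [exact: bfun_cst|exact: bf1|].
  by have /andP[] := fM (sh (x, z)).
rewrite -(bint_cst nu M); apply: bint_le => [||z]; [exact: bf1|exact: bfun_cst|].
by have /andP[] := fM (sh (x, z)).
Qed.

(** Adding the same 1/(n + 1) to p and q makes both exceed 1 and preserves the constraint because
    rho^2 <= 1. *)
Lemma contraction_bounded_below f (a M : R) : bfun f -> 0 < a -> (forall x, a <= f x <= M) ->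
  ((\int[gs]_x P f x `^ q) `^ q^-1 <= (\int[gt]_x f x `^ p) `^ p^-1)%R.
Proof.
move=> bf a0 fM.
have c1 := @cvg_norm_exponent _ _ _ gs _ _ _ _ q0 a0 (bP bf) (P_bounds bf fM).
have c2 := @cvg_norm_exponent _ _ _ gt _ _ _ _ p0 a0 bf fM.
refine (ler_cvg_to c1 c2 (nearW _ _)) => n; have n0 : 0 < n.+1%:R^-1 :> R by rewrite invr_gt0.
apply: (HC _ _ _ bf a0 fM).
- by rewrite (le_lt_trans p1)// ltrDl.
- by rewrite (le_lt_trans q1)// ltrDl.
- rewrite [q + _ - 1]addrAC mulrDr [p + _ - 1]addrAC; apply: lerD => //.
  by rewrite ler_piMl// ltW.
Qed.

(** [f] is raised to at least [a]. In this form, with the p-th power taken, the right side grows by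
    at most a^p <= a <= e, using p >= 1 and a <= 1. *)
Lemma contraction_bounded f (M : R) : bfun f -> (forall x, 0 <= f x <= M) ->
  ((\int[gs]_x P f x `^ q) `^ (q^-1 * p) <= \int[gt]_x f x `^ p)%R.
Proof.
move=> bf fM; apply/ler_addgt0Pr => e e0.
pose a := Num.min e 1; have a0 : 0 < a by rewrite lt_min e0/=.
have a1 : a <= 1 by rewrite ge_min lexx orbT.
pose g x := Num.max (f x) a.
have fg x : f x <= g x by rewrite le_max lexx.
have gM x : a <= g x <= Num.max M a.
  by have /andP[_ h] := fM x; rewrite /g le_max lexx orbT/= ge_max !le_max h lexx orbT.
have bg : bfun g.
  by apply: (bfun_itv _ gM); apply: measurable_maxr; [have [] := bf|exact: measurable_cst].
have P0 x : 0 <= P f x by have /andP[] := P_bounds bf fM x.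
have f0 x : 0 <= f x by have /andP[] := fM x.
have g0 x : 0 <= g x by rewrite (le_trans (f0 x)).
have Pg0 x : 0 <= P g x by rewrite (le_trans (P0 x))// P_le.
have h0 : (0 <= \int[gs]_x P f x `^ q)%R by apply: Rintegral_ge0 => x _; exact: powR_ge0.
have h1 : (\int[gs]_x P f x `^ q <= \int[gs]_x P g x `^ q)%R.
  apply: bint_le => [||x]; [by apply: bfun_powR (ltW q0) _ (bP _)|by apply: bfun_powR (ltW q0) _ (bP _)|].
  by rewrite ge0_ler_powR ?nnegrE ?(ltW q0)//; exact: P_le.
have h2 : (\int[gt]_x g x `^ p <= \int[gt]_x f x `^ p + e)%R.
  rewrite -(bint_cst gt e) -bintD; [|by apply: bfun_powR => //; exact: ltW|exact: bfun_cst].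
  apply: bint_le => [||x]; [by apply: bfun_powR => //; exact: ltW| |].
    by apply: bfunD; [by apply: bfun_powR => //; exact: ltW|exact: bfun_cst].
  rewrite /g; case: (leP (f x) a) => fa.
    rewrite ler_wpDl ?powR_ge0// (@le_trans _ _ a)// ?ge1r_powR ?a0//.
    by rewrite ge_min lexx.
  by rewrite lerDl ltW.
have K0 : (0 <= \int[gt]_x g x `^ p)%R by apply: Rintegral_ge0 => x _; exact: powR_ge0.
exact: (powR_chain p0 q0 h0 h1 K0 h2 (contraction_bounded_below bg a0 gM)).
Qed.

(** Extended-valued, so that it makes sense for unbounded f before finiteness is known. *)
Definition kernel_int (f : T -> R) x : \bar R := (\int[nu]_z (f (sh (x, z)))%:E)%E.

Lemma measurable_kernel_int (f : T -> R) : measurable_fun [set: T] f -> (forall x, 0 <= f x) ->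
  measurable_fun [set: T] (kernel_int f).
Proof.
move=> mf f0; apply: (@measurable_fun_fubini_tonelli_F _ _ _ _ _ nu (fun z => (f (sh z))%:E)) => [|z]; last by rewrite lee_fin.
by apply/measurable_EFinP; exact: measurableT_comp.
Qed.

Let kernel_bint f x : bfun f -> kernel_int f x = (P f x)%:E.
Proof.
by move=> bf; rewrite /P/Rintegral fineK//; apply: integrable_fin_num => //; exact: (bfun_int nu (bf1 x bf)).
Qed.

(** Truncation at n and monotone convergence twice, inside the kernel and under the outer
    integral. *)
Lemma kernel_int_Lnorm (f : T -> R) : measurable_fun [set: T] f -> (forall x, 0 <= f x) ->
  ('N[gs]_q%:E[kernel_int f] <= 'N[gt]_p%:E[EFin \o f])%E.
Proof.
move=> mf f0; pose g n x := Num.min (f x) n%:R.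
have g0 n x : 0 <= g n x by rewrite le_min f0/=.
have gn n x : 0 <= g n x <= n%:R by rewrite g0 ge_min lexx orbT.
have gf n x : g n x <= f x by rewrite ge_min lexx.
have bg n : bfun (g n).
  by apply: (bfun_itv _ (gn n)); apply: measurable_minr => //; exact: measurable_cst.
have gnd x : nondecreasing_seq (g ^~ x).
  by move=> n m nm; rewrite /g le_min !ge_min lexx ler_nat nm orbT.
have P0 n x : 0 <= P (g n) x by have /andP[] := P_bounds (bg n) (gn n) x.
pose K := ('N[gt]_p%:E[EFin \o f])%E.
have K0 : (0 <= K)%E by exact: Lnorm_ge0.
pose h n x := (P (g n) x `^ q)%:E.
have mh n : measurable_fun [set: T] (h n).
  by apply/measurable_EFinP; have [] := bfun_powR (ltW q0) (P0 n) (bP (bg n)).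
have hnd x : nondecreasing_seq (h ^~ x).
  move=> n m nm; rewrite lee_fin ge0_ler_powR ?nnegrE ?(ltW q0)//.
  by apply: P_le => // y; exact: gnd.
have hK n : (\int[gs]_x h n x <= K `^ q)%E.
  have -> : (K `^ q = (\int[gt]_x (f x `^ p)%:E) `^ (p^-1 * q))%E.
    rewrite /K unlock -poweRrM (eq_integral (fun x => (f x `^ p)%:E))// => x _.
    by rewrite /= ger0_norm.
  have := contraction_bounded (bg n) (gn n); set J := (\int[gs]_x _)%R => JK.
  have -> : (\int[gs]_x h n x)%E = J%:E.
    rewrite /J/Rintegral fineK//; apply: integrable_fin_num => //.
    exact: (bfun_int gs (bfun_powR (ltW q0) (P0 n) (bP (bg n)))).
  have J0 : 0 <= J by apply: Rintegral_ge0 => x _; exact: powR_ge0.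
  have -> : J = (J `^ (q^-1 * p)) `^ (p^-1 * q).
    by rewrite -powRrM mulrA -(mulrA _ p) mulfV ?gt_eqF// mulr1 mulVf ?gt_eqF// powRr1.
  rewrite -poweR_EFin; apply: gt0_ler_poweR.
  - by rewrite mulr_ge0 ?invr_ge0 ?ltW.
  - by rewrite in_itv/= lee_fin powR_ge0 leey.
  - by rewrite in_itv/= leey andbT; apply: integral_ge0 => x _; rewrite lee_fin powR_ge0.
  apply: (@le_trans _ _ (\int[gt]_x (g n x `^ p)%R)%R%:E); first by rewrite lee_fin.
  rewrite /Rintegral fineK; last first.
    apply: integrable_fin_num => //.
    exact: (bfun_int gt (bfun_powR (ltW p0) (g0 n) (bg n))).
  apply: ge0_le_integral => //.
  - by move=> x _; rewrite lee_fin powR_ge0.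
  - by apply/measurable_EFinP; have [] := bfun_powR (ltW p0) (g0 n) (bg n).
  - by apply/measurable_EFinP; exact: (measurableT_comp (measurable_powR p)).
  - by move=> x _; rewrite lee_fin ge0_ler_powR ?nnegrE ?(ltW p0).
have G0 x : (0 <= kernel_int f x)%E by apply: integral_ge0 => z _; rewrite lee_fin.
have Gh x : (kernel_int f x `^ q <= limn (h ^~ x))%E.
  have hcv := ereal_nondecreasing_is_cvgn (hnd x).
  have hL n : (h n x <= limn (h ^~ x))%E by exact: (ereal_nondecreasing_le_limn (hnd x) n).
  set L := limn _ in hL *.
  have L0 : (0 <= L)%E by apply: le_trans (hL 0%N); rewrite lee_fin powR_ge0.
  rewrite -(poweRe1 L0) -(mulVf (lt0r_neq0 q0)) poweRrM.
  apply: gt0_ler_poweR; rewrite ?in_itv/= ?leey ?andbT ?G0 ?poweR_ge0 ?(ltW q0)//.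
  have cG : (kernel_int (g n) x)%E @[n --> \oo] --> kernel_int f x.
    rewrite [X in _ --> X](_ : _ = \int[nu]_z limn (fun n => (g n (sh (x, z)))%:E))%E.
      apply: cvg_monotone_convergence => //.
      - move=> n; apply/measurable_EFinP.
        by have [] := bf1 x (bg n).
      - by move=> n z _; rewrite lee_fin.
      - by move=> z _ n m nm; rewrite lee_fin; exact: gnd.
    apply: eq_integral => z _; apply/esym/cvg_lim => //.
    apply: cvg_near_cst; exists (Num.bound (f (sh (x, z)))) => // n /= nb.
    rewrite /g min_l// (le_trans (ltW (archi_boundP _)))// ler_nat; exact: nb.
  rewrite -(cvg_lim _ cG)//; apply: lime_le; first by apply: cvgP cG.
  apply: nearW => n; rewrite kernel_bint//.
  rewrite -(powRr1 (P0 n x)) -(mulfV (lt0r_neq0 q0)) powRrM -poweR_EFin.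
  by apply: gt0_ler_poweR; rewrite ?in_itv/= ?leey ?andbT ?lee_fin ?powR_ge0 ?invr_ge0 ?(ltW q0)//; exact: hL.
rewrite -/K -(poweRe1 K0) -(mulfV (lt0r_neq0 q0)) poweRrM unlock.
apply: gt0_ler_poweR; rewrite ?in_itv/= ?leey ?andbT ?poweR_ge0 ?invr_ge0 ?(ltW q0)//.
  by apply: integral_ge0 => x _; rewrite poweR_ge0.
apply: (@le_trans _ _ (\int[gs]_x limn (h ^~ x))%E).
  apply: ge0_le_integral => //.
  - by move=> x _; rewrite poweR_ge0.
  - apply: (measurableT_comp (measurable_poweR q)).
    by apply: measurableT_comp => //; exact: measurable_kernel_int.
  - apply: (emeasurable_fun_cvg h) => // x _; exact: ereal_nondecreasing_is_cvgn.
  - by move=> x _; rewrite gee0_abs//; exact: Gh.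
rewrite (monotone_convergence gs measurableT mh); [|by move=> n x _; rewrite lee_fin powR_ge0|by move=> x _; exact: hnd].
apply: lime_le; last exact: nearW.
apply: ereal_nondecreasing_is_cvgn => n m nm.
by apply: (@ge0_le_integral _ _ _ gs [set: T] measurableT (h n) (h m) _ (mh n) (mh m)) => x _;
  [rewrite lee_fin powR_ge0|exact: hnd].
Qed.

End positive.

(** Markov's inequality in L^m gives P (G >= c) <= (k / c)^m for every m >= 1, which tends to 0 for
    each c > k. *)
Lemma Lnorm_infty_le {R : realType} d (T : measurableType d) (P : probability T R) (G : T -> \bar R) (K : \bar R) :
  measurable_fun [set: T] G -> (forall x, (0 <= G x)%E) ->
  (forall q : R, 1 <= q -> ('N[P]_q%:E[G] <= K)%E) -> ('N[P]_+oo[G] <= K)%E.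
Proof.
move=> mG G0 GK; have K0 : (0 <= K)%E by exact: (le_trans (Lnorm_ge0 P 1%:E G) (GK 1 (lexx _))).
rewrite unlock /Lnorm/= probability_setT lte01; apply/ess_supP.
case: K GK K0 => [k GK|_ _|//]; last by apply: nearW => x; rewrite leey.
rewrite lee_fin => k0.
pose E n := [set x | ((k + n.+1%:R^-1)%:E <= G x)%E].
have mE n : measurable (E n).
  have -> : E n = [set: T] `&` [set x | ((k + n.+1%:R^-1)%:E <= G x)%E] by rewrite setTI.
  by apply: emeasurable_fun_c_infty.
suff E0 n : P (E n) = 0%E.
  apply: (@negligibleS _ _ _ P (\bigcup_n E n)); last first.
    by apply: negligible_bigcup => n; exists (E n); split => //; exact: E0.
  move=> x /= /negP; rewrite gee0_abs// -ltNge => kG.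
  have [N kN] : exists N, ((k + N.+1%:R^-1)%:E <= G x)%E.
    case: (G x) kG => [g|_|//]; last by exists 0%N; rewrite leey.
    rewrite lte_fin => kg; exists (Num.bound (g - k)^-1); rewrite lee_fin -lerBrDl.
    rewrite -[leRHS]invrK lef_pV2 ?posrE ?invr_gt0 ?subr_gt0//.
    rewrite (le_trans (ltW (archi_boundP _))) ?invr_ge0 ?subr_ge0 ?(ltW kg)//.
    by rewrite ler_nat.
  by exists N.
have c0 : 0 < k + n.+1%:R^-1 by rewrite ltr_wpDl// invr_gt0.
have kc : k < k + n.+1%:R^-1 by rewrite ltrDl invr_gt0.
move: (E n) (mE n) (fun x => id : E n x -> (_ <= G x)%E) kc c0; move: (k + _) => c F mF Fc kc c0.
have bnd (m : nat) : fine (P F) <= (k / c) ^+ m.+1.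
  have PF : P F = (fine (P F))%:E by rewrite fineK// fin_num_measure.
  rewrite expr_div_n ler_pdivlMr ?exprn_gt0// mulrC -lee_fin EFinM -PF.
  apply: (@le_trans _ _ ('N[P]_(m.+1%:R)%:E[G] `^ m.+1%:R)%E).
    rewrite poweR_Lnorm ?pnatr_eq0//.
    rewrite -[X in (X <= _)%E](integral_cst P mF).
    apply: (@le_trans _ _ (\int[P]_(x in F) (`|G x| `^ m.+1%:R))%E).
      apply: ge0_le_integral => //.
      - by move=> x _; rewrite lee_fin exprn_ge0// ltW.
      - apply: (measurableT_comp (measurable_poweR _)); apply: measurableT_comp => //.
        exact: measurable_funTS.
      - move=> x Fx; rewrite /= gee0_abs// -powR_mulrn ?(ltW c0)// -poweR_EFin.
        by apply: gt0_ler_poweR; rewrite ?in_itv/= ?leey ?andbT ?lee_fin ?(ltW c0) ?G0 ?ler0n//; exact: Fc.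
    apply: ge0_subset_integral => //.
    - by apply: (measurableT_comp (measurable_poweR _)); apply: measurableT_comp.
    - by move=> x _; rewrite poweR_ge0.
  apply: (@le_trans _ _ (k%:E `^ m.+1%:R)%E); last by rewrite poweR_EFin powR_mulrn.
  apply: gt0_ler_poweR; rewrite ?in_itv/= ?leey ?andbT ?lee_fin ?Lnorm_ge0 ?ler0n//.
  by apply: GK; rewrite ler1n.
have r01 : 0 <= k / c < 1 by rewrite divr_ge0 ?(ltW c0)// ltr_pdivrMr// mul1r.
have cv : (k / c) ^+ m.+1 @[m --> \oo] --> (0 : R).
  by rewrite (cvg_shiftS (fun m => (k / c) ^+ m)); apply: cvg_expr; have /andP[h1 h2] := r01; rewrite ger0_norm.
have PF0 : fine (P F) <= 0 by apply: (ler_cvg_to (cvg_cst _) cv); exact: nearW.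
by apply/eqP; rewrite eq_le measure_ge0 andbT -[P F]fineK ?fin_num_measure// lee_fin.
Qed.

(** * Operators on L^p *)

Section Lnorm_ae.
Context {R : realType} d (T : measurableType d) (P : probability T R).
Implicit Types f g : T -> \bar R.

Lemma LfunE (f : T -> R) (q : \bar R) : f \in Lfun P q <->
  measurable_fun [set: T] f /\ ('N[P]_q[EFin \o f] < +oo)%E.
Proof.
split; first by move=> /andP[]; rewrite !inE.
by move=> [mf ff]; apply/andP; split; rewrite inE.
Qed.

Lemma Lnorm_ae_le f g (q : \bar R) : measurable_fun [set: T] f -> measurable_fun [set: T] g -> (0 < q)%E ->
  (\forall x \ae P, (`|f x| <= `|g x|)%E) -> ('N[P]_q[f] <= 'N[P]_q[g])%E.
Proof.
move=> mf mg q0 fg; rewrite unlock /Lnorm; case: q q0 => [q|_|//].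
- rewrite lte_fin => q0.
  have q1 : 0 <= q^-1 by rewrite invr_ge0 ltW.
  have mp (h : T -> \bar R) : measurable_fun [set: T] h -> measurable_fun [set: T] (fun x => `|h x| `^ q)%E.
    by move=> mh; apply: (measurableT_comp (measurable_poweR q)); exact: measurableT_comp.
  apply: gt0_ler_poweR => //; rewrite ?in_itv/= ?leey ?andbT.
  - by apply: integral_ge0 => x _; rewrite poweR_ge0.
  - by apply: integral_ge0 => x _; rewrite poweR_ge0.
  - apply: ae_ge0_le_integral => //.
    + by move=> x _; rewrite poweR_ge0.
    + exact: mp.
    + by move=> x _; rewrite poweR_ge0.
    + exact: mp.
    + apply: filterS fg => x fgx _.
      by apply: gt0_ler_poweR; rewrite ?in_itv/= ?leey ?abse_ge0 ?(ltW q0).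
- rewrite /= probability_setT lte01; apply/ess_supP.
  have gs : \forall x \ae P, (`|g x| <= ess_sup P (abse \o g))%E by exact: (ess_sup_ge P (abse \o g)).
  by apply: filterS2 fg gs => x /= h1 h2; exact: le_trans h2.
Qed.

Lemma Lnorm_le_int f (q : R) (K : \bar R) : 0 < q -> (0 <= K)%E ->
  (\int[P]_x (`|f x| `^ q) <= K `^ q)%E -> ('N[P]_q%:E[f] <= K)%E.
Proof.
move=> q0 K0 h; rewrite -(poweRe1 K0) -(mulfV (lt0r_neq0 q0)) poweRrM unlock.
apply: gt0_ler_poweR; rewrite ?in_itv/= ?leey ?andbT ?poweR_ge0 ?invr_ge0 ?(ltW q0)//.
by apply: integral_ge0 => x _; rewrite poweR_ge0.
Qed.

Lemma Lnorm_ae_eq f g (q : \bar R) : measurable_fun [set: T] f -> measurable_fun [set: T] g -> (0 < q)%E ->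
  (\forall x \ae P, f x = g x) -> 'N[P]_q[f]%E = 'N[P]_q[g]%E.
Proof.
move=> mf mg q0 fg; apply/eqP; rewrite eq_le !Lnorm_ae_le//.
  by apply: filterS fg => x ->.
by apply: filterS fg => x ->.
Qed.

Lemma Lnorm_ae_eqr (f g : T -> R) (q : \bar R) : measurable_fun [set: T] f -> measurable_fun [set: T] g ->
  (0 < q)%E -> f = g %[ae P] -> 'N[P]_q[EFin \o f]%E = 'N[P]_q[EFin \o g]%E.
Proof.
move=> mf mg q0 fg; apply: Lnorm_ae_eq => //; [exact/measurable_EFinP|exact/measurable_EFinP|].
by apply: filterS fg => x /(_ I) /= ->.
Qed.

Lemma ae_Lfun (f g : T -> R) (q K : \bar R) : measurable_fun [set: T] f -> measurable_fun [set: T] g ->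
  (0 < q)%E -> f = g %[ae P] -> (K < +oo)%E -> ('N[P]_q[EFin \o g] <= K)%E ->
  f \in Lfun P q /\ ('N[P]_q[EFin \o f] <= K)%E.
Proof.
move=> mf mg q0 fg Kf gK; have NE := Lnorm_ae_eqr mf mg q0 fg.
by split; [apply/LfunE; split => //; rewrite NE; exact: le_lt_trans Kf|rewrite NE].
Qed.

Lemma ae_notin_Lfun (f g : T -> R) (q : \bar R) : measurable_fun [set: T] f -> measurable_fun [set: T] g ->
  (0 < q)%E -> f = g %[ae P] -> 'N[P]_q[EFin \o g]%E = +oo%E -> f \notin Lfun P q.
Proof.
move=> mf mg q0 fg gy; apply/negP => /LfunE[_]; rewrite (Lnorm_ae_eqr mf mg q0 fg) gy.
by rewrite ltxx.
Qed.

Lemma Lnorm_fin_ae (G : T -> \bar R) (p : R) : 0 < p -> measurable_fun [set: T] G -> (forall x, (0 <= G x)%E) ->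
  ('N[P]_p%:E[G] < +oo)%E -> \forall x \ae P, (G x < +oo)%E.
Proof.
move=> p0 mG G0 Gf.
have fin : (\int[P]_x (G x `^ p) < +oo)%E.
  have -> : (\int[P]_x (G x `^ p) = 'N[P]_p%:E[G] `^ p)%E.
    by rewrite poweR_Lnorm ?gt_eqF//; apply: eq_integral => x _; rewrite gee0_abs.
  exact: poweR_lty.
have mp : measurable_fun [set: T] (fun x => G x `^ p)%E by exact: (measurableT_comp (measurable_poweR p)).
have [mA PA] := ge0_finite_ae mp (fun x => poweR_ge0 _ _) fin.
exists (~` [set x | (G x `^ p < +oo)%E]); split => //; first exact: measurableC.
by move=> x /=; apply: contra_not; apply: lty_poweRy; rewrite gt_eqF.
Qed.

End Lnorm_ae.

(** * The kernel operator on L^p *)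

Section kernel_operator.
Context {R : realType} d (T : measurableType d).
Variables (gs gt nu : probability T R) (sh : T * T -> T).
Hypothesis msh : measurable_fun [set: T * T] sh.

Definition kernel_op (f : T -> R) x : R := (\int[nu]_z f (sh (x, z)))%R.

Let msh1 (f : T -> R) x : measurable_fun [set: T] f -> measurable_fun [set: T] (fun z => f (sh (x, z))).
Proof. by move=> mf; apply: (measurableT_comp mf); exact: (measurableT_comp msh (pair1_measurable x)). Qed.

Let mpos (f : T -> R) : measurable_fun [set: T] f -> measurable_fun [set: T] (kernel_int nu sh (fun x => Num.max (f x) 0)).
Proof.
move=> mf; apply: (measurable_kernel_int nu msh).
  by apply: measurable_maxr => //; exact: measurable_cst.
by move=> x; rewrite le_max lexx orbT.
Qed.

Lemma measurable_kernel_op f : measurable_fun [set: T] f -> measurable_fun [set: T] (kernel_op f).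
Proof.
move=> mf.
(* No integrability is known here, so [f] is split into its positive and negative parts, whose
   kernel integrals are measurable in any case. *)
have -> : kernel_op f = fine \o (kernel_int nu sh (fun x => Num.max (f x) 0%R) \-
    kernel_int nu sh (fun x => Num.max (- f x)%R 0%R))%E.
  apply/funext => x; rewrite /kernel_op /Rintegral integralE /=; congr fine.
  congr (_ - _)%E; apply: eq_integral => z _.
    by rewrite funeposE/= EFin_max.
  by rewrite funenegE/= EFin_max.
apply: (measurableT_comp (fine_measurable measurableT)); apply: emeasurable_funB; apply: mpos => //.
exact: measurableT_comp.
Qed.

(** Valid without integrability, since [fine] sends an infinite integral to 0. *)
Lemma kernel_op_abs f x : measurable_fun [set: T] f ->
  (`|kernel_op f x|%:E <= kernel_int nu sh (fun x => `|f x|%R) x)%E.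
Proof.
move=> mf; rewrite /kernel_op /Rintegral /kernel_int.
have h := le_abse_integral nu measurableT (iffRL (measurable_EFinP _ _) (msh1 x mf)).
apply: (le_trans _ h); move: (\int[nu]_z _)%E => y.
by case: y => [r| |]//=; rewrite ?normr0 ?lexx ?leey.
Qed.

Lemma kernel_op_Lnorm_le (f : T -> R) (q : \bar R) : measurable_fun [set: T] f -> (0 < q)%E ->
  ('N[gs]_q[EFin \o kernel_op f] <= 'N[gs]_q[kernel_int nu sh (fun x => `|f x|%R)])%E.
Proof.
move=> mf q0; apply: Lnorm_ae_le => //.
- by apply/measurable_EFinP; exact: measurable_kernel_op.
- by apply: (measurable_kernel_int nu msh) => //; exact: measurableT_comp.
- apply: nearW => x /=; rewrite [leRHS]gee0_abs; first exact: kernel_op_abs.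
  by apply: integral_ge0 => z _; rewrite lee_fin.
Qed.

Variable p : R.
Hypothesis p1 : 1 <= p.
Hypothesis contr : forall f : T -> R, measurable_fun [set: T] f -> (forall x, 0 <= f x) ->
  ('N[gs]_p%:E[kernel_int nu sh f] <= 'N[gt]_p%:E[EFin \o f])%E.

Let p0 : 0 < p. Proof. exact: lt_le_trans p1. Qed.

Let contr_abs (f : T -> R) : measurable_fun [set: T] f ->
  ('N[gs]_p%:E[kernel_int nu sh (fun x => `|f x|%R)] <= 'N[gt]_p%:E[EFin \o f])%E.
Proof.
move=> mf; have mf' : measurable_fun [set: T] (fun x => `|f x|%R) by exact: measurableT_comp.
apply: (le_trans (contr mf' (fun x => normr_ge0 _))); rewrite -(Lnorm_abse gt (EFin \o f)).
by [].
Qed.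

Lemma kernel_op_contraction (f : T -> R) : measurable_fun [set: T] f ->
  ('N[gs]_p%:E[EFin \o kernel_op f] <= 'N[gt]_p%:E[EFin \o f])%E.
Proof. by move=> mf; apply: (le_trans (kernel_op_Lnorm_le mf _)) => //; exact: contr_abs. Qed.

Lemma kernel_op_Lfun (f : T -> R) : f \in Lfun gt p%:E -> kernel_op f \in Lfun gs p%:E.
Proof.
move=> /LfunE[mf ff]; apply/LfunE; split; first exact: measurable_kernel_op.
exact: le_lt_trans (kernel_op_contraction mf) ff.
Qed.

(** The contraction makes the kernel integral of |f| finite almost everywhere. Linearity of
    [kernel_op] thus holds almost everywhere, not at every point. *)
Lemma kernel_integrable (f : T -> R) : f \in Lfun gt p%:E ->
  \forall x \ae gs, nu.-integrable [set: T] (fun z => (f (sh (x, z)))%:E).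
Proof.
move=> /LfunE[mf ff]; have mf' : measurable_fun [set: T] (fun x => `|f x|%R) by exact: measurableT_comp.
have := Lnorm_fin_ae p0 (measurable_kernel_int nu msh mf' (fun x => normr_ge0 _)) _
  (le_lt_trans (contr_abs mf) ff).
case/(_ _)/Wrap => [x|]; first by apply: integral_ge0 => z _; rewrite lee_fin.
apply: filterS => x fx; apply/integrableP; split; first by apply/measurable_EFinP; exact: msh1.
exact: fx.
Qed.

Lemma kernel_op_linear (a : R) (f g : T -> R) : f \in Lfun gt p%:E -> g \in Lfun gt p%:E ->
  kernel_op (fun x => a * f x + g x) = (fun x => a * kernel_op f x + kernel_op g x) %[ae gs].
Proof.
move=> /kernel_integrable fi /kernel_integrable gi.
apply: filterS2 fi gi => x fx gx _; rewrite /kernel_op RintegralD//; last first.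
  by have := integrableZl measurableT a fx.
by rewrite RintegralZl.
Qed.

(** Null sets of [gt] are carried to the kernel by the contraction: f - g has norm 0, hence so has
    its image. *)
Lemma kernel_op_ae (f g : T -> R) : f \in Lfun gt p%:E -> g \in Lfun gt p%:E ->
  f = g %[ae gt] -> kernel_op f = kernel_op g %[ae gs].
Proof.
move=> fL gL fg; have lin := kernel_op_linear (-1) gL fL.
have [mf _] := (LfunE gt f p%:E).1 fL; have [mg _] := (LfunE gt g p%:E).1 gL.
pose h x := -1 * g x + f x.
have mh : measurable_fun [set: T] h by apply: measurable_funD => //; exact: measurable_funM.
have N0 : ('N[gs]_p%:E[EFin \o kernel_op h] = 0)%E.
  apply/eqP; rewrite eq_le Lnorm_ge0 andbT (le_trans (kernel_op_contraction mh))//.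
  rewrite -(@Lnorm0 _ _ _ gt p%:E) ?gt_eqF// Lnorm_ae_le//.
  - by apply/measurable_EFinP.
  - apply: filterS fg => x /(_ I) /= E; rewrite /h E mulN1r addNr.
    by [].
have := Lnorm_eq0_eq0 (iffRL (measurable_EFinP _ _) (measurable_kernel_op mh)) _ N0.
case/(_ _)/Wrap => [|h0]; first by rewrite lte_fin.
apply: filterS2 lin h0 => x /(_ I) + /(_ I)/= [hx0] _.
by rewrite [LHS]hx0 mulN1r => /eqP; rewrite eq_sym addrC subr_eq0 => /eqP.
Qed.

End kernel_operator.

(** * Uniqueness of the bounded extension *)

Section extension.
Context {R : realType} d (T : measurableType d).
Variables (gs gt : probability T R) (p : R) (P0 : (T -> R) -> (T -> R)).
Hypothesis p1 : 1 <= p.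
Let p0 : 0 < p. Proof. exact: lt_le_trans p1. Qed.

(** [is_Lp_extension] for arbitrary measures and an arbitrary operator [P0] on bounded functions;
    the two are convertible. *)
Definition Lp_extension (S : (T -> R) -> (T -> R)) : Prop :=
  [/\ forall f, f \in Lfun gt p%:E -> S f \in Lfun gs p%:E,
      forall f g, f \in Lfun gt p%:E -> g \in Lfun gt p%:E ->
        f = g %[ae gt] -> S f = S g %[ae gs],
      forall (a : R) f g, f \in Lfun gt p%:E -> g \in Lfun gt p%:E ->
        S (fun x => a * f x + g x) = (fun x => a * S f x + S g x) %[ae gs],
      exists C : R, forall f, f \in Lfun gt p%:E ->
        ('N[gs]_p%:E[EFin \o S f] <= C%:E * 'N[gt]_p%:E[EFin \o f])%E &
      forall phi : T -> R, measurable_fun [set: T] phi ->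
        (exists M, forall x, `|phi x| <= M) -> S phi = P0 phi %[ae gs]].

Lemma bfun_Lfun (f : T -> R) : bfun f -> f \in Lfun gt p%:E.
Proof.
move=> [mf [M fM]]; apply/LfunE; split => //.
apply: (@le_lt_trans _ _ ('N[gt]_p%:E[EFin \o cst M])%E).
  apply: Lnorm_ae_le => //; first by apply/measurable_EFinP.
    by apply/measurable_EFinP.
  by apply: nearW => x; rewrite /= lee_fin (le_trans (fM x))// ler_norm.
by have /LfunE[_] := Lfun_cst gt M p.
Qed.

(** Truncation where |f| <= n and dominated convergence. The difference is written with a factor -1
    to match the linearity clause of [Lp_extension]. *)
Lemma truncation_dense (f : T -> R) (e : R) : f \in Lfun gt p%:E -> 0 < e ->
  exists g, bfun g /\ ('N[gt]_p%:E[EFin \o (fun x => -1 * g x + f x)%R] <= e%:E)%E.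
Proof.
move=> /LfunE[mf ff] e0.
have mA n : measurable [set x | `|f x| <= n%:R].
  rewrite -[X in measurable X]setTI; apply: (measurable_fun_le (f := fun x => `|f x|) (g := cst n%:R)) => //.
  exact: measurableT_comp.
pose g n x := f x * \1_[set x | `|f x| <= n%:R] x.
have bg n : bfun (g n).
  apply: (@bfun_itv _ _ _ _ (- n%:R) n%:R) => [|x].
    by apply: measurable_funM => //; exact: measurable_indic.
  rewrite -ler_norml /g indicE; case: (boolP (x \in _)) => [|_]; last by rewrite mulr0 normr0.
  by rewrite inE/= mulr1.
pose r n x := -1 * g n x + f x.
have rE n x : r n x = if `|f x| <= n%:R then 0 else f x.
  rewrite /r /g indicE; case: ifPn => h.
    by rewrite mem_set//= mulr1 mulN1r addNr.
  by rewrite memNset ?mulr0 ?add0r//=; exact/negP.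
have mr n : measurable_fun [set: T] (r n).
  by apply: measurable_funD => //; apply: measurable_funM => //; have [] := bg n.
pose F x := (`|f x| `^ p)%:E; pose Fn n x := (`|r n x| `^ p)%:E.
have mF (h : T -> R) : measurable_fun [set: T] h -> measurable_fun [set: T] (fun x => (`|h x| `^ p)%:E).
  by move=> mh; apply/measurable_EFinP; apply: (measurableT_comp (measurable_powR p)); exact: measurableT_comp.
have iF : gt.-integrable [set: T] F.
  apply/integrableP; split; first exact: mF.
  have -> : (\int[gt]_x `|F x| = 'N[gt]_p%:E[EFin \o f] `^ p)%E.
    rewrite poweR_Lnorm ?gt_eqF//; apply: eq_integral => x _.
    by rewrite gee0_abs ?lee_fin ?powR_ge0.
  exact: poweR_lty.
have cv : (\int[gt]_x Fn n x)%E @[n --> \oo] --> (\int[gt]_x (cst 0 x))%E.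
  apply: (@dominated_cvg _ _ _ gt setT measurableT Fn (cst 0%E) F) => //.
  - by move=> n; exact: mF.
  - move=> x _; apply: cvg_near_cst; exists (Num.bound `|f x|) => // n /= nb.
    rewrite /Fn rE ifT ?normr0 ?powR0 ?gt_eqF//.
    by rewrite (le_trans (ltW (archi_boundP _)))// ler_nat; exact: nb.
  - by move=> n x _; rewrite /Fn gee0_abs ?lee_fin ?powR_ge0// rE; case: ifP => // _;
      rewrite normr0 powR0 ?gt_eqF ?powR_ge0.
rewrite integral0 in cv.
have ep0 : (0 < (e `^ p)%:E)%E by rewrite lte_fin powR_gt0.
have [N _ NP] := cv _ (open_ereal_lt' ep0).
exists (g N); split=> //; have := NP N (leqnn N); rewrite /= => h.
by apply: (Lnorm_le_int p0); rewrite ?lee_fin ?(ltW e0)//; exact: (ltW h).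
Qed.

(** Both extensions agree with [P0] on a bounded g, so S1 f - S2 f = S1 h - S2 h almost everywhere
    for h = f - g, and the right side is small in norm. *)
Lemma Lp_extension_unique S1 S2 : Lp_extension S1 -> Lp_extension S2 ->
  forall f, f \in Lfun gt p%:E -> S1 f = S2 f %[ae gs].
Proof.
move=> [L1 _ lin1 [C1 n1] b1] [L2 _ lin2 [C2 n2] b2] f fL.
have mS (S : (T -> R) -> T -> R) : (forall h, h \in Lfun gt p%:E -> S h \in Lfun gs p%:E) ->
    forall h, h \in Lfun gt p%:E -> measurable_fun [set: T] (EFin \o S h).
  by move=> LS h /LS/LfunE[mh _]; exact/measurable_EFinP.
have mD : measurable_fun [set: T] (EFin \o (S1 f \- S2 f)).
  by apply/measurable_EFinP; apply: measurable_funB; apply/measurable_EFinP; exact: mS.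
suff N0 : ('N[gs]_p%:E[EFin \o (S1 f \- S2 f)%R] = 0)%E.
  have := Lnorm_eq0_eq0 mD _ N0; case/(_ _)/Wrap => [|h0]; first by rewrite lte_fin.
  by apply: filterS h0 => x /(_ I)/= [/eqP]; rewrite subr_eq0 => /eqP.
apply/eqP; rewrite eq_le Lnorm_ge0 andbT; apply/lee_addgt0Pr => e e0; rewrite add0e.
pose C := 1 + `|C1| + `|C2|; have C0 : 0 < C by rewrite /C; have := normr_ge0 C1; have := normr_ge0 C2; lra.
have [g [bg ge]] := truncation_dense fL (divr_gt0 e0 C0).
pose h x := -1 * g x + f x; have gL := bfun_Lfun bg.
have hL : h \in Lfun gt p%:E.
  apply/LfunE; split; last by apply: (le_lt_trans ge); rewrite ltry.
  have [mf _] := (LfunE gt f p%:E).1 fL; apply: measurable_funD => //.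
  by apply: measurable_funM => //; have [] := bg.
have mDh : measurable_fun [set: T] (EFin \o (S1 h \- S2 h)).
  by apply/measurable_EFinP; apply: measurable_funB; apply/measurable_EFinP; exact: mS.
rewrite (Lnorm_ae_eq mD mDh); last 2 first.
- by rewrite lte_fin.
- have e1 := lin1 (-1) g f gL fL; have e2 := lin2 (-1) g f gL fL.
  have [mg bd] := bg; have e3 := b1 g mg bd; have e4 := b2 g mg bd.
  apply: filterS2 (filterI e1 e2) (filterI e3 e4) => x [/(_ I) + /(_ I)] + [/(_ I) + /(_ I)].
  by rewrite /h/= => -> -> -> ->; congr EFin; ring.
apply: (@le_trans _ _ ('N[gs]_p%:E[EFin \o S1 h] + 'N[gs]_p%:E[EFin \o S2 h])%E).
  rewrite -(oppe_Lnorm gs (EFin \o S2 h)).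
  have m1 : measurable_fun [set: T] (S1 h) by exact/measurable_EFinP/mS.
  have m2 : measurable_fun [set: T] (\- S2 h) by apply: measurableT_comp => //; exact/measurable_EFinP/mS.
  exact: (minkowski_EFin gs m1 m2 p1).
have NC (c : R) (k : \bar R) : (0 <= k)%E -> (c%:E * k <= `|c|%:E * k)%E.
  by move=> k0; apply: lee_wpmul2r => //; rewrite lee_fin ler_norm.
apply: (le_trans (leeD (le_trans (n1 h hL) (NC _ _ (Lnorm_ge0 _ _ _))) (le_trans (n2 h hL) (NC _ _ (Lnorm_ge0 _ _ _))))).
have N0 : (0 <= 'N[gt]_p%:E[EFin \o h])%E by exact: Lnorm_ge0.
rewrite -ge0_muleDl ?lee_fin//.
apply: (@le_trans _ _ (C%:E * (e / C)%:E)%E); last by rewrite -EFinM lee_fin mulrCA mulfV ?mulr1 ?gt_eqF.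
apply: lee_pmul => //; rewrite lee_fin; first exact: addr_ge0.
by rewrite /C; lra.
Qed.

End extension.

(** * Sharpness *)

Section gaussian_squares.
Context {R : realType}.
Notation mu := (@lebesgue_measure R).

Let msq (b : R) : measurable_fun [set: measurableTypeR R] (fun y : R => (expR (b * y ^+ 2))%:E).
Proof.
apply/measurable_EFinP; apply: measurableT_comp => //; apply: measurable_funM => //.
Qed.

(** The product with the density is a multiple of the normal density of variance 1 / (1 - 2 b). *)
Lemma normal_exp_square_lty (b : R) : b < 2^-1 ->
  (\int[normal_prob (0 : R) 1]_y (expR (b * y ^+ 2))%:E < +oo)%E.
Proof.
move=> b2; pose s := Num.sqrt (1 - b * 2)^-1.
have d0 : 0 < 1 - b * 2 by move: b2; rewrite -(ltr_pM2r (ltr0n R 2)) mulVf ?pnatr_eq0//; lra.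
have s0 : 0 < s by rewrite sqrtr_gt0 invr_gt0.
have s2 : s ^+ 2 = (1 - b * 2)^-1 by rewrite sqr_sqrtr// invr_ge0 ltW.
have sn : s != 0 by rewrite gt_eqF.
rewrite ge0_integral_normal; [|exact: msq|by move=> y; rewrite lee_fin expR_ge0].
pose c := normal_peak 1 / normal_peak s.
rewrite [X in (X < _)%E](_ : _ = (\int[mu]_y (c%:E * (normal_pdf 0 s y)%:E))%E); last first.
  apply: eq_integral => y _; rewrite -!EFinM !normal_pdf_val ?oner_eq0//; congr EFin.
  rewrite mulrCA -expRD /c [RHS]mulrA divfK ?gt_eqF ?normal_peak_gt0 ?sn//; congr (_ * expR _).
  by rewrite s2; field; rewrite gt_eqF.
rewrite ge0_integralZl//; last 3 first.
- by apply/measurable_EFinP; exact: measurable_normal_pdf.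
- by move=> y _; rewrite lee_fin normal_pdf_ge0.
- by rewrite lee_fin divr_ge0 ?normal_peak_ge0.
by rewrite integral_normal_pdf mule1 ltry.
Qed.

(** The exponent cancels that of the density exactly, leaving a positive constant on the line. *)
Lemma normal_exp_square_pinfty (s : R) : s != 0 ->
  (\int[normal_prob (0 : R) s]_y (expR ((s ^+ 2 * 2)^-1 * y ^+ 2))%:E = +oo)%E.
Proof.
move=> s0.
rewrite ge0_integral_normal; [|exact: msq|by move=> y; rewrite lee_fin expR_ge0].
rewrite [LHS](_ : _ = (\int[mu]_(y in [set: measurableTypeR R]) (cst (normal_peak s)%:E y))%E); last first.
  apply: eq_integral => y _; rewrite -EFinM normal_pdf_val//; congr EFin.
  rewrite mulrCA -expRD subr0 [X in expR X](_ : _ = 0) ?expR0 ?mulr1//.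
  by field; rewrite s0.
have lT : mu [set: measurableTypeR R] = +oo%E by rewrite -set_itvNyy lebesgue_measure_itv.
have h := @integral_cst _ _ _ mu [set: measurableTypeR R] measurableT (normal_peak s)%:E.
rewrite h [X in (_ * X)%E]lT gt0_muley// lte_fin normal_peak_gt0//.
Qed.

End gaussian_squares.

Section gaussian_line.
Context {R : realType} {X : hilbertType R}.
Variables (mu : probability (borel X) R) (a : X) (Q : X -> X) (h : X).
Hypothesis gmu : is_gaussian mu a Q.

Lemma gaussian_line_integral (g : measurableTypeR R -> \bar R) : 0 < inner (Q h) h ->
  measurable_fun [set: measurableTypeR R] g -> (forall y, (0 <= g y)%E) ->
  (\int[mu]_x g (inner (x : X) h) =
   \int[normal_prob (inner a h) (Num.sqrt (inner (Q h) h))]_y g y)%E.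
Proof.
move=> q0 mg g0; rewrite -(push_ge0_integral mu (measurable_inner h) mg g0).
apply: eq_measure_integral => E mE _; rewrite [LHS](_ : _ = gaussian1 (inner a h) (inner (Q h) h) E); last exact: gmu.
by rewrite /gaussian1 gt_eqF.
Qed.

Lemma gaussian_line_mgf (l : R) : 0 <= inner (Q h) h ->
  (\int[mu]_x (expR (l * (inner (x : X) h - inner a h)))%:E = (expR (l ^+ 2 * inner (Q h) h / 2))%:E)%E.
Proof.
have mg : measurable_fun [set: measurableTypeR R] (fun y : R => (expR (l * (y - inner a h)))%:E).
  apply/measurable_EFinP; apply: measurableT_comp => //; apply: measurable_funM => //.
  exact: measurable_funB.
have g0 (y : R) : (0 <= (expR (l * (y - inner a h)))%:E)%E by rewrite lee_fin expR_ge0.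
rewrite le_eqVlt => /predU1P[q0|q0].
  rewrite -(push_ge0_integral mu (measurable_inner h) mg g0).
  rewrite (@eq_measure_integral _ _ _ _ (\d_(inner a h : measurableTypeR R))); last first.
    move=> E mE _; rewrite [LHS](_ : _ = gaussian1 (inner a h) (inner (Q h) h) E); last exact: gmu.
    by rewrite /gaussian1 -q0 eqxx.
  by rewrite integral_dirac// diracT mul1e subrr mulr0 -q0 mulr0 mul0r.
rewrite (gaussian_line_integral q0 mg g0) normal_mgf ?gt_eqF ?sqrtr_gt0//.
by rewrite sqr_sqrtr ?ltW.
Qed.

End gaussian_line.

(** * A Gaussian peak whose image leaves L^q *)

Section counterexample.
Context {R : realType} {X : hilbertType R}.
Hypothesis sX : separable X.
Variables (A C Vs Vt : X -> X) (gs gt nu : probability (borel X) R).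
Hypotheses (bA : bounded_op A) (ggs : is_gaussian gs 0 Vs) (ggt : is_gaussian gt 0 Vt) (gnu : is_gaussian nu 0 C).
Variables (k : X) (p q : R).
Hypotheses (p1 : 1 <= p) (q1 : 1 <= q).
Let t := inner (Vs (adjoint A k)) (adjoint A k).
Hypotheses (Vt1 : inner (Vt k) k = 1) (t0 : 0 < t) (t1 : t <= 1) (Ck : inner (C k) k = 1 - t).
Hypothesis tpq : p - 1 < t * (q - 1).
Let w := 1 + t * (q - 1).

(* The choice of w turns the lower bound of gauss_peak_lower into
   exp(m^2 / (2 t q)), whose q-th power is just not integrable. *)
Definition gauss_peak (x : borel X) : R := expR ((w * 2)^-1 * inner (x : X) k ^+ 2).

Let w0 : 0 < w.
Proof. by rewrite /w; move: tpq p1; move: (t * (q - 1)) => u; lra. Qed.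
Let q0 : 0 < q. Proof. exact: lt_le_trans q1. Qed.
Let p0 : 0 < p. Proof. exact: lt_le_trans p1. Qed.

Let msq (b : R) : measurable_fun [set: measurableTypeR R] (fun y : R => (expR (b * y ^+ 2))%:E).
Proof. by apply/measurable_EFinP; apply: measurableT_comp => //; apply: measurable_funM => //. Qed.

Lemma measurable_gauss_peak : measurable_fun [set: borel X] gauss_peak.
Proof.
apply: measurableT_comp => //; apply: measurable_funM => //.
by apply: measurable_funX; exact: (measurable_inner k).
Qed.

Lemma gauss_peak_Lfun : gauss_peak \in Lfun gt p%:E.
Proof.
apply/LfunE; split; first exact: measurable_gauss_peak.
rewrite unlock; apply: poweR_lty.
rewrite (eq_integral (fun x : borel X => (expR ((p / (w * 2)) * inner (x : X) k ^+ 2))%:E)); last first.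
  move=> x _; rewrite /gauss_peak/= ger0_norm ?expR_ge0// /powR gt_eqF ?expR_gt0// expRK.
  by rewrite mulrA.
rewrite (gaussian_line_integral ggt _ (msq (p / (w * 2)))) ?Vt1//.
rewrite inner0l sqrtr1; apply: normal_exp_square_lty.
rewrite ltr_pdivrMr ?mulr_gt0// mulrCA mulVf ?mulr1 ?pnatr_eq0//.
by rewrite /w; move: tpq; move: (t * (q - 1)) => u; lra.
Qed.

(** For every l, y^2 / (2 w) >= l y - l^2 w / 2; integrating with the normal moment generating
    function gives l m - l^2 (w - 1 + t) / 2 in the exponent. As w - 1 + t = t q, the best choice is
    l = m / (t q). *)
Lemma gauss_peak_lower x : nu.-integrable [set: borel X] (fun z => (gauss_peak (mehler_shift A (x, z)))%:E) ->
  expR ((t * q * 2)^-1 * inner (x : X) (adjoint A k) ^+ 2) <= kernel_op nu (mehler_shift A) gauss_peak x.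
Proof.
move=> fi; set m := inner (x : X) (adjoint A k).
have tq0 : 0 < t * q by exact: mulr_gt0.
pose l := m / (t * q).
have Ck0 : 0 <= inner (C k) k by rewrite Ck subr_ge0.
have mg := gaussian_line_mgf gnu l Ck0.
rewrite -lee_fin /kernel_op /Rintegral fineK; last exact: (integrable_fin_num measurableT fi).
pose c := expR (l * m - l ^+ 2 * w / 2).
apply: (@le_trans _ _ (\int[nu]_z (c%:E * (expR (l * (inner (z : X) k - inner 0 k)))%:E))%E).
  have me : measurable_fun [set: borel X] (fun z : borel X => (expR (l * (inner (z : X) k - inner 0 k)))%:E).
    apply/measurable_EFinP; apply: measurableT_comp => //; apply: measurable_funM => //.
    by apply: measurable_funB => //; exact: (measurable_inner k).
  have c0 : (0 <= c%:E)%E by rewrite lee_fin expR_ge0.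
  rewrite (ge0_integralZl nu measurableT me (fun z _ => _) c0)//.
  rewrite [X in (_ <= _ * X)%E]mg -EFinM lee_fin -expRD ler_expR Ck /l /w.
  have E (u v : R) : u != 0 -> v != 0 -> (u * v * 2)^-1 * m ^+ 2 =
      m / (u * v) * m - (m / (u * v)) ^+ 2 * (1 + u * (v - 1)) / 2 + (m / (u * v)) ^+ 2 * (1 - u) / 2.
    by move=> u0 v0; field; rewrite u0 v0.
  by rewrite [leLHS]E ?gt_eqF.
apply: ge0_le_integral => //.
- by move=> z _; rewrite -EFinM lee_fin mulr_ge0 ?expR_ge0.
- apply/measurable_EFinP; apply: measurable_funM => //; apply: measurableT_comp => //; apply: measurable_funM => //.
  by apply: measurable_funB => //; exact: (measurable_inner k).
- by apply/measurable_EFinP; exact: (measurableT_comp measurable_gauss_peak (measurable_shift1 sX bA x)).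
- move=> z _; rewrite -EFinM lee_fin -expRD ler_expR inner0l subr0.
  rewrite [inner (mehler_shift A (x, z) : X) k](_ : _ = m + inner (z : X) k); last by rewrite /mehler_shift innerDl (adjointP bA).
  move: (inner (z : X) k) => y; rewrite -subr_ge0.
  have -> : (w * 2)^-1 * (m + y) ^+ 2 - (l * m - l ^+ 2 * w / 2 + l * y) = (w * 2)^-1 * (m + y - w * l) ^+ 2.
    by field; rewrite gt_eqF.
  by rewrite mulr_ge0 ?sqr_ge0// invr_ge0 mulr_ge0// ltW.
Qed.

(** Integrability for almost every x matters: [kernel_op] would read an infinite integral as 0 and
    destroy the lower bound. *)
Lemma gauss_peak_notin_Lfun : (\forall x \ae gs, nu.-integrable [set: borel X] (fun z => (gauss_peak (mehler_shift A (x, z)))%:E)) ->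
  'N[gs]_q%:E[EFin \o kernel_op nu (mehler_shift A) gauss_peak]%E = +oo%E.
Proof.
move=> fi; apply/eqP; rewrite -leye_eq.
pose g (x : borel X) := expR ((t * q * 2)^-1 * inner (x : X) (adjoint A k) ^+ 2).
have tq0 : 0 < t * q by exact: mulr_gt0.
have mg : measurable_fun [set: borel X] g.
  apply: measurableT_comp => //; apply: measurable_funM => //.
  by apply: measurable_funX; exact: (measurable_inner (adjoint A k)).
apply: (@le_trans _ _ ('N[gs]_q%:E[EFin \o g])%E); last first.
  apply: Lnorm_ae_le => //.
  - exact/measurable_EFinP.
  - by apply/measurable_EFinP; apply: (measurable_kernel_op nu (measurable_shift sX bA)); exact: measurable_gauss_peak.
  - apply: filterS fi => x fx; rewrite /= lee_fin ger0_norm ?expR_ge0//.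
    by rewrite (le_trans (gauss_peak_lower fx))// ler_norm.
rewrite unlock leye_eq; apply/eqP; apply: eqy_poweR; first by rewrite invr_gt0.
rewrite (eq_integral (fun x : borel X => (expR ((t * 2)^-1 * inner (x : X) (adjoint A k) ^+ 2))%:E)); last first.
  move=> x _; rewrite /g/= ger0_norm ?expR_ge0// /powR gt_eqF ?expR_gt0// expRK.
  by congr (expR _)%:E; field; rewrite !gt_eqF.
rewrite (gaussian_line_integral ggs _ (msq (t * 2)^-1)) -/t// inner0l.
have := @normal_exp_square_pinfty R (Num.sqrt t); rewrite sqr_sqrtr ?(ltW t0)//; apply.
by rewrite gt_eqF// sqrtr_gt0.
Qed.

End counterexample.

(** * Hypercontractivity *)

Section mehler_kernel.
Context {R : realType} {X : hilbertType R}.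
Hypothesis sX : separable X.
Variables (e : nat -> X) (A C Vs Vt : X -> X) (Mc Ms Mt : R).
Hypotheses (fe : frame e) (bA : bounded_op A).
Hypotheses (nC : nonneg_op C) (nVs : nonneg_op Vs) (nVt : nonneg_op Vt).
Hypotheses (trC : forall n, \sum_(k < n) inner (C (e k)) (e k) <= Mc)
  (trs : forall n, \sum_(k < n) inner (Vs (e k)) (e k) <= Ms)
  (trt : forall n, \sum_(k < n) inner (Vt (e k)) (e k) <= Mt).
Hypothesis VtE : forall k, inner (Vt k) k = inner (C k) k + inner (Vs (adjoint A k)) (adjoint A k).

Notation gs := (gaussian 0 Vs).
Notation gt := (gaussian 0 Vt).
Notation nu := (gaussian 0 C).

Lemma mehler_kernel_Lnorm (rho p q : R) : 0 <= rho -> rho <= 1 ->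
  (forall k, inner (Vs (adjoint A k)) (adjoint A k) <= rho ^+ 2 * inner (Vt k) k) ->
  1 <= p -> 1 <= q -> rho ^+ 2 * (q - 1) <= p - 1 ->
  forall f : borel X -> R, measurable_fun [set: borel X] f -> (forall x, 0 <= f x) ->
  ('N[gs]_q%:E[kernel_int nu (mehler_shift A) f] <= 'N[gt]_p%:E[EFin \o f])%E.
Proof.
move=> rho0 rho1 Vrho p1 q1 pq; apply: (kernel_int_Lnorm (measurable_shift sX bA) _ p1 q1 pq); last first.
  by rewrite expr_le1.
move=> p' q' f a M p'1 q'1 pq' bf a0 fM.
move: rho0; rewrite le_eqVlt => /predU1P[rho0|rho0]; last first.
  exact: (mehler_hypercontractive sX fe bA nC nVs nVt trC trs trt VtE rho0 rho1 Vrho p'1 q'1 pq' bf a0 fM).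
pose r := Num.min 1 ((p' - 1) / (q' - 1)).
have r0 : 0 < r by rewrite lt_min ltr01 divr_gt0// subr_gt0.
have r1 : r <= 1 by rewrite ge_min lexx.
apply: (mehler_hypercontractive sX fe bA nC nVs nVt trC trs trt VtE r0 r1 _ p'1 q'1 _ bf a0 fM).
  move=> k; apply: (le_trans (Vrho k)); rewrite -rho0 expr0n/= mul0r mulr_ge0 ?exprn_ge0 ?(ltW r0)//.
  by have [_ _] := nVt; exact.
rewrite -ler_pdivlMr ?subr_gt0//; apply: (@le_trans _ _ r); last by rewrite ge_min lexx orbT.
by rewrite expr2 ler_piMl// ltW.
Qed.

(** N_{A x, C} is the translate of N_{0, C} by A x. Positive and negative parts are compared
    separately, so no integrability of f is assumed. *)
Lemma gaussian_kernel_op (f : borel X -> R) x : measurable_fun [set: borel X] f ->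
  Rintegral (gaussian (A x) C) [set: borel X] f = kernel_op nu (mehler_shift A) f x.
Proof.
move=> mf; have m1 := measurable_shift1 sX bA x.
have gE E : measurable E -> gaussian (A x) C E = push nu m1 E.
  apply: (char_unique sX) => h c.
  have /(is_gaussian_char _ _ nC) -> := gaussianP sX (A x) fe nC trC.
  rewrite (push_int nu m1 (bfun_cos_inner h c)).
  have /(is_gaussian_char _ _ nC)/(_ h (inner (A x) h + c)) := gaussianP sX 0 fe nC trC.
  rewrite inner0l add0r => <-; apply: eq_Rintegral => z _; rewrite /mehler_shift innerDl.
  by congr cos; ring.
rewrite /Rintegral (eq_measure_integral (push nu m1)); last by move=> E mE _; exact: gE.
have mE : measurable_fun [set: borel X] (fun x => (f x)%:E) by exact/measurable_EFinP.
rewrite /kernel_op /Rintegral integralE [in RHS]integralE; congr (fine (_ - _)).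
  rewrite (push_ge0_integral nu m1 (measurable_funepos mE) (funepos_ge0 _)).
  by apply: eq_integral => z _; rewrite !funeposE.
rewrite (push_ge0_integral nu m1 (measurable_funeneg mE) (funeneg_ge0 _)).
by apply: eq_integral => z _; rewrite !funenegE.
Qed.

End mehler_kernel.

(** c^2 is the midpoint of (p - 1) / (q - 1) and rho^2. *)
Lemma critical_variance {R : realType} (p q rho : R) : 1 <= p -> 0 < rho -> 1 + (p - 1) * rho ^- 2 < q ->
  exists c, [/\ 0 <= c, c < rho & p - 1 < c ^+ 2 * (q - 1)].
Proof.
move=> p1 rho0 pq; have r2 : 0 < rho ^+ 2 by rewrite exprn_gt0.
have p0 : 0 <= p - 1 by rewrite subr_ge0.
have pq' : (p - 1) / rho ^+ 2 < q - 1 by move: pq; move: (_ / _) => u; lra.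
have q0 : 0 < q - 1 by apply: le_lt_trans pq'; rewrite divr_ge0// ltW.
have pr : (p - 1) / (q - 1) < rho ^+ 2 by rewrite ltr_pdivrMr// mulrC -ltr_pdivrMr.
pose m := ((p - 1) / (q - 1) + rho ^+ 2) / 2.
have [m1 m2] : (p - 1) / (q - 1) < m /\ m < rho ^+ 2 by rewrite /m; move: pr; move: (_ / _) (rho ^+ 2) => u v; split; lra.
have m0 : 0 <= m by apply: le_trans (ltW m1); rewrite divr_ge0// ltW.
exists (Num.sqrt m); split; first exact: sqrtr_ge0.
- by rewrite -(@ltr_pXn2r _ 2)// ?nnegrE ?sqrtr_ge0 ?(ltW rho0)// sqr_sqrtr.
- by rewrite sqr_sqrtr// -ltr_pdivrMr.
Qed.

Section transition_operator.
Context {R : realType} {X : hilbertType R}.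
Variables (U : R -> R -> X -> X) (B : R -> X -> X) (s t p : R).

Lemma Lp_transition_ae (S : (X -> R) -> (X -> R)) : 1 <= p -> is_Lp_extension U B s t p S ->
  forall f, f \in Lfun (invariant_measure U B t) p%:E ->
  [/\ Lp_transition U B s t p f \in Lfun (invariant_measure U B s) p%:E &
    Lp_transition U B s t p f = S f %[ae invariant_measure U B s]].
Proof.
move=> p1 eS; have eL : is_Lp_extension U B s t p (Lp_transition U B s t p) by apply: xgetPex; exists S.
move=> f fL; split; first by have [h _ _ _ _] := eL; exact: h.
exact: (Lp_extension_unique p1 eL eS fL).
Qed.

End transition_operator.

Theorem corollary5p6 (R : realType) (X : hilbertType R)
    (U : R -> R -> X -> X) (B : R -> X -> X) :
  separable X ->
  strongly_continuous_evolution U ->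
  bounded_measurable_family B ->
  finite_trace U B ->
  stability U B ->
  forall s t : R, s < t -> (CM_opnorm U B t s < 1)%E ->
  forall p : R, 1 <= p ->
    (forall q : \bar R, (1 <= q)%E -> (q <= critical_exponent U B s t p)%E ->
      forall f : X -> R, f \in Lfun (invariant_measure U B t) p%:E ->
        Lp_transition U B s t p f \in Lfun (invariant_measure U B s) q /\
        ('N[invariant_measure U B s]_q[EFin \o Lp_transition U B s t p f]
           <= 'N[invariant_measure U B t]_p%:E[EFin \o f])%E) /\
    (forall q : \bar R, (critical_exponent U B s t p < q)%E ->
      exists f : X -> R, f \in Lfun (invariant_measure U B t) p%:E /\
        Lp_transition U B s t p f \notin Lfun (invariant_measure U B s) q).
Proof.
move=> sX sU bB ftU stU s t st CM1 p p1.
have [e [fe trE]] := frame_trace sX.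
have bA : bounded_op (U t s) by have [h _ _ _] := sU; exact/h/ltW.
have [nC _] := Qcov_spec sX sU bB s t.
have [Mc trC] := Qcov_trace sX sU bB stU trE t.
have [nVs _ [Ms trs]] := Qinf_spec sX sU bB stU fe trE s.
have [nVt _ [Mt trt]] := Qinf_spec sX sU bB stU fe trE t.
have VtE k := Qinf_split sX sU bB stU fe trE k (ltW st).
have trC' := trC s st.
have VV k : inner (Qinf U B s (adjoint (U t s) k)) (adjoint (U t s) k) <= inner (Qinf U B t k) k.
  by rewrite VtE lerDr; have [_ _] := nC; exact.
have [rho [rhoE rho0 Vrho rhoS]] := CM_opnorm_spec nVs nVt bA VV.
have rho1 : rho < 1 by move: CM1; rewrite rhoE lte_fin.
have msh := measurable_shift sX bA.
have HC := mehler_kernel_Lnorm sX fe bA nC nVs nVt trC' trs trt VtE rho0 (ltW rho1) Vrho.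
pose gs := gaussian 0 (Qinf U B s); pose gt := gaussian 0 (Qinf U B t); pose nu := gaussian 0 (Qcov U B t s).
pose S := kernel_op nu (mehler_shift (U t s)).
(* The case q = p, allowed since rho <= 1; it makes [S] an extension of [transition] to L^p. *)
have contr : forall f : borel X -> R, measurable_fun [set: borel X] f -> (forall x, 0 <= f x) ->
    ('N[gs]_p%:E[kernel_int nu (mehler_shift (U t s)) f] <= 'N[gt]_p%:E[EFin \o f])%E.
  by apply: HC => //; rewrite ler_piMl ?subr_ge0// expr_le1// ltW.
have tS (f : borel X -> R) x : measurable_fun [set: borel X] f -> transition U B s t f x = S f x.
  by move=> mf; rewrite /transition (lt_eqF st); exact: (gaussian_kernel_op sX fe bA nC trC').
have eS : is_Lp_extension U B s t p S.
  split.
  - by move=> f fL; exact: (kernel_op_Lfun msh p1 contr fL).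
  - by move=> f g fL gL; exact: (kernel_op_ae msh p1 contr fL gL).
  - by move=> a f g fL gL; exact: (kernel_op_linear msh p1 contr a fL gL).
  - exists 1 => f /LfunE[mf _]; rewrite mul1e; exact: (kernel_op_contraction msh p1 contr mf).
  - by move=> f mf _; apply: aeW => x _; rewrite tS.
have transE f : f \in Lfun gt p%:E ->
    [/\ measurable_fun [set: borel X] f, measurable_fun [set: borel X] (Lp_transition U B s t p f : borel X -> R) &
    Lp_transition U B s t p f = S f %[ae gs]].
  move=> fL; have [/LfunE[mT _] TS] := Lp_transition_ae p1 eS fL.
  by have /LfunE[mf _] := fL.
have mS f : measurable_fun [set: borel X] f -> measurable_fun [set: borel X] (S f).
  exact: (measurable_kernel_op nu msh).
split.
- move=> q q1 qc f fL; have q0 : (0 < q)%E by exact: lt_le_trans q1.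
  have [mf mT TS] := transE f fL; have /LfunE[_ ff] := fL.
  have mf' : measurable_fun [set: borel X] (fun x => `|f x|%R) by exact: measurableT_comp.
  suff Nle : ('N[gs]_q[EFin \o S f] <= 'N[gt]_p%:E[EFin \o f])%E.
    exact: (ae_Lfun mT (mS f mf) q0 TS ff Nle).
  apply: (le_trans (kernel_op_Lnorm_le gs nu msh mf q0)).
  have HCq (r : R) : 1 <= r -> rho ^+ 2 * (r - 1) <= p - 1 ->
      ('N[gs]_r%:E[kernel_int nu (mehler_shift (U t s)) (fun x => `|f x|%R)] <= 'N[gt]_p%:E[EFin \o f])%E.
    move=> r1 rp; apply: (le_trans (HC p r p1 r1 rp _ mf' (fun x => normr_ge0 _))).
    by rewrite -(Lnorm_abse gt (EFin \o f)).
  case: q q0 q1 qc => [q|_ _ |//].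
    move=> _ q1 qc; apply: HCq => //; move: qc; rewrite /critical_exponent rhoE eqe.
    case: eqP => [->|/eqP rhon]; first by rewrite expr0n/= mul0r subr_ge0.
    have r2 : 0 < rho ^+ 2 by rewrite exprn_gt0// lt_def rhon.
    by rewrite lee_fin/= -lerBlDl ler_pdivlMr// mulrC.
  (* The exponent +oo is admissible only when rho = 0; then every finite exponent is, and the bound
     does not depend on it. *)
  rewrite /critical_exponent rhoE eqe; case: eqP => [rho00 _|_]; last by rewrite leye_eq.
  apply: Lnorm_infty_le.
  + by apply: (measurable_kernel_int nu msh).
  + by move=> x; apply: integral_ge0 => z _; rewrite lee_fin.
  + by move=> r r1; apply: HCq => //; rewrite rho00 expr0n/= mul0r subr_ge0.
move=> q; rewrite /critical_exponent rhoE eqe; case: eqP => [_|/eqP rhon]; first by rewrite ltNge leey.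
have rho00 : 0 < rho by rewrite lt_def rhon.
have counter (r : R) : 1 + (p - 1) * rho ^- 2 < r -> exists f : X -> R, f \in Lfun gt p%:E /\
    Lp_transition U B s t p f \notin Lfun gs r%:E.
  move=> rc; have [c [c0 crho cr]] := critical_variance p1 rho00 rc.
  have [k0 ck0] := rhoS c c0 crho.
  have [[bVt _ pVt] [bVs _ pVs]] := (nVt, nVs); have [[lC _] _ pC] := nC.
  set v := inner (Qinf U B t k0) k0 in ck0; have v0 : 0 < v.
    by apply: lt_le_trans (VV k0); apply: le_lt_trans ck0; rewrite mulr_ge0 ?exprn_ge0 ?pVt.
  (* Normalizes k0 so that <Q(t,-oo) k, k> = 1. *)
  pose a := (Num.sqrt v)^-1; have a2 : a ^+ 2 * v = 1 by rewrite exprVn sqr_sqrtr ?mulVf ?gt_eqF ?ltW.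
  pose k := a *: k0.
  have scal (Q : X -> X) x : linear Q -> inner (Q (a *: x)) (a *: x) = a ^+ 2 * inner (Q x) x.
    by move=> lQ; rewrite (lin_Z _ _ lQ) innerZl innerZr mulrA expr2.
  have Vt1 : inner (Qinf U B t k) k = 1 by rewrite (scal _ _ bVt.1).
  pose tau := inner (Qinf U B s (adjoint (U t s) k)) (adjoint (U t s) k).
  have ctau : c ^+ 2 < tau.
    rewrite /tau /k (lin_Z _ _ (adjoint_linear bA)) (scal _ _ bVs.1) -[ltLHS]mulr1 -a2 mulrCA ltr_pM2l//.
    by rewrite exprn_gt0// invr_gt0 sqrtr_gt0.
  have tau0 : 0 < tau by apply: le_lt_trans ctau; rewrite exprn_ge0.
  have tau1 : tau <= 1 by rewrite -Vt1 VV.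
  have Ck : inner (Qcov U B t s k) k = 1 - tau by rewrite -Vt1 VtE addrK.
  have r1 : 1 <= r.
    by apply: le_trans (ltW rc); rewrite lerDl mulr_ge0 ?subr_ge0// invr_ge0 exprn_ge0.
  have tpq : p - 1 < tau * (r - 1).
    by apply: (lt_le_trans cr); rewrite ler_wpM2r ?subr_ge0// ltW.
  have ggs := gaussianP sX 0 fe nVs trs; have ggt := gaussianP sX 0 fe nVt trt.
  have gnu := gaussianP sX 0 fe nC trC'.
  have fL := gauss_peak_Lfun ggt p1 Vt1 tpq.
  exists (gauss_peak (U t s) (Qinf U B s) k r); split=> //.
  have r0 : (0 < r%:E)%E by rewrite lte_fin (lt_le_trans _ r1).
  have [mf mT TS] := transE _ fL.
  apply: (ae_notin_Lfun mT (mS _ mf) r0 TS).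
  exact: (gauss_peak_notin_Lfun sX bA ggs gnu p1 r1 tau0 tau1 Ck tpq (kernel_integrable msh p1 contr fL)).
case: q => [q|_|//]; first by rewrite lte_fin; exact: counter.
(* For q = +oo the counterexample of a finite exponent above the critical one serves, L^oo being
   contained in that L^r. *)
have [|f [fL fN]] := counter (1 + (p - 1) * rho ^- 2 + 1); first by rewrite ltrDl.
have q1 : (1 <= (1 + (p - 1) * rho ^- 2 + 1)%:E)%E.
  by rewrite lee_fin lerDr addr_ge0// mulr_ge0 ?subr_ge0// invr_ge0 exprn_ge0.
have fin : (gs [set: borel X] \is a fin_num)%E by rewrite probability_setT.
exists f; split=> //; apply: contra fN.
exact: (Lfun_subset q1 (leey 1%E) fin (leey _)).
Qed.
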